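(* Let $n\geq 2$ be an integer and let $p>n$ be real. Write $\mathbb{R}^n_+=\{x\in\mathbb{R}^n:x_n>0\}$. (1) If $\Omega\subsetneq\mathbb{R}^n$ is nonempty, convex and open, then $\lambda_p(\Omega)=\lambda_p(\mathbb{R}^n_+)$, and $\Omega$ has an extremal if and only if $\Omega$ is a halfspace. (2) If $\Omega\subset\mathbb{R}^n$ is open (possibly $\Omega=\mathbb{R}^n$) and $x_0\in\Omega$, then $\lambda_p(\Omega\setminus\{x_0\})=\lambda_p(\mathbb{R}^n\setminus\{0\})$, and $\Omega\setminus\{x_0\}$ has an extremal if and only if $\Omega=\mathbb{R}^n$. (3) If $K\subset\mathbb{R}^n$ is compact and nonempty, then $\lambda_p(\mathbb{R}^n\setminus K)=\lambda_p(\mathbb{R}^n\setminus\{0\})$, and $\mathbb{R}^n\setminus K$ has an extremal if and only if $K$ is a singleton.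
   Context: $\mathcal{D}^{1,p}(\mathbb{R}^n)=\{u\in L^1_{\rm loc}(\mathbb{R}^n): \text{all weak partial derivatives } u_{x_i}\in L^p(\mathbb{R}^n)\}$; since $p>n$, each $u$ is identified with its Hölder continuous representative. For a nonempty open $\Omega\subsetneq\mathbb{R}^n$, $\mathcal{D}^{1,p}_0(\Omega)=\{u\in\mathcal{D}^{1,p}(\mathbb{R}^n): u(x)=0 \text{ for all } x\notin\Omega\}$, with norm $\|Du\|_p$, and $d_\Omega(x)=\inf_{y\in\Omega^c}|x-y|$. For $u\in\mathcal{D}^{1,p}_0(\Omega)\setminus\{0\}$, $\mathcal{R}_p(\Omega,u)=\bigl\|u/d_\Omega^{1-n/p}\bigr\|_\infty^{-p}\,\|Du\|_p^p$ (the supremum norm is taken over $\Omega$), and $\lambda_p(\Omega)=\inf_{u\in\mathcal{D}^{1,p}_0(\Omega)\setminus\{0\}}\mathcal{R}_p(\Omega,u)$. An extremal for $\Omega$ is a $u\in\mathcal{D}^{1,p}_0(\Omega)\setminus\{0\}$ with $\mathcal{R}_p(\Omega,u)=\lambda_p(\Omega)$; ''$\Omega$ has an extremal'' means such a $u$ exists. *)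

(* Defs.v *)
From HB Require Import structures.
From mathcomp Require Import all_boot all_order all_algebra.
From mathcomp Require Import all_classical all_reals all_analysis.

Set Implicit Arguments.
Unset Strict Implicit.
Unset Printing Implicit Defensive.

Import Order.TTheory GRing.Theory Num.Theory.
Import numFieldNormedType.Exports.

Local Open Scope classical_set_scope.
Local Open Scope ring_scope.

(* Borel sets of 'rV[R]_n; the library puts no sigma-algebra on matrices. *)
HB.instance Definition _ (R : realType) (n : nat) :=
  @isMeasurable.Build (sigma_display (@open 'rV[R]_n)) 'rV[R]_n
    <<s (@open 'rV[R]_n) >>
    (@sigma_algebra0 _ setT _) (@sigma_algebraC _ _)
    (@sigma_algebra_bigcup _ setT _).

Section lebesgue_measure_tuple.
Context {R : realType}.
Local Open Scope ereal_scope.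

Section step.
Variable n : nat.
Local Notation tupleR n := (n.-tuple (measurableTypeR R)).

Definition cons_pair (xt : measurableTypeR R * tupleR n) : tupleR n.+1 :=
  [tuple of xt.1 :: xt.2].

Let measurable_cons_pair : measurable_fun setT cons_pair.
Proof. exact: measurable_cons. Qed.

HB.instance Definition _ :=
  isMeasurableFun.Build _ _ _ _ cons_pair measurable_cons_pair.

Variable m : {sigma_finite_measure set (tupleR n) -> \bar R}.

Definition lebesgue_cons : set (tupleR n.+1) -> \bar R :=
  pushforward (lebesgue_measure \x m) cons_pair.

Let lebesgue_cons0 : lebesgue_cons set0 = 0.
Proof. by rewrite /lebesgue_cons /pushforward preimage_set0 measure0. Qed.

Let lebesgue_cons_ge0 A : 0 <= lebesgue_cons A.
Proof. exact: measure_ge0. Qed.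

Let mpre A : measurable A -> measurable (cons_pair @^-1` A).
Proof. by move=> mA; rewrite -[X in measurable X]setTI; exact: measurable_cons_pair. Qed.

Let lebesgue_cons_sigma_additive : semi_sigma_additive lebesgue_cons.
Proof.
move=> F mF tF mUF; rewrite /lebesgue_cons /pushforward preimage_bigcup.
apply: measure_semi_sigma_additive.
- by move=> k; exact: mpre.
- apply/trivIsetP => /= i j _ _ ij; rewrite -preimage_setI.
  by move/trivIsetP : tF => /(_ _ _ _ _ ij) ->//; rewrite preimage_set0.
- by rewrite -preimage_bigcup; exact: mpre.
Qed.

HB.instance Definition _ := isMeasure.Build _ _ _ lebesgue_cons
  lebesgue_cons0 lebesgue_cons_ge0 lebesgue_cons_sigma_additive.

Let lebesgue_cons_sigma_finite : sigma_finite setT lebesgue_cons.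
Proof.
have /sigma_finiteP[F [FT ndF Foo]] := sigma_finiteT (@lebesgue_measure R).
have /sigma_finiteP[G [GT ndG Goo]] := sigma_finiteT m.
pose uncons (t : tupleR n.+1) : measurableTypeR R * tupleR n :=
  (thead t, [tuple of behead t]).
have cons_pairK : cancel cons_pair uncons.
  by move=> [x t]; rewrite /uncons theadE; congr pair; exact: val_inj.
have muncons : measurable_fun setT uncons.
  apply/measurable_fun_pair; last exact: measurable_behead.
  exact: measurable_tnth.
exists (fun k => uncons @^-1` (F k `*` G k)).
  rewrite predeqE => t; split=> // _.
  have [k _ Fk] : (\bigcup_k F k) (thead t) by rewrite -FT.
  have [l _ Gl] : (\bigcup_k G k) [tuple of behead t] by rewrite -GT.
  exists (maxn k l) => //; split.
  - by move: Fk; exact/subsetPset/ndF/leq_maxl.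
  - by move: Gl; exact/subsetPset/ndG/leq_maxr.
move=> k; have [mFk Fkoo] := Foo k; have [mGk Gkoo] := Goo k; split.
  rewrite -[X in measurable X]setTI; apply: muncons => //.
  exact: measurableX.
rewrite /lebesgue_cons /pushforward -comp_preimage.
rewrite (_ : uncons \o cons_pair = id); last first.
  by apply/funext => x; exact: cons_pairK.
by rewrite preimage_id product_measure1E// lte_mul_pinfty// ge0_fin_numE.
Qed.

HB.instance Definition _ := Measure_isSigmaFinite.Build _ _ _ lebesgue_cons
  lebesgue_cons_sigma_finite.

End step.

(* The n-fold product of the Lebesgue measure on R (see lebesgue_rV_box). *)
Fixpoint lebesgue_tuple (n : nat) :
    {sigma_finite_measure set (n.-tuple (measurableTypeR R)) -> \bar R} :=
  match n with
  | 0 => \d_([tuple] : 0.-tuple (measurableTypeR R))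
  | n'.+1 => lebesgue_cons (lebesgue_tuple n')
  end.

End lebesgue_measure_tuple.

Section lebesgue_measure_row.
Context {R : realType} (n : nat).

Definition row_of_tuple (t : n.-tuple (measurableTypeR R)) : 'rV[R]_n :=
  \row_i tnth t i.

Let measurable_preimage_ball (c : 'rV[R]_n) (r : R) :
  measurable (row_of_tuple @^-1` ball c r).
Proof.
have [r0|r0] := ltP 0 r; last first.
  rewrite (_ : _ @^-1` _ = set0) ?measurable0//.
  by rewrite -subset0 => t /= [/lt_le_trans/(_ r0)]; rewrite ltxx.
rewrite (_ : _ @^-1` _ =
  \bigcap_(i in [set: 'I_n]) ((@tnth _ _)^~ i @^-1` ball (c ord0 i) r)).
  apply: fin_bigcap_measurable => // i _.
  rewrite -[X in measurable X]setTI; apply: measurable_tnth => //.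
  exact: measurable_realfun.measurable_ball.
rewrite predeqE => t; split => /=.
  by move=> [_ ct] i _ /=; have := ct ord0 i; rewrite mxE.
move=> ct; split=> // i j; rewrite mxE (ord1 i); exact: ct.
Qed.

Let open_bigcup_ball (A : set 'rV[R]_n) : open A ->
  A = \bigcup_(q in [set q : 'rV[rat]_n * nat |
        ball (map_mx ratr q.1 : 'rV[R]_n) q.2.+1%:R^-1 `<=` A])
        ball (map_mx ratr q.1 : 'rV[R]_n) q.2.+1%:R^-1.
Proof.
move=> oA; rewrite predeqE => x; split=> [Ax|[q /= qA]]; last exact: qA.
have /nbhs_ballP[e /= e0 xeA] : nbhs x A by exact: open_nbhs_nbhs.
have [k ke] : exists k : nat, k.+1%:R^-1 < e / 2 :> R.
  have := near_infty_natSinv_lt (PosNum (divr_gt0 e0 (ltr0n _ 2))).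
  by move=> [k _ /(_ k (leqnn k))]; exists k.
have k0 : 0 < k.+1%:R^-1 :> R by rewrite invr_gt0.
have qP (i : 'I_n) : exists q : rat, ball (x ord0 i) k.+1%:R^-1 (ratr q : R).
  have /rat_in_itvoo[q] : x ord0 i < x ord0 i + k.+1%:R^-1 by rewrite ltrDl.
  rewrite in_itv /= => /andP[xq qx]; exists q.
  by rewrite /ball /= distrC ger0_norm ?subr_ge0 ?ltW// ltrBlDl.
have [q {}qP] := choice qP.
have xq : ball x k.+1%:R^-1 (map_mx ratr (\row_i q i) : 'rV[R]_n).
  by split=> // i j; rewrite !mxE (ord1 i).
exists (\row_i q i, k) => /=; last by apply: ball_sym.
move=> y qy; apply: xeA; rewrite [e]splitr.
exact: ball_triangle (le_ball (ltW ke) xq) (le_ball (ltW ke) qy).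
Qed.

Let measurable_row_of_tuple : measurable_fun setT row_of_tuple.
Proof.
apply: (@measurability _ _ _ _ setT _ (@open 'rV[R]_n)) => // _ [A oA <-].
rewrite setTI (open_bigcup_ball oA) preimage_bigcup.
rewrite bigcup_mkcond; apply: countable_bigcupT_measurable => // q.
by case: ifPn => // _; rewrite preimage_set0.
Qed.

HB.instance Definition _ :=
  isMeasurableFun.Build _ _ _ _ row_of_tuple measurable_row_of_tuple.

(* Restricted to Borel sets; every Lebesgue measurable function has a Borel
   representative, so no class of functions modulo a.e. equality is lost. *)
Definition lebesgue_rV : set 'rV[R]_n -> \bar R :=
  pushforward (lebesgue_tuple n) row_of_tuple.

Let mpre A : measurable A -> measurable (row_of_tuple @^-1` A).
Proof.
by move=> mA; rewrite -[X in measurable X]setTI; exact: measurable_row_of_tuple.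
Qed.

Let lebesgue_rV0 : lebesgue_rV set0 = 0%E.
Proof. by rewrite /lebesgue_rV /pushforward preimage_set0 measure0. Qed.

Let lebesgue_rV_ge0 A : (0 <= lebesgue_rV A)%E.
Proof. exact: measure_ge0. Qed.

Let lebesgue_rV_sigma_additive : semi_sigma_additive lebesgue_rV.
Proof.
move=> F mF tF mUF; rewrite /lebesgue_rV /pushforward preimage_bigcup.
apply: measure_semi_sigma_additive.
- by move=> k; exact: mpre.
- apply/trivIsetP => /= i j _ _ ij; rewrite -preimage_setI.
  by move/trivIsetP : tF => /(_ _ _ _ _ ij) ->//; rewrite preimage_set0.
- by rewrite -preimage_bigcup; exact: mpre.
Qed.

HB.instance Definition _ := isMeasure.Build _ _ _ lebesgue_rV
  lebesgue_rV0 lebesgue_rV_ge0 lebesgue_rV_sigma_additive.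

End lebesgue_measure_row.

Lemma lebesgue_tuple_box (R : realType) (n : nat)
    (A : 'I_n -> set (measurableTypeR R)) :
  (forall i, measurable (A i)) ->
  lebesgue_tuple n [set t | forall i, A i (tnth t i)] =
  (\prod_(i < n) lebesgue_measure (A i))%E.
Proof.
elim: n A => [|n IHn] A mA.
  by rewrite big_ord0 /= diracE mem_set//= => -[].
have mB : measurable [set t : n.-tuple (measurableTypeR R) |
    forall i, A (lift ord0 i) (tnth t i)].
  rewrite (_ : mkset _ = \bigcap_(i in [set: 'I_n])
      ((@tnth _ _)^~ i @^-1` A (lift ord0 i))).
    apply: fin_bigcap_measurable => // i _.
    by rewrite -[X in measurable X]setTI; apply: measurable_tnth.
  by rewrite predeqE => t; split=> [At i _|At i]; exact: At.
rewrite big_ord_recl -IHn// -product_measure1E//=.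
rewrite /lebesgue_cons /pushforward; congr product_measure1.
rewrite predeqE => -[x t]; split=> /= [At|[Ax At] i].
  split; first exact: (At ord0).
  by move=> i; have := At (lift ord0 i); rewrite tnthS.
by case: (unliftP ord0 i) => [j|] ->; [rewrite tnthS; exact: At|].
Qed.

Lemma lebesgue_rV_box (R : realType) (n : nat)
    (A : 'I_n -> set (measurableTypeR R)) :
  (forall i, measurable (A i)) ->
  lebesgue_rV [set v : 'rV[R]_n | forall i, A i (v ord0 i)] =
  (\prod_(i < n) lebesgue_measure (A i))%E.
Proof.
move=> mA; rewrite -lebesgue_tuple_box// /lebesgue_rV /pushforward.
congr (lebesgue_tuple _ _); rewrite predeqE => t.
by split=> At i; have := At i; rewrite /= mxE.
Qed.

Section sobolev.
Context {R : realType} {n : nat}.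
Local Notation Rn := 'rV[R]_n.
Local Notation mu := (@lebesgue_rV R n).

(* The Euclidean norm; the norm `| x | of 'rV[R]_n is the sup norm. *)
Definition enorm (x : Rn) : R := Num.sqrt (\sum_i x ord0 i ^+ 2).

Definition partial (i : 'I_n) (f : Rn -> R) : Rn -> R :=
  'D_(delta_mx ord0 i) f.

Definition smooth (f : Rn -> R) : Prop :=
  forall s : seq 'I_n, let f_s := foldr partial f s in
  continuous f_s /\ forall i x, derivable f_s x (delta_mx ord0 i).

Definition test_function (phi : Rn -> R) : Prop :=
  smooth phi /\ compact (closure [set x | phi x != 0]).

Definition L1loc (f : Rn -> R) : Prop :=
  measurable_fun setT f /\
  forall K : set Rn, compact K -> mu.-integrable K (EFin \o f).

Definition weak_gradient (u : Rn -> R) (g : Rn -> Rn) : Prop :=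
  forall i : 'I_n, L1loc (fun x => g x ord0 i) /\
    forall phi, test_function phi ->
      \int[mu]_x (u x * partial i phi x) = - \int[mu]_x (g x ord0 i * phi x).

(* A weak gradient of u, if there is one; it is unique almost everywhere. *)
Definition wgrad (u : Rn -> R) : Rn -> Rn :=
  xget (fun=> 0) [set g | weak_gradient u g].

Definition D1p (p : R) (u : Rn -> R) : Prop :=
  L1loc u /\ exists2 g, weak_gradient u g &
    forall i : 'I_n, (fun x => g x ord0 i) \in Lfun mu p%:E.

(* For p > n each a.e. class in D1p has exactly one continuous representative,
   and it is Hoelder continuous by Morrey's inequality: requiring continuity
   selects that representative. *)
Definition D1p0 (p : R) (Omega : set Rn) (u : Rn -> R) : Prop :=
  [/\ D1p p u, continuous u & forall x, ~ Omega x -> u x = 0].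

Definition grad_norm (p : R) (u : Rn -> R) : \bar R :=
  ('N[mu]_p%:E[EFin \o enorm \o wgrad u])%E.

Definition dist_compl (Omega : set Rn) (x : Rn) : R :=
  inf [set enorm (x - y) | y in ~` Omega].

(* || u / d^(1 - n/p) ||_oo over Omega, as a supremum since u is continuous. *)
Definition weighted_sup (p : R) (Omega : set Rn) (u : Rn -> R) : \bar R :=
  ereal_sup [set (`|u x / dist_compl Omega x `^ (1 - n%:R / p)|)%:E
            | x in Omega].

Definition rayleigh (p : R) (Omega : set Rn) (u : Rn -> R) : \bar R :=
  ((weighted_sup p Omega u `^ p)^-1 * grad_norm p u `^ p)%E.

Definition D1p0_nonzero (p : R) (Omega : set Rn) : set (Rn -> R) :=
  [set u | D1p0 p Omega u /\ u <> (fun=> 0)].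

Definition lambda_p (p : R) (Omega : set Rn) : \bar R :=
  ereal_inf [set rayleigh p Omega u | u in D1p0_nonzero p Omega].

Definition has_extremal (p : R) (Omega : set Rn) : Prop :=
  exists2 u, D1p0_nonzero p Omega u & rayleigh p Omega u = lambda_p p Omega.

(* { x | x_n > 0 }: coordinates are numbered from 0, so the last one is the i
   with i.+1 = n. *)
Definition upper_halfspace : set Rn :=
  [set x | forall i : 'I_n, i.+1 = n -> 0 < x ord0 i].

Definition is_halfspace (Omega : set Rn) : Prop :=
  exists (a : Rn) (b : R), a != 0 /\
    Omega = [set x | b < \sum_i a ord0 i * x ord0 i].

End sobolev.

Arguments upper_halfspace : clear implicits.

(* Main.v *)
(* Let C(a), for a <> 0, be the halfspace {z : a.z > 0}, or else the punctured space
   {z : z <> 0}. Since C is equivariant under rotations and dilations, the least energy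
   of a u in D_0(C(a)) with u(a) = 1, multiplied by |a|^(p-n), is a constant K that does
   not depend on a. A minimizer w exists and is unique, by Clarkson's and Morrey's
   inequalities; it is nonnegative, and it is positive in C(a) because the energy of
   log(w + eps) is locally bounded uniformly in eps.

   For every u <> 0 in D_0(Omega) the supremum of |u| / d^(1-n/p) is attained, because
   Morrey's inequality on small balls and on complements of large balls makes the
   quotient tend to 0 at the boundary and at infinity. Let x be a maximum point, and y
   a point of the complement nearest to x. For the domains considered, Omega is
   contained in y + C(x - y), hence u is a competitor for that cone and R_p(Omega, u) is
   at least K; in case of equality u is a multiple of the minimizer, so that it has no
   zero in the cone and Omega = y + C(x - y).

   Conversely, w can be cut off near the vertex of its cone and near infinity at an
   arbitrarily small cost. After a slight translation, a dilation maps the support of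
   the result into Omega: a small one near y if Omega is convex or punctured at y, and
   a large one if the complement is compact. Hence lambda_p(Omega) is at most K. *)
Require Import Defs.
From HB Require Import structures.
From mathcomp Require Import all_boot all_order all_algebra.
From mathcomp Require Import all_classical all_reals all_analysis.
From mathcomp Require Import measurable_realfun ring lra.

Set Implicit Arguments.
Unset Strict Implicit.
Unset Printing Implicit Defensive.

Import Order.TTheory GRing.Theory Num.Theory.
Import numFieldNormedType.Exports.

Local Open Scope classical_set_scope.
Local Open Scope ring_scope.

(** * Lebesgue measure on row vectors *)

Section lebesgue_rV_theory.
Context {R : realType} {n : nat}.
Local Notation Rn := 'rV[R]_n.
Local Notation mu := (@lebesgue_rV R n).

(** As n >= 2, p > n forces p > 2; Clarkson's inequality is then a consequence of the parallelogram
    law, and Morrey's inequality makes the value at one point a legitimate normalization. No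
    Euler-Lagrange equation is written down. Positivity comes from comparing w with w + t q^(m+1) (w
    + eps)^(1-p), q a cutoff: the gradient of this competitor is a convex combination of Dw and a
    field tied to Dq, so convexity of the p-th power alone bounds the energy of log(w + eps). Weak
    gradients are only ever composed with C^1 functions; hence |u| is replaced by a smooth
    approximation, and the product rule is obtained from squares. The cones form a family indexed by
    the vector from the vertex to the normalization point because, for a convex domain, the normal x
    - y of the supporting halfspace varies with u; a rotation brings every such cone to a fixed one,
    which is why the invariance of the measure under rotations has to be established. Averages and
    cutoffs live on sup-norm balls, while gradients and distances are Euclidean; factors n compare
    the two. *)

Lemma continuous_measurable_rV (f : Rn -> R) :
  continuous f -> measurable_fun setT f.
Proof.
move=> cf; apply: (measurability _ (measurable_realfun.RGenOpens.measurableE R)) => _ [_ [a [b ->]] <-].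
rewrite setTI; apply: sub_sigma_algebra.
by move/continuousP : cf; apply; exact: interval_open.
Qed.

Lemma open_measurable_rV (A : set Rn) : open A -> measurable A.
Proof. by move=> oA; apply: sub_sigma_algebra. Qed.

Lemma closed_measurable_rV (A : set Rn) : closed A -> measurable A.
Proof.
by move=> cA; rewrite -(setCK A); apply: measurableC; apply: open_measurable_rV; exact: closed_openC.
Qed.

Lemma continuous_coord (i : 'I_n) : continuous (fun v : Rn => v ord0 i).
Proof. by move=> v; exact: coord_continuous. Qed.

Lemma measurable_coord (i : 'I_n) : measurable_fun setT (fun v : Rn => v ord0 i).
Proof. by apply: continuous_measurable_rV; exact: continuous_coord. Qed.

Lemma measurable_fun_rV d (T : measurableType d) (f : T -> Rn) :
  (forall i, measurable_fun setT (fun t => f t ord0 i)) -> measurable_fun setT f.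
Proof.
move=> mf; rewrite (_ : f = @row_of_tuple R n \o
   (fun t => [tuple (f t ord0 i : measurableTypeR R) | i < n])); last first.
  apply/funext => t; apply/rowP => i.
  by rewrite /row_of_tuple /= mxE tnth_mktuple.
apply: measurableT_comp => //.
apply/measurable_fun_tnthP => i; apply: eq_measurable_fun (mf i) => t _.
by rewrite /= tnth_mktuple.
Qed.

(** Half-open boxes form a pi-system generating the Borel sets, and their preimages under
    translations and dilations are boxes; measures are therefore identified on them. *)
Definition box (a b : Rn) : set Rn :=
  [set v | forall i, `]a ord0 i, b ord0 i]%classic (v ord0 i)].

Definition boxes : set (set Rn) := [set box x.1 x.2 | x in [set: Rn * Rn]].

Lemma boxI a b c d : box a b `&` box c d =
  box (\row_i Num.max (a ord0 i) (c ord0 i)) (\row_i Num.min (b ord0 i) (d ord0 i)).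
Proof.
apply/seteqP; split=> [v [ab cd] i|v abcd].
  have := ab i; have := cd i; rewrite /= !in_itv/= !mxE => /andP[? ?] /andP[? ?].
  by rewrite gt_max le_min; apply/andP; split; apply/andP.
split=> i; have := abcd i; rewrite /= !in_itv/= !mxE gt_max le_min.
  by move=> /andP[/andP[-> _] /andP[-> _]].
by move=> /andP[/andP[_ ->] /andP[_ ->]].
Qed.

Lemma measurable_box a b : measurable (box a b).
Proof.
rewrite (_ : box a b = \bigcap_(i in [set: 'I_n])
    ((fun v : Rn => v ord0 i) @^-1` `]a ord0 i, b ord0 i]%classic)); last first.
  by apply/seteqP; split=> [v vab i _|v vab i]; [exact: vab|exact: (vab i)].
apply: fin_bigcap_measurable => // i _.
by rewrite -[X in measurable X]setTI; exact: measurable_coord.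
Qed.

Definition cbox (k : nat) : set Rn := box (const_mx (- k%:R)) (const_mx k%:R).

Lemma bigcup_box : \bigcup_k cbox k = setT.
Proof.
apply/seteqP; split=> // v _.
have [k kv] : exists k : nat, `|v| < k%:R.
  by exists (Num.truncn `|v|).+1; rewrite truncnS_gt.
exists k => // i; rewrite /= in_itv/= !mxE.
have vi : `|v ord0 i| <= `|v|.
  by rewrite [leRHS]mx_normrE; apply: le_bigmax (ord0, i).
have := le_lt_trans vi kv; rewrite ltr_norml => /andP[-> /ltW ->//].
Qed.

(** The coordinates, and with them the identity map, are measurable for the sigma-algebra generated
    by the boxes; this gives the inclusion of the Borel sets. *)
Lemma measurable_rV_boxes : @measurable _ Rn = <<s boxes >>.
Proof.
apply/seteqP; split=> A mA; last first.
  by apply: (smallest_sub (@sigma_algebra_measurable _ _) _ mA) => _ [[a b] _ <-];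
    exact: measurable_box.
pose f (v : g_sigma_algebraType boxes) : n.-tuple (measurableTypeR R) :=
  [tuple (v : Rn) ord0 i | i < n].
have mf : measurable_fun setT f.
  apply/measurable_fun_tnthP => i.
  suff mi : measurable_fun setT
      (fun v : g_sigma_algebraType boxes => (v : Rn) ord0 i : measurableTypeR R).
    by apply: eq_measurable_fun mi => v _; rewrite /f /= tnth_mktuple.
  apply: (@measurability _ _ _ (measurableTypeR R) setT _ (@ocitv R)) => // _ [_ [[a b] _ <-] <-].
  rewrite setTI.
  (* The slab a < v_i <= b is the union over k of the boxes whose other sides are ]-k, k]. *)
  pose up (c k : R) : Rn := \row_j if j == i then c else k.
  rewrite (_ : _ @^-1` _ = \bigcup_k box (up a (- k%:R)) (up b k%:R)); last first.
    apply/seteqP; split=> [v /= vab|v [k _ /(_ i)] /=]; last by rewrite !mxE eqxx.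
    have : setT (v : Rn) by []; rewrite -bigcup_box => -[k _ kv].
    exists k => // j; have := kv j; rewrite /= !in_itv/= !mxE.
    by case: eqP => // -> _; move: vab; rewrite in_itv.
  apply: bigcupT_measurable => k; apply: sub_sigma_algebra.
  by exists (up a (- k%:R), up b k%:R).
have mrA : measurable (@row_of_tuple R n @^-1` A).
  by rewrite -[X in measurable X]setTI; exact: (@measurable_funPT _ _ _ _ (@row_of_tuple R n)).
have := mf measurableT _ mrA; rewrite setTI.
rewrite (_ : _ @^-1` _ = A)//; apply/seteqP; split=> v /=.
all: by rewrite /f (_ : row_of_tuple _ = v)//; apply/rowP => i; rewrite mxE tnth_mktuple.
Qed.

Lemma lebesgue_box (a b : Rn) : (forall i, a ord0 i <= b ord0 i) ->
  mu (box a b) = (\prod_i (b ord0 i - a ord0 i))%:E.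
Proof.
move=> ab.
transitivity (\prod_(i < n)
    lebesgue_measure (`]a ord0 i, b ord0 i]%classic : set (measurableTypeR R)))%E.
  by apply: (lebesgue_rV_box (A := fun i => `]a ord0 i, b ord0 i]%classic)) => i.
rewrite -prodEFin; apply: eq_bigr => i _.
rewrite lebesgue_measure_itv/= lte_fin; case: ltP => // ba.
by rewrite (@le_anti _ _ (a ord0 i) (b ord0 i)) ?ab// subrr.
Qed.

Lemma box_empty (a b : Rn) i : b ord0 i <= a ord0 i -> box a b = set0.
Proof.
move=> ba; rewrite -subset0 => v /(_ i) /=; rewrite in_itv/= => /andP[av vb].
by have := lt_le_trans av (le_trans vb ba); rewrite ltxx.
Qed.

Lemma lebesgue_box_lty a b : (mu (box a b) < +oo)%E.
Proof.
have [/existsP[i ba]|/existsPn ab] := boolP [exists i, b ord0 i <= a ord0 i].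
  by rewrite (box_empty ba) measure0.
by rewrite lebesgue_box ?ltry// => i; rewrite ltW// ltNge ab.
Qed.

Lemma lebesgue_rV_sigma_finite : sigma_finite setT mu.
Proof.
exists cbox.
  by rewrite bigcup_box.
by move=> k; split; [exact: measurable_box|exact: lebesgue_box_lty].
Qed.

Lemma lebesgue_rV_unique (m1 m2 : {measure set Rn -> \bar R}) :
  (forall a b, m1 (box a b) = m2 (box a b)) ->
  (forall k : nat, (m1 (cbox k) < +oo)%E) ->
  forall A, measurable A -> m1 A = m2 A.
Proof.
move=> m12 m1oo A mA.
apply: (measure_unique boxes cbox) => //.
- exact: measurable_rV_boxes.
- by move=> _ _ [[a b] _ <-] [[c d] _ <-]/=; rewrite boxI; eexists (_, _).
- by move=> i; eexists (_, _).
- exact: bigcup_box.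
- by move=> _ [[a b] _ <-]; exact: m12.
Qed.

End lebesgue_rV_theory.

HB.instance Definition _ (R : realType) (n : nat) :=
  Measure_isSigmaFinite.Build _ _ _ (@lebesgue_rV R n) lebesgue_rV_sigma_finite.

(** * Euclidean norm and similarities *)

Section euclid.
Context {R : realType} {n : nat}.
Local Notation Rn := 'rV[R]_n.
Implicit Types (x y z : Rn).

Definition dot x y : R := \sum_i x ord0 i * y ord0 i.

Lemma dotC x y : dot x y = dot y x.
Proof. by apply: eq_bigr => i _; rewrite mulrC. Qed.

Lemma dotDl x y z : dot (x + y) z = dot x z + dot y z.
Proof. by rewrite -big_split; apply: eq_bigr => i _; rewrite mxE mulrDl. Qed.

Lemma dotZl (a : R) x z : dot (a *: x) z = a * dot x z.
Proof. by rewrite /dot mulr_sumr; apply: eq_bigr => i _; rewrite mxE mulrA. Qed.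

Lemma dotDr x y z : dot z (x + y) = dot z x + dot z y.
Proof. by rewrite dotC dotDl !(dotC z). Qed.

Lemma dotZr (a : R) x z : dot z (a *: x) = a * dot z x.
Proof. by rewrite dotC dotZl dotC. Qed.

Lemma dotNl x z : dot (- x) z = - dot x z.
Proof. by rewrite -scaleN1r dotZl mulN1r. Qed.

Lemma dotNr x z : dot z (- x) = - dot z x.
Proof. by rewrite dotC dotNl dotC. Qed.

Lemma dotBl x y z : dot (x - y) z = dot x z - dot y z.
Proof. by rewrite dotDl dotNl. Qed.

Lemma dotBr x y z : dot z (x - y) = dot z x - dot z y.
Proof. by rewrite dotDr dotNr. Qed.

Lemma dot0l z : dot 0 z = 0.
Proof. by rewrite -(scale0r 0) dotZl mul0r. Qed.

Lemma dotxx_ge0 x : 0 <= dot x x.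
Proof. by apply: sumr_ge0 => i _; rewrite -expr2 sqr_ge0. Qed.

Lemma enormE x : enorm x = Num.sqrt (dot x x).
Proof. by congr Num.sqrt; apply: eq_bigr => i _; rewrite expr2. Qed.

Lemma enorm_ge0 x : 0 <= enorm x.
Proof. exact: sqrtr_ge0. Qed.

Lemma enorm_sqr x : enorm x ^+ 2 = dot x x.
Proof. by rewrite enormE sqr_sqrtr ?dotxx_ge0. Qed.

Lemma dotxx_eq0 x : (dot x x == 0) = (x == 0).
Proof.
apply/idP/eqP => [|->]; last by rewrite dot0l.
rewrite psumr_eq0 => [/allP x0|i _]; last by rewrite -expr2 sqr_ge0.
apply/rowP => i; rewrite mxE; have := x0 i (mem_index_enum _).
by rewrite mulf_eq0 orbb => /eqP.
Qed.

Lemma enorm_eq0 x : (enorm x == 0) = (x == 0).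
Proof. by rewrite -dotxx_eq0 -enorm_sqr sqrf_eq0. Qed.

Lemma enorm0 : enorm (0 : Rn) = 0.
Proof. by apply/eqP; rewrite enorm_eq0. Qed.

Lemma enorm_gt0 x : (0 < enorm x) = (x != 0).
Proof. by rewrite lt_neqAle enorm_ge0 andbT eq_sym enorm_eq0. Qed.

Lemma enormZ (a : R) x : enorm (a *: x) = `|a| * enorm x.
Proof.
by rewrite !enormE dotZl dotZr mulrA -expr2 sqrtrM ?sqr_ge0// sqrtr_sqr.
Qed.

Lemma enormN x : enorm (- x) = enorm x.
Proof. by rewrite -scaleN1r enormZ normrN1 mul1r. Qed.

Lemma enormB x y : enorm (x - y) = enorm (y - x).
Proof. by rewrite -enormN opprB. Qed.

Lemma dot_le_enorm x y : dot x y <= enorm x * enorm y.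
Proof.
have [->|x0] := eqVneq x 0; first by rewrite dot0l enorm0 mul0r.
have [->|y0] := eqVneq y 0; first by rewrite dotC dot0l enorm0 mulr0.
have xy0 : 0 < enorm x * enorm y by rewrite mulr_gt0 ?enorm_gt0.
have := dotxx_ge0 (enorm y *: x - enorm x *: y).
rewrite dotBl !dotBr !dotZl !dotZr -!enorm_sqr (dotC y x) => h.
rewrite -(ler_pM2l xy0); nra.
Qed.

Lemma ler_enormD x y : enorm (x + y) <= enorm x + enorm y.
Proof.
rewrite -(@ler_pXn2r _ 2)// ?nnegrE ?addr_ge0 ?enorm_ge0//.
rewrite enorm_sqr sqrrD dotDl !dotDr -!enorm_sqr (dotC y x).
by have := dot_le_enorm x y; lra.
Qed.

Lemma coord_le_norm x i : `|x ord0 i| <= `|x|.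
Proof. by rewrite [leRHS]mx_normrE; exact: (le_bigmax _ (fun ij => `|x ij.1 ij.2|) (ord0, i)). Qed.

Lemma norm_le_coord x (r : R) : 0 <= r -> (forall i, `|x ord0 i| <= r) -> `|x| <= r.
Proof.
move=> r0 xr; rewrite [leLHS]mx_normrE; apply: bigmax_le => //= -[i j] _ /=.
by rewrite (ord1 i).
Qed.

Lemma coord_le_enorm x i : `|x ord0 i| <= enorm x.
Proof.
rewrite -(@ler_pXn2r _ 2)// ?nnegrE ?enorm_ge0// enorm_sqr real_normK ?num_real//.
by rewrite /dot (bigD1 i)//= -expr2 lerDl sumr_ge0// => j _; rewrite -expr2 sqr_ge0.
Qed.

Lemma norm_le_enorm x : `|x| <= enorm x.
Proof. by apply: norm_le_coord; [exact: enorm_ge0|exact: coord_le_enorm]. Qed.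

Lemma enorm_le_norm x : enorm x <= n%:R * `|x|.
Proof.
rewrite -(@ler_pXn2r _ 2)// ?nnegrE ?enorm_ge0 ?mulr_ge0// enorm_sqr.
apply: (@le_trans _ _ (\sum_(i < n) `|x| ^+ 2)).
  apply: ler_sum => i _; rewrite -expr2 -real_normK ?num_real//.
  by rewrite ler_pXn2r ?nnegrE// coord_le_norm.
rewrite sumr_const card_ord -[leLHS]mulr_natl exprMn ler_wpM2r ?sqr_ge0//.
by rewrite -natrX ler_nat; case: n => // k; rewrite -[leqLHS]muln1 leq_mul.
Qed.

Lemma continuous_rsum (T : topologicalType) (I : finType) (f : I -> T -> R) :
  (forall i, continuous (f i)) -> continuous (fun w => \sum_i f i w).
Proof.
move=> cf; apply: continuous_big => //.
by move=> w; apply: cvgD; [exact: cvg_fst|exact: cvg_snd].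
Qed.

Lemma continuous_dotr z : continuous (fun x => dot x z).
Proof.
apply: continuous_rsum => i x.
apply: (@continuousM _ _ (fun w : Rn => w ord0 i) (fun=> z ord0 i)).
  exact: continuous_coord.
exact: cst_continuous.
Qed.

Lemma continuous_enorm : continuous (@enorm R n).
Proof.
move=> x; apply: (@continuous_comp _ _ _ (fun y : Rn => \sum_i y ord0 i ^+ 2) Num.sqrt);
  last exact: sqrt_continuous.
move: x; apply: continuous_rsum => i x.
apply: (@continuousM _ _ (fun w : Rn => w ord0 i) (fun w : Rn => w ord0 i)).
  exact: continuous_coord.
exact: continuous_coord.
Qed.

Lemma measurable_enorm : measurable_fun setT (@enorm R n).
Proof. exact: (continuous_measurable_rV continuous_enorm). Qed.

Definition orthogonal (M : 'M[R]_n) := M *m M^T = 1%:M.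

Lemma dot_mxE x y : dot x y = (x *m y^T) ord0 ord0.
Proof. by rewrite mxE; apply: eq_bigr => i _; rewrite mxE. Qed.

Lemma dot_orthogonal M x y : orthogonal M -> dot (x *m M) (y *m M) = dot x y.
Proof.
by move=> oM; rewrite !dot_mxE trmx_mul mulmxA -(mulmxA x) oM mulmx1.
Qed.

Lemma enorm_orthogonal M x : orthogonal M -> enorm (x *m M) = enorm x.
Proof. by move=> oM; rewrite !enormE dot_orthogonal. Qed.

Lemma orthogonal_tr M : orthogonal M -> orthogonal M^T.
Proof. by rewrite /orthogonal trmxK => /mulmx1C. Qed.

Definition householder (v : Rn) : 'M[R]_n := 1%:M - (2 / dot v v) *: (v^T *m v).

Lemma mul_householder x v :
  x *m householder v = x - (2 / dot v v * dot x v) *: v.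
Proof.
rewrite mulmxBr mulmx1 -scalemxAr mulmxA.
rewrite (_ : x *m v^T = (dot x v)%:M); last first.
  by rewrite [LHS]mx11_scalar dot_mxE.
by rewrite mul_scalar_mx scalerA.
Qed.

Lemma orthogonal_householder v : v != 0 -> orthogonal (householder v).
Proof.
move=> v0; have vv : dot v v != 0 by rewrite dotxx_eq0.
rewrite /orthogonal; have -> : (householder v)^T = householder v.
  by rewrite /householder linearB /= trmx1 linearZ /= trmx_mul trmxK.
apply/row_matrixP => i; rewrite row_mul mul_householder row1.
have -> : row i (householder v) = delta_mx 0 i *m householder v by rewrite rowE.
rewrite mul_householder dotBl dotZl -mulrA -addrA -opprD -scalerDl.
by rewrite [X in X *: v](_ : _ = 0) ?scale0r ?subr0//; field.
Qed.

(** Distinct vectors of equal norm are exchanged by the reflection in the hyperplane orthogonal to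
    their difference. *)
Lemma orthogonal_transitive x y : enorm x = enorm y ->
  exists2 M, orthogonal M & x *m M = y.
Proof.
move=> xy; have [->|xNy] := eqVneq x y.
  by exists 1%:M; rewrite ?mulmx1// /orthogonal trmx1 mulmx1.
have v0 : x - y != 0 by rewrite subr_eq0.
exists (householder (x - y)); first exact: orthogonal_householder.
have vv : dot (x - y) (x - y) != 0 by rewrite dotxx_eq0.
(* |x - y|^2 = 2 x.(x - y) because |x| = |y|, so the coefficient of the reflection is 1. *)
rewrite mul_householder (_ : 2 / _ * _ = 1) ?scale1r ?subKr//.
have : dot x x = dot y y by rewrite -!enorm_sqr xy.
move: vv; rewrite dotBl !dotBr (dotC y x) => vv xxyy.
have -> : dot x x - dot x y - (dot x y - dot y y) = 2 * (dot x x - dot x y).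
  by rewrite xxyy; ring.
have : dot x x - dot x y != 0.
  by apply: contraNneq vv; rewrite -xxyy => xx0; apply/eqP; lra.
by move=> h; field.
Qed.

End euclid.

(** * Invariance of the Lebesgue measure under similarities *)

Section similarity.
Context {R : realType} {n : nat}.
Local Notation Rn := 'rV[R]_n.
Local Notation mu := (@lebesgue_rV R n).
Implicit Types (c v : Rn) (t : R) (M : 'M[R]_n).

(** Both sides are measures in A, finite on the cubes [cbox k], so agreement on boxes suffices. *)
Lemma lebesgue_pushforward_unique (f : Rn -> Rn) (r : R) : 0 <= r ->
  measurable_fun setT f ->
  (forall a b, mu (f @^-1` box a b) = r%:E * mu (box a b))%E ->
  forall A, measurable A -> mu (f @^-1` A) = (r%:E * mu A)%E.
Proof.
move=> r0 mf fbox A mA.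
pose F : {mfun Rn >-> Rn} := HB.pack f (isMeasurableFun.Build _ _ _ _ f mf).
have := @lebesgue_rV_unique R n (pushforward mu F) (mscale (NngNum r0) mu).
rewrite /pushforward /mscale /=; apply => //.
by move=> k; rewrite /pushforward fbox lte_mul_pinfty// lebesgue_box_lty.
Qed.

Lemma measurable_shift c : measurable_fun setT (fun x : Rn => x + c).
Proof.
apply: measurable_fun_rV => i; apply: (eq_measurable_fun (fun x : Rn => x ord0 i + c ord0 i)).
  by move=> x _; rewrite mxE.
by apply: measurable_funD => //; exact: measurable_coord.
Qed.

Lemma measurable_scaler t : measurable_fun setT (fun x : Rn => t *: x).
Proof.
apply: measurable_fun_rV => i; apply: (eq_measurable_fun (fun x : Rn => t * x ord0 i)).
  by move=> x _; rewrite mxE.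
by apply: measurable_funM => //; exact: measurable_coord.
Qed.

Lemma measurable_mulmx M : measurable_fun setT (fun x : Rn => x *m M).
Proof.
apply: measurable_fun_rV => i.
apply: (eq_measurable_fun (fun x : Rn => \sum_j x ord0 j * M j i)).
  by move=> x _; rewrite mxE.
apply: measurable_sum => j.
by apply: measurable_funM => //; exact: measurable_coord.
Qed.

Lemma measurable_fun_addr d (T : measurableType d) (f g : T -> Rn) :
  measurable_fun setT f -> measurable_fun setT g ->
  measurable_fun setT (fun x => f x + g x).
Proof.
move=> mf mg; apply: measurable_fun_rV => i.
apply: (eq_measurable_fun (fun x => f x ord0 i + g x ord0 i)).
  by move=> x _; rewrite mxE.
by apply: measurable_funD; apply: (measurableT_comp (measurable_coord i)).
Qed.

Lemma measurable_fun_scaler d (T : measurableType d) t (f : T -> Rn) :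
  measurable_fun setT f -> measurable_fun setT (fun x => t *: f x).
Proof. exact: measurableT_comp (measurable_scaler t). Qed.

Lemma preimage_shift_box c a b :
  (fun x : Rn => x + c) @^-1` box a b = box (a - c) (b - c).
Proof.
apply/seteqP; split=> v /= vab i; have := vab i;
  by rewrite /= !in_itv/= !mxE ltrBlDr lerBrDr.
Qed.

Lemma lebesgue_shift c (A : set Rn) : measurable A -> mu ((fun x => x + c) @^-1` A) = mu A.
Proof.
move=> mA; rewrite (lebesgue_pushforward_unique ler01)// ?mul1e//.
  exact: measurable_shift.
move=> a b; rewrite mul1e preimage_shift_box.
have [/existsP[i ba]|/existsPn ab] := boolP [exists i, b ord0 i <= a ord0 i].
  by rewrite !(@box_empty _ _ _ _ i)// !mxE lerD2r.
have {}ab i : a ord0 i <= b ord0 i by rewrite ltW// ltNge ab.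
rewrite !lebesgue_box// => [|i]; last by rewrite !mxE lerD2r.
by congr _%:E; apply: eq_bigr => i _; rewrite !mxE opprB addrA subrK.
Qed.

Lemma lebesgue_scale t (A : set Rn) : 0 < t -> measurable A ->
  mu ((fun x => t *: x) @^-1` A) = ((t ^- n)%:E * mu A)%E.
Proof.
move=> t0 mA; have tV0 : 0 <= t ^- n by rewrite invr_ge0 exprn_ge0// ltW.
rewrite (lebesgue_pushforward_unique tV0)//; first exact: measurable_scaler.
move=> a b; have -> : (fun x : Rn => t *: x) @^-1` box a b = box (t^-1 *: a) (t^-1 *: b).
  apply/seteqP; split=> v /= vab i; have := vab i;
    by rewrite /= !in_itv/= !mxE !(mulrC t^-1) ltr_pdivrMr// ler_pdivlMr// (mulrC _ t).
have [/existsP[i ba]|/existsPn ab] := boolP [exists i, b ord0 i <= a ord0 i].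
  rewrite !(@box_empty _ _ _ _ i)// ?measure0 ?mule0//.
  by rewrite !mxE ler_pM2l// invr_gt0.
have {}ab i : a ord0 i <= b ord0 i by rewrite ltW// ltNge ab.
rewrite !lebesgue_box// => [|i]; last by rewrite !mxE ler_pM2l// invr_gt0.
rewrite -EFinM -exprVn; congr _%:E.
under eq_bigr do rewrite !mxE -mulrBr.
by rewrite big_split/= prodr_const card_ord.
Qed.

Definition eball (r : R) : set Rn := [set x | enorm x < r].

Lemma open_eball r : open (eball r).
Proof.
by apply: open_comp (@open_lt R r) => x _; exact: continuous_enorm.
Qed.

Lemma measurable_eball r : measurable (eball r).
Proof. by apply: open_measurable_rV; exact: open_eball. Qed.

Lemma eball_cbox (k : nat) : eball k%:R `<=` cbox k.
Proof.
move=> x xk i; have := le_lt_trans (coord_le_enorm x i) xk.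
by rewrite /= in_itv/= !mxE ltr_norml => /andP[-> /ltW].
Qed.

(** The Euclidean norm is at most n times the sup norm; n + 1 keeps the denominator positive for
    every n. *)
Lemma box_eball1 : box (const_mx (- (2 * n.+1%:R)^-1)) (const_mx (2 * n.+1%:R)^-1)
   `<=` eball 1.
Proof.
move=> x xb; rewrite /eball/=.
apply: (le_lt_trans (enorm_le_norm x)).
have n0 : 0 < (2 * n.+1%:R : R)^-1 by rewrite invr_gt0 mulr_gt0.
apply: (@le_lt_trans _ _ (n%:R * (2 * n.+1%:R)^-1)).
  rewrite ler_wpM2l//; apply: norm_le_coord; first exact: ltW.
  by move=> i; have := xb i; rewrite /= in_itv/= !mxE => /andP[/ltW ? ?]; rewrite ler_norml; apply/andP.
rewrite ltr_pdivrMr ?mul1r ?mulr_gt0// -natr1.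
have : 0 <= n%:R :> R by []. lra.
Qed.

(** Finiteness and positivity are what allows this measure to be cancelled in
    [lebesgue_orthogonal]. *)
Lemma lebesgue_eball1 : exists2 r : R, 0 < r & mu (eball 1) = r%:E.
Proof.
have oo : (mu (eball 1) < +oo)%E.
  apply: (@le_lt_trans _ _ (mu (cbox 1%N))); last exact: lebesgue_box_lty.
  by apply: le_measure; rewrite ?inE//; [exact: measurable_eball|exact: measurable_box|exact: (@eball_cbox 1)].
have pos : (0 < mu (eball 1))%E.
  pose b : R := (2 * n.+1%:R)^-1.
  have b0 : 0 < b by rewrite invr_gt0 mulr_gt0.
  apply: (@lt_le_trans _ _ (mu (box (const_mx (- b)) (const_mx b)))).
    rewrite lebesgue_box => [|i]; last by rewrite !mxE; lra.
    by rewrite lte_fin prodr_gt0// => i _; rewrite !mxE; lra.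
  by apply: le_measure; rewrite ?inE//; [exact: measurable_box|exact: measurable_eball|exact: box_eball1].
exists (fine (mu (eball 1))); first by rewrite fine_gt0// pos.
by rewrite fineK// ge0_fin_numE.
Qed.

Lemma ge0_integral_shift c (f : Rn -> \bar R) : measurable_fun [set: Rn] f ->
  (forall x, 0 <= f x)%E -> (\int[mu]_x f (x + c)%R = \int[mu]_x f x)%E.
Proof.
move=> mf f0; have ms := measurable_shift c.
have := @ge0_integral_pushforward _ _ _ _ R _ ms mu setT f measurableT mf (fun y _ => f0 y).
rewrite preimage_setT /comp => <-.
pose F : {mfun Rn >-> Rn} := HB.pack (fun x : Rn => x + c) (isMeasurableFun.Build _ _ _ _ _ ms).
apply: (@eq_measure_integral _ _ _ _ mu (pushforward mu F)) => A mA _.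
exact: lebesgue_shift.
Qed.

Lemma integral_indicT (A : set Rn) : measurable A -> (\int[mu]_x (\1_A x)%:E = mu A)%E.
Proof. by move=> mA; rewrite integral_indic// setIT. Qed.

(* Haar uniqueness: integrate 1_B(x) 1_A(x + y M), where B is the Euclidean unit ball,
   in both orders. *)
Lemma lebesgue_orthogonal M (A : set Rn) : orthogonal M -> measurable A ->
  mu ((fun x => x *m M) @^-1` A) = mu A.
Proof.
move=> oM mA.
have [r r0 Br] := lebesgue_eball1; have mB := @measurable_eball 1.
pose f (z : Rn * Rn) : \bar R := (\1_(eball 1) z.1 * \1_A (z.1 + z.2 *m M))%:E.
have mM : measurable_fun [set: Rn * Rn] (fun z : Rn * Rn => z.2 *m M).
  by apply: (measurableT_comp (measurable_mulmx M)).
have mAM : measurable ((fun x : Rn => x *m M) @^-1` A).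
  by rewrite -[X in measurable X]setTI; exact: measurable_mulmx.
have mf : measurable_fun [set: Rn * Rn] f.
  apply/measurable_EFinP; apply: measurable_funM.
    by apply: measurableT_comp => //; exact: measurable_indic.
  apply: measurableT_comp; first exact: measurable_indic.
  exact: measurable_fun_addr.
have f0 z : (0 <= f z)%E by rewrite lee_fin mulr_ge0.
pose g (z : Rn * Rn) : \bar R := (\1_(eball 1) (z.1 - z.2 *m M) * \1_A z.1)%:E.
have mg : measurable_fun [set: Rn * Rn] g.
  apply/measurable_EFinP; apply: measurable_funM; last first.
    by apply: measurableT_comp => //; exact: measurable_indic.
  apply: measurableT_comp; first exact: measurable_indic.
  apply: measurable_fun_addr => //.
  apply: (eq_measurable_fun (fun z : Rn * Rn => -1 *: (z.2 *m M))).
    by move=> z _; rewrite scaleN1r.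
  exact: measurable_fun_scaler.
have g0 z : (0 <= g z)%E by rewrite lee_fin mulr_ge0.
(* For fixed x, translating y by x M^T turns the inner integral into the measure of the preimage of
   A. *)
have I1 : (\int[mu]_x \int[mu]_y f (x, y) =
    r%:E * mu ((fun x => x *m M) @^-1` A))%E.
  transitivity (\int[mu]_x (mu ((fun x => x *m M) @^-1` A) * (\1_(eball 1) x)%:E))%E.
    apply: eq_integral => x _; rewrite /f/=; under eq_integral do rewrite EFinM.
    rewrite ge0_integralZl//; last first.
      apply/measurable_EFinP; apply: measurableT_comp; first exact: measurable_indic.
      by apply: measurable_fun_addr => //; exact: measurable_mulmx.
    rewrite muleC; congr (_ * _)%E.
    rewrite -(integral_indicT mAM).
    rewrite -(@ge0_integral_shift (x *m M^T)
      (fun y => (\1_((fun z : Rn => z *m M) @^-1` A) y)%:E))//; last first.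
      by apply/measurable_EFinP; exact: measurable_indic.
    apply: eq_integral => y _; rewrite !indicE; congr ((_ : bool)%:R)%:E.
    by apply/idP/idP; rewrite !inE/= mulmxDl -mulmxA (mulmx1C oM) mulmx1 addrC.
  rewrite ge0_integralZl//; last by apply/measurable_EFinP; exact: measurable_indic.
  by rewrite integral_indicT// Br muleC.
(* A translation of x by y M, where y is the outer variable, replaces f by g. After the exchange of
   integrals, |x - y M| = |y - x M^T| makes the integral in y the measure of the ball. *)
have I2 : (\int[mu]_y \int[mu]_x f (x, y) = r%:E * mu A)%E.
  transitivity (\int[mu]_y \int[mu]_x g (x, y))%E.
    apply: eq_integral => y _.
    rewrite -(@ge0_integral_shift (y *m M) (fun x => g (x, y)))//.
      by apply: eq_integral => x _; rewrite /f /g/= addrK.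
    exact: measurableT_comp mg _.
  rewrite -sfinite_Fubini//.
  transitivity (\int[mu]_x (r%:E * (\1_A x)%:E))%E.
    apply: eq_integral => x _; rewrite /g/=; under eq_integral do rewrite mulrC EFinM.
    rewrite ge0_integralZl//; last first.
      apply/measurable_EFinP; apply: measurableT_comp; first exact: measurable_indic.
      apply: measurable_fun_addr => //.
      apply: (eq_measurable_fun (fun y : Rn => -1 *: (y *m M))).
        by move=> z _; rewrite scaleN1r.
      by apply: measurable_fun_scaler; exact: measurable_mulmx.
    rewrite muleC; congr (_ * _)%E.
    rewrite -Br -(integral_indicT mB).
    transitivity (\int[mu]_y (\1_(eball 1) (y - x *m M^T))%:E)%E; last first.
      apply: (@ge0_integral_shift (- (x *m M^T)) (fun y => (\1_(eball 1) y)%:E)) => //.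
      by apply/measurable_EFinP; exact: measurable_indic.
    apply: eq_integral => y _; rewrite !indicE; congr ((_ : bool)%:R)%:E.
    have E : enorm (y - x *m M^T) = enorm (x - y *m M).
      by rewrite -(enorm_orthogonal _ oM) mulmxDl mulNmx -mulmxA (mulmx1C oM) mulmx1 enormB.
    by apply/idP/idP; rewrite !inE /eball/= E.
  rewrite ge0_integralZl ?integral_indicT ?lee_fin ?(ltW r0)//.
  by apply/measurable_EFinP; exact: measurable_indic.
have := sfinite_Fubini mu mu f f0 mf.
rewrite I1 I2 => E; apply/eqP; rewrite eq_le.
by apply/andP; split; rewrite -(@lee_pmul2l _ r%:E)// E.
Qed.

(** Translations, dilations and rotations are all instances of this map, so one change of variables
    serves throughout. *)
Definition sim c t M (x : Rn) : Rn := c + t *: (x *m M).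

Definition simV c t M (x : Rn) : Rn := t^-1 *: ((x - c) *m M^T).

Lemma simVE c t M : simV c t M = sim (- (t^-1 *: (c *m M^T))) t^-1 M^T.
Proof. by apply/funext => x; rewrite /simV /sim mulmxBl scalerBr addrC. Qed.

Lemma simK c t M : 0 < t -> orthogonal M -> cancel (sim c t M) (simV c t M).
Proof.
move=> t0 oM x; rewrite /sim /simV addrC addKr -scalemxAl scalerA mulVf ?gt_eqF//.
by rewrite scale1r -mulmxA oM mulmx1.
Qed.

Lemma simVK c t M : 0 < t -> orthogonal M -> cancel (simV c t M) (sim c t M).
Proof.
move=> t0 oM x; rewrite /sim /simV -scalemxAl scalerA mulfV ?gt_eqF//.
by rewrite scale1r -mulmxA (mulmx1C oM) mulmx1 addrC subrK.
Qed.

Lemma measurable_sim c t M : measurable_fun setT (sim c t M).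
Proof.
apply: (eq_measurable_fun (fun x => t *: (x *m M) + c)).
  by move=> x _; rewrite addrC.
apply: (measurableT_comp (measurable_shift c)); apply: measurable_fun_scaler.
exact: measurable_mulmx.
Qed.

Lemma lebesgue_sim c t M (A : set Rn) : 0 < t -> orthogonal M -> measurable A ->
  mu (sim c t M @^-1` A) = ((t ^- n)%:E * mu A)%E.
Proof.
move=> t0 oM mA.
have mA1 : measurable ((fun x => x + c) @^-1` A).
  by rewrite -[X in measurable X]setTI; exact: measurable_shift.
have mA2 : measurable ((fun x => t *: x) @^-1` ((fun x => x + c) @^-1` A)).
  by rewrite -[X in measurable X]setTI; exact: measurable_scaler.
rewrite -(lebesgue_shift c mA) -lebesgue_scale// -(lebesgue_orthogonal oM mA2).
by congr (mu _); apply/seteqP; split=> x; rewrite /sim/= addrC.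
Qed.

Lemma ge0_integral_sim c t M (f : Rn -> \bar R) : 0 < t -> orthogonal M ->
  measurable_fun [set: Rn] f -> (forall x, 0 <= f x)%E ->
  (\int[mu]_x f (sim c t M x) = (t ^- n)%:E * \int[mu]_x f x)%E.
Proof.
move=> t0 oM mf f0; have ms := measurable_sim c t M.
have := @ge0_integral_pushforward _ _ _ _ R _ ms mu setT f measurableT mf (fun y _ => f0 y).
rewrite preimage_setT /comp => <-.
pose F : {mfun Rn >-> Rn} := HB.pack (sim c t M) (isMeasurableFun.Build _ _ _ _ _ ms).
have tV0 : 0 <= t ^- n by rewrite invr_ge0 exprn_ge0// ltW.
rewrite -[X in (X * _)%E]/((NngNum tV0)%:num%:E) -ge0_integral_mscale//.
apply: (@eq_measure_integral _ _ _ _ (mscale (NngNum tV0) mu) (pushforward mu F)).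
by move=> A mA _; exact: lebesgue_sim.
Qed.

Lemma integrable_sim c t M (f : Rn -> R) : 0 < t -> orthogonal M ->
  mu.-integrable setT (EFin \o f) ->
  mu.-integrable setT (EFin \o (fun x => f (sim c t M x))).
Proof.
move=> t0 oM /integrableP[mf foo]; apply/integrableP; split.
  exact: (measurableT_comp mf (measurable_sim c t M)).
rewrite (@ge0_integral_sim c t M (fun x => `|(f x)%:E|)%E)//; last exact: measurableT_comp.
by rewrite lte_mul_pinfty// lee_fin invr_ge0 exprn_ge0// ltW.
Qed.

Lemma Rintegral_sim c t M (f : Rn -> R) : 0 < t -> orthogonal M ->
  mu.-integrable setT (EFin \o f) ->
  \int[mu]_x f (sim c t M x) = t ^- n * \int[mu]_x f x.
Proof.
move=> t0 oM fi; have := measurable_int _ fi => mf.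
rewrite /Rintegral -[t ^- n]/(fine (t ^- n)%:E) -fineM//; last exact: integrable_fin_num.
congr fine; rewrite [LHS]integralE [in RHS]integralE.
rewrite muleBr//; last exact: integrable_add_def.
congr (_ - _)%E.
  rewrite -(@ge0_integral_sim c t M ((EFin \o f)^\+)%E t0 oM)//; last exact: measurable_funepos.
  by apply: eq_integral => x _; rewrite !funeposE.
rewrite -(@ge0_integral_sim c t M ((EFin \o f)^\-)%E t0 oM)//; last exact: measurable_funeneg.
by apply: eq_integral => x _; rewrite !funenegE.
Qed.

Lemma orthogonal1 : orthogonal (1%:M : 'M[R]_n).
Proof. by rewrite /orthogonal trmx1 mulmx1. Qed.

Lemma sim_shift c : sim c 1 1%:M = fun x => x + c.
Proof. by apply/funext => x; rewrite /sim mulmx1 scale1r addrC. Qed.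

End similarity.

(** * Smooth functions *)

Section derivative_lemmas.
Context {R : realType}.
Implicit Types (V W : normedModType R).

Lemma cvg_is_derive V W (f : V -> W) (x v : V) (l : W) :
  h^-1 *: (f (h *: v + x) - f x) @[h --> 0^'] --> l -> is_derive x v f l.
Proof.
move=> fl; apply: DeriveDef; last exact: cvg_lim fl.
by apply/cvg_ex; exists l.
Qed.

Lemma is_derive_cvg V W (f : V -> W) (x v : V) (l : W) :
  is_derive x v f l -> h^-1 *: (f (h *: v + x) - f x) @[h --> 0^'] --> l.
Proof. by case=> dfx <-; exact: dfx. Qed.

(** The bridge by which one-variable rules, such as the chain rule and the mean value theorem, apply
    to directional derivatives. *)
Lemma is_derive_line V W (f : V -> W) (x v : V) (t : R) (l : W) :
  is_derive (x + t *: v) v f l <-> is_derive t 1 (fun s : R => f (x + s *: v)) l.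
Proof.
split=> /is_derive_cvg fl; apply: cvg_is_derive; apply: cvg_trans fl;
  apply: near_eq_cvg; near=> h; congr (_ *: (f _ - _));
  by rewrite [h *: 1]mulr1 scalerDl addrCA.
Unshelve. all: by end_near. Qed.

Lemma is_derive_line0 V W (f : V -> W) (x v : V) (l : W) :
  is_derive x v f l <-> is_derive (0 : R) 1 (fun s : R => f (x + s *: v)) l.
Proof. by rewrite -is_derive_line scale0r addr0. Qed.

Lemma is_derive_comp V (f : V -> R) (F : R -> R) (x v : V) (a b : R) :
  is_derive x v f b -> is_derive (f x) 1 F a ->
  is_derive x v (fun y => F (f y)) (a * b).
Proof.
move=> /is_derive_line0 fb Fa; apply/is_derive_line0.
by apply: is_derive1_comp; rewrite scale0r addr0.
Qed.

(** Meant for [expk] at 0, where two formulas meet and no differentiation rule applies. *)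
Lemma is_derive_quadratic (F : R -> R) (t C : R) :
  (forall s, `|F s - F t| <= C * (s - t) ^+ 2) -> is_derive t 1 F 0.
Proof.
move=> FC; apply: cvg_is_derive; apply/cvgr0Pnorm_le => e e0.
have C0 : 0 <= C.
  by have := FC (t + 1); rewrite [t + 1]addrC addrK expr1n mulr1; apply: le_trans.
near=> h.
have h0 : h != 0 by near: h; exact: nbhs_dnbhs_neq.
rewrite normrZ normfV ler_pdivrMl ?normr_gt0//.
apply: (le_trans (FC _)); rewrite [h *: 1]mulr1 addrK.
rewrite -[h ^+ 2]ger0_norm ?sqr_ge0// normrX expr2 mulrCA ler_wpM2l//.
have : `|h| <= e / (C + 1).
  near: h; apply: dnbhs0_le; rewrite divr_gt0//; lra.
rewrite ler_pdivlMr; last lra.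
by rewrite mulrDr mulr1 mulrC; apply: le_trans; rewrite lerDl.
Unshelve. all: by end_near. Qed.

(** The sign of s is free, and |r| <= |s| is the only trace kept of the intermediate point. *)
Lemma mvt_line V (f : V -> R) (y e : V) (s : R) :
  (forall z, derivable f z e) ->
  exists2 r, `|r| <= `|s| & f (y + s *: e) - f y = s * 'D_e f (y + r *: e).
Proof.
move=> df; pose g (r : R) := f (y + r *: e).
have dg (r : R) : is_derive r 1 g ('D_e f (y + r *: e)).
  exact: (proj1 (is_derive_line f y e r _) (derivableP (df _))).
have cg (a b : R) : {within `[a, b], continuous g}.
  apply: continuous_subspaceT => r.
  by apply/differentiable_continuous/derivable1_diffP; case: (dg r).
have [s0|s0] := leP 0 s.
  have [r rs gE] := MVT_segment s0 (fun r _ => dg r) (cg _ _).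
  exists r; last by move: gE; rewrite /g scale0r addr0 subr0 mulrC.
  by move: rs; rewrite in_itv/= => /andP[r0 rs]; rewrite !ger0_norm.
have [r rs gE] := MVT_segment (ltW s0) (fun r _ => dg r) (cg _ _).
exists r.
  move: rs; rewrite in_itv/= => /andP[r0 rs].
  by rewrite !ler0_norm ?lerN2// ltW.
move: gE; rewrite /g scale0r addr0 sub0r mulrC => gE; apply/eqP.
by rewrite -eqr_opp opprB gE mulNr.
Qed.

End derivative_lemmas.

(** * Directional derivatives of C^1 functions *)

Section total_derivative.
Context {R : realType} {n : nat}.
Local Notation Rn := 'rV[R]_n.

(** The vertices of the axis-parallel path from 0 to v. *)
Definition cut (v : Rn) (k : nat) : Rn := \row_j if (j < k)%N then v ord0 j else 0.

Lemma cutS (v : Rn) (k : 'I_n) : cut v k.+1 = cut v k + v ord0 k *: delta_mx ord0 k.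
Proof.
apply/rowP => j; rewrite !mxE ltnS leq_eqVlt eqxx /=.
rewrite -val_eqE /=; case: (ltngtP (j : nat) k) => [_|_|/val_inj ->] /=;
  by rewrite ?mulr1 ?add0r ?mulr0 ?addr0.
Qed.

Lemma cut0 (v : Rn) : cut v 0 = 0.
Proof. by apply/rowP => j; rewrite !mxE. Qed.

Lemma cutn (v : Rn) : cut v n = v.
Proof. by apply/rowP => j; rewrite !mxE ltn_ord. Qed.

Lemma norm_cut (v : Rn) k : `|cut v k| <= `|v|.
Proof.
apply: norm_le_coord => // i; rewrite mxE; case: ifP => _; first exact: coord_le_norm.
by rewrite normr0.
Qed.

(* The increment along v is telescoped coordinate by coordinate, and the mean value
   theorem is applied on each axis-parallel segment. *)
Lemma is_derive_C1 (f : Rn -> R) (x v : Rn) :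
  (forall i y, derivable f y (delta_mx ord0 i)) ->
  (forall i, continuous (partial i f)) ->
  is_derive x v f (\sum_i v ord0 i * partial i f x).
Proof.
move=> df cf; apply: cvg_is_derive; apply/cvgrPdist_le => e e0.
have C0 : 0 < \sum_i `|v ord0 i| + 1.
  by rewrite ltr_wpDl// sumr_ge0.
pose e' := e / (\sum_i `|v ord0 i| + 1).
have e'0 : 0 < e' by rewrite divr_gt0.
have /nbhs_ballP[d /= d0 hd] : \forall y \near x, forall i, `|partial i f x - partial i f y| <= e'.
  apply: (@filter_forall _ _ (fun i y => `|partial i f x - partial i f y| <= e') (nbhs x)).
  by move=> i; move/cvgrPdist_le : (cf i x); apply.
have key (h : R) (k : 'I_n) : `|h| * (1 + 2 * `|v|) < d ->
    `|f (x + h *: cut v k.+1) - f (x + h *: cut v k) - h * (v ord0 k * partial k f x)|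
      <= `|h| * (`|v ord0 k| * e').
  move=> hdlt; rewrite cutS scalerDr addrA scalerA.
  have [r rh ->] := mvt_line (x + h *: cut v k) (h * v ord0 k) (df k).
  rewrite -mulrA -mulrBr -mulrBr !normrM ler_wpM2l// ler_wpM2l// distrC.
  apply: hd; rewrite -ball_normE /= -addrA opprD addrA subrr sub0r normrN.
  apply: le_lt_trans hdlt; apply: (le_trans (ler_normD _ _)).
  rewrite !normrZ mulrDr mulr1 addrC mulrCA mulr_natl mulr2n addrA lerD//; last first.
    by rewrite ler_wpM2l// norm_cut.
  apply: (@le_trans _ _ (`|h| * `|v ord0 k| * 1)).
    rewrite -normrM ler_pM//; apply: norm_le_coord => // j.
    by rewrite mxE eqxx /=; case: (_ == _); rewrite ?normr1 ?normr0.
  by rewrite mulr1 (le_trans (ler_wpM2l _ (coord_le_norm v k)))// lerDr.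
near=> h.
have h0 : h != 0 by near: h; exact: nbhs_dnbhs_neq.
have hdlt : `|h| * (1 + 2 * `|v|) < d.
  rewrite -ltr_pdivlMr; last by rewrite ltr_wpDr// mulr_ge0.
  by near: h; apply: dnbhs0_lt; rewrite divr_gt0// ltr_wpDr// mulr_ge0.
have -> : f (h *: v + x) - f x =
    \sum_(k < n) (f (x + h *: cut v k.+1) - f (x + h *: cut v k)).
  rewrite -(big_mkord predT (fun k => f (x + h *: cut v k.+1) - f (x + h *: cut v k))).
  by rewrite telescope_sumr// cutn cut0 scaler0 addr0 (addrC x).
rewrite -[X in `|X - _|](scalerK h0) -scalerBr normrZ normfV ler_pdivrMl ?normr_gt0//.
rewrite distrC scaler_sumr -sumrB; apply: (le_trans (ler_norm_sum _ _ _)).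
apply: (@le_trans _ _ (\sum_k `|h| * (`|v ord0 k| * e'))).
  by apply: ler_sum => k _; exact: key.
rewrite -mulr_sumr ler_wpM2l// -mulr_suml /e' mulrCA ger_pMr//.
by rewrite ler_pdivrMr// mul1r lerDl.
Unshelve. all: by end_near. Qed.

End total_derivative.

(** * Smooth step and bump on the line *)

Section one_dim.
Context {R : realType}.
Implicit Types (t : R) (k : nat).

(* t^-k exp(-1/t), extended by 0 to t <= 0: a family closed under differentiation. *)
Definition expk k t : R := if 0 < t then t^-1 ^+ k * expR (- t^-1) else 0.

Lemma expk_ge0 k t : 0 <= expk k t.
Proof.
rewrite /expk; case: ifPn => // t0.
by rewrite mulr_ge0 ?expR_ge0// exprn_ge0// invr_ge0 ltW.
Qed.

Lemma expk_gt0 k t : 0 < t -> 0 < expk k t.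
Proof. by move=> t0; rewrite /expk t0 mulr_gt0 ?expR_gt0// exprn_gt0// invr_gt0. Qed.

Lemma expk_le0 k t : t <= 0 -> expk k t = 0.
Proof. by rewrite leNgt /expk => /negbTE ->. Qed.

(** With s = 1/t this is s^(k+2) / (k+2)! <= exp s, a single term of the exponential series. *)
Lemma expk_quadratic k t : `|expk k t| <= k.+2`!%:R * t ^+ 2.
Proof.
rewrite ger0_norm ?expk_ge0//; have [t0|t0] := ltP 0 t; last first.
  by rewrite expk_le0// mulr_ge0 ?sqr_ge0.
rewrite /expk t0.
have [s s0 ->] : exists2 s, 0 < s & t = s^-1.
  by exists t^-1; rewrite ?invr_gt0 ?invrK.
rewrite invrK exprVn expRN ler_pdivrMr ?expR_gt0// mulrAC ler_pdivlMr ?exprn_gt0//.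
rewrite -exprD addn2 mulrC -ler_pdivrMr ?ltr0n ?fact_gt0//.
by have := @expR_ge1Dxn _ s k.+1 (ltW s0); lra.
Qed.

Lemma is_derive_expk k t :
  is_derive t 1 (expk k) (expk k.+2 t - k%:R * expk k.+1 t).
Proof.
have [t0|t0|->] := ltgtP t 0.
- rewrite !expk_le0 ?(ltW t0)// mulr0 subr0.
  apply: (@near_eq_is_derive _ _ _ (cst 0)) => //.
  by near=> s; rewrite /cst expk_le0// ltW//; near: s; exact: lt_nbhsl.
- apply: (@near_eq_is_derive R R R (fun s : R => s^-1 ^+ k * expR (- s^-1))).
  + by near=> s; rewrite /expk ifT//; near: s; exact: lt_nbhsr.
  + have tN0 : t != 0 by rewrite gt_eqF.
    have dV : is_derive t 1 (fun s : R => s^-1) (- t ^- 2).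
      by have := is_deriveV tN0 (is_derive_id t 1); rewrite [_ *: _]mulr1.
    have dX : is_derive t 1 (fun s : R => s^-1 ^+ k) (k%:R * t^-1 ^+ k.-1 * - t ^- 2).
      have := @is_deriveX _ _ (fun s : R => s^-1) k t 1 (- t ^- 2) dV.
      by rewrite exprfctE.
    have dE : is_derive t 1 (fun s : R => expR (- s^-1)) (expR (- t^-1) * t ^- 2).
      apply: (@is_derive1_comp _ expR (fun s : R => - s^-1)).
      by have := is_deriveN dV; rewrite opprK.
    have := is_deriveM dX dE; rewrite /expk t0 => d.
    apply: is_derive_eq d _.
    rewrite /GRing.scale/=; case: k {dX} => [|k] /=.
      by rewrite -!exprVn; ring.
    by rewrite -!exprVn !exprS; ring.
- rewrite !expk_le0// mulr0 subr0.
  apply: (@is_derive_quadratic _ _ _ k.+2`!%:R) => s.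
  by rewrite subr0 (expk_le0 _ (lexx 0)) subr0 expk_quadratic.
Unshelve. all: by end_near. Qed.

Definition sden t : R := expk 0 (1 + t) + expk 0 (1 - t).

Lemma sden_gt0 t : 0 < sden t.
Proof.
have [t0|t0] := leP t 0.
  by rewrite ltr_wpDl ?expk_ge0// expk_gt0//; lra.
by rewrite ltr_wpDr ?expk_ge0// expk_gt0//; lra.
Qed.

(** The usual smooth transition, from 0 on t <= -1 to 1 on t >= 1. *)
Definition sstep t : R := expk 0 (1 + t) / sden t.

(* The derivative of sstep. *)
Definition sbump t : R :=
  (expk 2 (1 + t) * expk 0 (1 - t) + expk 0 (1 + t) * expk 2 (1 - t)) / sden t ^+ 2.

Lemma sstep_ge0 t : 0 <= sstep t.
Proof. by rewrite divr_ge0 ?expk_ge0// ltW// sden_gt0. Qed.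

Lemma sstep_le1 t : sstep t <= 1.
Proof. by rewrite ler_pdivrMr ?sden_gt0// mul1r lerDl expk_ge0. Qed.

Lemma sstep_eq0 t : t <= -1 -> sstep t = 0.
Proof. by move=> t1; rewrite /sstep expk_le0 ?mul0r//; lra. Qed.

Lemma sstep_eq1 t : 1 <= t -> sstep t = 1.
Proof.
move=> t1; have := sden_gt0 t; rewrite /sstep /sden (@expk_le0 _ (1 - t)) ?addr0.
  by move=> h; rewrite divff// gt_eqF.
by lra.
Qed.

Lemma sbump_ge0 t : 0 <= sbump t.
Proof.
by rewrite divr_ge0 ?sqr_ge0// addr_ge0// mulr_ge0 ?expk_ge0.
Qed.

Lemma sbump_eq0 t : 1 <= `|t| -> sbump t = 0.
Proof.
rewrite ler_normr orbC => /orP[t1|t1]; rewrite /sbump.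
  by rewrite !(@expk_le0 _ (1 + t)) ?mul0r ?addr0 ?mul0r//; lra.
by rewrite !(@expk_le0 _ (1 - t)) ?mulr0 ?addr0 ?mul0r//; lra.
Qed.

Lemma sbump_gt0 t : `|t| < 1 -> 0 < sbump t.
Proof.
rewrite ltr_norml => /andP[? ?]; rewrite divr_gt0 ?exprn_gt0 ?sden_gt0//.
by rewrite ltr_wpDr ?mulr_ge0 ?expk_ge0// mulr_gt0// expk_gt0//; lra.
Qed.

End one_dim.

(** * Closure properties of smooth functions and test functions *)

Section smooth_functions.
Context {R : realType} {n : nat}.
Local Notation Rn := 'rV[R]_n.
Local Notation e := (delta_mx ord0).

(* smooth speaks of all iterated derivatives at once; sm is closed under partial
   derivatives, so that smoothness needs a single differentiation. *)
Inductive sm : (Rn -> R) -> Prop :=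
| sm_cst c : sm (fun=> c)
| sm_coord (i : 'I_n) : sm (fun x => x ord0 i)
| sm_add f g : sm f -> sm g -> sm (fun x => f x + g x)
| sm_mul f g : sm f -> sm g -> sm (fun x => f x * g x)
| sm_inv f : sm f -> (forall x, f x != 0) -> sm (fun x => (f x)^-1)
| sm_expk k f : sm f -> sm (fun x => expk k (f x))
| sm_comp f c t M : smooth f -> sm (fun x => f (sim c t M x)).

Lemma smooth_partial (f : Rn -> R) i : smooth f -> smooth (partial i f).
Proof.
move=> sf s; have := sf (rcons s i).
by rewrite -cats1 foldr_cat.
Qed.

Lemma smooth_continuous (f : Rn -> R) : smooth f -> continuous f.
Proof. by move=> /(_ [::])[]. Qed.

Lemma smooth_derivable (f : Rn -> R) i x : smooth f -> derivable f x (e i).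
Proof. by move=> /(_ [::])[_]; exact. Qed.

Lemma smooth_derive (f : Rn -> R) (x v : Rn) : smooth f ->
  is_derive x v f (\sum_i v ord0 i * partial i f x).
Proof.
move=> sf; apply: is_derive_C1 => i; first by move=> y; exact: smooth_derivable.
exact/smooth_continuous/smooth_partial.
Qed.

Lemma sm_sum (I : Type) (r : seq I) (P : pred I) (F : I -> Rn -> R) :
  (forall i, sm (F i)) -> sm (fun x => \sum_(i <- r | P i) F i x).
Proof.
move=> sF; elim: r => [|i r IHr].
  rewrite (_ : (fun _ => _) = fun=> 0); first exact: sm_cst.
  by apply/funext => x; rewrite big_nil.
rewrite (_ : (fun _ => _) = fun x => (if P i then F i x else 0) +
    \sum_(j <- r | P j) F j x); last first.
  by apply/funext => x; rewrite big_cons; case: ifP => //; rewrite add0r.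
by apply: sm_add => //; case: (P i) => //; exact: sm_cst.
Qed.

Lemma sm_prod (I : Type) (r : seq I) (P : pred I) (F : I -> Rn -> R) :
  (forall i, sm (F i)) -> sm (fun x => \prod_(i <- r | P i) F i x).
Proof.
move=> sF; elim: r => [|i r IHr].
  rewrite (_ : (fun _ => _) = fun=> 1); first exact: sm_cst.
  by apply/funext => x; rewrite big_nil.
rewrite (_ : (fun _ => _) = fun x => (if P i then F i x else 1) *
    \prod_(j <- r | P j) F j x); last first.
  by apply/funext => x; rewrite big_cons; case: ifP => //; rewrite mul1r.
by apply: sm_mul => //; case: (P i) => //; exact: sm_cst.
Qed.

Lemma norm_mulmx (M : 'M[R]_n) (x : Rn) : `|x *m M| <= `|x| * \sum_i \sum_j `|M i j|.
Proof.
apply: norm_le_coord => [|i]; first by rewrite mulr_ge0// sumr_ge0// => i _; rewrite sumr_ge0.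
rewrite mxE mulr_sumr; apply: (le_trans (ler_norm_sum _ _ _)).
apply: ler_sum => j _; rewrite normrM ler_pM//; first exact: coord_le_norm.
by rewrite (bigD1 i)//= lerDl sumr_ge0.
Qed.

Lemma continuous_mulmx (M : 'M[R]_n) : continuous (fun x : Rn => x *m M).
Proof.
move=> x; apply/(@cvgrPdist_le R Rn Rn (nbhs x) (nbhs_filter x)) => r r0.
have C0 : 0 <= \sum_i \sum_j `|M i j| by apply: sumr_ge0 => i _; rewrite sumr_ge0.
near=> y; rewrite -mulmxBl.
apply: (le_trans (norm_mulmx _ _)).
apply: (@le_trans _ _ (`|x - y| * (\sum_i \sum_j `|M i j| + 1))); first by rewrite ler_wpM2l// lerDl.
rewrite -ler_pdivlMr; last by rewrite ltr_wpDl.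
near: y; apply: cvgr_dist_le => //; rewrite divr_gt0// ltr_wpDl//.
Unshelve. all: by end_near. Qed.

Lemma continuous_sim c t M : continuous (sim c t M : Rn -> Rn).
Proof.
move=> x; apply: (@continuousD _ _ _ (cst c) (fun y : Rn => t *: (y *m M))).
  exact: cst_continuous.
apply: (@continuous_comp _ _ _ (fun y : Rn => y *m M) ( *:%R t)); last first.
  exact: scaler_continuous.
exact: continuous_mulmx.
Qed.

Lemma is_derive_comp_sim (f : Rn -> R) c t M (x v : Rn) l :
  is_derive (sim c t M x) (t *: (v *m M)) f l ->
  is_derive x v (fun y => f (sim c t M y)) l.
Proof.
move=> /is_derive_line0 fl; apply/is_derive_line0.
rewrite (_ : (fun s => _) = (fun s => f (sim c t M x + s *: (t *: (v *m M)))))//.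
apply/funext => s; congr f; rewrite /sim mulmxDl -scalemxAl scalerDr addrA.
by rewrite !scalerA mulrC.
Qed.

Lemma sm_derive (f : Rn -> R) : sm f -> continuous f /\
  forall i, exists2 f', sm f' & forall x, is_derive x (e i) f (f' x).
Proof.
elim=> {f}.
- move=> c; split; first exact: cst_continuous.
  by move=> i; exists (fun=> 0); [exact: sm_cst|move=> x; exact: is_derive_cst].
- move=> j; split; first exact: continuous_coord.
  move=> i; exists (fun=> (i == j)%:R); first exact: sm_cst.
  move=> x; apply: cvg_is_derive; apply: cvg_near_cst; near=> h.
  rewrite !mxE addrK eqxx (eq_sym j) scalerA mulVf ?scale1r//.
  by near: h; exact: nbhs_dnbhs_neq.
- move=> f g _ [cf df] _ [cg dg]; split.
    by move=> x; apply: continuousD; [exact: cf|exact: cg].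
  move=> i; have [f' sf' f'E] := df i; have [g' sg' g'E] := dg i.
  exists (fun x => f' x + g' x); first exact: sm_add.
  by move=> x; exact: is_deriveD.
- move=> f g sf [cf df] sg [cg dg]; split.
    by move=> x; apply: continuousM; [exact: cf|exact: cg].
  move=> i; have [f' sf' f'E] := df i; have [g' sg' g'E] := dg i.
  exists (fun x => f x * g' x + g x * f' x).
    by apply: sm_add; exact: sm_mul.
  by move=> x; exact: is_deriveM.
- move=> f sf [cf df] f0; split.
    by move=> x; apply: continuousV; [exact: f0|exact: cf].
  move=> i; have [f' sf' f'E] := df i.
  exists (fun x => -1 * ((f x)^-1 * (f x)^-1) * f' x).
    by do 3?apply: sm_mul => //; [exact: sm_cst|exact: sm_inv..].
  move=> x; apply: (@is_derive_comp _ _ f GRing.inv _ _ _ _ (f'E x)).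
  have := is_deriveV (f0 x) (is_derive_id (f x) (1 : R)).
  by rewrite [_ *: _]mulr1 mulN1r -invfM -expr2.
- move=> k f sf [cf df]; split.
    move=> x; apply: (@continuous_comp _ _ _ f (expk k)); first exact: cf.
    apply/differentiable_continuous/derivable1_diffP.
    by case: (is_derive_expk k (f x)).
  move=> i; have [f' sf' f'E] := df i.
  exists (fun x => (expk k.+2 (f x) + - k%:R * expk k.+1 (f x)) * f' x).
    apply: sm_mul => //; apply: sm_add; first exact: sm_expk.
    by apply: sm_mul; [exact: sm_cst|exact: sm_expk].
  move=> x; apply: (@is_derive_comp _ _ f (expk k) _ _ _ _ (f'E x)).
  by rewrite mulNr; exact: is_derive_expk.
- move=> f c t M sf; split.
    move=> x; apply: continuous_comp; first exact: continuous_sim.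
    exact: smooth_continuous.
  move=> i; exists (fun x => \sum_j (t *: ((e i : Rn) *m M) : Rn) ord0 j * partial j f (sim c t M x)).
    apply: sm_sum => j; apply: sm_mul; first exact: sm_cst.
    exact/sm_comp/smooth_partial.
  by move=> x; apply: is_derive_comp_sim; exact: smooth_derive.
Unshelve. all: by end_near. Qed.

Lemma sm_smooth (f : Rn -> R) : sm f -> smooth f.
Proof.
move=> sf s; suff : sm (foldr partial f s).
  move=> /sm_derive[cf df]; split => // i x; have [f' _ f'E] := df i.
  by case: (f'E x).
elim: s => //= i s /sm_derive[_ df]; have [f' sf' f'E] := df i.
rewrite (_ : partial i _ = f')//; apply/funext => x.
by case: (f'E x).
Qed.

Lemma sm_of_smooth (f : Rn -> R) : smooth f -> sm f.
Proof.
move=> sf; rewrite (_ : f = fun x => f (sim 0 1 1%:M x)); first exact: sm_comp.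
by apply/funext => x; rewrite sim_shift addr0.
Qed.

Lemma sm_sstep (f : Rn -> R) : sm f -> sm (fun x => sstep (f x)).
Proof.
have s1 : sm (fun=> 1) := sm_cst 1.
move=> sf; have sNf : sm (fun x => 1 + -1 * f x).
  by apply: sm_add => //; apply: sm_mul => //; exact: sm_cst.
rewrite (_ : (fun _ => _) = fun x => expk 0 (1 + f x) *
    (expk 0 (1 + f x) + expk 0 (1 + -1 * f x))^-1); last first.
  by apply/funext => x; rewrite mulN1r.
apply: sm_mul; first by apply: sm_expk; exact: sm_add.
apply: sm_inv => [|x].
  by apply: sm_add; apply: sm_expk => //; exact: sm_add.
by rewrite mulN1r gt_eqF// sden_gt0.
Qed.

Lemma sm_sbump (f : Rn -> R) : sm f -> sm (fun x => sbump (f x)).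
Proof.
have s1 : sm (fun=> 1) := sm_cst 1.
move=> sf; have sNf : sm (fun x => 1 + -1 * f x).
  by apply: sm_add => //; apply: sm_mul => //; exact: sm_cst.
have sE k : sm (fun x => expk k (1 + f x)) by apply: sm_expk; exact: sm_add.
have sEN k : sm (fun x => expk k (1 + -1 * f x)) by exact: sm_expk.
have sd : sm (fun x => (expk 0 (1 + f x) + expk 0 (1 + -1 * f x))^-1).
  by apply: sm_inv => [|x]; [exact: sm_add|rewrite mulN1r gt_eqF// sden_gt0].
rewrite (_ : (fun _ => _) = fun x => (expk 2 (1 + f x) * expk 0 (1 + -1 * f x) +
     expk 0 (1 + f x) * expk 2 (1 + -1 * f x)) *
    ((expk 0 (1 + f x) + expk 0 (1 + -1 * f x))^-1 *
     (expk 0 (1 + f x) + expk 0 (1 + -1 * f x))^-1)); last first.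
  by apply/funext => x; rewrite mulN1r -invfM -expr2.
by apply: sm_mul; [apply: sm_add; exact: sm_mul|exact: sm_mul].
Qed.

(** The working form of compact support; [bsupp_compact] relates it to the closure in
    [test_function]. *)
Definition bsupp (f : Rn -> R) := exists M : R, forall x, M < `|x| -> f x = 0.

Lemma closed_norm_le (M : R) : closed [set x : Rn | `|x| <= M].
Proof. by apply: preimage_closed (@closed_le R M) => x _; exact: norm_continuous. Qed.

Lemma bsupp_compact (f : Rn -> R) : bsupp f <-> compact (closure [set x | f x != 0]).
Proof.
split=> [[M fM]|/compact_bounded[M [_ fM]]].
  apply: bounded_closed_compact; last exact: closed_closure.
  exists M; split; first exact: num_real.
  move=> M' MM' x fx; apply: ltW; apply: le_lt_trans MM'.
  suff : closure [set x | f x != 0] `<=` [set x | `|x| <= M] by exact.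
  rewrite [X in _ `<=` X](proj1 (closure_id _) (@closed_norm_le M)).
  apply: closureS => y /= fy; rewrite leNgt; apply: contra fy => My.
  by rewrite fM.
exists (M + 1) => x Mx; apply/eqP; apply: contraTT isT => fx0.
have : `|x| <= M + 1 by apply: fM; [rewrite ltrDl|exact: subset_closure].
by rewrite leNgt Mx.
Qed.

Lemma test_functionP (f : Rn -> R) : test_function f <-> smooth f /\ bsupp f.
Proof. by split=> -[sf /bsupp_compact bf]. Qed.

Lemma partial_bsupp i (f : Rn -> R) : bsupp f -> bsupp (partial i f).
Proof.
move=> [M fM]; exists M => x Mx; rewrite /partial.
rewrite (@near_eq_derive _ _ _ f (cst 0)); first exact: derive_cst.
near=> y; apply: fM; near: y.
have /open_nbhs_nbhs : open_nbhs x [set y | M < `|y|].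
  split=> //; apply: open_comp (@open_gt R M) => y _; exact: norm_continuous.
by [].
Unshelve. all: by end_near. Qed.

Lemma test_partial i (f : Rn -> R) : test_function f -> test_function (partial i f).
Proof.
move=> /test_functionP[sf bf]; apply/test_functionP; split.
  exact: smooth_partial.
exact: partial_bsupp.
Qed.

Lemma test_sm (f : Rn -> R) : sm f -> bsupp f -> test_function f.
Proof. by move=> sf bf; apply/test_functionP; split => //; exact: sm_smooth. Qed.

Lemma bsuppMl (f g : Rn -> R) : bsupp f -> bsupp (fun x => f x * g x).
Proof. by move=> [M fM]; exists M => x Mx; rewrite fM// mul0r. Qed.

Lemma bsuppMr (f g : Rn -> R) : bsupp g -> bsupp (fun x => f x * g x).
Proof. by move=> [M gM]; exists M => x Mx; rewrite gM// mulr0. Qed.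

Lemma bsupp_sim (f : Rn -> R) c t M : 0 < t -> orthogonal M -> bsupp f ->
  bsupp (fun x => f (sim c t M x)).
Proof.
move=> t0 oM [K fK]; exists (t^-1 * (n%:R * K + enorm c)) => x xK.
apply: fK; move: xK; rewrite ltr_pdivrMl// => xK.
rewrite ltNge; apply/negP => sK; move: xK; apply/negP; rewrite -leNgt.
have := enorm_le_norm (sim c t M x); have := ler_enormD (sim c t M x) (- c).
rewrite {1}/sim addrC addKr enormZ enorm_orthogonal// enormN gtr0_norm//.
move=> h1 h2; apply: (@le_trans _ _ (t * enorm x)).
  by rewrite ler_pM2l// norm_le_enorm.
apply: (le_trans h1); rewrite lerD2r; apply: (le_trans h2).
by rewrite ler_wpM2l.
Qed.

Lemma test_comp_sim (f : Rn -> R) c t M : 0 < t -> orthogonal M -> test_function f ->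
  test_function (fun x => f (sim c t M x)).
Proof.
move=> t0 oM /test_functionP[sf bf]; apply: test_sm; first exact: sm_comp.
exact: bsupp_sim.
Qed.

End smooth_functions.

(** * Local integrability and integration by parts *)

Section integration.
Context {R : realType} {n : nat}.
Local Notation Rn := 'rV[R]_n.
Local Notation mu := (@lebesgue_rV R n).
Local Notation e i := (delta_mx ord0 i : Rn).

Lemma compact_norm_le (M : R) : compact [set x : Rn | `|x| <= M].
Proof.
apply: bounded_closed_compact; last exact: closed_norm_le.
exists M; split; first exact: num_real.
by move=> M' /ltW MM' x /= /le_trans; apply.
Qed.

Lemma measurable_norm_le (M : R) : measurable [set x : Rn | `|x| <= M].
Proof. by apply: closed_measurable_rV; exact: closed_norm_le. Qed.

Lemma lebesgue_norm_le_lty (M : R) : (mu [set x : Rn | (`|x| <= M)%R] < +oo)%E.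
Proof.
pose k := (Num.truncn `|M|).+1.
apply: (@le_lt_trans _ _ (mu (cbox k))); last exact: lebesgue_box_lty.
apply: le_measure; rewrite ?inE; [exact: measurable_norm_le|exact: measurable_box|].
move=> x /= xM i; rewrite /= in_itv/= !mxE.
have : `|x ord0 i| < k%:R.
  apply: (le_lt_trans (coord_le_norm x i)); apply: (le_lt_trans xM).
  by apply: (le_lt_trans (ler_norm M)); rewrite truncnS_gt.
by rewrite ltr_norml => /andP[-> /ltW].
Qed.

Lemma compact_lebesgue_lty (K : set Rn) : compact K -> (mu K < +oo)%E.
Proof.
move=> cK; have [M [_ KM]] := compact_bounded cK.
apply: (@le_lt_trans _ _ (mu [set x : Rn | (`|x| <= M + 1)%R])); last exact: lebesgue_norm_le_lty.
apply: le_measure; rewrite ?inE; last by apply: KM; rewrite ltrDl.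
- by apply: closed_measurable_rV; apply: compact_closed => //; exact: norm_hausdorff.
- exact: measurable_norm_le.
Qed.

Lemma integrable_le (f g : Rn -> R) : measurable_fun [set: Rn] f ->
  (forall x, `|f x| <= g x) -> mu.-integrable setT (EFin \o g) ->
  mu.-integrable setT (EFin \o f).
Proof.
move=> mf fg; apply: le_integrable => //; first exact/measurable_EFinP.
by move=> x _ /=; rewrite lee_fin (le_trans (fg x))// ler_norm.
Qed.

Lemma integrableZR (C : R) (f : Rn -> R) : mu.-integrable setT (EFin \o f) ->
  mu.-integrable setT (EFin \o (fun x => C * f x)).
Proof.
move=> /(integrableZl measurableT C); by apply: eq_integrable.
Qed.

Lemma integrableDR (f g : Rn -> R) : mu.-integrable setT (EFin \o f) ->
  mu.-integrable setT (EFin \o g) -> mu.-integrable setT (EFin \o (fun x => f x + g x)).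
Proof.
move=> fi gi; have := integrableD measurableT fi gi.
by apply: eq_integrable => // x _ /=; rewrite EFinD.
Qed.

Lemma integrableBR (f g : Rn -> R) : mu.-integrable setT (EFin \o f) ->
  mu.-integrable setT (EFin \o g) -> mu.-integrable setT (EFin \o (fun x => f x - g x)).
Proof.
move=> fi gi; have := integrableB measurableT fi gi.
by apply: eq_integrable => // x _ /=; rewrite EFinB.
Qed.

Lemma integrable_normR (f : Rn -> R) : mu.-integrable setT (EFin \o f) ->
  mu.-integrable setT (EFin \o (fun x => `|f x|)).
Proof. by move=> fi; exact: integrable_norm. Qed.

Definition ind (M : R) : Rn -> R := \1_[set x : Rn | `|x| <= M].

Lemma ind1 M x : `|x| <= M -> ind M x = 1.
Proof. by move=> xM; rewrite /ind indicE mem_set. Qed.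

Lemma ind0 M x : M < `|x| -> ind M x = 0.
Proof. by move=> Mx; rewrite /ind indicE memNset//= leNgt Mx. Qed.

Lemma ind_ge0 M x : 0 <= ind M x.
Proof. by []. Qed.

Lemma ind_le1 M x : ind M x <= 1.
Proof. by rewrite /ind indicE lern1; case: (_ \in _). Qed.

Lemma measurable_ind M : measurable_fun [set: Rn] (ind M).
Proof. by apply: measurable_indic; exact: measurable_norm_le. Qed.

Lemma integrable_ind M : mu.-integrable setT (EFin \o ind M).
Proof.
apply/integrableP; split; first by apply/measurable_EFinP; exact: measurable_ind.
apply: (@le_lt_trans _ _ (\int[mu]_x (\1_[set y : Rn | (`|y| <= M)%R] x)%:E))%E.
  by apply: ge0_le_integral => //; [apply: measurableT_comp => //;
    apply/measurable_EFinP; exact: measurable_ind|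
    apply/measurable_EFinP; exact: measurable_ind|move=> x _ /=; rewrite ger0_norm].
by rewrite integral_indicT ?lebesgue_norm_le_lty//; exact: measurable_norm_le.
Qed.

Lemma bsupp_bounded (f : Rn -> R) : continuous f -> bsupp f ->
  exists2 C, 0 <= C & forall x, `|f x| <= C.
Proof.
move=> cf [M fM].
have /compact_bounded[C [_ hC]] : compact (f @` [set x | `|x| <= M]).
  apply: continuous_compact; last exact: compact_norm_le.
  exact: continuous_subspaceT.
exists (`|C| + 1); first by rewrite addr_ge0.
move=> x; have [xM|Mx] := leP `|x| M; last by rewrite fM// normr0 addr_ge0.
apply: hC; last by exists x.
by rewrite (le_lt_trans (ler_norm C))// ltrDl.
Qed.

Lemma compact_measurable (K : set Rn) : compact K -> measurable K.
Proof.
by move=> cK; apply: closed_measurable_rV; apply: compact_closed => //; exact: norm_hausdorff.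
Qed.

(** Every compact set lies in a ball about 0, so the balls decide; multiplying by an indicator keeps
    all integrals over the whole space. *)
Lemma L1locP (g : Rn -> R) : L1loc g <-> measurable_fun [set: Rn] g /\
  forall M, mu.-integrable setT (EFin \o (fun x => ind M x * g x)).
Proof.
split=> -[mg gi]; split=> //.
  move=> M; have := gi _ (@compact_norm_le M).
  rewrite integrable_mkcond; last exact: measurable_norm_le.
  apply: eq_integrable => // x _; rewrite /restrict/= /ind indicE.
  by case: ifPn => _; rewrite ?mul1r ?mul0r.
move=> K cK; have [M [_ KM]] := compact_bounded cK.
have mK := compact_measurable cK.
have := integrableS measurableT mK (@subsetT _ K) (gi (M + 1)).
apply: eq_integrable => // x; rewrite inE => Kx /=.
by rewrite ind1 ?mul1r//; apply: KM => //; rewrite ltrDl.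
Qed.

Lemma L1loc_mul_bsupp (g f : Rn -> R) : L1loc g -> continuous f -> bsupp f ->
  mu.-integrable setT (EFin \o (fun x => g x * f x)).
Proof.
move=> /L1locP[mg gi] cf bf; have [C C0 fC] := bsupp_bounded cf bf.
have [M fM] := bf.
apply: (integrable_le _ _ (integrableZR C (integrable_normR (gi M)))).
  by apply: measurable_funM => //; exact: continuous_measurable_rV.
move=> x; rewrite !normrM (ger0_norm (ind_ge0 _ _)).
have [xM|Mx] := leP `|x| M; last by rewrite fM// normr0 mulr0 !mulr_ge0.
by rewrite ind1// mul1r mulrC ler_wpM2r.
Qed.

Lemma L1loc_continuous (f : Rn -> R) : continuous f -> L1loc f.
Proof.
move=> cf; split; first exact: continuous_measurable_rV.
move=> K cK.
have mK := compact_measurable cK.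
apply: measurable_bounded_integrable => //.
- exact: compact_lebesgue_lty.
- by apply: measurable_funTS; exact: continuous_measurable_rV.
- have [C [Cr hC]] : bounded_set (f @` K).
    apply: compact_bounded; apply: continuous_compact => //.
    exact: continuous_subspaceT.
  by exists C; split => // D /hC DC x Kx; apply: DC; exists x.
Qed.

Lemma continuous_bsupp_integrable (f : Rn -> R) : continuous f -> bsupp f ->
  mu.-integrable setT (EFin \o f).
Proof.
move=> cf bf; have := L1loc_mul_bsupp (L1loc_continuous (@cst_continuous _ _ (1 : R))) cf bf.
by apply: eq_integrable => // x _ /=; rewrite mul1r.
Qed.

Lemma L1locM (g f : Rn -> R) : L1loc g -> continuous f -> L1loc (fun x => f x * g x).
Proof.
move=> /L1locP[mg gi] cf; apply/L1locP; split.
  by apply: measurable_funM => //; exact: continuous_measurable_rV.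
move=> M.
have [C [_ hC]] : bounded_set (f @` [set x | `|x| <= M]).
  apply: compact_bounded; apply: continuous_compact; last exact: compact_norm_le.
  exact: continuous_subspaceT.
apply: (integrable_le _ _ (integrableZR (`|C| + 1) (integrable_normR (gi M)))).
  apply: measurable_funM; first exact: measurable_ind.
  by apply: measurable_funM => //; exact: continuous_measurable_rV.
move=> x; rewrite !normrM (ger0_norm (ind_ge0 _ _)).
have [xM|Mx] := leP `|x| M; last by rewrite ind0// !mul0r mulr0.
rewrite mulrCA ler_wpM2r ?mulr_ge0//.
by apply: hC; [rewrite (le_lt_trans (ler_norm C))// ltrDl|exists x].
Qed.

Lemma L1locD (g f : Rn -> R) : L1loc g -> L1loc f -> L1loc (fun x => f x + g x).
Proof.
move=> [mg gi] [mf fi]; split; first exact: measurable_funD.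
move=> K cK.
have mK := compact_measurable cK.
by have := integrableD mK (fi K cK) (gi K cK).
Qed.

Lemma L1locZ (c : R) (g : Rn -> R) : L1loc g -> L1loc (fun x => c * g x).
Proof. by move=> Lg; apply: L1locM => // x; exact: cst_continuous. Qed.

Lemma L1loc_sim (g : Rn -> R) c t M : 0 < t -> orthogonal M -> L1loc g ->
  L1loc (fun x => g (sim c t M x)).
Proof.
move=> t0 oM /L1locP[mg gi]; apply/L1locP; split.
  exact: measurableT_comp mg (measurable_sim c t M).
move=> K.
have := integrable_normR (integrable_sim c t0 oM (gi (t * (n%:R * K) + enorm c))).
apply: integrable_le => //.
  apply: measurable_funM; first exact: measurable_ind.
  exact: measurableT_comp mg (measurable_sim c t M).
move=> x; rewrite !normrM ler_wpM2r//.
have [xK|Kx] := leP `|x| K; last by rewrite ind0// normr0.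
rewrite !ind1//; apply: (le_trans (norm_le_enorm _)).
apply: (le_trans (ler_enormD _ _)); rewrite addrC lerD2r enormZ enorm_orthogonal//.
rewrite gtr0_norm// ler_pM2l//; apply: (le_trans (enorm_le_norm _)).
by rewrite ler_wpM2l.
Qed.

Lemma Rintegral_cvg (f_ : nat -> Rn -> R) (f g : Rn -> R) :
  (forall k, measurable_fun [set: Rn] (f_ k)) ->
  (forall x, f_ k x @[k --> \oo] --> f x) ->
  mu.-integrable setT (EFin \o g) ->
  (forall k x, `|f_ k x| <= g x) ->
  (\int[mu]_x f_ k x) @[k --> \oo] --> \int[mu]_x f x.
Proof.
move=> mf ff gi fg.
have mlim : measurable_fun [set: Rn] f.
  by apply: (@measurable_fun_cvg _ _ _ _ f_).
have mf' k : measurable_fun [set: Rn] (fun x => (f_ k x)%:E).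
  by apply/measurable_EFinP; exact: mf.
have mlim' : measurable_fun [set: Rn] (EFin \o f) by exact/measurable_EFinP.
have a1 : {ae mu, forall x, [set: Rn] x -> (fun k => (f_ k x)%:E) @ \oo --> (EFin \o f) x}.
  by apply: aeW => x _; apply: cvg_EFin; [exact: nearW|exact: ff].
have a2 : {ae mu, forall x k, [set: Rn] x -> (`|(f_ k x)%:E| <= (EFin \o g) x)%E}.
  by apply: aeW => x k _ /=; rewrite lee_fin.
have [fi _ cvg] := dominated_convergence measurableT mf' mlim' a1 gi a2.
apply: fine_cvg; rewrite fineK; last exact: integrable_fin_num.
exact: cvg.
Qed.

Lemma Rintegral_shift (c : Rn) (f : Rn -> R) : mu.-integrable setT (EFin \o f) ->
  \int[mu]_x f (x + c) = \int[mu]_x f x.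
Proof.
move=> fi; have := Rintegral_sim c ltr01 orthogonal1 fi.
by rewrite sim_shift expr1n invr1 mul1r.
Qed.

Lemma integrable_shift (c : Rn) (f : Rn -> R) : mu.-integrable setT (EFin \o f) ->
  mu.-integrable setT (EFin \o (fun x => f (x + c))).
Proof. by move=> fi; have := integrable_sim c ltr01 orthogonal1 fi; rewrite sim_shift. Qed.

(** Difference quotients have integral zero by translation invariance. Their steps are at most 1, so
    all of them vanish outside the ball of radius M + 1 and are bounded by the mean value theorem;
    dominated convergence concludes. *)
Lemma Rintegral_partial (f : Rn -> R) i : continuous f -> bsupp f ->
  (forall x, derivable f x (e i)) -> continuous (partial i f) ->
  \int[mu]_x partial i f x = 0.
Proof.
move=> cf bf df cdf.
have [C C0 dfC] := bsupp_bounded cdf (partial_bsupp i bf).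
have [M fM] := bf.
pose h k : R := k.+1%:R^-1.
have h0 k : 0 < h k by rewrite invr_gt0.
pose q k x := (h k)^-1 * (f (x + h k *: e i) - f x).
have fi := continuous_bsupp_integrable cf bf.
have q0 k : \int[mu]_x q k x = 0.
  rewrite RintegralZl//; last first.
    by apply: integrableBR => //; exact: integrable_shift.
  by rewrite RintegralB//; [rewrite Rintegral_shift// subrr mulr0|exact: integrable_shift].
have : \int[mu]_x q k x @[k --> \oo] --> \int[mu]_x partial i f x.
  apply: (@Rintegral_cvg _ _ (fun x => C * ind (M + 1) x)).
  - move=> k; apply: measurable_funM => //; apply: measurable_funB.
      apply: measurableT_comp; first exact: continuous_measurable_rV.
      exact: measurable_shift.
    exact: continuous_measurable_rV.
  - move=> x; have fl := is_derive_cvg (derivableP (df x)).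
    have hc : h k @[k --> \oo] --> (0 : R)^'.
      move=> P P0; have : \forall k \near \oo, h k != 0 -> P (h k).
        exact: (@cvg_harmonic R _ P0).
      by apply: filterS => k; apply; exact: lt0r_neq0.
    apply: cvg_trans (cvg_comp _ _ hc fl); apply: near_eq_cvg; near=> k.
    by rewrite /q/= (addrC x).
  - apply: integrableZR; exact: integrable_ind.
  - move=> k x; rewrite /q.
    have [xM|Mx] := leP `|x| (M + 1).
      rewrite ind1// mulr1 normrM normfV ler_pdivrMl ?normr_gt0 ?gt_eqF//.
      have [r _ ->] := mvt_line x (h k) df.
      by rewrite normrM ler_wpM2l//; exact: dfC.
    have hM : M < `|x + h k *: e i|.
      rewrite -(ltrD2r 1); apply: (lt_le_trans Mx).
      rewrite -{1}(addrK (h k *: e i) x) (le_trans (ler_normB _ _))//.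
      rewrite lerD2l normrZ gtr0_norm// mulr_ile1 ?invr_ge0//.
        by rewrite invf_le1// ler1n.
      by apply: norm_le_coord => // j; rewrite mxE eqxx/=; case: (_ == _); rewrite ?normr1 ?normr0.
    rewrite !fM// ?subrr ?mulr0 ?normr0 ?mulr_ge0//.
    by rewrite (lt_trans _ Mx)// ltrDl.
rewrite (_ : (fun k => _) = cst 0) => [c0|]; last exact/funext.
by rewrite -(cvg_lim _ c0)// lim_cst.
Unshelve. all: by end_near. Qed.

End integration.

(** * Weak derivatives and mollification *)

Section du_bois_reymond.
Context {R : realType} {n : nat}.
Local Notation Rn := 'rV[R]_n.
Local Notation mu := (@lebesgue_rV R n).

(** The shift by -1 puts the transition to the right of a: at t = a the value is 0 for every k, and
    the limit is the indicator of the open ray, as half-open boxes require. *)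
Lemma sstep_cvg (a t : R) :
  sstep ((t - a) * k.+1%:R - 1) @[k --> \oo] --> ((a < t)%R%:R : R).
Proof.
have [ta|at_] := leP t a.
  apply: cvg_near_cst; apply: nearW => k; apply: sstep_eq0.
  by rewrite gerDr mulr_le0_ge0// subr_le0.
apply: cvg_near_cst; near=> k; apply: sstep_eq1.
rewrite lerBrDr -ler_pdivrMl ?subr_gt0// -natr1.
apply: ler_wpDr => //; near: k; exact: nbhs_infty_ger.
Unshelve. all: by end_near. Qed.

(** Test functions that converge at every point to the indicator of the half-open box, faces
    included. *)
Definition test_box (a b : Rn) (k : nat) (x : Rn) : R :=
  \prod_i (sstep ((x ord0 i - a ord0 i) * k.+1%:R - 1) *
           (1 - sstep ((x ord0 i - b ord0 i) * k.+1%:R - 1))).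

Lemma test_box_ge0 a b k x : 0 <= test_box a b k x.
Proof. by apply: prodr_ge0 => i _; rewrite mulr_ge0 ?sstep_ge0// subr_ge0 sstep_le1. Qed.

Lemma test_box_le1 a b k x : test_box a b k x <= 1.
Proof.
apply: prodr_ile1 => i _; rewrite mulr_ge0 ?sstep_ge0 ?subr_ge0 ?sstep_le1//=.
by rewrite mulr_ile1 ?sstep_ge0 ?subr_ge0 ?sstep_le1// gerBl sstep_ge0.
Qed.

Lemma test_box_supp a b k x : `|a| + `|b| + 2 < `|x| -> test_box a b k x = 0.
Proof.
move=> abx; apply/eqP; apply: contraTT isT => h.
suff : `|x| <= `|a| + `|b| + 2 by rewrite leNgt abx.
apply: norm_le_coord => [|i]; first by rewrite !addr_ge0.
have := h; rewrite /test_box (bigD1 i)//= mulf_eq0 negb_or => /andP[]; rewrite mulf_eq0 negb_or.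
move=> /andP[h1 h2] _.
have k1 : (1 : R) <= k.+1%:R by rewrite ler1n.
have ax : a ord0 i <= x ord0 i.
  rewrite leNgt; apply: contraNN h1 => xa; apply/eqP/sstep_eq0.
  by rewrite gerDr mulr_le0_ge0// subr_le0 ltW.
(* The transition at b has width 2 / (k+1), hence the 2, uniform in k. *)
have xb : x ord0 i <= b ord0 i + 2.
  rewrite leNgt; apply: contraNN h2 => bx; rewrite sstep_eq1 ?subrr//.
  have b2 : 2 <= x ord0 i - b ord0 i by lra.
  by rewrite lerBrDr (le_trans b2)// ler_peMr// (le_trans _ b2).
have := coord_le_norm a i; have := coord_le_norm b i; rewrite !ler_norml.
by move=> /andP[? ?] /andP[? ?]; apply/andP; split; lra.
Qed.

Lemma test_test_box a b k : test_function (test_box a b k).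
Proof.
apply: test_sm; last by exists (`|a| + `|b| + 2) => x; exact: test_box_supp.
have lin i c : sm (fun x : Rn => (x ord0 i - c) * k.+1%:R - 1).
  apply: sm_add; last exact: sm_cst.
  by apply: sm_mul; [apply: sm_add; [exact: sm_coord|exact: sm_cst]|exact: sm_cst].
apply: sm_prod => i; apply: sm_mul; first exact: sm_sstep.
rewrite (_ : (fun _ => _) =
    (fun x : Rn => 1 + -1 * sstep ((x ord0 i - b ord0 i) * k.+1%:R - 1))).
  apply: sm_add; first exact: sm_cst.
  by apply: sm_mul; [exact: sm_cst|exact: sm_sstep].
by apply/funext => x; rewrite mulN1r.
Qed.

Lemma test_box_cvg a b x : test_box a b k x @[k --> \oo] --> (\1_(box a b) x : R).
Proof.
have -> : \1_(box a b) x =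
    \prod_i ((a ord0 i < x ord0 i)%R%:R * (1 - (b ord0 i < x ord0 i)%R%:R)) :> R.
  rewrite indicE; have [|] := boolP (x \in box a b).
    rewrite inE => xab; rewrite big1// => i _; have := xab i; rewrite /= in_itv/=.
    by move=> /andP[-> xb]; rewrite ltNge xb subr0 mulr1.
  move=> /negP; rewrite inE => xab.
  have [i xi] : exists i, ~~ ((a ord0 i < x ord0 i) && (x ord0 i <= b ord0 i)).
    apply: contrapT => /forallNP h; apply: xab => i; rewrite /= in_itv/=.
    by have /negP := h i; rewrite negbK.
  rewrite (bigD1 i)//=; move: xi; rewrite negb_and -ltNge => /orP[/negbTE ->|->].
    by rewrite !mul0r.
  by rewrite subrr mulr0 mul0r.
apply: cvg_big => //.
  by move=> w; apply: cvgM; [exact: cvg_fst|exact: cvg_snd].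
move=> i _; apply: cvgM; first exact: sstep_cvg.
by apply: cvgB; [exact: cvg_cst|exact: sstep_cvg].
Qed.

Lemma smooth_measurable (f : Rn -> R) : smooth f -> measurable_fun [set: Rn] f.
Proof. by move=> sf; apply: continuous_measurable_rV; exact: smooth_continuous. Qed.

Lemma test_smooth (f : Rn -> R) : test_function f -> smooth f.
Proof. by case. Qed.

Lemma test_bsupp (f : Rn -> R) : test_function f -> bsupp f.
Proof. by move=> /test_functionP[]. Qed.

Lemma test_continuous (f : Rn -> R) : test_function f -> continuous f.
Proof. by move=> tf; apply/smooth_continuous/test_smooth. Qed.

Lemma Rintegral_box_eq0 (g : Rn -> R) (a b : Rn) : L1loc g ->
  (forall phi, test_function phi -> \int[mu]_x (g x * phi x) = 0) ->
  \int[mu]_x (g x * \1_(box a b) x) = 0.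
Proof.
move=> Lg g0; have [mg gi] := proj1 (L1locP g) Lg.
have : \int[mu]_x (g x * test_box a b k x) @[k --> \oo] -->
       \int[mu]_x (g x * \1_(box a b) x).
  apply: (@Rintegral_cvg _ _ _ _ (fun x => `|ind (`|a| + `|b| + 2) x * g x|)).
  - move=> k; apply: measurable_funM => //; apply: smooth_measurable.
    by apply: test_smooth; exact: test_test_box.
  - by move=> x; apply: cvgM; [exact: cvg_cst|exact: test_box_cvg].
  - exact: integrable_normR.
  - move=> k x; rewrite !normrM (ger0_norm (test_box_ge0 _ _ _ _)) mulrC.
    have [xab|abx] := leP `|x| (`|a| + `|b| + 2).
      by rewrite ind1// normr1 ler_wpM2r// test_box_le1.
    by rewrite test_box_supp// mul0r mulr_ge0.
rewrite (_ : (fun k => _) = cst 0) => [c0|].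
  by rewrite -(cvg_lim _ c0)// lim_cst.
by apply/funext => k; apply: g0; exact: test_test_box.
Qed.

(** The Borel sets on which f integrates to zero form a Dynkin class containing the pi-system of
    boxes. *)
Lemma integral_boxes_eq0 (f : Rn -> R) : mu.-integrable setT (EFin \o f) ->
  (forall a b, (\int[mu]_(x in box a b) (f x)%:E = 0)%E) ->
  {ae mu, forall x, f x = 0}.
Proof.
move=> fi f0; have mf : measurable_fun [set: Rn] f.
  by apply/measurable_EFinP; exact: measurable_int fi.
have fA A : measurable A -> (\int[mu]_(x in A) (f x)%:E = 0)%E.
  rewrite measurable_rV_boxes; move: A.
  (* Stability under complements needs the integral over the whole space, the limit of those over
     the cubes. *)
  have fT : (\int[mu]_x (f x)%:E = 0)%E.
    have : \int[mu]_x (\1_(cbox k) x * f x) @[k --> \oo] --> \int[mu]_x f x.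
      apply: (@Rintegral_cvg _ _ _ _ (fun x => `|f x|)).
      - by move=> k; apply: measurable_funM => //; by apply: measurable_indic; exact: measurable_box.
      - move=> x; apply: cvg_near_cst.
        have : setT x by []; rewrite -bigcup_box => -[k _ kx].
        exists k => // j /= kj; rewrite indicE mem_set ?mul1r// => i.
        have := kx i; rewrite /= !in_itv/= !mxE => /andP[h1 h2].
        by rewrite (le_lt_trans _ h1) ?lerN2 ?ler_nat// (le_trans h2)// ler_nat.
      - exact: integrable_normR.
      - by move=> k x; rewrite normrM ler_piMl// indicE; case: (_ \in _); rewrite ?normr1 ?normr0.
    rewrite (_ : (fun k => _) = cst 0) => [c0|].
      have := fineK (integrable_fin_num measurableT fi); rewrite /= => <-.
      by congr _%:E; rewrite -[LHS]/(\int[mu]_x f x)%R -(cvg_lim _ c0)// lim_cst.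
    apply/funext => k; rewrite /Rintegral.
    rewrite (_ : integral _ _ _ = 0%E)// -[RHS](f0 (const_mx (- k%:R)) (const_mx k%:R)).
    rewrite [RHS]integral_mkcond; apply: eq_integral => x _.
    by rewrite /restrict indicE; case: ifPn; rewrite ?mul1r ?mul0r.
  apply: dynkin_induction => //.
  - exact: measurable_rV_boxes.
  - by move=> _ _ [[a b] _ <-] [[c d] _ <-]/=; rewrite boxI; eexists (_, _).
  - by move=> _ [[a b] _ <-]; exact: f0.
  - move=> S mS S0; have := fT; rewrite -(setUv S) integral_setU//.
    + by rewrite S0 add0e.
    + exact: measurableC.
    + by apply: measurable_funTS; exact/measurable_EFinP.
    + by rewrite disj_set2E; apply/eqP; exact: setICr.
  - move=> F mF tF F0; rewrite integral_bigcup//.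
      by under eq_eseriesr do rewrite F0; exact: eseries0.
    by apply: integrableS fi => //; exact: bigcup_measurable.
have : ae_eq mu setT (EFin \o f) (cst 0%E).
  apply: integral_ae_eq => // E _ mE; rewrite fA// integral0//.
by apply: filterS => x /(_ I) /= [].
Qed.

(** Truncation to a cube makes g integrable, and the trace of a box on a cube is again a box. *)
Lemma du_bois_reymond (g : Rn -> R) : L1loc g ->
  (forall phi, test_function phi -> \int[mu]_x (g x * phi x) = 0) ->
  {ae mu, forall x, g x = 0}.
Proof.
move=> Lg g0; have [mg gi] := proj1 (L1locP g) Lg.
have : forall k : nat, {ae mu, forall x, \1_(cbox k) x * g x = 0}.
  move=> k.
  have ki : mu.-integrable setT (EFin \o (fun x => \1_(cbox k) x * g x)).
    apply: (integrable_le _ _ (integrable_normR (gi k%:R))).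
      by apply: measurable_funM => //; by apply: measurable_indic; exact: measurable_box.
    move=> x; rewrite !normrM ler_wpM2r// indicE.
    have [|_] := boolP (x \in _); last by rewrite normr0.
    rewrite inE => xk; rewrite ind1//; apply: norm_le_coord => // i.
    by have := xk i; rewrite /= in_itv/= !mxE ler_norml => /andP[/ltW -> ->].
  apply: integral_boxes_eq0 => // a b.
  have Ek : \int[mu]_x (g x * \1_(box a b `&` cbox k) x) = 0.
    by rewrite boxI; exact: Rintegral_box_eq0.
  have mab := measurable_box a b.
  have := fineK (integrable_fin_num mab (integrableS measurableT mab (@subsetT _ _) ki)).
  move=> <-; congr _%:E; rewrite -[RHS]Ek /Rintegral; congr fine.
  rewrite [LHS]integral_mkcond; apply: eq_integral => x _.
  rewrite /restrict indicI/= [\1_(box a b) x]indicE.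
  by case: (x \in box a b); rewrite ?mul1r ?mul0r ?mulr0// mulrC.
move=> /ae_foralln; apply: filterS => x gx.
have : setT x by []; rewrite -bigcup_box => -[k _ kx].
by have := gx k; rewrite indicE mem_set// mul1r.
Qed.

End du_bois_reymond.

(** * Kernels and correlations with test functions *)

Section kernels.
Context {R : realType} {n : nat}.
Local Notation Rn := 'rV[R]_n.
Local Notation mu := (@lebesgue_rV R n).

Lemma continuous_expk k : continuous (@expk R k).
Proof.
move=> t; apply/differentiable_continuous/derivable1_diffP.
by case: (is_derive_expk k t).
Qed.

Lemma sbumpN (t : R) : sbump (- t) = sbump t.
Proof.
by rewrite /sbump /sden !opprK; congr (_ / _ ^+ 2); [rewrite addrC; congr (_ + _); exact: mulrC|exact: addrC].
Qed.

Definition kern (c : Rn) (r : R) (x : Rn) : R :=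
  \prod_i (r^-1 * sbump (r^-1 * (x ord0 i - c ord0 i))).

Lemma kern_ge0 c r x : 0 < r -> 0 <= kern c r x.
Proof. by move=> r0; apply: prodr_ge0 => i _; rewrite mulr_ge0 ?sbump_ge0 ?invr_ge0 ?ltW. Qed.

Lemma kern_supp c r x : 0 < r -> r < `|x - c| -> kern c r x = 0.
Proof.
move=> r0 rx; apply/eqP; apply: contraTT isT => h.
suff : `|x - c| <= r by rewrite leNgt rx.
apply: norm_le_coord => [|i]; first exact: ltW.
rewrite !mxE leNgt; apply: contraNN h => ri; rewrite /kern (bigD1 i)//=.
rewrite sbump_eq0 ?mulr0 ?mul0r// normrM gtr0_norm ?invr_gt0//.
by rewrite mulrC ler_pdivlMr// mul1r ltW.
Qed.

Lemma kern_bsupp c r : 0 < r -> bsupp (kern c r).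
Proof.
move=> r0; exists (r + `|c|) => x xr; apply: kern_supp => //.
by have := ler_normD (x - c) c; rewrite subrK => ?; rewrite -(ltrD2r `|c|); exact: lt_le_trans xr _.
Qed.

Lemma sm_sbump_coord (i : 'I_n) (c r : R) : sm (fun x : Rn => r^-1 * sbump (r^-1 * (x ord0 i - c))).
Proof.
apply: sm_mul; first exact: sm_cst.
apply: sm_sbump; apply: sm_mul; first exact: sm_cst.
by apply: sm_add; [exact: sm_coord|exact: sm_cst].
Qed.

Lemma test_kern c r : 0 < r -> test_function (kern c r).
Proof.
move=> r0; apply: test_sm; last exact: kern_bsupp.
by apply: sm_prod => i; exact: sm_sbump_coord.
Qed.

Lemma kern_shift c r x y : kern (c + y) r (x + y) = kern c r x.
Proof. by apply: eq_bigr => i _; rewrite !mxE opprD addrACA subrr addr0. Qed.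

Lemma kern_sym c r x : kern c r x = kern x r c.
Proof. by apply: eq_bigr => i _; rewrite -sbumpN -mulrN opprB. Qed.

Lemma kern_scale r x : kern 0 r x = r ^- n * kern 0 1 (r^-1 *: x).
Proof.
rewrite /kern; under [in RHS]eq_bigr do rewrite !mxE invr1 !mul1r subr0.
under eq_bigr do rewrite mxE subr0.
by rewrite big_split/= prodr_const card_ord exprVn.
Qed.

(** The common mass of all kernels [kern c r], by which [moll] divides. *)
Definition kmass : R := \int[mu]_x kern 0 1 x.

Lemma kern_integrable c r : 0 < r -> mu.-integrable setT (EFin \o kern c r).
Proof.
move=> r0; apply: continuous_bsupp_integrable; last exact: kern_bsupp.
by apply: test_continuous; exact: test_kern.
Qed.

Lemma kern_mass c r : 0 < r -> \int[mu]_x kern c r x = kmass.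
Proof.
move=> r0; have -> : kern c r = fun x => kern 0 r (x + - c).
  by apply/funext => x; have := kern_shift 0 r (x - c) c; rewrite add0r subrK.
rewrite Rintegral_shift; last exact: kern_integrable.
under eq_Rintegral do rewrite kern_scale.
have ri : 0 < r^-1 by rewrite invr_gt0.
have k1 := kern_integrable 0 (@ltr01 R).
have E x : kern 0 1 (r^-1 *: x) = kern 0 1 (sim 0 r^-1 1%:M x).
  by rewrite /sim add0r mulmx1.
under eq_Rintegral do rewrite E.
rewrite RintegralZl//; last by apply: integrable_sim => //; exact: orthogonal1.
rewrite Rintegral_sim//; last exact: orthogonal1.
by rewrite exprVn invrK mulrA mulVf ?mul1r// expf_neq0// gt_eqF.
Qed.

Lemma continuous_sbump : continuous (@sbump R).
Proof.
have c1 k : continuous (fun t : R => expk k (1 + t)).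
  move=> t; apply: (@continuous_comp _ _ _ (fun t : R => 1 + t) (expk k)); last exact: continuous_expk.
  by apply: continuousD; [exact: cst_continuous|exact: cvg_id].
have c2 k : continuous (fun t : R => expk k (1 - t)).
  move=> t; apply: (@continuous_comp _ _ _ (fun t : R => 1 - t) (expk k)); last exact: continuous_expk.
  by apply: continuousB; [exact: cst_continuous|exact: cvg_id].
have cd : continuous (@sden R).
  move=> t; apply: (@continuousD _ _ _ (fun t : R => expk 0 (1 + t)) (fun t : R => expk 0 (1 - t))).
    exact: c1.
  exact: c2.
move=> t; apply: (@continuousM _ _ (fun t : R => expk 2 (1 + t) * expk 0 (1 - t) + expk 0 (1 + t) * expk 2 (1 - t))
  (fun t : R => (sden t ^+ 2)^-1)).
  by apply: continuousD; apply: continuousM; (exact: c1 || exact: c2).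
apply: (@continuousV _ _ (fun t : R => sden t ^+ 2)).
  by rewrite expf_neq0// gt_eqF// sden_gt0.
by apply: (@continuousM _ _ sden sden); exact: cd.
Qed.

Lemma sbump_bounded : exists2 C : R, 0 < C & forall t, sbump t <= C.
Proof.
have [|t _ tmax] := @EVT_max R sbump (-1) 1 _ (continuous_subspaceT continuous_sbump).
  by lra.
exists (sbump t + 1) => [|s]; first by rewrite ltr_wpDl ?sbump_ge0.
have [s1|s1] := leP `|s| 1.
  by rewrite ler_wpDr// tmax// in_itv/= -ler_norml.
by rewrite (sbump_eq0 (ltW s1)) addr_ge0 ?sbump_ge0.
Qed.

(** On [-1/2, 1/2] the bump has a positive minimum, so the kernel exceeds a multiple of the
    indicator of a cube. *)
Lemma kmass_gt0 : 0 < kmass.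
Proof.
have [|t t12 tmin] := @EVT_min R sbump (- 2^-1) 2^-1 _ (continuous_subspaceT continuous_sbump).
  by lra.
have m0 : 0 < sbump t.
  apply: sbump_gt0; move: t12; rewrite in_itv/= => /andP[? ?].
  by rewrite ltr_norml; apply/andP; split; lra.
pose h : Rn := const_mx 2^-1.
have mB := measurable_box (- h) h.
have -> : kmass = fine (\int[mu]_x (kern 0 1 x)%:E)%E by [].
have ki := integrable_fin_num measurableT (kern_integrable 0 (@ltr01 R)).
rewrite -lte_fin fineK//.
apply: (@lt_le_trans _ _ (\int[mu]_x (sbump t ^+ n * \1_(box (- h) h) x)%:E)%E).
  under eq_integral do rewrite EFinM.
  rewrite ge0_integralZl//; last 2 first.
  - by apply/measurable_EFinP; exact: measurable_indic.
  - by rewrite lee_fin exprn_ge0// ltW.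
  rewrite integral_indicT// lebesgue_box => [|i]; last by rewrite !mxE; lra.
  rewrite -EFinM lte_fin mulr_gt0 ?exprn_gt0// prodr_gt0// => i _.
  by rewrite !mxE; lra.
apply: ge0_le_integral => //.
- by move=> x _; rewrite lee_fin mulr_ge0// exprn_ge0// ltW.
- by apply/measurable_EFinP; apply: measurable_funM => //; exact: measurable_indic.
- apply/measurable_EFinP; apply: continuous_measurable_rV.
  by apply: test_continuous; exact: test_kern.
move=> x _; rewrite lee_fin indicE; have [|_] := boolP (x \in _); last first.
  by rewrite mulr0 kern_ge0.
rewrite inE => xh; rewrite mulr1 -[n in _ ^+ n]card_ord -prodr_const.
apply: ler_prod => i _; rewrite (ltW m0)/= invr1 !mul1r mxE subr0.
apply: tmin; have := xh i; rewrite /= !in_itv/= !mxE => /andP[/ltW -> ->]//.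
Qed.

Lemma kern_bounded : exists2 C : R, 0 < C & forall c r x, 0 < r -> kern c r x <= (C / r) ^+ n.
Proof.
have [C C0 bC] := sbump_bounded; exists C => // c r x r0.
rewrite -[n in _ ^+ n]card_ord -prodr_const; apply: ler_prod => i _.
rewrite mulr_ge0 ?sbump_ge0 ?invr_ge0 ?(ltW r0)//= mulrC ler_wpM2r ?invr_ge0 ?(ltW r0)//.
Qed.

(* Cross-correlation with a test function; with a kernel it is mollification. *)
Definition corr (u Phi : Rn -> R) (x : Rn) : R := \int[mu]_y (u y * Phi (y - x)).

Lemma test_shift (Phi : Rn -> R) x : test_function Phi ->
  test_function (fun y => Phi (y - x)).
Proof.
move=> tP; have := test_comp_sim (- x) ltr01 (@orthogonal1 R n) tP.
by rewrite (_ : (fun _ => _) = (fun y => Phi (y - x)))//; apply/funext => y; rewrite sim_shift.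
Qed.

Lemma partial_shift i (Phi : Rn -> R) x y :
  partial i (fun z => Phi (z - x)) y = partial i Phi (y - x).
Proof.
rewrite /partial /derive.
rewrite (_ : (fun h => _) = (fun h : R => h^-1 *:
  ((Phi \o shift (y - x)) (h *: delta_mx ord0 i) - Phi (y - x))))//.
by apply/funext => h /=; rewrite addrA.
Qed.

Lemma corr_integrable (u Phi : Rn -> R) x : L1loc u -> test_function Phi ->
  mu.-integrable setT (EFin \o (fun y => u y * Phi (y - x))).
Proof.
move=> Lu tP; have tPx := test_shift x tP.
by apply: L1loc_mul_bsupp => //; [exact: test_continuous|exact: test_bsupp].
Qed.

Lemma smooth_partial_bounded (Phi : Rn -> R) : test_function Phi ->
  exists2 C, 0 <= C & forall i x, `|partial i Phi x| <= C.
Proof.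
move=> tP.
have /choice[C hC] : forall i, exists C, 0 <= C /\ forall x, `|partial i Phi x| <= C.
  move=> i; have tPi := test_partial i tP.
  by have [C C0 hC] := bsupp_bounded (test_continuous tPi) (test_bsupp tPi); exists C.
exists (\sum_i C i) => [|i x]; first by apply: sumr_ge0 => i _; case: (hC i).
apply: (le_trans ((hC i).2 x)); rewrite (bigD1 i)//= lerDl.
by apply: sumr_ge0 => j _; case: (hC j).
Qed.

Lemma test_lipschitz (Phi : Rn -> R) : test_function Phi ->
  exists2 C, 0 <= C & forall x h, `|Phi (x + h) - Phi x| <= C * `|h|.
Proof.
move=> tP; have [C C0 dC] := smooth_partial_bounded tP.
have sP := test_smooth tP.
exists (n%:R * C) => [|x h]; first by rewrite mulr_ge0.
have dP z : derivable Phi z h by case: (smooth_derive z h sP).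
have [r _] := mvt_line x 1 dP; rewrite scale1r mul1r => ->.
have [_ ->] := smooth_derive (x + r *: h) h sP.
apply: (le_trans (ler_norm_sum _ _ _)).
apply: (@le_trans _ _ (\sum_(i < n) `|h| * C)).
  by apply: ler_sum => i _; rewrite normrM ler_pM// coord_le_norm.
by rewrite sumr_const card_ord -[leLHS]mulr_natl mulrA mulrAC.
Qed.

(** [Phi] is Lipschitz, and for z within 1 of x the integrand lives on the ball of radius K, where u
    is integrable. *)
Lemma corr_continuous (u Phi : Rn -> R) : L1loc u -> test_function Phi ->
  continuous (corr u Phi).
Proof.
move=> Lu tP x; have [C C0 LC] := test_lipschitz tP.
have [M PM] := test_bsupp tP.
have [mu_ ui] := proj1 (L1locP u) Lu.
pose K := `|x| + 1 + `|M|.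
have Ki := integrable_normR (ui K).
pose I := \int[mu]_y `|ind K y * u y|.
have I0 : 0 <= I by exact: Rintegral_ge0.
apply/(@cvgrPdist_le R R Rn (nbhs x) (nbhs_filter x)) => e e0; near=> z.
have xz : `|x - z| <= 1 by near: z; apply: cvgr_dist_le.
rewrite /corr -RintegralB//; [|exact: corr_integrable..].
apply: (le_trans (le_normr_Rintegral _ _)) => //.
  by apply: integrableBR; exact: corr_integrable.
apply: (@le_trans _ _ (\int[mu]_y ((C * `|x - z|) * `|ind K y * u y|))).
  apply: le_Rintegral => //.
  - by apply: integrable_normR; apply: integrableBR; exact: corr_integrable.
  - exact: integrableZR.
  - move=> y _; rewrite -mulrBr normrM mulrC.
    have [yK|Ky] := leP `|y| K.
      rewrite ind1// mul1r ler_wpM2r//.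
      by have := LC (y - z) (z - x); rewrite addrA subrK (distrC z x).
    have far w : `|x - w| <= 1 -> Phi (y - w) = 0.
      move=> xw; apply: PM; apply: (le_lt_trans (ler_norm M)).
      have : `|y| <= `|y - w| + `|x - w| + `|x|.
        have := ler_normD (y - w) w; have := ler_normD (w - x) x.
        by rewrite !subrK (distrC w); lra.
      by move: Ky; rewrite /K; lra.
    by rewrite !far ?subrr ?normr0 ?mul0r ?mulr_ge0.
rewrite RintegralZl// -/I.
apply: (@le_trans _ _ (`|x - z| * (C * I + 1))).
  rewrite mulrAC (mulrC _ `|x - z|) ler_wpM2l// lerDl//.
rewrite -ler_pdivlMr; last by rewrite ltr_wpDl// mulr_ge0.
near: z; apply: cvgr_dist_le => //; rewrite divr_gt0// ltr_wpDl// mulr_ge0.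
Unshelve. all: by end_near. Qed.

End kernels.

(** * Derivatives of correlations *)

Section chain_rule.
Context {R : realType} {n : nat}.
Local Notation Rn := 'rV[R]_n.
Local Notation mu := (@lebesgue_rV R n).
Local Notation e i := (delta_mx ord0 i : Rn).

Lemma norm_delta_le1 i : `|e i| <= 1.
Proof.
by apply: norm_le_coord => // j; rewrite mxE eqxx/=; case: (_ == _); rewrite ?normr1 ?normr0.
Qed.

Definition wgrad_coord (i : 'I_n) (u gi : Rn -> R) :=
  L1loc gi /\ forall phi, test_function phi ->
    \int[mu]_x (u x * partial i phi x) = - \int[mu]_x (gi x * phi x).

Lemma weak_gradientP (u : Rn -> R) (g : Rn -> Rn) :
  weak_gradient u g <-> forall i, wgrad_coord i u (fun x => g x ord0 i).
Proof. by []. Qed.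

(** Differentiating in x under the integral puts a derivative, with a minus sign, on [Phi]; since y
    -> Phi(y - x) is a test function, the definition of the weak derivative moves it to u with a
    second minus sign. *)
Lemma corr_is_derive i (u gi Phi : Rn -> R) x : L1loc u -> wgrad_coord i u gi ->
  test_function Phi -> is_derive x (e i) (corr u Phi) (corr gi Phi x).
Proof.
move=> Lu [Lg wg] tP; have tdP := test_partial i tP; have tddP := test_partial i tdP.
have [C C0 dC] := bsupp_bounded (test_continuous tddP) (test_bsupp tddP).
have [M PM] := test_bsupp tP; have [M' dPM] := test_bsupp tdP.
have [mu_ ui] := proj1 (L1locP u) Lu.
pose K := `|x| + 1 + `|M| + `|M'|.
have Ki := integrable_normR (ui K).
pose I := \int[mu]_y `|ind K y * u y|.
have I0 : 0 <= I by exact: Rintegral_ge0.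
have sP := test_smooth tP; have sdP := test_smooth tdP.
(* A second-order Taylor bound, from the mean value theorem for [Phi] and then for its partial
   derivative; it makes the difference quotient converge uniformly in y. *)
have quad z h : `|Phi (z - h *: e i) - Phi z + h * partial i Phi z| <= C * h ^+ 2.
  have dP y : derivable Phi y (e i) by exact: smooth_derivable.
  have ddP y : derivable (partial i Phi) y (e i) by exact: smooth_derivable.
  have [r rh E1] := mvt_line z (- h) dP.
  have [q _ E2] := mvt_line z r ddP.
  rewrite -scaleNr E1 mulNr -mulrN1 -[X in _ + X]mulr1 addrC.
  rewrite (_ : _ + _ = - h * (partial i Phi (z + r *: e i) - partial i Phi z)); last first.
    by rewrite /partial; ring.
  rewrite E2 mulrA !normrM normrN mulrC ler_pM//; first exact: dC.
  by rewrite -[h ^+ 2]ger0_norm ?sqr_ge0// normrX expr2 ler_wpM2l// -(normrN h).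
have xE : corr gi Phi x = - \int[mu]_y (u y * partial i Phi (y - x)).
  rewrite -[LHS]opprK; congr (- _); rewrite /corr -(wg _ (test_shift x tP)).
  by apply: eq_Rintegral => y _; rewrite partial_shift.
apply: cvg_is_derive; apply/cvgrPdist_le => eps eps0; near=> h.
have h0 : h != 0 by near: h; exact: nbhs_dnbhs_neq.
have h1 : `|h| <= 1 by near: h; exact: dnbhs0_le.
have iP w : mu.-integrable setT (EFin \o (fun y => u y * Phi (y - w))) by exact: corr_integrable.
have idP : mu.-integrable setT (EFin \o (fun y => u y * partial i Phi (y - x))).
  exact: corr_integrable.
rewrite -[X in `|X - _|](scalerK h0) -scalerBr normrZ normfV ler_pdivrMl ?normr_gt0//.
rewrite xE -normrN opprB scalerN opprK.
have -> : corr u Phi (h *: e i + x) - corr u Phi x +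
    h *: (\int[mu]_y (u y * partial i Phi (y - x))) =
  \int[mu]_y (u y * (Phi (y - x - h *: e i) - Phi (y - x) + h * partial i Phi (y - x))).
  transitivity (corr u Phi (h *: e i + x) - corr u Phi x +
    h * \int[mu]_y (u y * partial i Phi (y - x))); first by [].
  rewrite /corr -RintegralB// -RintegralZl// -RintegralD//; last 2 first.
  - exact: integrableBR.
  - exact: integrableZR.
  apply: eq_Rintegral => y _; rewrite opprD addrA (addrAC y); ring.
have far y w : K < `|y| -> `|x - w| <= 1 -> `|M| + `|M'| < `|y - w|.
  move=> Ky xw; have := ler_normD (y - w) w; have := ler_normD (w - x) x.
  by rewrite !subrK (distrC w); move: Ky; rewrite /K; lra.
apply: (le_trans (le_normr_Rintegral _ _)) => //.
  apply: (eq_integrable measurableT (EFin \o (fun y => u y * Phi (y - (h *: e i + x))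
    - u y * Phi (y - x) + h * (u y * partial i Phi (y - x))))).
    by move=> y _ /=; congr _%:E; rewrite opprD addrA (addrAC y); ring.
  by apply: integrableDR; [exact: integrableBR|exact: integrableZR].
apply: (@le_trans _ _ (\int[mu]_y ((C * h ^+ 2) * `|ind K y * u y|))).
  apply: le_Rintegral => //.
  - apply: integrable_normR.
    apply: (eq_integrable measurableT (EFin \o (fun y => u y * Phi (y - (h *: e i + x))
      - u y * Phi (y - x) + h * (u y * partial i Phi (y - x))))).
      by move=> y _ /=; congr _%:E; rewrite opprD addrA (addrAC y); ring.
    by apply: integrableDR; [exact: integrableBR|exact: integrableZR].
  - exact: integrableZR.
  move=> y _; rewrite normrM mulrC.
  have [yK|Ky] := leP `|y| K; first by rewrite ind1// mul1r ler_wpM2r.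
  have nM := ler_norm M; have nM' := ler_norm M'.
  have fx : `|M| + `|M'| < `|y - x| by apply: far; rewrite ?subrr ?normr0.
  have fxh : `|M| + `|M'| < `|y - x - h *: e i|.
    rewrite -addrA -opprD; apply: far => //; rewrite opprD addrA subrr sub0r normrN.
    by rewrite normrZ mulr_ile1// norm_delta_le1.
  have n0 := normr_ge0 M; have n0' := normr_ge0 M'.
  have Z1 : Phi (y - x) = 0 by apply: PM; lra.
  have Z2 : Phi (y - x - h *: e i) = 0 by apply: PM; lra.
  have Z3 : partial i Phi (y - x) = 0 by apply: dPM; lra.
  rewrite Z1 Z2 Z3 subrr mulr0 addr0 normr0 mul0r.
  exact: (mulr_ge0 (mulr_ge0 C0 (sqr_ge0 h)) (normr_ge0 _)).
rewrite RintegralZl// -/I.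
have hh : h ^+ 2 = `|h| * `|h| by rewrite -normrM -expr2 ger0_norm// sqr_ge0.
apply: (@le_trans _ _ (`|h| * (`|h| * (C * I + 1)))).
  rewrite hh -subr_ge0 [leRHS](_ : _ = `|h| * `|h|); first exact: mulr_ge0.
  by ring.
rewrite ler_wpM2l// -ler_pdivlMr; last by rewrite ltr_wpDl// mulr_ge0.
near: h; apply: dnbhs0_le; rewrite divr_gt0// ltr_wpDl// mulr_ge0//.
Unshelve. all: by end_near. Qed.

Lemma corr_fubini (psi g Phi : Rn -> R) : continuous psi -> bsupp psi -> L1loc g ->
  test_function Phi ->
  \int[mu]_x (psi x * corr g Phi x) = \int[mu]_y (g y * \int[mu]_x (psi x * Phi (y - x))).
Proof.
move=> cpsi bpsi Lg tP.
have [C C0 PC] := bsupp_bounded (test_continuous tP) (test_bsupp tP).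
have [M PM] := test_bsupp tP; have [N psiN] := bpsi.
have [mg gi] := proj1 (L1locP g) Lg.
have psi_i := integrable_normR (continuous_bsupp_integrable cpsi bpsi).
pose K := `|M| + `|N|.
pose f (z : Rn * Rn) := psi z.1 * (g z.2 * Phi (z.2 - z.1)).
have mP : measurable_fun [set: Rn] Phi.
  by apply: smooth_measurable; exact: test_smooth.
have mf : measurable_fun [set: Rn * Rn] f.
  apply: measurable_funM.
    exact: measurableT_comp (continuous_measurable_rV cpsi) measurable_fst.
  apply: measurable_funM; first exact: measurableT_comp mg measurable_snd.
  apply: measurableT_comp mP _.
  apply: measurable_fun_addr; first exact: measurable_snd.
  apply: (eq_measurable_fun (fun z : Rn * Rn => -1 *: z.1)).
    by move=> z _; rewrite scaleN1r.
  by apply: measurable_fun_scaler; exact: measurable_fst.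
have bound x y : `|f (x, y)| <= `|psi x| * (C * `|ind K y * g y|).
  rewrite /f/= !normrM.
  have [Nx|xN] := ltP N `|x|; first by rewrite psiN// normr0 !mul0r.
  rewrite ler_wpM2l// mulrC; have [yK|Ky] := leP `|y| K.
    by rewrite ind1// normr1 mul1r ler_wpM2r.
  rewrite PM ?normr0 ?mul0r ?mulr_ge0//.
  have := ler_normD (y - x) x; rewrite subrK.
  have := ler_norm M; have := ler_norm N; move: Ky; rewrite /K; lra.
have mfE : measurable_fun [set: Rn * Rn] (EFin \o f) by exact/measurable_EFinP.
have fi : (mu \x mu)%E.-integrable setT (EFin \o f).
  apply/integrable12ltyP => //.
  apply: (@le_lt_trans _ _ (\int[mu]_x (`|psi x|%:E * \int[mu]_y (C * `|ind K y * g y|)%:E)))%E.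
    apply: ge0_le_integral => //.
    - by move=> x _; exact: integral_ge0.
    - apply: (measurable_fun_fubini_tonelli_F (m2 := mu) (abse \o (EFin \o f))) => //.
        exact: measurableT_comp.
      by move=> z; exact: abse_ge0.
    - apply: emeasurable_funM => //; apply/measurable_EFinP.
      by apply: measurableT_comp => //; exact: continuous_measurable_rV.
    move=> x _; rewrite -ge0_integralZl//; last 2 first.
    - by apply/measurable_EFinP; apply/measurable_EFinP; exact: measurable_int (integrableZR C (integrable_normR (gi K))).
    - by move=> y _; rewrite lee_fin mulr_ge0.
    apply: ge0_le_integral => //.
    - by apply: measurableT_comp => //; exact: measurableT_comp mfE (pair1_measurable x).
    - by apply: emeasurable_funM => //; exact: measurable_int (integrableZR C (integrable_normR (gi K))).
    - by move=> y _; rewrite /= lee_fin; exact: bound.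
  have Fi := integrable_fin_num measurableT (integrableZR C (integrable_normR (gi K))).
  pose A := fine (\int[mu]_y (C * `|ind K y * g y|)%:E)%E.
  apply: (@le_lt_trans _ _ (\int[mu]_x (A * `|psi x|)%:E)%E).
    rewrite le_eqVlt; apply/orP; left; apply/eqP; apply: eq_integral => x _.
    by rewrite EFinM muleC /A fineK.
  exact: integrable_lty (integrableZR A psi_i).
have psiP y : mu.-integrable setT (EFin \o (fun x => psi x * Phi (y - x))).
  apply: continuous_bsupp_integrable; last exact: bsuppMl.
  move=> x; apply: continuousM; first exact: cpsi.
  apply: (@continuous_comp _ _ _ (fun x : Rn => y - x) Phi); last exact: test_continuous.
  by apply: continuousB; [exact: cst_continuous|exact: cvg_id].
rewrite [LHS]/Rintegral [RHS]/Rintegral; apply: (congr1 fine).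
transitivity (\int[mu]_x \int[mu]_y (EFin \o f) (x, y))%E.
  apply: eq_integral => x _; rewrite /corr -RintegralZl//; last exact: corr_integrable.
  rewrite /Rintegral fineK//; apply: integrable_fin_num => //.
  by apply: integrableZR; exact: corr_integrable.
rewrite (Fubini fi); apply: eq_integral => y _.
rewrite -[X in _ = (_ * X)%:E]/(\int[mu]_x (psi x * Phi (y - x))) -RintegralZl//.
rewrite /Rintegral fineK//; last by apply: integrable_fin_num => //; exact: integrableZR.
by apply: eq_integral => x _; rewrite /f/= mulrCA.
Qed.

End chain_rule.

(** * Mollification and the chain rule for weak derivatives *)

Section weak_chain_rule.
Context {R : realType} {n : nat}.
Local Notation Rn := 'rV[R]_n.
Local Notation mu := (@lebesgue_rV R n).
Local Notation e i := (delta_mx ord0 i : Rn).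

Lemma continuousMR (f g : Rn -> R) : continuous f -> continuous g ->
  continuous (fun x => f x * g x).
Proof. by move=> cf cg x; apply: (@continuousM _ _ f g); [exact: cf|exact: cg]. Qed.

Lemma continuousDR (f g : Rn -> R) : continuous f -> continuous g ->
  continuous (fun x => f x + g x).
Proof. by move=> cf cg x; apply: (@continuousD _ _ _ f g); [exact: cf|exact: cg]. Qed.

Definition moll (r : R) (x : Rn) : R := (@kmass R n)^-1 * kern 0 r x.

Section moll.
Variable r : R.
Hypothesis r0 : 0 < r.

Lemma test_moll : test_function (moll r).
Proof.
apply: test_sm.
  by apply: sm_mul; [exact: sm_cst|apply: sm_of_smooth; apply: test_smooth; exact: test_kern].
by apply: bsuppMr; exact: kern_bsupp.
Qed.

Lemma moll_ge0 x : 0 <= moll r x.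
Proof. by rewrite mulr_ge0 ?kern_ge0// invr_ge0 ltW// kmass_gt0. Qed.

Lemma moll_supp x : r < `|x| -> moll r x = 0.
Proof. by move=> xr; rewrite /moll kern_supp ?mulr0 ?subr0. Qed.

Lemma moll_even x : moll r (- x) = moll r x.
Proof.
rewrite /moll; congr (_ * _); rewrite kern_sym -[LHS](kern_shift _ _ _ x).
by rewrite addNr add0r.
Qed.

Lemma moll_mass x : \int[mu]_y moll r (y - x) = 1.
Proof.
have ki : mu.-integrable setT (EFin \o moll r) by exact/integrableZR/kern_integrable.
rewrite (Rintegral_shift (- x) ki) /moll RintegralZl//; last exact: kern_integrable.
by rewrite kern_mass// mulVf// gt_eqF// kmass_gt0.
Qed.

Lemma moll_integrable x : mu.-integrable setT (EFin \o (fun y => moll r (y - x))).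
Proof.
have ki : mu.-integrable setT (EFin \o moll r) by exact/integrableZR/kern_integrable.
exact: (integrable_shift (- x) ki).
Qed.

(** The mollification is an average for a probability density supported in the sup-norm ball of
    radius r. *)
Lemma corr_moll_near (v : Rn -> R) x a eps : L1loc v ->
  (forall y, `|y - x| <= r -> `|v y - a| <= eps) ->
  `|corr v (moll r) x - a| <= eps.
Proof.
move=> Lv va; have tm := test_moll.
have vi := corr_integrable x Lv tm; have mi := moll_integrable x.
have -> : corr v (moll r) x - a = \int[mu]_y ((v y - a) * moll r (y - x)).
  under [RHS]eq_Rintegral do rewrite mulrBl.
  rewrite RintegralB//; last exact: integrableZR.
  by rewrite RintegralZl// moll_mass mulr1.
have ii : mu.-integrable setT (EFin \o (fun y => (v y - a) * moll r (y - x))).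
  apply: (eq_integrable measurableT (EFin \o (fun y => v y * moll r (y - x) - a * moll r (y - x)))).
    by move=> y _ /=; rewrite mulrBl.
  by apply: integrableBR => //; exact: integrableZR.
apply: (le_trans (le_normr_Rintegral measurableT ii)).
rewrite -[leRHS]mulr1 -(moll_mass x) -RintegralZl//.
apply: le_Rintegral => //; [exact: integrable_normR|exact: integrableZR|].
move=> y _; rewrite normrM (ger0_norm (moll_ge0 _)).
have [yx|xy] := leP `|y - x| r; first by rewrite ler_wpM2r ?moll_ge0 ?va.
by rewrite moll_supp// !mulr0.
Qed.

(** Keeps the mollified values in the ray on which the outer function of the chain rule is
    differentiable. *)
Lemma corr_moll_ge (v : Rn -> R) x c : L1loc v -> (forall y, c <= v y) ->
  c <= corr v (moll r) x.
Proof.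
move=> Lv va; have tm := test_moll.
have vi := corr_integrable x Lv tm; have mi := moll_integrable x.
rewrite -[leLHS]mulr1 -(moll_mass x) -RintegralZl//.
apply: le_Rintegral => //; first exact: integrableZR.
by move=> y _; rewrite ler_wpM2r ?moll_ge0.
Qed.

(** Evenness of the mollifier makes mollification a symmetric operator. *)
Lemma corr_moll_fubini (psi g : Rn -> R) : continuous psi -> bsupp psi -> L1loc g ->
  \int[mu]_x (psi x * corr g (moll r) x) = \int[mu]_y (g y * corr psi (moll r) y).
Proof.
move=> cpsi bpsi Lg; rewrite (corr_fubini cpsi bpsi Lg test_moll).
apply: eq_Rintegral => y _; apply: (congr1 (fun z => g y * z)).
apply: eq_Rintegral => x _; apply: (congr1 (fun z => psi x * z)).
by rewrite -moll_even opprB.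
Qed.

End moll.

(** The extended bound c treats the whole line, c = -oo, together with closed rays; powers and
    logarithms of w + eps call for the latter. *)
Lemma ray_bounded (c : \bar R) (G : R -> R) (U : R) :
  (forall s, (c <= s%:E)%E -> {for s, continuous G}) ->
  exists2 A, 0 <= A & forall s, (c <= s%:E)%E -> `|s| <= U -> `|G s| <= A.
Proof.
move=> cG; pose K := [set s : R | (c <= s%:E)%E] `&` `[- U, U].
have cK : compact K.
  apply: subclosed_compact (@segment_compact _ (- U) U) _; last by move=> s [].
  apply: closedI; last exact: interval_closed.
  case: c {cG K} => [r||].
  - rewrite (_ : mkset _ = [set s | r <= s]); first exact: closed_ge.
    by apply/seteqP; split=> s /=; rewrite lee_fin.
  - rewrite (_ : mkset _ = set0); first exact: closed0.
    by apply/seteqP; split=> s.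
  - rewrite (_ : mkset _ = setT); first exact: closedT.
    by apply/seteqP; split=> s //= _; exact: leNye.
have [A [_ hA]] : bounded_set (G @` K).
  apply: compact_bounded; apply: continuous_compact => //.
  apply: continuous_in_subspaceT => s; rewrite inE => -[cs _].
  exact: cG.
exists (`|A| + 1) => [|s cs sU]; first by rewrite addr_ge0.
apply: hA; first by rewrite (le_lt_trans (ler_norm A))// ltrDl.
by exists s => //; split => //=; rewrite in_itv/= -ler_norml.
Qed.

(* Replacing u by its mollification u_k reduces to the classical chain rule; the
   mollified gradient is then handled by moving the mollifier, which is symmetric,
   onto the continuous factor F'(u_k) phi. *)
Lemma weak_chain i (c : \bar R) (u gi : Rn -> R) (F F' : R -> R) :
  continuous u -> wgrad_coord i u gi ->
  (forall x, (c <= (u x)%:E)%E) ->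
  (forall s, (c <= s%:E)%E -> is_derive s 1 F (F' s)) ->
  (forall s, (c <= s%:E)%E -> {for s, continuous F'}) ->
  wgrad_coord i (fun x => F (u x)) (fun x => F' (u x) * gi x).
Proof.
have rk_gt0 k : 0 < k.+1%:R^-1 :> R by rewrite invr_gt0.
pose rk k : R := k.+1%:R^-1.
move=> cu wgu uc dF cF'; have Lu := L1loc_continuous cu; have Lg := wgu.1.
have cF s : (c <= s%:E)%E -> {for s, continuous F}.
  by move=> cs; apply/differentiable_continuous/derivable1_diffP; case: (dF _ cs).
have cF'u : continuous (fun x => F' (u x)).
  by move=> x; apply: (@continuous_comp _ _ _ u F'); [exact: cu|exact: cF'].
split; first exact: L1locM.
move=> phi tphi; have [M phiM] := test_bsupp tphi.
have tdphi := test_partial i tphi.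
have cphi := test_continuous tphi; have cdphi := test_continuous tdphi.
(* Mollification with radius at most 1 at a point of the ball of radius |M| sees u on the ball of
   radius |M| + 1. *)
have [U U0 hU] : exists2 U, 0 <= U & forall x, `|x| <= `|M| + 1 -> `|u x| <= U.
  have [C [_ hC]] : bounded_set (u @` [set x | `|x| <= `|M| + 1]).
    apply: compact_bounded; apply: continuous_compact; last exact: compact_norm_le.
    exact: continuous_subspaceT.
  exists (`|C| + 1) => [|x xM]; first by rewrite addr_ge0.
  by apply: hC; [rewrite (le_lt_trans (ler_norm C))// ltrDl|exists x].
have [A A0 hA] := ray_bounded U cF; have [A' A'0 hA'] := ray_bounded U cF'.
have [B B0 hB] := bsupp_bounded cphi (test_bsupp tphi).
pose uk k := corr u (moll (rk k)).
have cuk k : continuous (uk k) by apply: corr_continuous => //; exact: (test_moll (rk_gt0 k)).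
have ukc k x : (c <= (uk k x)%:E)%E.
  case: c uc {dF cF' cF hA hA'} => [r||] uc; last exact: leNye.
    by rewrite lee_fin; apply: (corr_moll_ge (rk_gt0 k)) => // y; rewrite -lee_fin.
  by have := uc x.
have rk1 k : k.+1%:R^-1 <= 1 :> R by rewrite invf_le1// ler1n.
have ukU k x : `|x| <= `|M| -> `|uk k x| <= U.
  move=> xM; rewrite -[uk k x]subr0; apply: (corr_moll_near (rk_gt0 k)) => // y yx; rewrite subr0.
  apply: hU; have := ler_normD (y - x) x; rewrite subrK; have := le_trans yx (rk1 k); lra.
have phi0 x : `|M| < `|x| -> phi x = 0.
  by move=> Mx; apply: phiM; apply: le_lt_trans Mx; exact: ler_norm.
have dphi0 x : `|M| < `|x| -> partial i phi x = 0.
  have bp : forall y, `|M| < `|y| -> phi y = 0 by exact: phi0.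
  move=> Mx; rewrite /partial (@near_eq_derive _ _ _ phi (cst 0)); first exact: derive_cst.
  near=> y; apply: phi0; near: y.
  have : open_nbhs x [set y : Rn | `|M| < `|y|].
    split=> //; apply: open_comp (@open_gt R `|M|) => y _; exact: norm_continuous.
  by move/open_nbhs_nbhs.
(* Uniformity in x near y is required by [lim2], where F'(u_k) phi is averaged over a ball about y
   that shrinks with k. *)
have ukcvg y eps : 0 < eps -> \forall k \near \oo,
    forall x, `|x - y| <= k.+1%:R^-1 -> `|uk k x - u y| <= eps.
  move=> eps0; have /cvgrPdist_le/(_ _ eps0)/nbhs_ballP[d /= d0 hd] := cu y.
  near=> k => x xy; apply: (corr_moll_near (rk_gt0 k)) => // z zx; rewrite distrC; apply: hd.
  rewrite -ball_normE/= distrC.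
  have kd : k.+1%:R^-1 < d / 2 by near: k; apply: near_infty_natSinv_lt (PosNum (divr_gt0 d0 _)).
  have := ler_normD (z - x) (x - y); rewrite addrA subrK.
  have := le_lt_trans zx kd; have := le_lt_trans xy kd; lra.
have cFuk k : continuous (fun x => F (uk k x)).
  by move=> x; apply: (@continuous_comp _ _ _ (uk k) F); [exact: cuk|exact: cF].
have cF'uk k : continuous (fun x => F' (uk k x)).
  by move=> x; apply: (@continuous_comp _ _ _ (uk k) F'); [exact: cuk|exact: cF'].
pose gk k := corr gi (moll (rk k)).
have cgk k : continuous (gk k) by apply: corr_continuous => //; exact: (test_moll (rk_gt0 k)).
have dprod k x : is_derive x (e i) (fun x => F (uk k x) * phi x)
    (F (uk k x) * partial i phi x + F' (uk k x) * phi x * gk k x).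
  have d1 : is_derive x (e i) (uk k) (gk k x).
    by apply: corr_is_derive => //; exact: (test_moll (rk_gt0 k)).
  have d2 := is_derive_comp d1 (dF _ (ukc k x)).
  have d3 : is_derive x (e i) phi (partial i phi x).
    by apply: derivableP; apply: smooth_derivable; exact: test_smooth.
  by apply: is_derive_eq (is_deriveM d2 d3) _; rewrite /GRing.scale/=; ring.
have intk k : \int[mu]_x (F (uk k x) * partial i phi x) =
    - \int[mu]_y (gi y * corr (fun x => F' (uk k x) * phi x) (moll (rk k)) y).
  have cpsi : continuous (fun x => F' (uk k x) * phi x).
    exact: continuousMR (cF'uk k) cphi.
  have bpsi : bsupp (fun x => F' (uk k x) * phi x) by exact/bsuppMr/test_bsupp.
  have cp1 : continuous (fun x => F (uk k x) * partial i phi x).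
    exact: continuousMR (cFuk k) cdphi.
  have cp2 : continuous (fun x => F' (uk k x) * phi x * gk k x).
    exact: continuousMR cpsi (cgk k).
  have pE : partial i (fun x => F (uk k x) * phi x) =
      fun x => F (uk k x) * partial i phi x + F' (uk k x) * phi x * gk k x.
    by apply/funext => x; case: (dprod k x).
  have := @Rintegral_partial _ _ (fun x => F (uk k x) * phi x) i.
  rewrite pE RintegralD//; last 2 first.
  - by apply: continuous_bsupp_integrable => //; exact/bsuppMr/test_bsupp.
  - by apply: continuous_bsupp_integrable => //; exact/bsuppMl.
  rewrite (corr_moll_fubini (rk_gt0 k) cpsi bpsi Lg) => /(_ _ _ _ _)/eqP; rewrite addr_eq0.
  move=> /(_ _ _ _ _)/eqP; apply.
  - exact: continuousMR (cFuk k) cphi.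
  - exact/bsuppMr/test_bsupp.
  - by move=> x; case: (dprod k x).
  - exact: continuousDR cp1 cp2.
have lim1 : \int[mu]_x (F (uk k x) * partial i phi x) @[k --> \oo] -->
    \int[mu]_x (F (u x) * partial i phi x).
  apply: (@Rintegral_cvg _ _ _ _ (fun x => A * `|partial i phi x|)).
  - move=> k; apply: continuous_measurable_rV.
    exact: continuousMR (cFuk k) cdphi.
  - move=> x; apply: cvgM; last exact: cvg_cst.
    apply: (@cvg_comp _ _ _ (uk ^~ x) F _ (nbhs (u x))); last exact: cF.
    apply/cvgrPdist_le => eps eps0; have := ukcvg x eps eps0; apply: filterS => k h.
    by rewrite distrC; apply: h; rewrite subrr normr0 ltW.
  - apply/integrableZR/integrable_normR/continuous_bsupp_integrable => //.
    exact: test_bsupp.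
  - move=> k x; rewrite normrM; have [xM|Mx] := leP `|x| `|M|.
      by rewrite ler_wpM2r// hA// ukU.
    by rewrite dphi0// normr0 !mulr0.
have lim2 : \int[mu]_y (gi y * corr (fun x => F' (uk k x) * phi x) (moll (rk k)) y) @[k --> \oo]
    --> \int[mu]_x (F' (u x) * gi x * phi x).
  have [mg ggi] := proj1 (L1locP gi) Lg.
  have cpsi k : continuous (fun x => F' (uk k x) * phi x).
    exact: continuousMR (cF'uk k) cphi.
  have psiAB k x : `|F' (uk k x) * phi x| <= A' * B.
    rewrite normrM; have [xM|Mx] := leP `|x| `|M|.
      by rewrite ler_pM// hA'// ukU.
    by rewrite phi0// normr0 mulr0 mulr_ge0.
  apply: (@Rintegral_cvg _ _ _ _ (fun x => (A' * B) * `|ind (`|M| + 1) x * gi x|)).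
  - move=> k; apply: measurable_funM => //; apply: continuous_measurable_rV.
    by apply: corr_continuous; [exact: L1loc_continuous|exact: (test_moll (rk_gt0 k))].
  - move=> y; rewrite [X in _ --> X](_ : _ = gi y * (F' (u y) * phi y)); last by ring.
    apply: cvgM; first exact: cvg_cst.
    apply/cvgrPdist_le => eps eps0.
    have : {for (u y, y), continuous (fun z : R * Rn => F' z.1 * phi z.2)}.
      apply: continuousM.
        apply: (@continuous_comp _ _ _ fst F'); first exact: cvg_fst.
        exact: (cF' _ (uc y)).
      by apply: (@continuous_comp _ _ _ snd phi); [exact: cvg_snd|exact: cphi].
    move=> /cvgrPdist_le/(_ _ eps0)/nbhs_ballP[d /= d0 hd].
    have d20 : 0 < d / 2 by rewrite divr_gt0.
    near=> k; rewrite distrC; apply: (corr_moll_near (rk_gt0 k)); first exact: L1loc_continuous.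
    move=> x xy; rewrite distrC; apply: (hd (uk k x, x)); split => /=.
      rewrite -ball_normE/= distrC; apply: (@le_lt_trans _ _ (d / 2)); last lra.
      by move: x xy; near: k; exact: ukcvg.
    rewrite -ball_normE/= distrC; apply: (le_lt_trans xy).
    by near: k; exact: near_infty_natSinv_lt (PosNum d0).
  - exact/integrableZR/integrable_normR.
  - move=> k y; rewrite normrM mulrC.
    have [yM|My] := leP `|y| (`|M| + 1).
      rewrite ind1// mul1r ler_wpM2r// -[corr _ _ _]subr0.
      by apply: (corr_moll_near (rk_gt0 k)) => [|x _]; [exact: L1loc_continuous|rewrite subr0].
    rewrite (_ : corr _ _ _ = 0) ?normr0 ?mul0r ?mulr_ge0//.
    apply/eqP; rewrite -normr_le0 -[corr _ _ _]subr0.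
    apply: (corr_moll_near (rk_gt0 k)) => [|x xy]; first exact: L1loc_continuous.
    rewrite phi0 ?mulr0 ?subr0 ?normr0//.
    have := ler_normD (y - x) x; rewrite subrK; rewrite distrC in xy; have := le_trans xy (rk1 k); lra.
have lim3 : \int[mu]_x (F (uk k x) * partial i phi x) @[k --> \oo] -->
    - \int[mu]_x (F' (u x) * gi x * phi x).
  by rewrite (_ : (fun k => _) = (fun k => - \int[mu]_y (gi y *
     corr (fun x => F' (uk k x) * phi x) (moll (rk k)) y))); [exact: cvgN|exact/funext].
by rewrite -(cvg_lim _ lim1)// -(cvg_lim _ lim3).
Unshelve. all: by end_near. Qed.

End weak_chain_rule.

(** * Algebra, similarities and uniqueness of weak gradients *)

Section weak_calculus.
Context {R : realType} {n : nat}.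
Local Notation Rn := 'rV[R]_n.
Local Notation mu := (@lebesgue_rV R n).
Local Notation e i := (delta_mx ord0 i : Rn).

Lemma wgrad_coordD i (u v gu gv : Rn -> R) : continuous u -> continuous v ->
  wgrad_coord i u gu -> wgrad_coord i v gv ->
  wgrad_coord i (fun x => u x + v x) (fun x => gu x + gv x).
Proof.
move=> cu cv [Lgu wu] [Lgv wv]; split; first exact: L1locD.
move=> phi tphi; have tdphi := test_partial i tphi.
have I1 (f psi : Rn -> R) : L1loc f -> test_function psi ->
    mu.-integrable setT (EFin \o (fun x => f x * psi x)).
  move=> Lf tpsi.
  exact: L1loc_mul_bsupp Lf (test_continuous tpsi) (test_bsupp tpsi).
under eq_Rintegral do rewrite mulrDl.
under [in RHS]eq_Rintegral do rewrite mulrDl.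
rewrite (RintegralD measurableT (I1 _ _ (L1loc_continuous cu) tdphi) (I1 _ _ (L1loc_continuous cv) tdphi)).
by rewrite (RintegralD measurableT (I1 _ _ Lgu tphi) (I1 _ _ Lgv tphi)) wu// wv// opprD.
Qed.

Lemma wgrad_coordZ i (c : R) (u gu : Rn -> R) : continuous u ->
  wgrad_coord i u gu -> wgrad_coord i (fun x => c * u x) (fun x => c * gu x).
Proof.
move=> cu [Lgu wu]; split; first exact: L1locZ.
move=> phi tphi; have tdphi := test_partial i tphi.
have I1 (f psi : Rn -> R) : L1loc f -> test_function psi ->
    mu.-integrable setT (EFin \o (fun x => f x * psi x)).
  move=> Lf tpsi.
  exact: L1loc_mul_bsupp Lf (test_continuous tpsi) (test_bsupp tpsi).
under eq_Rintegral do rewrite -mulrA.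
under [in RHS]eq_Rintegral do rewrite -mulrA.
rewrite (RintegralZl _ measurableT (I1 _ _ (L1loc_continuous cu) tdphi)).
by rewrite (RintegralZl _ measurableT (I1 _ _ Lgu tphi)) wu// mulrN.
Qed.

Lemma wgrad_coord_ext i (u v gu gv : Rn -> R) : u =1 v -> gu =1 gv ->
  wgrad_coord i u gu -> wgrad_coord i v gv.
Proof. by move=> /funext -> /funext ->. Qed.

Lemma wgrad_coord_sqr i (u gu : Rn -> R) : continuous u -> wgrad_coord i u gu ->
  wgrad_coord i (fun x => u x ^+ 2) (fun x => 2 * u x * gu x).
Proof.
move=> cu wu; apply: (@weak_chain _ _ i -oo%E u gu (fun s => s ^+ 2) (fun s => 2 * s)) => //.
- by move=> x; exact: leNye.
- move=> s _; have := is_deriveM (is_derive_id s (1 : R)) (is_derive_id s (1 : R)) => h.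
  by apply: is_derive_eq h _; rewrite /GRing.scale/= mulr1 mulr_natl mulr2n.
- by move=> s _; apply: continuousM; [exact: cst_continuous|exact: cvg_id].
Qed.

(** Polarization: 2 u v = (u + v)^2 - u^2 - v^2, and squares are covered by the chain rule. *)
Lemma wgrad_coordM i (u v gu gv : Rn -> R) : continuous u -> continuous v ->
  wgrad_coord i u gu -> wgrad_coord i v gv ->
  wgrad_coord i (fun x => u x * v x) (fun x => u x * gv x + v x * gu x).
Proof.
move=> cu cv wu wv.
have cuv := continuousDR cu cv.
have c2 (f : Rn -> R) : continuous f -> continuous (fun x => f x ^+ 2).
  by move=> cf; exact (continuousMR cf cf).
have w1 := wgrad_coordZ 2^-1 (c2 _ cuv) (wgrad_coord_sqr cuv (wgrad_coordD cu cv wu wv)).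
have w2 := wgrad_coordZ (- 2^-1) (c2 _ cu) (wgrad_coord_sqr cu wu).
have w3 := wgrad_coordZ (- 2^-1) (c2 _ cv) (wgrad_coord_sqr cv wv).
have cZ (a : R) (f : Rn -> R) : continuous f -> continuous (fun x => a * f x).
  by move=> cf; apply: continuousMR cf => x; exact: cst_continuous.
have w12 := wgrad_coordD (cZ _ _ (c2 _ cuv)) (cZ _ _ (c2 _ cu)) w1 w2.
have := wgrad_coordD (continuousDR (cZ _ _ (c2 _ cuv)) (cZ _ _ (c2 _ cu))) (cZ _ _ (c2 _ cv)) w12 w3.
by apply: wgrad_coord_ext => x; field.
Qed.

Lemma wgrad_coord_C1 i (u : Rn -> R) : continuous u ->
  (forall x, derivable u x (e i)) -> continuous (partial i u) ->
  wgrad_coord i u (partial i u).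
Proof.
move=> cu du cdu; split; first exact: L1loc_continuous.
move=> phi tphi; have tdphi := test_partial i tphi.
have cphi := test_continuous tphi; have bphi := test_bsupp tphi.
have cdphi := test_continuous tdphi; have bdphi := test_bsupp tdphi.
have d x : is_derive x (e i) (fun x => u x * phi x) (u x * partial i phi x + partial i u x * phi x).
  have d1 : is_derive x (e i) u (partial i u x) by exact: derivableP.
  have d2 : is_derive x (e i) phi (partial i phi x).
    by apply: derivableP; apply: smooth_derivable; exact: test_smooth.
  by apply: is_derive_eq (is_deriveM d1 d2) _; rewrite /GRing.scale/= [in LHS](mulrC (phi x)).
have pE : partial i (fun x => u x * phi x) =
    fun x => u x * partial i phi x + partial i u x * phi x.
  by apply/funext => x; case: (d x).
have c1 := continuousMR cu cdphi; have c2 := continuousMR cdu cphi.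
have i1 := continuous_bsupp_integrable c1 (bsuppMr u bdphi).
have i2 := continuous_bsupp_integrable c2 (bsuppMr (partial i u) bphi).
have dd x : derivable (fun x => u x * phi x) x (e i) by case: (d x).
have cp : continuous (partial i (fun x => u x * phi x)) by rewrite pE; exact: continuousDR.
have := Rintegral_partial (continuousMR cu cphi) (bsuppMr u bphi) dd cp.
by rewrite pE (RintegralD measurableT i1 i2) => /eqP; rewrite addr_eq0 => /eqP.
Qed.

Lemma wgrad_coord_test i (u : Rn -> R) : smooth u -> wgrad_coord i u (partial i u).
Proof.
move=> su; apply: wgrad_coord_C1; first exact: smooth_continuous.
  by move=> x; exact: smooth_derivable.
exact/smooth_continuous/smooth_partial.
Qed.

Lemma wgrad_coord_cst i (c : R) : wgrad_coord i (fun _ : Rn => c) (fun=> 0).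
Proof.
have pE : partial i (fun _ : Rn => c) = fun=> 0 by apply/funext => x; exact: derive_cst.
rewrite -[X in wgrad_coord _ _ X]pE; apply: wgrad_coord_C1; last rewrite pE.
- by move=> x; exact: cst_continuous.
- by move=> x; exact: derivable_cst.
- by move=> x; exact: cst_continuous.
Qed.

(** The test function is pulled back by the inverse similarity; the change of variables then gives
    both sides the same factor t^(-n). Gradients are row vectors, hence the transpose of M. *)
Lemma weak_gradient_sim (u : Rn -> R) (g : Rn -> Rn) c t M :
  0 < t -> orthogonal M -> continuous u -> weak_gradient u g ->
  weak_gradient (fun x => u (sim c t M x)) (fun x => t *: (g (sim c t M x) *m M^T)).
Proof.
move=> t0 oM cu wg i.
have gE x : (t *: (g (sim c t M x) *m M^T)) ord0 i =
    \sum_j (t * M i j) * g (sim c t M x) ord0 j.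
  by rewrite !mxE mulr_sumr; apply: eq_bigr => j _; rewrite mxE; ring.
rewrite (_ : (fun x => _) = fun x => \sum_j (t * M i j) * g (sim c t M x) ord0 j); last exact/funext.
have Lj j : L1loc (fun x => g (sim c t M x) ord0 j).
  by apply: (L1loc_sim (g := fun x => g x ord0 j)) => //; case: (wg j).
have Lsum : L1loc (fun x => \sum_j (t * M i j) * g (sim c t M x) ord0 j).
  rewrite /index_enum; elim: (Finite.enum _) => [|j r IHr].
    rewrite (_ : (fun x => _) = fun=> 0); last by apply/funext => x; rewrite big_nil.
    by apply: L1loc_continuous => x; exact: cst_continuous.
  rewrite (_ : (fun x => _) = fun x => (t * M i j) * g (sim c t M x) ord0 j +
      \sum_(j <- r) (t * M i j) * g (sim c t M x) ord0 j); last first.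
    by apply/funext => x; rewrite big_cons.
  by apply: L1locD => //; exact: L1locZ.
split => // phi tphi.
pose psi x := phi (simV c t M x).
have tV0 : 0 < t^-1 by rewrite invr_gt0.
have tpsi : test_function psi.
  by rewrite /psi simVE; apply: test_comp_sim => //; exact: orthogonal_tr.
have phiE x : phi x = psi (sim c t M x) by rewrite /psi simK.
have dphiE x : partial i phi x = \sum_j (t * M i j) * partial j psi (sim c t M x).
  have := smooth_derive (sim c t M x) (t *: (e i *m M)) (test_smooth tpsi).
  move=> /is_derive_comp_sim; rewrite (_ : (fun y => psi _) = phi); last first.
    by apply/funext => y; rewrite phiE.
  case=> _ dE; rewrite [LHS]dE; apply: eq_bigr => j _; congr (_ * _).
  rewrite !mxE; congr (_ * _); rewrite (bigD1 i)//= mxE !eqxx mul1r big1 ?addr0// => k ki.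
  by rewrite mxE (negbTE ki) andbF mul0r.
have I1 (f h : Rn -> R) : L1loc f -> test_function h ->
    mu.-integrable setT (EFin \o (fun x => f x * h x)).
  move=> Lf th; exact: L1loc_mul_bsupp Lf (test_continuous th) (test_bsupp th).
have intsum (F : 'I_n -> Rn -> R) : (forall j, mu.-integrable setT (EFin \o F j)) ->
    \int[mu]_x (\sum_j F j x) = \sum_j \int[mu]_x F j x.
  move=> Fi; rewrite /Rintegral.
  under eq_integral do rewrite -sumEFin.
  rewrite integral_sum// -sum_fine// => j _; exact: (integrable_fin_num measurableT (Fi j)).
have Lu := L1loc_continuous cu.
have A1 j : mu.-integrable setT (EFin \o (fun x => u (sim c t M x) * partial j psi (sim c t M x))).
  have := integrable_sim c t0 oM (I1 _ _ Lu (test_partial j tpsi)); exact.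
have A2 j : mu.-integrable setT (EFin \o (fun x => g (sim c t M x) ord0 j * psi (sim c t M x))).
  have := integrable_sim c t0 oM (I1 _ _ (wg j).1 tpsi); exact.
transitivity (\int[mu]_x \sum_j (t * M i j) * (u (sim c t M x) * partial j psi (sim c t M x))).
  apply: eq_Rintegral => x _; rewrite dphiE mulr_sumr; apply: eq_bigr => j _; ring.
rewrite intsum; last by move=> j; exact: integrableZR.
transitivity (- \int[mu]_x \sum_j (t * M i j) * (g (sim c t M x) ord0 j * psi (sim c t M x))); last first.
  congr (- _); apply: eq_Rintegral => x _; rewrite gE phiE mulr_suml; apply: eq_bigr => j _; ring.
rewrite intsum; last by move=> j; exact: integrableZR.
rewrite -sumrN; apply: eq_bigr => j _.
rewrite (RintegralZl _ measurableT (A1 j)) (RintegralZl _ measurableT (A2 j)).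
rewrite (Rintegral_sim c t0 oM (I1 _ _ Lu (test_partial j tpsi))).
rewrite (Rintegral_sim c t0 oM (I1 _ _ (wg j).1 tpsi)).
by rewrite (wg j).2//; ring.
Qed.

(** Makes [grad_norm], which refers to a chosen weak gradient, computable from any weak gradient. *)
Lemma weak_gradient_unique (u : Rn -> R) (g h : Rn -> Rn) : continuous u ->
  weak_gradient u g -> weak_gradient u h -> {ae mu, forall x, g x = h x}.
Proof.
move=> cu wg wh.
have : {ae mu, forall x, forall i, g x ord0 i - h x ord0 i = 0}.
  apply: (@filter_forall _ _ (fun i x => g x ord0 i - h x ord0 i = 0)) => i.
  have Ld : L1loc (fun x => g x ord0 i - h x ord0 i).
    have := L1locD (L1locZ (-1) (wh i).1) (wg i).1.
    by rewrite (_ : (fun x => _ + _) = (fun x => g x ord0 i - h x ord0 i))//;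
      apply/funext => x; rewrite mulN1r.
  apply: du_bois_reymond => // phi tphi.
  have I1 (f : Rn -> R) : L1loc f -> mu.-integrable setT (EFin \o (fun x => f x * phi x)).
    move=> Lf; exact: L1loc_mul_bsupp Lf (test_continuous tphi) (test_bsupp tphi).
  under eq_Rintegral do rewrite mulrBl.
  rewrite (RintegralB measurableT (I1 _ (wg i).1) (I1 _ (wh i).1)).
  by rewrite -[X in X - _]opprK -(wg i).2// -[X in _ - X]opprK -(wh i).2// subrr.
apply: filterS => x gh; apply/rowP => i; apply/eqP.
by rewrite -subr_eq0 gh.
Qed.

End weak_calculus.

(** * Morrey's inequality *)

Section morrey.
Context {R : realType} {n : nat} (p : R).
Hypothesis np : n%:R < p.
Hypothesis p1 : 1 < p.
Local Notation Rn := 'rV[R]_n.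
Local Notation mu := (@lebesgue_rV R n).
Local Notation e i := (delta_mx ord0 i : Rn).

(** The gradient is carried along with u instead of being chosen by [wgrad], so that sums, multiples
    and limits come with explicit gradients. *)
Definition W1p (u : Rn -> R) (g : Rn -> Rn) := [/\ continuous u, weak_gradient u g &
  mu.-integrable setT (EFin \o (fun z => enorm (g z) `^ p))].

Let p0 : 0 < p. Proof. exact: lt_trans p1. Qed.

Lemma ler_powRl (a b r : R) : 0 <= r -> 0 <= a -> a <= b -> a `^ r <= b `^ r.
Proof.
move=> r0 a0 ab; apply: ge0_ler_powR => //; rewrite nnegrE//.
exact: le_trans ab.
Qed.

Lemma ltr_powRl (a b r : R) : 0 < r -> 0 <= a -> a < b -> a `^ r < b `^ r.
Proof.
move=> r0 a0 ab; apply: gt0_ltr_powR => //; rewrite nnegrE//.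
exact: le_trans (ltW ab).
Qed.

Lemma powRK (a r : R) : 0 <= a -> r != 0 -> (a `^ r) `^ r^-1 = a.
Proof. by move=> a0 r0; rewrite -powRrM divff// powRr1. Qed.

Lemma powRVK (a r : R) : 0 <= a -> r != 0 -> (a `^ r^-1) `^ r = a.
Proof. by move=> a0 r0; rewrite -powRrM mulVf// powRr1. Qed.

Lemma moll_bounded : exists2 B : R, 0 < B & forall r x, 0 < r -> moll r (x : Rn) <= B * r ^- n.
Proof.
have [C C0 hC] := @kern_bounded R n; have k0 := @kmass_gt0 R n.
exists ((@kmass R n)^-1 * C ^+ n) => [|r x r0]; first by rewrite mulr_gt0 ?invr_gt0 ?exprn_gt0.
rewrite /moll -mulrA ler_wpM2l ?invr_ge0 ?(ltW k0)//.
by rewrite (le_trans (hC _ _ _ r0))// expr_div_n.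
Qed.

(** Plays the part of Hölder's inequality: if a > l, then a = a^(1-p) a^p <= l^(1-p) a^p. After
    integration, l is chosen to balance the two terms. *)
Lemma le_young (l a : R) : 0 < l -> 0 <= a -> a <= l + l `^ (1 - p) * a `^ p.
Proof.
move=> l0 a0; have [al|la] := leP a l.
  by rewrite (le_trans al)// lerDl mulr_ge0 ?powR_ge0.
have a0' : 0 < a by exact: lt_trans la.
apply: (@le_trans _ _ (a `^ (1 - p) * a `^ p)).
  by rewrite -powRD ?subrK ?powRr1// (gt_eqF a0') implybT.
apply: (@le_trans _ _ (l `^ (1 - p) * a `^ p)); last by rewrite lerDr ltW.
rewrite ler_wpM2r ?powR_ge0//.
rewrite -opprB !powRN lef_pV2 ?posrE ?powR_gt0// ler_powRl ?(ltW l0) ?(ltW la)//.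
by rewrite subr_ge0 ltW.
Qed.

Section estimates.
Variables (u : Rn -> R) (g : Rn -> Rn) (B E : R).
Hypothesis Wu : W1p u g.
Hypothesis B0 : 0 < B.
Hypothesis hB : forall r x, 0 < r -> moll r (x : Rn) <= B * r ^- n.
Hypothesis E0 : 0 < E.

Definition energy_on (g : Rn -> Rn) x rho := \int[mu]_z (ind rho (z - x) * enorm (g z) `^ p).

Let cu : continuous u. Proof. by case: Wu. Qed.
Let Lu : L1loc u. Proof. exact: L1loc_continuous. Qed.
Let Lg i : L1loc (fun z => g z ord0 i). Proof. by case: Wu => _ /(_ i)[]. Qed.
Let ig : mu.-integrable setT (EFin \o (fun z => enorm (g z) `^ p)). Proof. by case: Wu. Qed.
Let en_ge0 z : 0 <= enorm (g z) `^ p. Proof. exact: powR_ge0. Qed.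

Lemma measurable_ind_shift x rho : measurable_fun [set: Rn] (fun z => ind rho (z - x)).
Proof. exact: measurableT_comp (measurable_ind rho) (measurable_shift (- x)). Qed.

Lemma energy_integrable x rho :
  mu.-integrable setT (EFin \o (fun z => ind rho (z - x) * enorm (g z) `^ p)).
Proof.
apply: integrable_le ig; last first.
  by move=> z; rewrite normrM (ger0_norm (ind_ge0 _ _)) (ger0_norm (en_ge0 z)) ler_piMl// ind_le1.
apply: measurable_funM; first exact: measurable_ind_shift.
by apply/measurable_EFinP; exact: measurable_int ig.
Qed.

Lemma energy_on_sub x y r rho : `|x - y| + r <= rho -> energy_on g x rho <= E ->
  energy_on g y r <= E.
Proof.
move=> xyr; apply: le_trans; apply: le_Rintegral => //; try exact: energy_integrable.
move=> z _; apply: ler_wpM2r => //.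
have [zr|rz] := leP `|z - y| r; last by rewrite (ind0 rz) ind_ge0.
rewrite (ind1 zr) ind1//; apply: le_trans xyr.
have := ler_normD (z - y) (y - x); rewrite addrA subrK (distrC y); lra.
Qed.

Lemma avg_grad_le i r z : 0 < r -> energy_on g z r <= E ->
  `|corr (fun y => g y ord0 i) (moll r) z| <= 2 * (B * r ^- n * E) `^ p^-1.
Proof.
(* With l = (B r^(-n) E)^(1/p) the terms l and l^(1-p) B r^(-n) E are equal, hence the factor 2. *)
move=> r0 er; set l := (_ `^ _).
have BE0 : 0 < B * r ^- n * E by rewrite !mulr_gt0// invr_gt0 exprn_gt0.
have l0 : 0 < l by exact: powR_gt0.
have tm := @test_moll R n r r0.
have i1 := corr_integrable z (Lg i) tm.
have i2 := @moll_integrable R n r r0 z.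
have i3 := energy_integrable z r.
apply: (le_trans (le_normr_Rintegral measurableT i1)).
apply: (@le_trans _ _ (\int[mu]_y (l * moll r (y - z) +
    l `^ (1 - p) * (B * r ^- n) * (ind r (y - z) * enorm (g y) `^ p)))).
  apply: le_Rintegral => //; first exact: integrable_normR.
    by apply: integrableDR; exact: integrableZR.
  move=> y _; rewrite normrM (ger0_norm (moll_ge0 r0 _)).
  apply: (@le_trans _ _ ((l + l `^ (1 - p) * enorm (g y) `^ p) * moll r (y - z))).
    rewrite ler_wpM2r ?moll_ge0//.
    apply: (le_trans (coord_le_enorm _ _)); apply: le_young => //; exact: enorm_ge0.
  rewrite mulrDl lerD2l -!mulrA ler_wpM2l ?powR_ge0//.
  have [yr|ry] := leP `|y - z| r; last by rewrite moll_supp// ind0// !(mulr0, mul0r).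
  by rewrite ind1// mul1r mulrC mulrA ler_wpM2r// hB.
rewrite RintegralD//; [|exact: integrableZR|exact: integrableZR].
rewrite (RintegralZl _ measurableT i2) (RintegralZl _ measurableT i3) moll_mass// mulr1.
rewrite mulr_natl mulr2n lerD2l -mulrA.
apply: (@le_trans _ _ (l `^ (1 - p) * (B * r ^- n * E))).
  rewrite ler_wpM2l ?powR_ge0// ler_wpM2l ?(ltW (mulr_gt0 _ _))//.
  by rewrite invr_gt0 exprn_gt0.
have -> : B * r ^- n * E = l `^ p by rewrite /l powRVK ?(ltW BE0) ?gt_eqF.
by rewrite -powRD ?subrK ?powRr1 ?(ltW l0)// (gt_eqF l0) implybT.
Qed.

(** The mollification is C^1 and its gradient is the mollified one; every averaging ball along the
    segment lies in the ball of radius r + |y - x| about x. *)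
Lemma avg_lipschitz r x y : 0 < r -> energy_on g x (r + `|y - x|) <= E ->
  `|corr u (moll r) y - corr u (moll r) x| <=
  `|y - x| * (n%:R * (2 * (B * r ^- n * E) `^ p^-1)).
Proof.
move=> r0 eE; have tm := @test_moll R n r r0.
pose f := corr u (moll r).
have df i z : is_derive z (e i) f (corr (fun y => g y ord0 i) (moll r) z).
  by apply: corr_is_derive => //; case: Wu => _ /weak_gradientP.
have pf i : partial i f = corr (fun y => g y ord0 i) (moll r).
  by apply/funext => z; case: (df i z).
have dv z : is_derive z (y - x) f (\sum_i (y - x) ord0 i * partial i f z).
  apply: is_derive_C1 => i; first by move=> z'; case: (df i z').
  by rewrite pf; apply: corr_continuous.
have [|s s1 fE] := @mvt_line R _ f x (y - x) 1; first by move=> z; case: (dv z).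
rewrite normr1 in s1; rewrite scale1r subrKC mul1r in fE; rewrite fE.
case: (dv (x + s *: (y - x))) => _ ->.
apply: (le_trans (ler_norm_sum _ _ _)).
rewrite mulrCA (_ : n%:R * _ = \sum_(i < n) `|y - x| * (2 * (B * r ^- n * E) `^ p^-1)); last first.
  by rewrite sumr_const card_ord mulr_natl.
apply: ler_sum => i _; rewrite normrM ler_pM ?coord_le_norm// pf.
apply: avg_grad_le => //; apply: energy_on_sub eE.
rewrite opprD addNKr normrN normrZ addrC lerD2l ler_piMl//.
Qed.

(** The weight of the double average at y is an integral over z, and the reflection z -> x + y - z
    exchanges the two mollifiers in it. *)
Lemma corr_moll_comm r s x : 0 < r -> 0 < s ->
  corr (corr u (moll s)) (moll r) x = corr (corr u (moll r)) (moll s) x.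
Proof.
move=> r0 s0.
have key r' s' : 0 < r' -> 0 < s' -> corr (corr u (moll s')) (moll r') x =
    \int[mu]_y (u y * \int[mu]_z (moll r' (z - x) * moll s' (y - z))).
  move=> r'0 s'0.
  have tr := test_shift x (@test_moll R n r' r'0).
  rewrite -(corr_fubini (test_continuous tr) (test_bsupp tr) Lu (@test_moll R n s' s'0)).
  by apply: eq_Rintegral => y _; rewrite mulrC.
apply: (etrans (key r s r0 s0)); apply: (etrans _ (esym (key s r s0 r0))).
apply: eq_Rintegral => y _.
apply: (congr1 (fun t => u y * t)).
have i1 : mu.-integrable setT (EFin \o (fun z => moll r (z - x) * moll s (y - z))).
  have tr := test_shift x (@test_moll R n r r0).
  have ts := test_shift y (@test_moll R n s s0).
  apply: (eq_integrable measurableT (EFin \o (fun z => moll r (z - x) * moll s (z - y)))).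
    by move=> z _ /=; rewrite -[moll s (z - y)]moll_even opprB.
  apply: continuous_bsupp_integrable; last exact/bsuppMr/test_bsupp.
  exact: continuousMR (test_continuous tr) (test_continuous ts).
have oN : orthogonal (- 1%:M : 'M[R]_n).
  by rewrite /orthogonal mulNmx mul1mx linearN/= trmx1 opprK.
have := Rintegral_sim (x + y) ltr01 oN i1; rewrite expr1n invr1 mul1r => <-.
apply: eq_Rintegral => z _.
rewrite /sim mulmxN mulmx1 scale1r.
have -> : x + y - z - x = y - z by rewrite -addrA addrC addrA subrK addrC.
have -> : y - (x + y - z) = z - x by rewrite opprB addrCA opprD (addrC (- x)) addNKr.
exact: mulrC.
Qed.

Let D := n%:R * (4 * (B * 2 ^+ n) `^ p^-1).
Let al := 1 - n%:R / p.

Let D_ge0 : 0 <= D. Proof. by rewrite !mulr_ge0 ?powR_ge0. Qed.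

Let al0 : 0 < al. Proof. by rewrite subr_gt0 ltr_pdivrMr// mul1r. Qed.

(** From t >= r/2 comes t^(-n) <= 2^n r^(-n), the origin of 2^n in [D]; r times r^(-n/p) is r^al.
    The bound is half of D r^al E^(1/p) because [avg_halve] adds two such errors. *)
Lemma scale_bound r t : 0 < r -> r / 2 <= t ->
  r * (n%:R * (2 * (B * t ^- n * E) `^ p^-1)) <= D / 2 * r `^ al * E `^ p^-1.
Proof.
move=> r0 rt.
have t0 : 0 < t by apply: lt_le_trans rt; rewrite divr_gt0.
have -> : D / 2 * r `^ al * E `^ p^-1 =
    r * (n%:R * (2 * ((B * 2 ^+ n) `^ p^-1 * (r ^- n) `^ p^-1 * E `^ p^-1))).
  have -> : r `^ al = r * (r ^- n) `^ p^-1.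
    rewrite /al powRB ?(gt_eqF r0) ?implybT// powRr1 ?(ltW r0)//; congr (_ * _).
    rewrite -powR_invn ?(ltW r0)// -powRrM mulNr powRN//.
  by rewrite /D; field.
rewrite -!powRM ?mulr_ge0 ?invr_ge0 ?exprn_ge0 ?(ltW E0) ?(ltW B0) ?(ltW r0)//.
rewrite ler_wpM2l ?(ltW r0)// ler_wpM2l// ler_wpM2l//.
apply: ler_powRl; rewrite ?invr_ge0 ?(ltW p0)//.
  by rewrite !mulr_ge0 ?invr_ge0 ?exprn_ge0 ?(ltW E0) ?(ltW B0) ?(ltW t0).
rewrite ler_wpM2r ?(ltW E0)// -mulrA ler_wpM2l ?(ltW B0)//.
rewrite -exprVn -[in leRHS]exprVn -exprMn lerXn2r ?nnegrE ?invr_ge0 ?mulr_ge0 ?invr_ge0 ?(ltW t0) ?(ltW r0)//.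
by rewrite -[2 in leRHS]invrK -invfM lef_pV2 ?posrE 1?mulrC// divr_gt0.
Qed.

(* Both averages are compared with the double average, in which the two mollifiers
   commute. *)
Lemma avg_halve r x : 0 < r -> energy_on g x (2 * r) <= E ->
  `|corr u (moll (r / 2)) x - corr u (moll r) x| <= D * r `^ al * E `^ p^-1.
Proof.
move=> r0 eE; have r20 : 0 < r / 2 by rewrite divr_gt0.
have Ls s : 0 < s -> L1loc (corr u (moll s)).
  by move=> s0; apply: L1loc_continuous; apply: corr_continuous => //; exact: test_moll.
have h1 : `|corr (corr u (moll (r / 2))) (moll r) x - corr u (moll (r / 2)) x| <=
    D / 2 * r `^ al * E `^ p^-1.
  apply: (corr_moll_near r0 (Ls _ r20)) => y yr.
  apply: (le_trans (avg_lipschitz r20 _)).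
    by apply: energy_on_sub eE; rewrite subrr normr0 add0r; lra.
  apply: (le_trans _ (scale_bound r0 (lexx _))); rewrite ler_wpM2r//.
  by rewrite !mulr_ge0 ?powR_ge0.
have h2 : `|corr (corr u (moll r)) (moll (r / 2)) x - corr u (moll r) x| <=
    D / 2 * r `^ al * E `^ p^-1.
  apply: (corr_moll_near r20 (Ls _ r0)) => y yr.
  apply: (le_trans (avg_lipschitz r0 _)).
    by apply: energy_on_sub eE; rewrite subrr normr0 add0r; lra.
  have rr : r / 2 <= r by lra.
  apply: (le_trans _ (scale_bound r0 rr)); rewrite ler_wpM2r//; last lra.
  by rewrite !mulr_ge0 ?powR_ge0.
rewrite (corr_moll_comm _ r0 r20) in h1.
set a := r `^ al * E `^ p^-1; move: h1 h2; rewrite -!(mulrA _ (r `^ al)) -/a.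
move: (corr (corr _ _) _ _) (corr u (moll (r / 2)) x) (corr u (moll r) x) a => X Y Z a h1 h2.
have := ler_distD X Y Z; rewrite (distrC Y X); lra.
Qed.

(** Each halving of the radius multiplies the error by 2^(-al) < 1, and by continuity the averages
    tend to u(x): a geometric series. *)
Lemma avg_near r x : 0 < r -> energy_on g x (2 * r) <= E ->
  `|u x - corr u (moll r) x| <= D * r `^ al * E `^ p^-1 / (1 - 2 `^ (- al)).
Proof.
move=> r0 eE; set S := D * r `^ al * E `^ p^-1; set q := 2 `^ (- al).
have q0 : 0 < q by exact: powR_gt0.
have q1 : q < 1.
  have := @ltr_powRl 1 2 al al0 ler01 (ltr1n _ 2).
  by rewrite powR1 /q powRN => h; rewrite invf_lt1// powR_gt0.
have S0 : 0 <= S by rewrite !mulr_ge0 ?powR_ge0.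
have rk0 k : 0 < r / 2 ^+ k by rewrite divr_gt0// exprn_gt0.
have step k : `|corr u (moll (r / 2 ^+ k)) x - corr u (moll r) x| <= S / (1 - q) * (1 - q ^+ k).
  elim: k => [|k IHk]; first by rewrite !expr0 divr1 !subrr normr0 mulr0.
  have := @avg_halve (r / 2 ^+ k) x (rk0 k).
  have -> : (r / 2 ^+ k / 2) = r / 2 ^+ k.+1 by rewrite exprSr invfM mulrA.
  have -> : D * (r / 2 ^+ k) `^ al * E `^ p^-1 = S * q ^+ k.
    rewrite powRM ?(ltW r0) ?invr_ge0 ?exprn_ge0// /S.
    rewrite (_ : (2 ^+ k)^-1 `^ al = q ^+ k); first by rewrite -!mulrA [_ * (q ^+ k)]mulrC; ring.
    rewrite -powR_invn// -powRrM mulNr mulrC -mulNr powRrM powR_mulrn ?powR_ge0//.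
  move=> /(_ _)/le_trans h.
  have {}h : `|corr u (moll (r / 2 ^+ k.+1)) x - corr u (moll (r / 2 ^+ k)) x| <= S * q ^+ k.
    apply: h => //; apply: energy_on_sub eE; rewrite subrr normr0 add0r ler_wpM2l//.
    by rewrite ler_pdivrMr ?exprn_gt0// ler_peMr ?(ltW r0)// exprn_ege1// ler1n.
  apply: (le_trans (ler_distD (corr u (moll (r / 2 ^+ k)) x) _ _)).
  apply: (le_trans (lerD h IHk)); rewrite exprS.
  have q1' : 1 - q != 0 by rewrite subr_eq0 gt_eqF.
  by rewrite le_eqVlt; apply/orP; left; apply/eqP; field.
rewrite distrC; apply/ler_addgt0Pr => eps eps0.
have /cvgrPdist_le/(_ _ eps0)/nbhs_ballP[d /= d0 hd] := @cu x.
have [k kd] : exists k, r / 2 ^+ k < d.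
  have : (r / 2 ^+ k) @[k --> \oo] --> (0 : R).
    rewrite -[X in _ --> X](mulr0 r); apply: cvgM; first exact: cvg_cst.
    have -> : (fun k => (2 ^+ k)^-1) = (fun k => (2^-1 : R) ^+ k).
      by apply/funext => k; rewrite exprVn.
    by apply: cvg_expr; rewrite ger0_norm// invf_lt1// ltr1n.
  move=> /cvgrPdist_lt/(_ _ d0)[k _ /(_ _ (leqnn k))].
  by rewrite /= sub0r normrN ger0_norm ?(ltW (rk0 k))//; exists k.
have h : `|corr u (moll (r / 2 ^+ k)) x - u x| <= eps.
  apply: (corr_moll_near (rk0 k) Lu) => y yx; rewrite distrC; apply: hd.
  by rewrite -ball_normE/= distrC (le_lt_trans yx).
have := step k; have : S / (1 - q) * (1 - q ^+ k) <= S / (1 - q).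
  rewrite ler_piMr//; first by rewrite divr_ge0// subr_ge0 ltW.
  by rewrite gerBl exprn_ge0// ltW.
move: h; move: (corr u (moll (r / 2 ^+ k)) x) (corr u (moll r) x) (S / (1 - q) * (1 - q ^+ k)) (S / (1 - q)) => X Z c' c h h1 h2.
have := ler_distD X (u x) Z; rewrite (distrC (u x) X); move: h h1 h2; rewrite (distrC Z); lra.
Qed.

(** u(x) and u(y) are linked through their averages at radius r = |x - y|. Each comparison needs the
    energy on a ball of radius 2r, and the one about y lies in the ball of radius 3r about x. *)
Lemma morrey_aux x y : energy_on g x (3 * `|x - y|) <= E ->
  `|u x - u y| <= D * (2 / (1 - 2 `^ (- al)) + 1) * `|x - y| `^ al * E `^ p^-1.
Proof.
move=> eE; have [->|xy] := eqVneq x y.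
  by rewrite subrr normr0 (subrr y) normr0 powR0 ?mulr0 ?mul0r// gt_eqF.
set r := `|x - y| in eE *; have r0 : 0 < r by rewrite normr_gt0 subr_eq0.
have e2 : energy_on g x (r + r) <= E.
  by apply: energy_on_sub eE; rewrite subrr normr0; lra.
have rr : r / 2 <= r by lra.
have h1 : `|u x - corr u (moll r) x| <= D * r `^ al * E `^ p^-1 / (1 - 2 `^ (- al)).
  by apply: avg_near => //; apply: energy_on_sub eE; rewrite subrr normr0; lra.
have h2 : `|u y - corr u (moll r) y| <= D * r `^ al * E `^ p^-1 / (1 - 2 `^ (- al)).
  by apply: avg_near => //; apply: energy_on_sub eE; rewrite -/r; lra.
have h3 : `|corr u (moll r) y - corr u (moll r) x| <= D / 2 * r `^ al * E `^ p^-1.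
  have yx : `|y - x| = r by rewrite distrC.
  apply: (le_trans (avg_lipschitz r0 _)).
    by rewrite yx.
  by rewrite yx; exact: scale_bound.
set A := r `^ al * E `^ p^-1.
have A0 : 0 <= A by rewrite mulr_ge0 ?powR_ge0.
rewrite -mulrA -/A; move: h1 h2 h3; rewrite -!(mulrA _ (r `^ al)) -/A.
move: (corr u (moll r) x) (corr u (moll r) y) (1 - _)^-1 => X Y Q h1 h2 h3.
have -> : D * (2 * Q + 1) * A = D * A * Q + (D * A * Q + D * A) by ring.
have -> : u x - u y = (u x - X) + ((X - Y) + (Y - u y)) by rewrite [X - Y + _]addrA subrK addrA subrK.
apply: (le_trans (ler_normD _ _)); apply: lerD => //.
apply: (le_trans (ler_normD _ _)); rewrite addrC; apply: lerD; rewrite distrC//.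
apply: (le_trans h3); by rewrite ler_wpM2r// ler_pdivrMr// ler_peMr// ler1n.
Qed.

End estimates.

Let al := 1 - n%:R / p.

(** Only the energy near x enters, which is what later yields smallness at a zero of u and at
    infinity. E is positive so that the balancing parameter l is. *)
Lemma morrey_local : exists2 C : R, 0 < C & forall u g, W1p u g -> forall E x y, 0 < E ->
  energy_on g x (3 * `|x - y|) <= E -> `|u x - u y| <= C * `|x - y| `^ al * E `^ p^-1.
Proof.
have [B B0 hB] := moll_bounded.
set C := n%:R * (4 * (B * 2 ^+ n) `^ p^-1) * (2 / (1 - 2 `^ (- al)) + 1).
exists (`|C| + 1) => [|u g Wu E x y E0 eE]; first by rewrite ltr_wpDl.
apply: (le_trans (morrey_aux Wu B0 hB E0 eE)).
rewrite -/al -/C ler_wpM2r ?powR_ge0// ler_wpM2r ?powR_ge0//.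
by rewrite (le_trans (ler_norm C))// lerDl.
Qed.

Definition energy (g : Rn -> Rn) := \int[mu]_z (enorm (g z) `^ p).

Lemma energy_ge0 g : 0 <= energy g.
Proof. by apply: Rintegral_ge0 => z _; exact: powR_ge0. Qed.

Lemma energy_on_le u g x r : W1p u g -> energy_on g x r <= energy g.
Proof.
move=> Wu; have [_ _ ig] := Wu; apply: le_Rintegral => //; first exact: energy_integrable Wu _ _.
by move=> z _; rewrite ler_piMl ?powR_ge0// ind_le1.
Qed.

(** The local estimate holds for each E above the total energy. Passing to the limit also covers
    zero energy, on which uniqueness of minimizers rests. *)
Lemma morrey : exists2 C : R, 0 < C & forall u g, W1p u g -> forall x y,
  `|u x - u y| <= C * `|x - y| `^ al * energy g `^ p^-1.
Proof.
have [C C0 hC] := morrey_local; exists C => // u g Wu x y.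
have key E : energy g < E -> `|u x - u y| <= C * `|x - y| `^ al * E `^ p^-1.
  move=> gE; apply: (hC _ _ Wu); first by apply: le_lt_trans gE; exact: energy_ge0.
  exact: le_trans (energy_on_le _ _ Wu) (ltW gE).
set a := C * `|x - y| `^ al in key *; have a0 : 0 <= a by rewrite mulr_ge0 ?powR_ge0 ?ltW.
have [ua|ua] := leP `|u x - u y| (a * energy g `^ p^-1) => //; exfalso.
have pV : 0 < p^-1 by rewrite invr_gt0.
have a0' : 0 < a.
  rewrite lt_neqAle a0 andbT eq_sym; apply/eqP => aE; move: ua (key (energy g + 1)).
  rewrite aE !mul0r ltrDl => h /(_ ltr01) h'; have := lt_le_trans h h'; by rewrite ltxx.
(* The value of E that would make the estimate an equality; any smaller one above the energy, such
   as the midpoint E', contradicts it. *)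
pose E := (`|u x - u y| / a) `^ p.
have ua0 : 0 <= `|u x - u y| / a by rewrite divr_ge0.
have hE : energy g < E.
  rewrite -[ltLHS](@powRVK _ p) ?energy_ge0 ?gt_eqF// ltr_powRl ?powR_ge0//.
  by rewrite ltr_pdivlMr// mulrC.
pose E' := (energy g + E) / 2.
have hE' : energy g < E' by rewrite /E'; lra.
have := key _ hE'; rewrite leNgt => /negP; apply.
rewrite mulrC -ltr_pdivlMr// -[ltRHS](@powRK _ p) ?gt_eqF// -/E ltr_powRl//.
  by rewrite /E' divr_ge0// addr_ge0 ?energy_ge0// powR_ge0.
by rewrite /E'; lra.
Qed.

End morrey.

(** * Minimizers *)

Section lp_inequalities.
Context {R : realType} (p : R).
Hypothesis p1 : 1 < p.
Let p0 : 0 < p. Proof. exact: lt_trans p1. Qed.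

Lemma powR_convex (q s a b : R) : 1 <= q -> 0 <= s <= 1 -> 0 <= a -> 0 <= b ->
  (s * a + (1 - s) * b) `^ q <= s * a `^ q + (1 - s) * b `^ q.
Proof.
move=> q1 /andP[s0 s1] a0 b0.
have := @convex_powR R q q1 (Itv01 s0 s1) a b.
rewrite !inE/= !in_itv/= !andbT => /(_ a0 b0).
by rewrite !convRE/=.
Qed.

(** a^q = a a^(q-1) <= a (a + b)^(q-1), and likewise for b. *)
Lemma powR_superadditive (q a b : R) : 1 <= q -> 0 <= a -> 0 <= b ->
  a `^ q + b `^ q <= (a + b) `^ q.
Proof.
move=> q1 a0 b0; have q0 : 0 < q by exact: lt_le_trans q1.
rewrite -(mulr_powRB1 a0 q0) -(mulr_powRB1 b0 q0) -(mulr_powRB1 (addr_ge0 a0 b0) q0).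
rewrite mulrDl lerD// ler_wpM2l// ler_powRl ?subr_ge0// ?lerDl ?lerDr//.
Qed.

Lemma powR_le1D (a q : R) : 0 <= a -> 0 <= q <= 1 -> a `^ q <= 1 + a.
Proof.
move=> a0 /andP[q0 q1]; have [a1|a1] := leP 1 a.
  by rewrite (le_trans (ler1_powR a1 q1))// lerDr.
rewrite (@le_trans _ _ 1) ?lerDl//.
by have := ler_powRl q0 a0 (ltW a1); rewrite powR1.
Qed.

(** Convexity at the points a/(1-s) and b/s with weights 1-s and s. The coefficient of a^p tends to
    1 with s, so that a perturbation b of small energy changes the energy by a factor close to 1. *)
Lemma powR_scaleD (s a b : R) : 0 < s < 1 -> 0 <= a -> 0 <= b ->
  (a + b) `^ p <= (1 - s) `^ (1 - p) * a `^ p + s `^ (1 - p) * b `^ p.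
Proof.
move=> /andP[s0 s1] a0 b0; have t0 : 0 < 1 - s by rewrite subr_gt0.
have key t c : 0 < t -> 0 <= c -> t * (c / t) `^ p = t `^ (1 - p) * c `^ p.
  move=> t'0 c0; rewrite powRM// ?invr_ge0 ?(ltW t'0)// mulrCA mulrC; congr (_ * _).
  rewrite powRB ?(gt_eqF t'0) ?implybT// powRr1 ?(ltW t'0)//; congr (_ * _).
  by rewrite -(powR_inv1 (ltW t'0)) -powRrM mulN1r powRN.
have := @powR_convex p (1 - s) (a / (1 - s)) (b / s) (ltW p1).
rewrite !divr_ge0 ?(ltW s0) ?(ltW t0)// gerBl (ltW s0) => /(_ erefl erefl erefl).
rewrite opprB subrKC (key (1 - s))// (key s)//.
by rewrite (mulrC (1 - s)) (mulrC s) !divfK ?gt_eqF.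
Qed.

Lemma powR_scaleD2 (a b : R) : 0 <= a -> 0 <= b ->
  (a + b) `^ p <= 2 `^ p * (a `^ p + b `^ p).
Proof.
move=> a0 b0; wlog ab : a b a0 b0 / a <= b => [h|].
  by have [/h|/ltW/h] := leP a b; [exact|rewrite addrC [X in _ * X]addrC; exact].
apply: (@le_trans _ _ ((2 * b) `^ p)).
  by rewrite ler_powRl ?(ltW p0) ?addr_ge0// mulr_natl mulr2n lerD2r.
by rewrite powRM// ler_wpM2l ?powR_ge0// lerDr powR_ge0.
Qed.

Context {n : nat}.
Local Notation Rn := 'rV[R]_n.

(** With q = p/2 >= 1: superadditivity of the q-th power, the parallelogram identity for the
    squares, then convexity of the q-th power. *)
Lemma clarkson (a b : Rn) : 2 <= p ->
  enorm (2^-1 *: (a + b)) `^ p + enorm (2^-1 *: (a - b)) `^ p <=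
  2^-1 * (enorm a `^ p + enorm b `^ p).
Proof.
move=> p2; pose q := p / 2.
have q1 : 1 <= q by rewrite ler_pdivlMr// mul1r.
have pE (x : Rn) : enorm x `^ p = (enorm x ^+ 2) `^ q.
  by rewrite -powR_mulrn ?enorm_ge0// -powRrM mulrCA divff ?mulr1// pnatr_eq0.
rewrite !pE; apply: (le_trans (powR_superadditive q1 (sqr_ge0 _) (sqr_ge0 _))).
have -> : enorm (2^-1 *: (a + b)) ^+ 2 + enorm (2^-1 *: (a - b)) ^+ 2 =
   2^-1 * (enorm a ^+ 2) + (1 - 2^-1) * (enorm b ^+ 2).
  rewrite !enormZ !exprMn !enorm_sqr dotBl !dotBr dotDl !dotDr ger0_norm ?invr_ge0//.
  by rewrite (dotC b a); field.
apply: (le_trans (powR_convex q1 _ (sqr_ge0 _) (sqr_ge0 _))).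
  by rewrite invr_ge0 ler0n/= invf_le1// ler1n.
by rewrite mulrDr lerD2l ler_wpM2r ?powR_ge0//; lra.
Qed.

End lp_inequalities.

Section integral_rules.
Context {R : realType} {n : nat}.
Local Notation Rn := 'rV[R]_n.
Local Notation mu := (@lebesgue_rV R n).
Variables (f h : Rn -> R).
Hypothesis fi : mu.-integrable setT (EFin \o f).
Hypothesis hi : mu.-integrable setT (EFin \o h).

Lemma RintD : \int[mu]_x (f x + h x) = \int[mu]_x f x + \int[mu]_x h x.
Proof. exact: (RintegralD measurableT fi hi). Qed.

Lemma RintZ (c : R) : \int[mu]_x (c * f x) = c * \int[mu]_x f x.
Proof. exact: (RintegralZl c measurableT fi). Qed.

Lemma le_Rint : (forall x, f x <= h x) -> \int[mu]_x f x <= \int[mu]_x h x.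
Proof. by move=> fh; apply: (le_Rintegral measurableT fi hi) => x _. Qed.

End integral_rules.

(** * Functions of finite energy *)

Section energy_space.
Context {R : realType} {n : nat} (p : R).
Hypothesis p1 : 1 < p.
Local Notation Rn := 'rV[R]_n.
Local Notation mu := (@lebesgue_rV R n).
Local Notation en g := (fun z => enorm (g z) `^ p).
Local Notation lp g := (mu.-integrable setT (EFin \o (fun z => enorm (g z) `^ p))).

Let p0 : 0 < p. Proof. exact: lt_trans p1. Qed.

Lemma measurable_enormp (g : Rn -> Rn) : measurable_fun [set: Rn] g ->
  measurable_fun [set: Rn] (fun z => enorm (g z) `^ p).
Proof.
move=> mg; apply: (measurableT_comp (f := fun t : R => t `^ p)).
  exact: measurable_powR.
exact: measurableT_comp measurable_enorm mg.
Qed.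

Lemma weak_gradient_measurable (u : Rn -> R) g : weak_gradient u g -> measurable_fun [set: Rn] g.
Proof. by move=> wg; apply: measurable_fun_rV => i; case: (wg i) => -[]. Qed.

Lemma Rintegral_ae (f h : Rn -> R) : measurable_fun [set: Rn] f -> measurable_fun [set: Rn] h ->
  {ae mu, forall x, f x = h x} -> \int[mu]_x f x = \int[mu]_x h x.
Proof.
move=> mf mh fh; rewrite /Rintegral; congr fine; apply: ae_eq_integral => //.
- exact/measurable_EFinP.
- exact/measurable_EFinP.
- by apply: filterS fh => x fhx _ /=; rewrite fhx.
Qed.

Lemma lp_L1loc (g : Rn -> Rn) i : measurable_fun [set: Rn] g -> lp g ->
  L1loc (fun z => g z ord0 i).
Proof.
move=> mg ig; apply/L1locP.
have mgi : measurable_fun [set: Rn] (fun z => g z ord0 i).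
  exact: measurableT_comp (measurable_coord i) mg.
split => // M; apply: (integrable_le _ _ (integrableDR (integrable_ind M) ig)).
  by apply: measurable_funM => //; exact: measurable_ind.
move=> x; rewrite normrM (ger0_norm (ind_ge0 _ _)).
have [xM|Mx] := leP `|x| M; last by rewrite (ind0 Mx) mul0r add0r powR_ge0.
rewrite (ind1 xM) mul1r (le_trans (coord_le_enorm _ _))//.
by have := @le_young _ p p1 1 (enorm (g x)) ltr01 (enorm_ge0 _); rewrite powR1 mul1r.
Qed.

Lemma lpD (g h : Rn -> Rn) : measurable_fun [set: Rn] g -> measurable_fun [set: Rn] h ->
  lp g -> lp h -> lp (fun z => g z + h z).
Proof.
move=> mg mh ig ih; apply: (integrable_le _ _ (integrableZR (2 `^ p) (integrableDR ig ih))).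
  by apply: measurable_enormp; exact: measurable_fun_addr.
move=> x; rewrite ger0_norm ?powR_ge0//.
apply: le_trans (powR_scaleD2 p1 (enorm_ge0 _) (enorm_ge0 _)).
by rewrite ler_powRl ?(ltW p0) ?enorm_ge0// ler_enormD.
Qed.

Lemma W1p_measurable (u : Rn -> R) g : W1p p u g -> measurable_fun [set: Rn] g.
Proof. by case=> _ wg _; exact: weak_gradient_measurable wg. Qed.

Lemma W1pD (u v : Rn -> R) g h : W1p p u g -> W1p p v h ->
  W1p p (fun x => u x + v x) (fun x => g x + h x).
Proof.
move=> Wu Wv; have mg := W1p_measurable Wu; have mh := W1p_measurable Wv.
case: Wu Wv => cu wg ig [cv wh ih]; split; [exact: continuousDR| |exact: lpD].
apply/weak_gradientP => i.
have := wgrad_coordD cu cv ((weak_gradientP _ _).1 wg i) ((weak_gradientP _ _).1 wh i).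
by apply: wgrad_coord_ext => // x; rewrite mxE.
Qed.

Lemma enormpZ (c : R) (x : Rn) : enorm (c *: x) `^ p = `|c| `^ p * enorm x `^ p.
Proof. by rewrite enormZ powRM ?enorm_ge0. Qed.

Lemma W1pZ (c : R) (u : Rn -> R) g : W1p p u g -> W1p p (fun x => c * u x) (fun x => c *: g x).
Proof.
case=> cu wg ig; split.
- by apply: continuousMR cu => x; exact: cst_continuous.
- apply/weak_gradientP => i; have := wgrad_coordZ c cu ((weak_gradientP _ _).1 wg i).
  by apply: wgrad_coord_ext => // x; rewrite mxE.
- have := integrableZR (`|c| `^ p) ig; apply: eq_integrable => // x _ /=.
  by rewrite enormpZ.
Qed.

Lemma energyZ (c : R) g : lp g -> energy p (fun x => c *: g x) = `|c| `^ p * energy p g.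
Proof.
move=> ig; rewrite /energy; under eq_Rintegral do rewrite enormpZ.
by rewrite RintegralZl.
Qed.

Lemma W1pB (u v : Rn -> R) g h : W1p p u g -> W1p p v h ->
  W1p p (fun x => u x - v x) (fun x => g x - h x).
Proof.
move=> Wu Wv; have := W1pD Wu (W1pZ (-1) Wv).
rewrite (_ : (fun x => u x + _) = (fun x => u x - v x)); last by apply/funext => x; rewrite mulN1r.
by rewrite (_ : (fun x => g x + _) = (fun x => g x - h x))//; apply/funext => x; rewrite scaleN1r.
Qed.

Lemma energyD_le (s : R) (g h : Rn -> Rn) : measurable_fun [set: Rn] g ->
  measurable_fun [set: Rn] h -> lp g -> lp h -> 0 < s < 1 ->
  energy p (fun x => g x + h x) <= (1 - s) `^ (1 - p) * energy p g + s `^ (1 - p) * energy p h.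
Proof.
move=> mg mh ig ih s01; rewrite -[energy p g]/(\int[mu]_x (en g x)) -[energy p h]/(\int[mu]_x (en h x)).
rewrite -(RintZ ig) -(RintZ ih) -(RintD (integrableZR _ ig) (integrableZR _ ih)).
apply: (le_Rint (lpD mg mh ig ih) (integrableDR (integrableZR _ ig) (integrableZR _ ih))).
move=> x; apply: le_trans (powR_scaleD p1 s01 (enorm_ge0 _) (enorm_ge0 _)).
by rewrite ler_powRl ?(ltW p0) ?enorm_ge0// ler_enormD.
Qed.

Lemma energy_clarkson (u v : Rn -> R) g h : 2 <= p -> W1p p u g -> W1p p v h ->
  energy p (fun x => 2^-1 *: (g x + h x)) + energy p (fun x => 2^-1 *: (g x - h x)) <=
  2^-1 * (energy p g + energy p h).
Proof.
move=> p2 Wu Wv.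
have [_ _ i1] := W1pZ 2^-1 (W1pD Wu Wv); have [_ _ i2] := W1pZ 2^-1 (W1pB Wu Wv).
have eq_le (x y : R) : x = y -> x <= y by move=> ->.
have [_ _ ig] := Wu; have [_ _ ih] := Wv.
set G := fun x => 2^-1 *: (g x + h x) in i1 *; set H := fun x => 2^-1 *: (g x - h x) in i2 *.
have e1 : energy p G + energy p H = \int[mu]_x (enorm (G x) `^ p + enorm (H x) `^ p).
  exact: (esym (RintD i1 i2)).
have i3 := integrableZR 2^-1 (integrableDR ig ih).
have e2 : 2^-1 * (energy p g + energy p h) =
    \int[mu]_x (2^-1 * (enorm (g x) `^ p + enorm (h x) `^ p)).
  by rewrite (RintZ (integrableDR ig ih)) (RintD ig ih).
have key x : enorm (G x) `^ p + enorm (H x) `^ p <= 2^-1 * (enorm (g x) `^ p + enorm (h x) `^ p).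
  exact: clarkson.
have key2 := le_Rint (integrableDR i1 i2) i3 key.
apply: (le_trans (eq_le _ _ e1)); apply: (le_trans key2).
exact: (eq_le _ _ (esym e2)).
Qed.

End energy_space.

(** * Geometric convergence and continuity *)

Section geometric_convergence.
Context {R : realType}.

Lemma cvg_powR {T} (F : set_system T) {FF : Filter F} (a : T -> R) (l r : R) :
  0 < r -> 0 <= l -> (forall t, 0 <= a t) -> a t @[t --> F] --> l ->
  a t `^ r @[t --> F] --> l `^ r.
Proof.
move=> r0; rewrite le_eqVlt => /predU1P[<-|l0] a0 al.
  rewrite powR0 ?gt_eqF//; apply/cvgrPdist_le => eps eps0.
  have e0 : 0 < eps `^ r^-1 by exact: powR_gt0.
  move/cvgrPdist_le : al => /(_ _ e0); apply: filterS => t.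
  rewrite !sub0r !normrN !ger0_norm ?powR_ge0// => h.
  by rewrite -(@powRVK _ eps r) ?(ltW eps0) ?gt_eqF// ler_powRl// ltW.
apply: (@cvg_comp _ _ _ a (fun t => t `^ r) _ (nbhs l)) => //.
have cp : {for l, continuous (fun t : R => t `^ r)}.
  by apply/differentiable_continuous/derivable1_diffP; case: (is_derive1_powR r l0).
exact: cp.
Qed.

Lemma geometric_cvg (a : nat -> R) (A : R) :
  (forall k, `|a k.+1 - a k| <= A / 2 ^+ k) -> cvgn a.
Proof.
move=> aA; have A0 : 0 <= A by have := aA 0%N; rewrite expr0 divr1; exact: le_trans.
have : cvgn (series (telescope a)).
  apply: normed_cvg; apply: (@series_le_cvg _ _ (geometric A 2^-1)) => //.
  - by move=> k; exact: normr_ge0.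
  - by move=> k; rewrite /geometric/= mulr_ge0// exprn_ge0// invr_ge0.
  - by move=> k; rewrite /geometric/= exprVn; exact: aA.
  - by apply: is_cvg_geometric_series; rewrite ger0_norm ?invr_ge0// invf_lt1// ltr1n.
move=> h; rewrite (_ : a = fun k => a 0%N + series (telescope a) k); last first.
  by apply/funext => k; exact: eq_sum_telescope.
by apply: is_cvgD => //; exact: is_cvg_cst.
Qed.

Context {n : nat}.
Local Notation Rn := 'rV[R]_n.

Lemma cvg_rV (a : nat -> Rn) (l : Rn) :
  (forall i, a k ord0 i @[k --> \oo] --> l ord0 i) -> a k @[k --> \oo] --> l.
Proof.
move=> al; apply/cvgrPdist_le => eps eps0.
have : \forall k \near \oo, forall i, `|l ord0 i - a k ord0 i| <= eps.
  apply: (@filter_forall _ _ (fun i k => `|l ord0 i - a k ord0 i| <= eps)) => i.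
  by move/cvgrPdist_le : (al i) => /(_ _ eps0).
apply: filterS => k h; apply: norm_le_coord => [|i]; first exact: ltW.
by rewrite !mxE.
Qed.

Lemma geometric_enorm_le (a : nat -> Rn) (A : R) :
  (forall k, enorm (a k.+1 - a k) <= A / 2 ^+ k) ->
  forall k, enorm (a k) <= enorm (a 0%N) + 2 * A.
Proof.
move=> aA; have A0 : 0 <= A.
  by have := aA 0%N; rewrite expr0 divr1; apply: le_trans; exact: enorm_ge0.
have h k : enorm (a k) <= enorm (a 0%N) + 2 * A * (1 - (2 ^+ k)^-1).
  elim: k => [|k IHk]; first by rewrite expr0 invr1 subrr mulr0 addr0.
  have -> : a k.+1 = (a k.+1 - a k) + a k by rewrite subrK.
  apply: (le_trans (ler_enormD _ _)); apply: (le_trans (lerD (aA k) IHk)).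
  rewrite exprS invfM addrCA lerD2l le_eqVlt; apply/orP; left; apply/eqP; field.
  by rewrite expf_neq0// pnatr_eq0.
move=> k; apply: (le_trans (h k)); rewrite lerD2l ler_piMr ?mulr_ge0//.
Qed.

Lemma holder_continuous (r : R) (u : Rn -> R) (A : R) : 0 < r ->
  (forall x x', `|u x - u x'| <= A * `|x - x'| `^ r) -> continuous u.
Proof.
move=> r0 uA x.
apply/(@cvgrPdist_le R R Rn (nbhs x) (nbhs_filter x)) => eps eps0.
have A0 : 0 < `|A| + 1 by rewrite ltr_wpDl.
have d0 : 0 < (eps / (`|A| + 1)) `^ r^-1 by rewrite powR_gt0 ?divr_gt0.
apply/nbhs_ballP; exists ((eps / (`|A| + 1)) `^ r^-1) => //= x'.
rewrite -ball_normE/= => xx'; apply: (le_trans (uA x x')).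
apply: (@le_trans _ _ ((`|A| + 1) * `|x - x'| `^ r)).
  by rewrite ler_wpM2r ?powR_ge0// (le_trans (ler_norm A))// lerDl.
rewrite mulrC -ler_pdivlMr// -[leRHS](@powRVK _ _ r) ?(gt_eqF r0)//.
  by rewrite ler_powRl ?(ltW r0) ?(ltW xx').
by rewrite divr_ge0 ?(ltW A0) ?(ltW eps0).
Qed.

Lemma continuous_normR (f : Rn -> R) : continuous f -> continuous (fun x => `|f x|).
Proof.
move=> cf x; apply: (@continuous_comp _ _ _ f (@Num.norm R R)); first exact: cf.
exact: norm_continuous.
Qed.

Lemma continuous_distR (y : Rn) : continuous (fun x : Rn => `|x - y|).
Proof.
move=> x; apply: (@continuous_comp _ _ _ (fun x : Rn => x - y) (@Num.norm R Rn)); last first.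
  exact: norm_continuous.
by apply: (@continuousD _ _ _ id (cst (- y))); [exact: cvg_id|exact: cst_continuous].
Qed.

Lemma continuous_cstR (c : R) : continuous (fun _ : Rn => c).
Proof. by move=> x; exact: cst_continuous. Qed.

End geometric_convergence.

(** * Completeness of the energy space *)

Section completeness.
Context {R : realType} {n : nat} (p : R).
Hypothesis np : n%:R < p.
Hypothesis p1 : 1 < p.
Local Notation Rn := 'rV[R]_n.
Local Notation mu := (@lebesgue_rV R n).
Local Notation lp g := (mu.-integrable setT (EFin \o (fun z => enorm (g z) `^ p))).
Let p0 : 0 < p. Proof. exact: lt_trans p1. Qed.
Let al := 1 - n%:R / p.
Let al0 : 0 < al. Proof. by rewrite subr_gt0 ltr_pdivrMr// mul1r. Qed.
Let al1 : al <= 1. Proof. by rewrite gerBl divr_ge0// ltW. Qed.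

Variables (u_ : nat -> Rn -> R) (g_ : nat -> Rn -> Rn) (y : Rn) (Em : R).
Hypothesis W_ : forall k, W1p p (u_ k) (g_ k).
Hypothesis u_y : forall k, u_ k y = 0.
Hypothesis E_ : forall k, energy p (g_ k) <= Em.
Hypothesis dE : forall k, energy p (fun x => g_ k.+1 x - g_ k x) <= (4 ^+ k.+1)^-1 `^ p.

Let Wd k : W1p p (fun x => u_ k.+1 x - u_ k x) (fun x => g_ k.+1 x - g_ k x).
Proof. exact: W1pB. Qed.

(* The weight 2^k gives |g_(k+1) - g_k| <= 2^(-k) (sum_k f_k)^(1/p) pointwise. *)
Let f k x := enorm (2 ^+ k *: (g_ k.+1 x - g_ k x)) `^ p.

Let f_int k : mu.-integrable setT (EFin \o f k).
Proof. by have [_ _] := W1pZ (2 ^+ k) (Wd k). Qed.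

Let f_ge0 k x : 0 <= f k x. Proof. exact: powR_ge0. Qed.

(** 2^k / 4^(k+1) = 2^(-k-2), and a number in ]0, 1] only decreases when raised to a power p >=
    1. *)
Let int_f k : (\int[mu]_x (f k x)%:E <= (1 / (2 ^ k.+1)%:R)%:E)%E.
Proof.
have -> : (\int[mu]_x (f k x)%:E)%E = (\int[mu]_x f k x)%:E.
  by rewrite /Rintegral fineK//; exact: (integrable_fin_num measurableT (f_int k)).
have [_ _ id] := Wd k.
rewrite lee_fin -[X in X <= _]/(energy p (fun x => 2 ^+ k *: (g_ k.+1 x - g_ k x))).
rewrite (energyZ _ id) ger0_norm ?exprn_ge0//.
apply: (@le_trans _ _ ((2 ^+ k) `^ p * (4 ^+ k.+1)^-1 `^ p)).
  by rewrite ler_wpM2l ?powR_ge0.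
rewrite -powRM ?invr_ge0 ?exprn_ge0//.
have -> : 2 ^+ k / 4 ^+ k.+1 = 2^-1 ^+ k.+2 :> R.
  have -> : (4 : R) = 2 * 2 by rewrite -natrM.
  rewrite exprMn !exprS exprVn; field.
  by rewrite expf_neq0// pnatr_eq0.
have h1 : 0 < (2^-1 : R) ^+ k.+2 <= 1.
  by rewrite exprn_gt0 ?invr_gt0//= exprn_ile1 ?invr_ge0// invf_le1// ler1n.
apply: (le_trans (ge1r_powR h1 (ltW p1))).
rewrite natrX div1r -exprVn ler_wiXn2l ?invr_ge0//; last by rewrite invf_le1// ler1n.
Qed.

Let H x := (\sum_(0 <= k <oo) (f k x)%:E)%E.

Let mf k : measurable_fun [set: Rn] (fun x => (f k x)%:E).
Proof. exact: measurable_int (f_int k). Qed.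

Let H_int : mu.-integrable setT H.
Proof.
have H0 x : (0 <= H x)%E by apply: nneseries_ge0 => k _ _; rewrite lee_fin.
apply/integrableP; split.
  by apply: (ge0_emeasurable_sum (P := xpredT)) => [k x _ _|k _]; [rewrite lee_fin|exact: mf].
under eq_integral do rewrite gee0_abs//.
rewrite integral_nneseries//; last by move=> k x _; rewrite lee_fin.
apply: (@le_lt_trans _ _ 1%E); last by rewrite ltry.
apply: le_trans (epsilon_trick0 xpredT ler01).
apply: lee_nneseries => // k _ _; apply: integral_ge0 => x _; by rewrite lee_fin.
Qed.

Let D := [set x : Rn | H x \is a fin_num].

Let mD : measurable D.
Proof.
have [mH _] := integrableP _ _ _ H_int.
by have := emeasurable_fin_num measurableT mH; rewrite setTI.
Qed.

Let ae_D : {ae mu, forall x, D x}.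
Proof. by have := integrable_ae measurableT H_int; apply: filterS => x; apply. Qed.

(** Off the set of full measure [D] the gradients are replaced by 0; convergence and domination then
    hold at every point. *)
Let chi : Rn -> R := \1_D.
Let h x := chi x * fine (H x).

Let mh : measurable_fun [set: Rn] h.
Proof.
apply: measurable_funM; first exact: measurable_indic.
have [mH _] := integrableP _ _ _ H_int.
exact: measurableT_comp mH.
Qed.

Let chi1 x : D x -> chi x = 1. Proof. by move=> Dx; rewrite /chi indicE mem_set. Qed.
Let chi0 x : ~ D x -> chi x = 0. Proof. by move=> Dx; rewrite /chi indicE memNset. Qed.

Let h_ge0 x : 0 <= h x.
Proof.
rewrite mulr_ge0// fine_ge0//; apply: nneseries_ge0 => k _ _; by rewrite lee_fin.
Qed.

Let h_int : mu.-integrable setT (EFin \o h).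
Proof.
apply: (le_integrable measurableT _ _ H_int); first exact/measurable_EFinP.
move=> x _ /=; have H0 : (0 <= H x)%E by apply: nneseries_ge0 => k _ _; rewrite lee_fin.
rewrite (gee0_abs H0) ger0_norm// /h.
have [Dx|nDx] := pselect (D x); first by rewrite chi1// mul1r fineK.
by rewrite chi0// mul0r.
Qed.

Let fh k x : D x -> f k x <= h x.
Proof.
move=> Dx; rewrite /h chi1// mul1r -lee_fin fineK//.
apply: (@le_trans _ _ (\sum_(0 <= i < k.+1) (f i x)%:E)%E); last first.
  by apply: nneseries_lim_ge => j _ _; rewrite lee_fin.
rewrite big_nat_recr//= leeDr// sume_ge0// => j _; by rewrite lee_fin.
Qed.

Let gg k x : Rn := chi x *: g_ k x.

Let dgg k x : enorm (gg k.+1 x - gg k x) <= h x `^ p^-1 / 2 ^+ k.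
Proof.
have [Dx|nDx] := pselect (D x); last first.
  by rewrite /gg chi0// !scale0r subrr enorm0 divr_ge0 ?powR_ge0 ?exprn_ge0.
rewrite /gg chi1// !scale1r ler_pdivlMr ?exprn_gt0//.
have -> : enorm (g_ k.+1 x - g_ k x) * 2 ^+ k = f k x `^ p^-1.
  by rewrite /f powRK ?enorm_ge0 ?gt_eqF// enormZ ger0_norm ?exprn_ge0// mulrC.
by rewrite ler_powRl ?invr_ge0 ?(ltW p0)//; exact: fh.
Qed.

Let gl x : Rn := \row_i limn (fun k => gg k x ord0 i).

Let gg_cvg x : gg k x @[k --> \oo] --> gl x.
Proof.
apply: cvg_rV => i; rewrite mxE.
apply: (@geometric_cvg _ _ (h x `^ p^-1)) => k.
by apply: le_trans (dgg k x); have := coord_le_enorm (gg k.+1 x - gg k x) i; rewrite !mxE.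
Qed.

(** Bounds the p-th power of |g_0| + 2 h^(1/p), which the geometric series gives as a bound for all
    the gradients. *)
Let dom x := 2 `^ p * (enorm (g_ 0 x) `^ p + 2 `^ p * h x).

Let dom_int : mu.-integrable setT (EFin \o dom).
Proof.
have [_ _ i0] := W_ 0.
exact: (integrableZR (2 `^ p) (integrableDR i0 (integrableZR (2 `^ p) h_int))).
Qed.

Let gg_dom k x : enorm (gg k x) `^ p <= dom x.
Proof.
have := @geometric_enorm_le _ _ (fun k => gg k x) _ (fun k => dgg k x) k => hk.
apply: (@le_trans _ _ ((enorm (g_ 0 x) + 2 * h x `^ p^-1) `^ p)).
  apply: ler_powRl; rewrite ?(ltW p0) ?enorm_ge0//; apply: (le_trans hk).
  rewrite lerD2r enormZ ler_piMl ?enorm_ge0//.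
  have [Dx|nDx] := pselect (D x); first by rewrite chi1// normr1.
  by rewrite chi0// normr0.
apply: (le_trans (powR_scaleD2 p1 _ _)); rewrite ?enorm_ge0 ?mulr_ge0 ?powR_ge0//.
by rewrite powRM ?powR_ge0// powRVK ?h_ge0 ?gt_eqF.
Qed.

Let mg k : measurable_fun [set: Rn] (g_ k).
Proof. exact: (W1p_measurable (W_ k)). Qed.

Let mgg k : measurable_fun [set: Rn] (gg k).
Proof.
apply: measurable_fun_rV => i; apply: (eq_measurable_fun (fun x => chi x * g_ k x ord0 i)).
  by move=> x _; rewrite mxE.
apply: measurable_funM; first exact: measurable_indic.
exact: measurableT_comp (measurable_coord i) (mg k).
Qed.

Let mgl : measurable_fun [set: Rn] gl.
Proof.
apply: measurable_fun_rV => i.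
apply: (measurable_fun_cvg (h := fun k x => gg k x ord0 i)).
  by move=> k; exact: measurableT_comp (measurable_coord i) (mgg k).
move=> x _; apply: (@cvg_comp _ _ _ (fun k => gg k x) (fun v : Rn => v ord0 i) _ (nbhs (gl x))).
  exact: gg_cvg.
exact: continuous_coord.
Qed.

Let enp_cvg x : enorm (gg k x) `^ p @[k --> \oo] --> enorm (gl x) `^ p.
Proof.
apply: cvg_powR => //; try by move=> *; exact: enorm_ge0.
apply: (@cvg_comp _ _ _ (fun k => gg k x) (@enorm R n) _ (nbhs (gl x))); first exact: gg_cvg.
exact: continuous_enorm.
Qed.

Let gl_int : lp gl.
Proof.
apply: (integrable_le (measurable_enormp p mgl) _ dom_int) => x.
rewrite ger0_norm ?powR_ge0// -(cvg_lim (@Rhausdorff R) (@enp_cvg x)).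
by apply: limr_le; [exact: cvgP (@enp_cvg x)|apply: nearW => k; exact: gg_dom].
Qed.

Let energy_gg k : energy p (gg k) = energy p (g_ k).
Proof.
apply: Rintegral_ae; [exact: measurable_enormp (mgg k)|exact: measurable_enormp (mg k)|].
by apply: filterS ae_D => x Dx; rewrite /gg chi1// scale1r.
Qed.

Let energy_cvg : energy p (g_ k) @[k --> \oo] --> energy p gl.
Proof.
rewrite (_ : (fun k => _) = fun k => energy p (gg k)); last first.
  by apply/funext => k; rewrite energy_gg.
apply: (Rintegral_cvg _ enp_cvg dom_int) => [k|k x]; first exact: measurable_enormp (mgg k).
by rewrite ger0_norm ?powR_ge0//; exact: gg_dom.
Qed.

(** All u_k vanish at y, so Morrey's inequality turns the bound on the energy of u_(k+1) - u_k into
    a pointwise one. A single constant serves both claims. *)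
Let holder_u : exists2 C, 0 <= C & (forall k x x', `|u_ k x - u_ k x'| <= C * `|x - x'| `^ al) /\
  forall x k, `|u_ k.+1 x - u_ k x| <= C * `|x - y| `^ al / 2 ^+ k.
Proof.
have [C C0 hC] := @morrey R n p np p1.
exists (C * (1 + Em `^ p^-1)) => [|].
  by rewrite mulr_ge0 ?(ltW C0)// addr_ge0 ?powR_ge0.
split=> [k x x'|x k].
  apply: (le_trans (hC _ _ (W_ k) x x')); rewrite -/al mulrAC ler_wpM2r ?powR_ge0//.
  rewrite ler_wpM2l ?(ltW C0)//; apply: (@le_trans _ _ (Em `^ p^-1)); last by rewrite lerDr.
  by rewrite ler_powRl ?invr_ge0 ?(ltW p0)// energy_ge0.
have := hC _ _ (Wd k) x y; rewrite !u_y !subrr subr0 => /le_trans; apply.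
rewrite -/al (_ : _ / 2 ^+ k = C * `|x - y| `^ al * ((1 + Em `^ p^-1) / 2 ^+ k)); last by ring.
rewrite ler_wpM2l ?mulr_ge0 ?powR_ge0 ?(ltW C0)//.
  apply: (@le_trans _ _ (2 ^+ k)^-1); last by rewrite ler_peMl ?invr_ge0 ?exprn_ge0// lerDl powR_ge0.
  apply: (@le_trans _ _ (4 ^+ k.+1)^-1).
    have := @ler_powRl R _ _ p^-1 _ (@energy_ge0 R n p _) (dE k).
    by rewrite powRK ?invr_ge0 ?exprn_ge0 ?gt_eqF//; apply; exact: ltW.
  rewrite lef_pV2 ?posrE ?exprn_gt0//; apply: (@le_trans _ _ (4 ^+ k)).
    by rewrite lerXn2r ?nnegrE ?ler_nat.
  by rewrite exprS ler_peMl ?exprn_ge0// ler1n.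
Qed.

Let ul x := limn (fun k => u_ k x).

Let u_cvg x : u_ k x @[k --> \oo] --> ul x.
Proof. by have [C C0 [_ hC]] := holder_u; exact: geometric_cvg (hC x). Qed.

Let ul_continuous : continuous ul.
Proof.
have [C C0 [hC _]] := holder_u.
apply: (@holder_continuous _ _ al _ C al0) => x x'.
have lim : `|u_ k x - u_ k x'| @[k --> \oo] --> `|ul x - ul x'|.
  by apply: cvg_norm; apply: cvgB; exact: u_cvg.
rewrite -(cvg_lim (@Rhausdorff R) lim); apply: limr_le; first exact: cvgP lim.
by apply: nearW => k; exact: hC.
Qed.

Let ul_gradient : weak_gradient ul gl.
Proof.
move=> i; split; first exact: lp_L1loc mgl gl_int.
move=> phi tphi; have tdphi := test_partial i tphi.
have cphi := test_continuous tphi; have cdphi := test_continuous tdphi.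
have [B B0 hB] := bsupp_bounded cphi (test_bsupp tphi).
have [M phiM] := test_bsupp tphi.
have lim1 : \int[mu]_x (gg k x ord0 i * phi x) @[k --> \oo] --> \int[mu]_x (gl x ord0 i * phi x).
  apply: (@Rintegral_cvg _ _ _ _ (fun x => B * (ind M x + dom x))).
  - move=> k; apply: measurable_funM; last exact: continuous_measurable_rV.
    exact: measurableT_comp (measurable_coord i) (mgg k).
  - move=> x; apply: cvgM; last exact: cvg_cst.
    apply: (@cvg_comp _ _ _ (fun k => gg k x) (fun v : Rn => v ord0 i) _ (nbhs (gl x))).
      exact: gg_cvg.
    exact: continuous_coord.
  - exact: integrableZR (integrableDR (integrable_ind M) dom_int).
  - move=> k x; have dom0 : 0 <= dom x by apply: le_trans (gg_dom k x); exact: powR_ge0.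
    have [xM|Mx] := leP `|x| M; last first.
      by rewrite phiM// mulr0 normr0 mulr_ge0// addr_ge0 ?ind_ge0.
    rewrite normrM mulrC ler_pM// ind1//.
    apply: (le_trans (coord_le_enorm _ _)).
    have := @le_young _ p p1 1 (enorm (gg k x)) ltr01 (enorm_ge0 _).
    by rewrite powR1 mul1r => /le_trans; apply; rewrite lerD2l.
have [C C0 [_ hC]] := holder_u.
have uC k x : `|u_ k x| <= `|u_ 0%N x| + 2 * (C * `|x - y| `^ al).
  have uj j : `|u_ j x| <= `|u_ 0%N x| + 2 * (C * `|x - y| `^ al) * (1 - (2 ^+ j)^-1).
    elim: j => [|j IHj]; first by rewrite expr0 invr1 subrr mulr0 addr0.
    have -> : u_ j.+1 x = (u_ j.+1 x - u_ j x) + u_ j x by rewrite subrK.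
    apply: (le_trans (ler_normD _ _)); apply: (le_trans (lerD (hC x j) IHj)).
    rewrite exprS invfM addrCA lerD2l le_eqVlt; apply/orP; left; apply/eqP; field.
    by rewrite expf_neq0// pnatr_eq0.
  apply: (le_trans (uj k)); rewrite lerD2l ler_piMr ?mulr_ge0 ?powR_ge0//.
have lim2 : \int[mu]_x (u_ k x * partial i phi x) @[k --> \oo] -->
    \int[mu]_x (ul x * partial i phi x).
  pose b x := (`|u_ 0%N x| + 2 * (C * (1 + `|x - y|))) * `|partial i phi x|.
  have cb : continuous b.
    apply: continuousMR; last exact: continuous_normR.
    apply: continuousDR; first by apply: continuous_normR; case: (W_ 0).
    apply: continuousMR; first exact: continuous_cstR.
    apply: continuousMR; first exact: continuous_cstR.
    by apply: continuousDR; [exact: continuous_cstR|exact: continuous_distR].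
  have bb : bsupp b.
    have [M' dM'] := test_bsupp tdphi; exists M' => x Mx.
    by rewrite /b dM'// normr0 mulr0.
  apply: (@Rintegral_cvg _ _ _ _ b).
  - move=> k; apply: continuous_measurable_rV; apply: continuousMR cdphi.
    by case: (W_ k).
  - by move=> x; apply: cvgM; [exact: u_cvg|exact: cvg_cst].
  - exact: continuous_bsupp_integrable.
  - move=> k x; rewrite normrM ler_wpM2r//; apply: (le_trans (uC k x)).
    rewrite lerD2l ler_wpM2l// ler_wpM2l//; apply: powR_le1D => //.
    by rewrite (ltW al0).
have e k : \int[mu]_x (u_ k x * partial i phi x) = - \int[mu]_x (gg k x ord0 i * phi x).
  have [_ wk _] := W_ k; rewrite (wk i).2//; congr (- _); apply: Rintegral_ae.
  - apply: measurable_funM; last exact: continuous_measurable_rV.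
    exact: measurableT_comp (measurable_coord i) (mg k).
  - apply: measurable_funM; last exact: continuous_measurable_rV.
    exact: measurableT_comp (measurable_coord i) (mgg k).
  - by apply: filterS ae_D => x Dx; rewrite /gg chi1// scale1r.
have lim3 : \int[mu]_x (u_ k x * partial i phi x) @[k --> \oo] -->
    - \int[mu]_x (gl x ord0 i * phi x).
  rewrite (_ : (fun k => _) = (fun k => - \int[mu]_x (gg k x ord0 i * phi x))); last exact/funext.
  exact: cvgN lim1.
by rewrite -(cvg_lim (@Rhausdorff R) lim2) -(cvg_lim (@Rhausdorff R) lim3).
Qed.

(** The Riesz-Fischer argument for gradients; the common zero y excludes drifting additive
    constants, so the functions converge as well. *)
Lemma W1p_complete : exists u g, [/\ W1p p u g, forall x, u_ k x @[k --> \oo] --> u x &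
  energy p (g_ k) @[k --> \oo] --> energy p g].
Proof. by exists ul, gl; split => //; split. Qed.

End completeness.

(** * Vector form of the gradient rules, and cutoff functions *)

Section weak_gradient_rules.
Context {R : realType} {n : nat}.
Local Notation Rn := 'rV[R]_n.

Lemma weak_gradientM (u v : Rn -> R) gu gv : continuous u -> continuous v ->
  weak_gradient u gu -> weak_gradient v gv ->
  weak_gradient (fun x => u x * v x) (fun x => u x *: gv x + v x *: gu x).
Proof.
move=> cu cv /weak_gradientP wu /weak_gradientP wv; apply/weak_gradientP => i.
have := wgrad_coordM cu cv (wu i) (wv i).
by apply: wgrad_coord_ext => // x; rewrite !mxE.
Qed.

Lemma weak_gradient_chain (c : \bar R) (u : Rn -> R) g (F F' : R -> R) :
  continuous u -> weak_gradient u g -> (forall x, (c <= (u x)%:E)%E) ->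
  (forall s, (c <= s%:E)%E -> is_derive s 1 F (F' s)) ->
  (forall s, (c <= s%:E)%E -> {for s, continuous F'}) ->
  weak_gradient (fun x => F (u x)) (fun x => F' (u x) *: g x).
Proof.
move=> cu /weak_gradientP wu uc dF cF'; apply/weak_gradientP => i.
have := weak_chain cu (wu i) uc dF cF'.
by apply: wgrad_coord_ext => // x; rewrite mxE.
Qed.

Lemma continuous_chain (c : \bar R) (u : Rn -> R) (F F' : R -> R) :
  continuous u -> (forall x, (c <= (u x)%:E)%E) ->
  (forall s, (c <= s%:E)%E -> is_derive s 1 F (F' s)) ->
  continuous (fun x => F (u x)).
Proof.
move=> cu uc dF x; apply: (@continuous_comp _ _ _ u F); first exact: cu.
by apply/differentiable_continuous/derivable1_diffP; case: (dF _ (uc x)).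
Qed.

Definition grad (f : Rn -> R) (x : Rn) : Rn := \row_i partial i f x.

Lemma smooth_grad (f : Rn -> R) : smooth f -> weak_gradient f (grad f).
Proof.
move=> sf; apply/weak_gradientP => i; have := wgrad_coord_test i sf.
by apply: wgrad_coord_ext => // x; rewrite mxE.
Qed.

Lemma test_grad_bounded (f : Rn -> R) : test_function f ->
  exists2 C, 0 < C & forall x, enorm (grad f x) <= C.
Proof.
move=> tf; have [C C0 hC] := smooth_partial_bounded tf.
exists (n%:R * C + 1) => [|x]; first by rewrite ltr_wpDl// mulr_ge0.
apply: (le_trans (enorm_le_norm _)); rewrite (@le_trans _ _ (n%:R * C)) ?lerDl//.
by rewrite ler_wpM2l//; apply: norm_le_coord => // i; rewrite mxE.
Qed.

(** As |x_i| grows from 1 to 2, one of the arguments 3 + 2 x_i and 3 - 2 x_i falls from 1 to -1,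
    through the whole transition of [sstep]. *)
Definition box_bump (x : Rn) : R :=
  \prod_i (sstep (3 + 2 * x ord0 i) * sstep (3 - 2 * x ord0 i)).

Lemma box_bump_ge0 x : 0 <= box_bump x.
Proof. by apply: prodr_ge0 => i _; rewrite mulr_ge0 ?sstep_ge0. Qed.

Lemma box_bump_le1 x : box_bump x <= 1.
Proof.
suff : 0 <= box_bump x <= 1 by case/andP.
rewrite /box_bump; apply: (big_ind (fun a : R => 0 <= a <= 1)).
- by rewrite ler01 lexx.
- by move=> a b /andP[a0 a1] /andP[b0 b1]; rewrite mulr_ge0//= mulr_ile1.
- by move=> i _; rewrite mulr_ge0 ?sstep_ge0//= mulr_ile1 ?sstep_ge0 ?sstep_le1.
Qed.

Lemma box_bump1 x : `|x| <= 1 -> box_bump x = 1.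
Proof.
move=> x1; rewrite /box_bump big1// => i _.
have := le_trans (coord_le_norm x i) x1; rewrite ler_norml => /andP[h1 h2].
by rewrite !sstep_eq1 ?mulr1//; lra.
Qed.

Lemma box_bump0 x : 2 <= `|x| -> box_bump x = 0.
Proof.
move=> x2; apply/eqP; apply: contraTT x2 => h; rewrite -ltNge.
have hi i : `|x ord0 i| < 2.
  rewrite ltNge; apply: contraNN h; rewrite ler_normr => xi; rewrite /box_bump (bigD1 i)//=.
  case/orP : xi => xi; first by rewrite (@sstep_eq0 _ (3 - _)) ?mulr0 ?mul0r//; lra.
  by rewrite (@sstep_eq0 _ (3 + _)) ?mul0r//; lra.
have [n0|n0] := posnP n.
  suff -> : x = 0 by rewrite normr0.
  by apply/rowP => j; move: (ltn_ord j); rewrite [X in (_ < X)%N -> _]n0.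
pose i0 := Ordinal n0; pose i := [arg max_(i > i0) `|x ord0 i|]%O.
apply: le_lt_trans (hi i); apply: norm_le_coord => // j.
by rewrite /i; case: arg_maxP => // k _; apply.
Qed.

Lemma test_box_bump : test_function box_bump.
Proof.
apply: test_sm; last by exists 2 => x /ltW; exact: box_bump0.
apply: sm_prod => i; have h (a : R) : sm (fun x : Rn => sstep (3 + a * x ord0 i)).
  apply: sm_sstep; apply: sm_add; first exact: sm_cst.
  by apply: sm_mul; [exact: sm_cst|exact: sm_coord].
apply: sm_mul; first exact: h.
rewrite (_ : (fun x => _) = fun x : Rn => sstep (3 + - 2 * x ord0 i)); first exact: h.
by apply/funext => x; rewrite mulNr.
Qed.

(** All cutoffs are images of one bump under similarities, so the constant C depends on neither c
    nor r. *)
Lemma box_cutoff : exists2 C : R, 0 < C & forall (c : Rn) r, 0 < r -> exists q G,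
  [/\ continuous q /\ weak_gradient q G, forall x, 0 <= q x <= 1,
      forall x, `|x - c| <= r -> q x = 1,
      forall x, 2 * r <= `|x - c| -> q x = 0 &
      forall x, enorm (G x) <= C / r * ind (2 * r) (x - c)].
Proof.
have [C C0 hC] := test_grad_bounded test_box_bump; exists C => // c r r0.
have rV0 : 0 < r^-1 by rewrite invr_gt0.
have simE x : sim (- (r^-1 *: c)) r^-1 1%:M x = r^-1 *: (x - c).
  by rewrite /sim mulmx1 addrC scalerBr.
have nE x : `|sim (- (r^-1 *: c)) r^-1 1%:M x| = `|x - c| / r.
  by rewrite simE normrZ gtr0_norm// mulrC.
have cq := test_continuous test_box_bump.
exists (fun x => box_bump (sim (- (r^-1 *: c)) r^-1 1%:M x)).
exists (fun x => r^-1 *: (grad box_bump (sim (- (r^-1 *: c)) r^-1 1%:M x) *m 1%:M^T)).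
split.
- split; last exact: weak_gradient_sim orthogonal1 cq (smooth_grad (test_smooth test_box_bump)).
  move=> x; apply: (@continuous_comp _ _ _ (sim (- (r^-1 *: c)) r^-1 1%:M) box_bump).
    exact: continuous_sim.
  exact: cq.
- by move=> x; rewrite box_bump_ge0 box_bump_le1.
- by move=> x xc; rewrite box_bump1// nE ler_pdivrMr// mul1r.
- by move=> x xc; rewrite box_bump0// nE ler_pdivlMr.
- move=> x; rewrite trmx1 mulmx1 enormZ gtr0_norm// mulrC.
  have [xc|xc] := leP `|x - c| (2 * r).
    by rewrite ind1// mulr1 ler_wpM2r ?(ltW rV0).
  rewrite ind0// mulr0; set y := sim _ _ _ x.
  have y2 : 2 < `|y| by rewrite nE ltr_pdivlMr.
  suff -> : grad box_bump y = 0 by rewrite enorm0 mul0r.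
  apply/rowP => i; rewrite !mxE /partial (@near_eq_derive _ _ _ box_bump (cst 0)).
    exact: derive_cst.
  near=> z; apply: box_bump0; apply: ltW; near: z.
  have : open_nbhs y [set z : Rn | 2 < `|z|].
    split=> //; apply: open_comp (@open_gt R 2) => z _; exact: norm_continuous.
  by move/open_nbhs_nbhs.
Unshelve. all: by end_near. Qed.

End weak_gradient_rules.

(** * Existence and uniqueness of minimizers *)

Section minimizers.
Context {R : realType} {n : nat} (p : R).
Hypothesis np : n%:R < p.
Hypothesis p2 : 2 <= p.
Local Notation Rn := 'rV[R]_n.
Local Notation mu := (@lebesgue_rV R n).
Local Notation lp g := (mu.-integrable setT (EFin \o (fun z => enorm (g z) `^ p))).
Let p1 : 1 < p. Proof. by apply: lt_le_trans p2; rewrite ltr1n. Qed.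
Let p0 : 0 < p. Proof. exact: lt_trans p1. Qed.

Lemma lp_bounded (g : Rn -> Rn) A c r : measurable_fun [set: Rn] g ->
  (forall x, enorm (g x) <= A * ind r (x - c)) -> lp g.
Proof.
move=> mg gA.
have i1 := integrable_shift (- c) (integrable_ind (R := R) (n := n) r).
apply: (integrable_le (measurable_enormp p mg) _ (integrableZR (`|A| `^ p) i1)) => x.
rewrite ger0_norm ?powR_ge0//; have := gA x.
have [xr|rx] := leP `|x - c| r.
  rewrite ind1// !mulr1 => h; apply: ler_powRl; rewrite ?(ltW p0) ?enorm_ge0//.
  exact: le_trans (ler_norm A).
rewrite ind0// !mulr0 => h; have /eqP -> : enorm (g x) == 0 by rewrite eq_le h enorm_ge0.
by rewrite powR0 ?gt_eqF.
Qed.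

Lemma powR_lt1 (a r : R) : 0 < r -> 0 <= a -> a < 1 -> a `^ r < 1.
Proof. by move=> r0 a0 a1; have := ltr_powRl r0 a0 a1; rewrite powR1. Qed.

(** Prescribing the value at one point makes the class convex, so that midpoints are competitors in
    Clarkson's inequality. *)
Definition admissible (Omega : set Rn) (x : Rn) u g :=
  [/\ W1p p u g, forall z, ~ Omega z -> u z = 0 & u x = 1].

Definition minimal Omega x w g := admissible Omega x w g /\
  forall u h, admissible Omega x u h -> energy p g <= energy p h.

Lemma admissible_exists Omega x : open Omega -> Omega x -> exists u g, admissible Omega x u g.
Proof.
move=> oO Ox; have /nbhs_ballP[d /= d0 hd] : nbhs x Omega by exact: open_nbhs_nbhs.
have [C C0 hC] := @box_cutoff R n.
have d20 : 0 < d / 2 by rewrite divr_gt0.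
have [q [G [[cq wq] q01 q1 q0 GC]]] := hC x (d / 2) d20.
exists q, G; split; first split => //.
- by apply: lp_bounded GC; exact: weak_gradient_measurable wq.
- move=> z Oz; apply: q0; rewrite mulrC divfK// leNgt; apply/negP => zx; apply: Oz.
  by apply: hd; rewrite -ball_normE/= distrC.
- by rewrite q1// subrr normr0 ltW.
Qed.

(* s |-> sq d s - d is a smooth replacement of the absolute value. *)
Let sq d s : R := Num.sqrt (s ^+ 2 + d ^+ 2).

Let sq_gt0 d s : 0 < d -> 0 < sq d s.
Proof. by move=> d0; rewrite sqrtr_gt0 ltr_wpDl ?sqr_ge0// exprn_gt0. Qed.

Let is_derive_sq d s : 0 < d -> is_derive s (1 : R) (sq d) (s / sq d s).
Proof.
move=> d0; have h0 : 0 < s ^+ 2 + d ^+ 2 by rewrite ltr_wpDl ?sqr_ge0// exprn_gt0.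
have d1 : is_derive s 1 (fun s : R => s ^+ 2 + d ^+ 2) (2 * s).
  have := is_deriveD (is_deriveM (is_derive_id s (1 : R)) (is_derive_id s (1 : R)))
    (is_derive_cst (d ^+ 2) s (1 : R)).
  move=> h; apply: (is_derive_eq h).
  by rewrite /GRing.scale/= mulr1 addr0 mulr_natl mulr2n.
have := @is_derive1_comp _ (@Num.sqrt R) (fun s : R => s ^+ 2 + d ^+ 2) s _ _ (is_derive1_sqrt h0) d1.
move=> h; apply: (is_derive_eq h); rewrite invfM.
by rewrite -[Num.sqrt _]/(sq d s); field; rewrite gt_eqF// sq_gt0.
Qed.

Let continuous_dsq d : 0 < d -> continuous (fun s : R => s / sq d s).
Proof.
move=> d0 s; apply: cvgM; first exact: cvg_id.
apply: cvgV; first by rewrite gt_eqF// sq_gt0.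
by apply/differentiable_continuous/derivable1_diffP; case: (is_derive_sq s d0).
Qed.

(** F(s) = [sq d s] - d is 1-Lipschitz, nonnegative and zero at 0, but F(1) < 1; the result is
    divided by F(1), and the slack in energy < M pays for it. *)
Lemma admissible_nonneg Omega x u g M : admissible Omega x u g -> energy p g < M ->
  exists v h, [/\ admissible Omega x v h, forall z, 0 <= v z & energy p h < M].
Proof.
move=> [[cu wg ig] uO ux] gM; have M0 := le_lt_trans (@energy_ge0 _ _ p g) gM.
(* The energy is th^p M, so division by F(1) stays below M when F(1) > th; F(1) >= 1 - d and d = (1
   - th)/2 ensure this. *)
pose th := (energy p g / M) `^ p^-1.
have th0 : 0 <= th by exact: powR_ge0.
have th1 : th < 1.
  rewrite /th powR_lt1 ?invr_gt0 ?divr_ge0 ?energy_ge0 ?(ltW M0)//.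
  by rewrite ltr_pdivrMr// mul1r.
pose d := (1 - th) / 2; have d0 : 0 < d by rewrite divr_gt0// subr_gt0.
pose F (s : R) := sq d s - d.
have sq_ge s : d <= sq d s.
  rewrite -[leLHS](ger0_norm (ltW d0)) -[leLHS]sqrtr_sqr ler_sqrt ?lerDr ?sqr_ge0//.
  by rewrite addr_ge0 ?sqr_ge0.
have F1 : th < F 1.
  have : 1 <= sq d 1 by rewrite -[leLHS]sqrtr1 ler_sqrt expr1n ?lerDl ?addr_ge0 ?sqr_ge0.
  have : th + d < 1 by move: th1; rewrite /d; move: (th) => t; lra.
  by rewrite /F ltrBrDr; exact: lt_le_trans.
have F10 : 0 < F 1 by exact: le_lt_trans F1.
have dF (s : R) : (-oo <= s%:E)%E -> is_derive s 1 F (s / sq d s).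
  move=> _; have := is_deriveB (is_derive_sq s d0) (is_derive_cst d s (1 : R)).
  by rewrite subr0.
have uc (z : Rn) : (-oo <= (u z)%:E)%E by exact: leNye.
have wF := weak_gradient_chain cu wg uc dF (fun s _ => @continuous_dsq d d0 s).
have cF := continuous_chain cu uc dF.
have WF : W1p p (fun x => F (u x)) (fun x => (u x / sq d (u x)) *: g x).
  split => //; apply: (integrable_le _ _ ig).
    by apply: measurable_enormp; exact: weak_gradient_measurable wF.
  move=> z; rewrite ger0_norm ?powR_ge0// ler_powRl ?(ltW p0) ?enorm_ge0//.
  rewrite enormZ ler_piMl ?enorm_ge0// normrM normfV (gtr0_norm (sq_gt0 _ d0)).
  rewrite ler_pdivrMr ?sq_gt0// mul1r -sqrtr_sqr ler_sqrt ?lerDl ?sqr_ge0//.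
  by rewrite addr_ge0 ?sqr_ge0.
have EF : energy p (fun x => (u x / sq d (u x)) *: g x) <= energy p g.
  have [_ _ iF] := WF; apply: (le_Rint iF ig) => z.
  rewrite ler_powRl ?(ltW p0) ?enorm_ge0//.
  rewrite enormZ ler_piMl ?enorm_ge0// normrM normfV (gtr0_norm (sq_gt0 _ d0)).
  rewrite ler_pdivrMr ?sq_gt0// mul1r -sqrtr_sqr ler_sqrt ?lerDl ?sqr_ge0//.
  by rewrite addr_ge0 ?sqr_ge0.
exists (fun z => (F 1)^-1 * F (u z)), (fun z => (F 1)^-1 *: ((u z / sq d (u z)) *: g z)).
split.
- split; first exact: W1pZ.
    move=> z /uO ->; rewrite /F /sq expr0n/= add0r sqrtr_sqr gtr0_norm// subrr mulr0//.
  by rewrite ux mulVf// gt_eqF.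
- move=> z; rewrite mulr_ge0 ?invr_ge0 ?(ltW F10)// subr_ge0//.
- have [_ _ iF] := WF; rewrite (energyZ _ iF) gtr0_norm ?invr_gt0//.
  apply: (@le_lt_trans _ _ ((F 1)^-1 `^ p * energy p g)).
    by rewrite ler_wpM2l ?powR_ge0.
  have -> : energy p g = th `^ p * M.
    by rewrite /th powRVK ?divr_ge0 ?energy_ge0 ?(ltW M0) ?(gt_eqF p0)// divfK// gt_eqF.
  rewrite mulrA -powRM ?invr_ge0 ?(ltW F10)// gtr_pMl//.
  rewrite powR_lt1 ?mulr_ge0 ?invr_ge0 ?(ltW F10)//.
  by rewrite mulrC ltr_pdivrMr// mul1r.
Qed.

Lemma admissible_mid Omega x u g v h : admissible Omega x u g -> admissible Omega x v h ->
  admissible Omega x (fun z => 2^-1 * (u z + v z)) (fun z => 2^-1 *: (g z + h z)).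
Proof.
move=> [Wu uO ux] [Wv vO vx]; split.
- exact/W1pZ/W1pD.
- by move=> z Oz; rewrite uO// vO// addr0 mulr0.
- by rewrite ux vx; field.
Qed.

(** By Clarkson's inequality half the difference has zero energy; by Morrey's it is constant, and it
    vanishes at x. *)
Lemma minimal_unique Omega x u g v h : minimal Omega x u g -> minimal Omega x v h -> u =1 v.
Proof.
move=> [au mu_] [av mv] z.
have [Wu _ ux] := au; have [Wv _ vx] := av.
have e1 := mu_ _ _ (admissible_mid au av); have e2 := energy_clarkson p1 p2 Wu Wv.
have e3 := mu_ _ _ av; have e4 := mv _ _ au.
have Wd := W1pZ 2^-1 (W1pB p1 Wu Wv).
have e0 : energy p (fun x => 2^-1 *: (g x - h x)) = 0.
  apply/eqP; rewrite eq_le energy_ge0 andbT; move: e1 e2 e3 e4.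
  move: (energy p _) (energy p _) (energy p g) (energy p h) => a b c d; lra.
have [C C0 hC] := @morrey R n p np p1.
have := hC _ _ Wd z x; rewrite e0 powR0 ?invr_eq0 ?gt_eqF// mulr0 ux vx subrr mulr0 subr0.
rewrite normr_le0 mulf_eq0 invr_eq0 pnatr_eq0/= subr_eq0 => /eqP ->//.
Qed.

(** No weak compactness: Clarkson's inequality makes a fast minimizing sequence Cauchy. A point y
    off Omega is the common zero for [W1p_complete], and nonnegativity, arranged along the sequence,
    passes to the pointwise limit. *)
Lemma minimal_exists Omega x : open Omega -> Omega x -> Omega <> setT ->
  exists w g, minimal Omega x w g /\ forall z, 0 <= w z.
Proof.
move=> oO Ox OT; have [y Oy] : exists y, ~ Omega y.
  by apply: contra_notP OT => /forallNP h; apply/seteqP; split => // z _; apply: contrapT; exact: h.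
pose S := [set energy p g | g in [set g | exists u, admissible Omega x u g]].
have [u0 [g0 a0]] := admissible_exists oO Ox.
have S0 : S !=set0 by exists (energy p g0), g0 => //; exists u0.
have Slb : lbound S 0 by move=> _ [g _ <-]; exact: energy_ge0.
have infS : has_inf S by split => //; exists 0.
pose m := inf S.
have mle u g : admissible Omega x u g -> m <= energy p g.
  by move=> a; apply: ge_inf; [exists 0|exists g => //; exists u].
(* Clarkson's inequality bounds the energy of half the difference by eps k; removing the factor
   2^(-p) leaves the rate required by [W1p_complete]. *)
pose eps k : R := (2^-1 * (4 ^+ k.+1)^-1) `^ p.
have eps0 k : 0 < eps k by rewrite powR_gt0// mulr_gt0 ?invr_gt0// exprn_gt0.
have epsle k : eps k <= k.+1%:R^-1.
  have q0 : 0 < 2 * 4 ^+ k.+1 :> R by rewrite mulr_gt0// exprn_gt0.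
  have q1 : k.+1%:R <= 2 * 4 ^+ k.+1 :> R.
    rewrite -natrX -natrM ler_nat; apply: (@leq_trans (4 ^ k.+1)%N); last by rewrite leq_pmull.
    by rewrite ltnW// ltn_expl.
  have h1 : 0 < (2^-1 : R) * (4 ^+ k.+1)^-1 <= 1.
    rewrite -invfM invr_gt0 q0/= invf_le1//; apply: le_trans q1; by rewrite ler1n.
  apply: (le_trans (ge1r_powR h1 (ltW p1))).
  by rewrite -invfM lef_pV2 ?posrE.
have /choice[ug hug] : forall k, exists ug : (Rn -> R) * (Rn -> Rn),
    [/\ admissible Omega x ug.1 ug.2, forall z, 0 <= ug.1 z & energy p ug.2 < m + eps k].
  move=> k; have [_ [g [u a] <-] gm] := inf_adherent (eps0 k) infS.
  have [v [h [av v0 hm]]] := admissible_nonneg a gm.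
  by exists (v, h).
pose u_ k := (ug k).1; pose g_ k := (ug k).2.
have a_ k : admissible Omega x (u_ k) (g_ k) by case: (hug k).
have W_ k : W1p p (u_ k) (g_ k) by case: (a_ k).
have dE k : energy p (fun x => g_ k.+1 x - g_ k x) <= (4 ^+ k.+1)^-1 `^ p.
  have Wd := W1pB p1 (W_ k.+1) (W_ k); have [_ _ id] := Wd.
  have e1 := mle _ _ (admissible_mid (a_ k.+1) (a_ k)).
  have e2 := energy_clarkson p1 p2 (W_ k.+1) (W_ k).
  have [_ _ e3] := hug k; have [_ _ e4] := hug k.+1.
  have e5 : eps k.+1 <= eps k.
    rewrite ler_powRl ?(ltW p0) ?mulr_ge0 ?invr_ge0 ?exprn_ge0// ler_wpM2l ?invr_ge0//.
    by rewrite lef_pV2 ?posrE ?exprn_gt0// [leRHS]exprS ler_peMl ?exprn_ge0// ler1n.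
  have : energy p (fun x => 2^-1 *: (g_ k.+1 x - g_ k x)) <= eps k.
    move: e1 e2 e3 e4 e5; rewrite -/(g_ k) -/(g_ k.+1); move: (energy p _) (energy p _).
    move: (energy p (g_ k)) (energy p (g_ k.+1)) (eps k) (eps k.+1) => c d e e' a b; lra.
  rewrite (energyZ _ id) /eps powRM ?invr_ge0 ?exprn_ge0// ger0_norm ?invr_ge0//.
  by rewrite ler_pM2l// powR_gt0// invr_gt0.
have E_ k : energy p (g_ k) <= m + 1.
  have [_ _ /ltW e3] := hug k; apply: (le_trans e3); rewrite lerD2l.
  by apply: (le_trans (epsle k)); rewrite invf_le1// ler1n.
have u_y k : u_ k y = 0 by case: (a_ k) => _ /(_ y Oy).
have [w [g [Ww u_cvg e_cvg]]] := W1p_complete np p1 W_ u_y E_ dE.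
have u_lim z c : (forall k, u_ k z = c) -> w z = c.
  move=> uc; rewrite -(cvg_lim (@Rhausdorff R) (u_cvg z)).
  by rewrite (_ : (fun k => _) = fun=> c) ?lim_cst//; exact/funext.
exists w, g; split; first split; first split => //.
- by move=> z Oz; apply: u_lim => k; case: (a_ k) => _ /(_ z Oz).
- by apply: u_lim => k; case: (a_ k).
- move=> u h a; apply: (le_trans _ (mle _ _ a)).
  have l2 : m + k.+1%:R^-1 @[k --> \oo] --> m.
    rewrite -[X in _ --> X]addr0; apply: cvgD; [exact: cvg_cst|exact: cvg_harmonic].
  apply: (ler_cvg_to e_cvg l2); apply: nearW => k.
  by have [_ _ /ltW e3] := hug k; apply: (le_trans e3); rewrite lerD2l.
- move=> z; rewrite -(cvg_lim (@Rhausdorff R) (u_cvg z)).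
  apply: limr_ge; first exact: cvgP (u_cvg z).
  by apply: nearW => k; case: (hug k) => _ /(_ z).
Qed.

(** Dividing by v(x) >= 1 restores the normalization and does not increase the energy. *)
Lemma minimal_above Omega x w g v h : minimal Omega x w g -> W1p p v h ->
  (forall z, ~ Omega z -> v z = 0) -> 1 <= v x -> energy p g <= energy p h.
Proof.
move=> [_ mw] Wv vO vx; have vx0 : 0 < v x by exact: lt_le_trans vx.
apply: (@le_trans _ _ (energy p (fun z => (v x)^-1 *: h z))).
  apply: (mw (fun z => (v x)^-1 * v z)); split; first exact: W1pZ.
    by move=> z /vO ->; rewrite mulr0.
  by rewrite mulVf// gt_eqF.
have [_ _ ih] := Wv; rewrite (energyZ _ ih) ler_piMl ?energy_ge0// gtr0_norm ?invr_gt0//.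
have : (v x)^-1 `^ p <= 1 `^ p by rewrite ler_powRl ?(ltW p0) ?invr_ge0 ?(ltW vx0)// invf_le1.
by rewrite powR1.
Qed.

End minimizers.

(** * Distance to the complement *)

Section distance.
Context {R : realType} {n : nat}.
Local Notation Rn := 'rV[R]_n.
Variable Omega : set Rn.
Local Notation d := (dist_compl Omega).

Let lbd x : lbound [set enorm (x - y) | y in ~` Omega] 0.
Proof. by move=> _ [y _ <-]; exact: enorm_ge0. Qed.

Lemma dist_compl_le x y : ~ Omega y -> d x <= enorm (x - y).
Proof. by move=> Oy; apply: ge_inf; [exists 0; exact: lbd|exists y]. Qed.

Lemma dist_compl_ge y0 x r : ~ Omega y0 -> (forall y, ~ Omega y -> r <= enorm (x - y)) -> r <= d x.
Proof.
by move=> y0O h; apply: lb_le_inf; [exists (enorm (x - y0)), y0|move=> _ [y Oy <-]; exact: h].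
Qed.

Lemma dist_compl_ge0 y0 x : ~ Omega y0 -> 0 <= d x.
Proof. by move=> y0O; apply: (dist_compl_ge y0O) => y _; exact: enorm_ge0. Qed.

Lemma dist_compl_lip y0 x x' : ~ Omega y0 -> d x <= d x' + enorm (x - x').
Proof.
move=> y0O; rewrite -lerBlDr; apply: (dist_compl_ge y0O) => y Oy; rewrite lerBlDr.
apply: (le_trans (dist_compl_le x Oy)); rewrite [leRHS]addrC.
by have := ler_enormD (x - x') (x' - y); rewrite addrA subrK.
Qed.

Lemma continuous_dist_compl y0 : ~ Omega y0 -> continuous d.
Proof.
move=> y0O; apply: (@holder_continuous _ _ 1 _ n%:R ltr01) => x x'; rewrite powRr1//.
apply: le_trans (enorm_le_norm _); have := dist_compl_lip x x' y0O; have := dist_compl_lip x' x y0O.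
by rewrite -enormN opprB ler_norml => h1 h2; apply/andP; split; lra.
Qed.

(** Only points of norm at most |x| + |x - y0| can compete with y0, and those in the complement form
    a compact set. *)
Lemma dist_compl_nearest y0 x : open Omega -> ~ Omega y0 -> exists2 y, ~ Omega y & enorm (x - y) = d x.
Proof.
move=> oO y0O; pose A := ~` Omega `&` [set z : Rn | `|z| <= `|x| + enorm (x - y0)].
have cA : compact A.
  apply: (@subclosed_compact _ _ [set z : Rn | `|z| <= `|x| + enorm (x - y0)]).
  - by apply: closedI; [exact: open_closedC|exact: closed_norm_le].
  - exact: compact_norm_le.
  - by move=> z [].
have A0 : A y0.
  split => //=; have := ler_normB x (x - y0); rewrite subKr => /le_trans; apply.
  by rewrite lerD2l norm_le_enorm.
have cf : continuous (fun z : Rn => enorm (x - z)).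
  move=> z; apply: (@continuous_comp _ _ _ (fun z : Rn => x - z) (@enorm R n)); last exact: continuous_enorm.
  apply: (@continuousD _ _ _ (cst x) (fun z : Rn => - z)); first exact: cst_continuous.
  exact: opp_continuous.
have [|c] := @EVT_min_rV R n (fun z => enorm (x - z)) A _ cA (continuous_subspaceT cf).
  by exists y0.
rewrite inE => -[Oc cM] cmin; exists c => //; apply/eqP; rewrite eq_le dist_compl_le// andbT.
apply: (dist_compl_ge y0O) => y Oy.
have [yM|My] := leP `|y| (`|x| + enorm (x - y0)); first by apply: cmin; rewrite inE.
apply: (@le_trans _ _ (enorm (x - y0))); first by apply: cmin; rewrite inE.
apply: le_trans (norm_le_enorm _).
have := ler_normB x (x - y); rewrite subKr => h; have := lt_le_trans My h.
by rewrite ltrD2l => /ltW.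
Qed.

Lemma dist_compl_gt0 y0 x : open Omega -> ~ Omega y0 -> Omega x -> 0 < d x.
Proof.
move=> oO y0O Ox; have [y Oy <-] := dist_compl_nearest x oO y0O; rewrite enorm_gt0.
by apply: contra_notN Oy; rewrite subr_eq0 => /eqP <-.
Qed.

Lemma dist_compl_ball x z : enorm (x - z) < d x -> Omega z.
Proof.
move=> xz; apply: contrapT => Oz; move: xz; apply/negP; rewrite -leNgt.
exact: dist_compl_le.
Qed.

End distance.

(** * Positivity of minimizers *)

Section positivity.
Context {R : realType} {n : nat} (p : R).
Hypothesis np : n%:R < p.
Hypothesis p2 : 2 <= p.
Local Notation Rn := 'rV[R]_n.
Local Notation mu := (@lebesgue_rV R n).
Local Notation lp g := (mu.-integrable setT (EFin \o (fun z => enorm (g z) `^ p))).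
Let p1 : 1 < p. Proof. by apply: lt_le_trans p2; rewrite ltr1n. Qed.
Let p0 : 0 < p. Proof. exact: lt_trans p1. Qed.

Lemma is_derive_shift (F : R -> R) (a s l : R) : is_derive (s + a) 1 F l ->
  is_derive s 1 (fun s => F (s + a)) l.
Proof.
move=> h; have := is_derive_comp (is_deriveD (is_derive_id s (1 : R)) (is_derive_cst a s (1 : R))) h.
by rewrite addr0 mulr1.
Qed.

Section competitor.
Variables (Omega : set Rn) (x0 : Rn) (w : Rn -> R) (g : Rn -> Rn).
Hypothesis mw : minimal p Omega x0 w g.
Hypothesis w0 : forall z, 0 <= w z.
Variables (q : Rn -> R) (G : Rn -> Rn).
Hypothesis cq : continuous q.
Hypothesis wq : weak_gradient q G.
Hypothesis q01 : forall x, 0 <= q x <= 1.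
Hypothesis qO : forall x, ~ Omega x -> q x = 0.
Hypothesis iG : lp G.
Variables (eps : R) (m : nat).
Hypothesis eps0 : 0 < eps.
Hypothesis pm : p <= m.+1%:R.

(** The largest factor for which a >= eps and q <= 1 force the weight [th] to be at most 1. *)
Let t := eps `^ p / (p - 1).
Let a z := w z + eps.
Let a0 z : 0 < a z. Proof. by rewrite ltr_wpDl. Qed.
Let pp : 0 < p - 1. Proof. by rewrite subr_gt0. Qed.
Let t0 : 0 < t. Proof. by rewrite divr_gt0 ?powR_gt0. Qed.
Let Ww : W1p p w g. Proof. by case: mw => -[]. Qed.

(* The weight of the convex combination: D(w + t q^m (w + eps)^(1 - p)) is
   (1 - theta) Dw + theta X, where theta |X|^p does not depend on eps up to the
   factor t. *)
Let th z := t * (p - 1) * q z ^+ m.+1 * a z `^ (- p).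

Let th01 z : 0 <= th z <= 1.
Proof.
have /andP[q0 q1] := q01 z.
rewrite /th /t divfK ?(gt_eqF pp)// !mulr_ge0 ?powR_ge0 ?exprn_ge0//=.
rewrite mulrAC powRN -[X in _ <= X]mulr1 -[1 in X in _ <= X]mulr1 ler_pM ?exprn_ge0//.
- by rewrite mulr_ge0 ?invr_ge0 ?powR_ge0.
- by rewrite ler_pdivrMr ?powR_gt0// !mul1r ler_powRl ?(ltW p0) ?(ltW eps0)// lerDr.
- by rewrite mulr1 exprn_ile1.
Qed.

Let v z := w z + t * (q z ^+ m.+1 * a z `^ (1 - p)).
Let Dq z := (m.+1%:R * q z ^+ m) *: G z.
Let gv z := (1 - th z) *: g z + (t * a z `^ (1 - p)) *: Dq z.

Let cw : continuous w. Proof. by case: Ww. Qed.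

Let uc z : (0 <= (w z)%:E)%E. Proof. by rewrite lee_fin. Qed.

Let dF (r s : R) : (0 <= s%:E)%E -> is_derive s 1 (fun s => (s + eps) `^ r) (r * (s + eps) `^ (r - 1)).
Proof.
rewrite lee_fin => s0; apply: (@is_derive_shift (fun s => s `^ r)).
by apply: is_derive1_powR; rewrite ltr_wpDl.
Qed.

Let cF' (r s : R) : (0 <= s%:E)%E -> {for s, continuous (fun s => r * (s + eps) `^ (r - 1))}.
Proof.
move=> s0; apply: continuousM; first exact: cst_continuous.
by apply/differentiable_continuous/derivable1_diffP; case: (@dF (r - 1) s s0).
Qed.

Let wv : continuous v /\ weak_gradient v gv.
Proof.
have [_ wg _] := Ww.
have cp := continuous_chain cw uc (@dF (1 - p)).
have wp := weak_gradient_chain cw wg uc (@dF (1 - p)) (@cF' (1 - p)).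
have dX (s : R) : (-oo <= s%:E)%E -> is_derive s 1 (fun s => s ^+ m.+1) (m.+1%:R * s ^+ m).
  move=> _; have := @is_deriveX _ _ id m.+1 s 1 1 (is_derive_id s (1 : R)).
  rewrite (_ : id ^+ m.+1 = fun s : R => s ^+ m.+1); last by apply/funext => z; rewrite exprfctE.
  move=> h; apply: (is_derive_eq h).
  by rewrite /GRing.scale/= mulr1.
have cX (s : R) : (-oo <= s%:E)%E -> {for s, continuous (fun s : R => m.+1%:R * s ^+ m)}.
  by move=> _; apply: continuousM; [exact: cst_continuous|exact: exprn_continuous].
have qc z : (-oo <= (q z)%:E)%E by exact: leNye.
have cqm := continuous_chain cq qc dX; have wqm := weak_gradient_chain cq wq qc dX cX.
have cqp := continuousMR cqm cp; have wqp := weak_gradientM cqm cp wqm wp.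
split.
  by apply: (continuousDR cw); apply: continuousMR => //; exact: continuous_cstR.
apply/weak_gradientP => i; move/weak_gradientP : wg => /(_ i) wgi.
move/weak_gradientP : wqp => /(_ i) wqpi.
have := wgrad_coordD cw _ wgi (wgrad_coordZ t cqp wqpi).
have h : continuous (fun x => t * (q x ^+ m.+1 * (w x + eps) `^ (1 - p))).
  by apply: continuousMR => //; exact: continuous_cstR.
move=> /(_ h); apply: wgrad_coord_ext => // x.
rewrite /gv /Dq !mxE /th -[w x + eps]/(a x) (_ : 1 - p - 1 = - p); last by rewrite addrAC subrr add0r.
ring.
Qed.

Let K := (p - 1) `^ (1 - p) * m.+1%:R `^ p.

(** Where q = 0 the added terms vanish. Elsewhere, after the powers of a cancel, the factor
    q^(m+1-p) remains, and p <= m + 1 bounds it by 1. *)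
Let gv_le z : enorm (gv z) `^ p <= (1 - th z) * enorm (g z) `^ p + t * K * enorm (G z) `^ p.
Proof.
have /andP[q0 q1] := q01 z; have /andP[th0 th1] := th01 z.
have tK0 : 0 <= t * K by rewrite !mulr_ge0 ?powR_ge0 ?invr_ge0 ?(ltW pp).
have [qz|qz] := eqVneq (q z) 0.
  have m0 : (0 < m)%N by rewrite -ltnS -(ltr_nat R); apply: lt_le_trans pm.
  have thz : th z = 0 by rewrite /th qz expr0n/= mulr0 mul0r.
  rewrite /gv /Dq qz expr0n (gtn_eqF m0)/= mulr0 scale0r scaler0 addr0 thz subr0 scale1r mul1r.
  by rewrite lerDl mulr_ge0 ?powR_ge0.
have qz0 : 0 < q z by rewrite lt_neqAle eq_sym qz.
have thz0 : 0 < th z.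
  by rewrite /th mulr_gt0 ?powR_gt0// mulr_gt0 ?exprn_gt0// mulr_gt0.
pose X := (a z / ((p - 1) * q z ^+ m.+1)) *: Dq z.
have XE : (t * a z `^ (1 - p)) *: Dq z = th z *: X.
  rewrite /X scalerA; congr (_ *: _); rewrite /th.
  rewrite -[1 - p]opprB opprB powRB ?(gt_eqF (a0 z)) ?implybT// powRr1 ?(ltW (a0 z))// powRN.
  by field; rewrite expf_neq0// ?(gt_eqF pp) ?(gt_eqF (powR_gt0 _ _)).
have XpE : th z * enorm X `^ p <= t * K * enorm (G z) `^ p.
  have -> : X = (a z * ((p - 1)^-1 * (m.+1%:R * (q z)^-1))) *: G z.
    rewrite /X /Dq scalerA; congr (_ *: _); rewrite exprS.
    by field; rewrite expf_neq0// qz (gt_eqF pp).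
  rewrite enormpZ ger0_norm; last first.
    by rewrite !mulr_ge0 ?invr_ge0 ?(ltW pp) ?(ltW (a0 z)).
  rewrite mulrA ler_wpM2r ?powR_ge0//.
  rewrite !powRM ?mulr_ge0 ?invr_ge0 ?(ltW pp) ?(ltW (a0 z))//.
  have iE (b : R) : 0 < b -> b^-1 `^ p = (b `^ p)^-1.
    by move=> b0; rewrite -(powR_inv1 (ltW b0)) -powRrM mulN1r powRN.
  rewrite !iE// /K /th powRN powRB ?(gt_eqF pp) ?implybT// powRr1 ?(ltW pp)//.
  have ap0 : a z `^ p != 0 by rewrite gt_eqF ?powR_gt0.
  have pp0 : (p - 1) `^ p != 0 by rewrite gt_eqF ?powR_gt0.
  have qp0 : 0 < q z `^ p by exact: powR_gt0.
  rewrite (_ : _ * _ = t * ((p - 1) / (p - 1) `^ p * m.+1%:R `^ p) * (q z ^+ m.+1 / q z `^ p)); last first.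
    by field; rewrite ap0 pp0 (gt_eqF qp0).
  rewrite ler_piMr// ?mulr_ge0 ?invr_ge0 ?powR_ge0 ?(ltW t0) ?(ltW pp)//.
  rewrite ler_pdivrMr// mul1r -powR_mulrn//.
  by apply: ger_powR => //; rewrite qz0 q1.
rewrite /gv XE; apply: le_trans (_ : (1 - th z) * enorm (g z) `^ p + th z * enorm X `^ p <= _); last first.
  by rewrite lerD2l.
have := @powR_convex R p (th z) (enorm X) (enorm (g z)) (ltW p1) (th01 z) (enorm_ge0 _) (enorm_ge0 _).
rewrite [leRHS]addrC; apply: le_trans.
apply: ler_powRl; rewrite ?(ltW p0) ?enorm_ge0//.
apply: (le_trans (ler_enormD _ _)).
by rewrite !enormZ (ger0_norm th0) (@ger0_norm _ (1 - th z)) ?subr_ge0// [leRHS]addrC.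
Qed.

Let mth : measurable_fun [set: Rn] th.
Proof.
have mq := continuous_measurable_rV cq.
apply: measurable_funM; first apply: measurable_funM => //.
  exact: measurable_funX.
apply: (measurableT_comp (f := fun s : R => s `^ (- p))); first exact: measurable_powR.
by apply: measurable_funD => //; exact: continuous_measurable_rV.
Qed.

(** Minimality gives energy g <= energy gv, while convexity bounds the latter by energy g - int th
    |g|^p + t K energy G. The term energy g cancels, then t, and with t the dependence of the bound
    on eps. *)
Lemma log_energy :
  mu.-integrable setT (EFin \o (fun z => q z ^+ m.+1 * enorm ((a z)^-1 *: g z) `^ p)) /\
  \int[mu]_z (q z ^+ m.+1 * enorm ((a z)^-1 *: g z) `^ p) <= K / (p - 1) * energy p G.
Proof.
have [cv wgv] := wv; have [_ _ ig] := Ww.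
have mg := W1p_measurable Ww; have mgv := weak_gradient_measurable wgv.
have ith : mu.-integrable setT (EFin \o (fun z => th z * enorm (g z) `^ p)).
  apply: (integrable_le _ _ ig); first by apply: measurable_funM => //; exact: measurable_enormp.
  move=> z; have /andP[th0 th1] := th01 z.
  by rewrite (ger0_norm (mulr_ge0 th0 (powR_ge0 _ _))) ler_piMl ?powR_ge0.
have iR := integrableDR (integrableBR ig ith) (integrableZR (t * K) iG).
have gv_le' z : enorm (gv z) `^ p <=
    enorm (g z) `^ p - th z * enorm (g z) `^ p + t * K * enorm (G z) `^ p.
  by apply: (le_trans (gv_le z)); rewrite mulrBl mul1r.
have igv : lp gv.
  apply: (integrable_le (measurable_enormp p mgv) _ iR) => z.
  by rewrite ger0_norm ?powR_ge0.
have e1 : energy p g <= energy p gv.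
  apply: (minimal_above p2 mw (v := v)) => //.
  - move=> z Oz; case: mw => -[_ wO _] _; by rewrite /v wO// qO// expr0n/= mul0r mulr0 addr0.
  - case: mw => -[_ _ wx0] _; rewrite /v wx0 lerDl mulr_ge0 ?(ltW t0)// mulr_ge0 ?powR_ge0// exprn_ge0//.
    by case/andP: (q01 x0).
have e2 := le_Rint igv iR gv_le'.
have e3 : \int[mu]_z (enorm (g z) `^ p - th z * enorm (g z) `^ p + t * K * enorm (G z) `^ p) =
    energy p g - \int[mu]_z (th z * enorm (g z) `^ p) + t * K * energy p G.
  rewrite (RintD (integrableBR ig ith) (integrableZR (t * K) iG)) (RintZ iG).
  by congr (_ + _); exact: (RintegralB measurableT ig ith).
have e4 : \int[mu]_z (th z * enorm (g z) `^ p) <= t * K * energy p G.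
  have := le_trans e1 e2.
  by rewrite e3 -[X in _ <= X]addrA lerDl addrC subr_ge0.
have thE z : th z * enorm (g z) `^ p =
    t * (p - 1) * (q z ^+ m.+1 * enorm ((a z)^-1 *: g z) `^ p).
  rewrite enormpZ ger0_norm ?invr_ge0 ?(ltW (a0 z))// /th -!mulrA.
  by rewrite -(powR_inv1 (ltW (a0 z))) -powRrM mulN1r.
have i5 : mu.-integrable setT (EFin \o (fun z => q z ^+ m.+1 * enorm ((a z)^-1 *: g z) `^ p)).
  have := integrableZR (t * (p - 1))^-1 ith; apply: eq_integrable => // z _ /=.
  by rewrite thE mulKf// mulf_neq0 ?gt_eqF.
have e5 : \int[mu]_z (th z * enorm (g z) `^ p) =
    t * (p - 1) * \int[mu]_z (q z ^+ m.+1 * enorm ((a z)^-1 *: g z) `^ p).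
  by rewrite -(RintZ i5); apply: eq_Rintegral => z _; exact: thE.
split=> //; rewrite e5 in e4; rewrite mulrAC ler_pdivlMr// -(ler_pM2l t0).
by rewrite [X in t * X <= _]mulrC (mulrA t (p - 1)) (mulrA t K).
Qed.

Lemma log_W1p : W1p p (fun z => ln (a z)) (fun z => (a z)^-1 *: g z).
Proof.
have [_ wg ig] := Ww.
have dl (s : R) : (0 <= s%:E)%E -> is_derive s 1 (fun s => ln (s + eps)) (s + eps)^-1.
  by rewrite lee_fin => s0; apply: (@is_derive_shift (@ln R)); apply: is_derive1_ln; rewrite ltr_wpDl.
have cl (s : R) : (0 <= s%:E)%E -> {for s, continuous (fun s => (s + eps)^-1)}.
  rewrite lee_fin => s0; apply: continuousV; first by rewrite gt_eqF// ltr_wpDl.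
  by apply: continuousD; [exact: cvg_id|exact: cst_continuous].
have wl := weak_gradient_chain cw wg uc dl cl.
split => //; first exact: continuous_chain cw uc dl.
apply: (integrable_le _ _ (integrableZR (eps^-1 `^ p) ig)).
  by apply: measurable_enormp; exact: weak_gradient_measurable wl.
move=> z; rewrite ger0_norm ?powR_ge0// enormpZ ger0_norm ?invr_ge0 ?(ltW (a0 z))//.
rewrite ler_wpM2r ?powR_ge0// ler_powRl ?(ltW p0) ?invr_ge0 ?(ltW (a0 z))//.
by rewrite lef_pV2 ?posrE// lerDr.
Qed.

End competitor.

(* If w y = 0, the energy estimate for ln (w + eps) and Morrey's inequality bound
   ln (w c + eps) - ln eps uniformly in eps. *)
Lemma minimal_pos_step (Omega : set Rn) x0 w g c r y : minimal p Omega x0 w g -> (forall z, 0 <= w z) ->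
  0 < r -> (forall z, `|z - c| < 2 * r -> Omega z) -> 3 * `|c - y| <= r ->
  0 < w c -> 0 < w y.
Proof.
move=> mw w0 r0 rO cy wc; rewrite lt_neqAle w0 andbT; apply/eqP => wy.
have [C C0 hC] := @box_cutoff R n; have [q [G [[cq wq] q01 q1 q0 GC]]] := hC c r r0.
have [C' C'0 hC'] := @morrey_local R n p np p1.
have iG : lp G by apply: (lp_bounded p2) GC; exact: weak_gradient_measurable wq.
have qO z : ~ Omega z -> q z = 0.
  by move=> Oz; apply: q0; rewrite leNgt; apply/negP => zc; apply: Oz; exact: rO.
pose m := Num.truncn p.
have pm : p <= m.+1%:R by apply: ltW; exact: truncnS_gt.
pose B := (p - 1) `^ (1 - p) * m.+1%:R `^ p / (p - 1) * energy p G.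
have B0 : 0 <= B by rewrite !mulr_ge0 ?powR_ge0 ?energy_ge0 ?invr_ge0 ?subr_ge0 ?(ltW p1).
pose A := C' * `|c - y| `^ (1 - n%:R / p) * (B + 1) `^ p^-1.
have key eps : 0 < eps -> ln (w c + eps) - ln eps <= A.
  move=> eps0; have lW := log_W1p mw w0 eps0.
  have [i5 le] := log_energy mw w0 cq wq q01 qO iG eps0 pm.
  have := hC' _ _ lW (B + 1) c y; rewrite -wy add0r -/A => h.
  apply: (le_trans (ler_norm _)); apply: h; first by rewrite ltr_wpDl.
  apply: (@le_trans _ _ B); last by rewrite lerDl.
  apply: le_trans le; apply: (le_Rint (energy_integrable lW c _) i5) => z.
  rewrite ler_wpM2r ?powR_ge0//.
  have [zr|rz] := leP `|z - c| r.
    by rewrite q1// expr1n ind_le1.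
  rewrite ind0 ?exprn_ge0//; first by case/andP: (q01 z).
  exact: le_lt_trans cy rz.
(* With eps = w(c) exp(-A - 1) the difference ln(w(c) + eps) - ln eps is at least A + 1, against the
   bound A. *)
have eA : 0 < w c * expR (- (A + 1)) by rewrite mulr_gt0// expR_gt0.
have := key _ eA; rewrite lnM ?posrE ?expR_gt0// expRK.
have : ln (w c) <= ln (w c + w c * expR (- (A + 1))).
  by rewrite ler_ln ?posrE ?lerDl ?(ltW eA)// addr_gt0.
move: (ln (w c)) (ln (_ + _)) => l1 l2; lra.
Qed.

(** Compactness gives the segment a positive distance to the complement, so the local step has a
    uniform length and finitely many steps reach y. *)
Lemma minimal_pos_segment (Omega : set Rn) x0 w g y0 x y : open Omega -> ~ Omega y0 ->
  minimal p Omega x0 w g -> (forall z, 0 <= w z) ->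
  (forall t, 0 <= t <= 1 -> Omega (x + t *: (y - x))) -> 0 < w x -> 0 < w y.
Proof.
move=> oO Oy0 mw w0 seg wx; pose pt (t : R) : Rn := x + t *: (y - x).
have cpt : continuous pt.
  move=> t; apply: (@continuousD _ _ _ (cst x) (fun t : R => t *: (y - x))); first exact: cst_continuous.
  exact: scalel_continuous.
have cd : continuous (fun t => dist_compl Omega (pt t)).
  move=> t; apply: (@continuous_comp _ _ _ pt (dist_compl Omega)); first exact: cpt.
  have cdc := continuous_dist_compl Oy0; exact: cdc.
have [t0 t0I tmin] := @EVT_min R _ 0 1 ler01 (continuous_subspaceT cd).
set dl := dist_compl Omega (pt t0) in tmin.
have dl0 : 0 < dl by apply: (dist_compl_gt0 oO Oy0); apply: seg; move: t0I; rewrite in_itv.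
have n0 : 0 < 2 * n.+1%:R :> R by rewrite mulr_gt0.
(* A sup-norm ball of radius 2r lies in the Euclidean ball of radius 2 n r, and 2 n r < dl. *)
pose r := dl / (2 * n.+1%:R); have r0 : 0 < r by rewrite divr_gt0.
have rO t z : 0 <= t <= 1 -> `|z - pt t| < 2 * r -> Omega z.
  move=> t01 zr; suff h : enorm (pt t - z) < dist_compl Omega (pt t).
    exact: dist_compl_ball h.
  apply: (@lt_le_trans _ _ dl); last by apply: tmin; rewrite in_itv.
  apply: (le_lt_trans (enorm_le_norm _)); rewrite distrC.
  apply: (@le_lt_trans _ _ (n%:R * (2 * r))); first by rewrite ler_wpM2l// ltW.
  have N0 : 0 < n.+1%:R :> R by [].
  have nN : n%:R < n.+1%:R :> R by rewrite ltr_nat.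
  have -> : n%:R * (2 * r) = n%:R / n.+1%:R * dl.
    by rewrite /r; move: (n.+1%:R) N0 => N N0; field; rewrite gt_eqF.
  by rewrite gtr_pMl// ltr_pdivrMr// mul1r.
pose N := Num.truncn (3 * `|y - x| / r).
have hN : 3 * `|y - x| / r < N.+1%:R by exact: truncnS_gt.
have N0 : 0 < N.+1%:R :> R by [].
have step (k : nat) : (k <= N.+1)%N -> 0 < w (pt (k%:R / N.+1%:R)).
  elim: k => [_|k IHk kN]; first by rewrite mul0r /pt scale0r addr0.
  have kI : 0 <= (k%:R / N.+1%:R : R) <= 1.
    by rewrite divr_ge0//= ler_pdivrMr// mul1r ler_nat ltnW.
  apply: (minimal_pos_step mw w0 r0 _ _ (IHk (ltnW kN))); first by move=> z; exact: rO.
  have -> : pt (k%:R / N.+1%:R) - pt (k.+1%:R / N.+1%:R) = - N.+1%:R^-1 *: (y - x).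
    rewrite /pt opprD addrACA subrr add0r -scalerBl; congr (_ *: _).
    by rewrite -mulrBl -[k.+1]addn1 natrD opprD addrA subrr add0r mulN1r.
  rewrite normrZ normrN gtr0_norm ?invr_gt0// mulrCA mulrC ler_pdivrMr// mulrC.
  by rewrite mulrC (mulrC r) -ler_pdivrMr// ltW.
have := step N.+1 (leqnn _); rewrite divff ?gt_eqF// /pt scale1r subrKC.
by [].
Qed.

End positivity.

(** * Rayleigh quotients *)

Section cutoff.
Context {R : realType} {n : nat} (p : R).
Hypothesis n0 : (0 < n)%N.
Hypothesis np : n%:R < p.
Hypothesis p2 : 2 <= p.
Local Notation Rn := 'rV[R]_n.
Local Notation mu := (@lebesgue_rV R n).
Local Notation lp g := (mu.-integrable setT (EFin \o (fun z => enorm (g z) `^ p))).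
Let p1 : 1 < p. Proof. by apply: lt_le_trans p2; rewrite ltr1n. Qed.
Let p0 : 0 < p. Proof. exact: lt_trans p1. Qed.
Let al := 1 - n%:R / p.
Let al0 : 0 < al. Proof. by rewrite subr_gt0 ltr_pdivrMr// mul1r. Qed.
Let alp : al * p = p - n%:R. Proof. by rewrite mulrBl mul1r divfK// gt_eqF. Qed.

Lemma lebesgue_set1 (y : Rn) : mu [set y] = 0%E.
Proof.
rewrite (_ : [set y] = [set v : Rn | forall i, [set y ord0 i] (v ord0 i)]); last first.
  apply/seteqP; split => [v -> //|v vy]; apply/rowP => i; exact: vy.
apply: (etrans (@lebesgue_rV_box R n (fun i => [set y ord0 i]) _)).
  by move=> i; exact: measurable_set1.
by rewrite (bigD1 (Ordinal n0))//= lebesgue_measure_set1 mul0e.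
Qed.

(** The truncated integrands converge to a function supported on the null set {y}; n > 0 makes it
    null. *)
Lemma energy_on_small (u : Rn -> R) g y eta : W1p p u g -> 0 < eta ->
  exists2 r, 0 < r & energy_on p g y r <= eta.
Proof.
move=> Wu eta0; have [_ _ ig] := Wu.
pose f0 (x : Rn) : R := if x == y then enorm (g y) `^ p else 0.
have lim : \int[mu]_x (ind k.+1%:R^-1 (x - y) * enorm (g x) `^ p) @[k --> \oo] --> \int[mu]_x f0 x.
  apply: (Rintegral_cvg _ _ ig) => [k|x|k x].
  - apply: measurable_funM; first exact: measurable_ind_shift.
    by apply/measurable_EFinP; exact: measurable_int ig.
  - rewrite /f0; case: eqP => [->|/eqP xy].
      rewrite (_ : (fun k => _) = fun=> enorm (g y) `^ p); first exact: cvg_cst.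
      by apply/funext => k; rewrite subrr ind1 ?mul1r// normr0.
    apply: cvg_near_cst; near=> k; rewrite ind0 ?mul0r//; near: k.
    apply: near_infty_natSinv_lt (PosNum _); by rewrite normr_gt0 subr_eq0.
  - by rewrite ger0_norm ?mulr_ge0 ?ind_ge0 ?powR_ge0// ler_piMl ?powR_ge0// ind_le1.
have f00 : \int[mu]_x f0 x = 0.
  rewrite (@Rintegral_ae _ _ _ (fun=> 0)).
  - by rewrite /Rintegral integral0_eq.
  - rewrite (_ : f0 = fun x => enorm (g y) `^ p * \1_[set y] x).
      by apply: measurable_funM => //; apply: measurable_indic; exact: compact_measurable (@compact_set1 _ y).
    by apply/funext => x; rewrite /f0 indicE; case: eqP => [->|xy];
      [rewrite mem_set ?mulr1|rewrite memNset ?mulr0].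
  - exact: measurable_cst.
  - exists [set y]; split; [exact: compact_measurable (@compact_set1 _ y)|exact: lebesgue_set1|].
    by move=> x /= h; apply: contrapT => xy; apply: h; rewrite /f0; case: eqP.
rewrite f00 in lim; move/cvgrPdist_le : lim => /(_ _ eta0)[k _ /(_ _ (leqnn k))].
rewrite sub0r normrN => h; exists k.+1%:R^-1; first by rewrite invr_gt0.
by apply: le_trans h; exact: ler_norm.
Unshelve. all: by end_near. Qed.

Lemma energy_on_large (u : Rn -> R) g y eta : W1p p u g -> 0 < eta ->
  exists2 r, 0 < r & forall rho, r <= rho -> energy p g - energy_on p g y rho <= eta.
Proof.
move=> Wu eta0; have [_ _ ig] := Wu.
have lim : energy_on p g y k%:R @[k --> \oo] --> energy p g.
  apply: (Rintegral_cvg _ _ ig) => [k|x|k x].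
  - apply: measurable_funM; first exact: measurable_ind_shift.
    by apply/measurable_EFinP; exact: measurable_int ig.
  - apply: cvg_near_cst; near=> k; rewrite ind1 ?mul1r//; near: k.
    by apply: nbhs_infty_ger.
  - by rewrite ger0_norm ?mulr_ge0 ?ind_ge0 ?powR_ge0// ler_piMl ?powR_ge0// ind_le1.
move/cvgrPdist_le : lim => /(_ _ eta0)[k _ hk].
exists k.+1%:R => // rho krho; have := hk k.+1 (leqnSn k) => h.
apply: (@le_trans _ _ (energy p g - energy_on p g y k.+1%:R)).
  rewrite lerD2l lerN2; apply: (energy_on_sub Wu _ (lexx _)).
  by rewrite subrr normr0 add0r.
by apply: le_trans h; exact: ler_norm.
Unshelve. all: by end_near. Qed.

Lemma ball_mass (y : Rn) r : 0 < r ->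
  \int[mu]_x ind r (x - y) = r ^+ n * \int[mu]_x (ind 1 (x : Rn)).
Proof.
move=> r0; have rV0 : 0 < r^-1 by rewrite invr_gt0.
have := Rintegral_sim (- (r^-1 *: y)) rV0 (@orthogonal1 R n) (@integrable_ind R n 1).
rewrite exprVn invrK => <-; apply: eq_Rintegral => x _.
have -> : sim (- (r^-1 *: y)) r^-1 1%:M x = r^-1 *: (x - y).
  by rewrite /sim mulmx1 addrC scalerBr.
have nE : `|r^-1 *: (x - y)| = `|x - y| / r by rewrite normrZ gtr0_norm// mulrC.
have [xr|rx] := leP `|x - y| r.
  by rewrite !ind1// nE ler_pdivrMr// mul1r.
by rewrite !ind0// nE ltr_pdivlMr// mul1r.
Qed.

(** Scale invariance: (s (2r)^al)^p (C/r)^p times the volume, of order (2r)^n, equals s^p up to a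
    constant, because al p = p - n. The radius drops out. *)
Lemma cutoff_energy : exists2 A : R, 0 < A & forall (u : Rn -> R) y r, continuous u -> 0 < r ->
  exists q G, [/\ continuous q /\ weak_gradient q G, forall x, 0 <= q x <= 1,
      forall x, `|x - y| <= r -> q x = 1, forall x, 2 * r <= `|x - y| -> q x = 0 &
      lp (fun x => u x *: G x) /\ forall s, 0 <= s ->
      (forall x, `|x - y| <= 2 * r -> `|u x| <= s * (2 * r) `^ al) ->
      energy p (fun x => u x *: G x) <= A * s `^ p].
Proof.
have [C C0 hC] := @box_cutoff R n; pose c0 : R := \int[mu]_x (ind 1 (x : Rn)).
have c0_ge0 : 0 <= c0 by apply: Rintegral_ge0 => x _; exact: ind_ge0.
exists ((2 * C) `^ p * (c0 + 1)) => [|u y r cu r0].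
  by rewrite mulr_gt0 ?powR_gt0 ?mulr_gt0// ltr_wpDl.
have [q [G [[cq wq] q01 q1 q0 GC]]] := hC y r r0.
exists q, G; have r20 : 0 < 2 * r by rewrite mulr_gt0.
have mG := weak_gradient_measurable wq.
have muG : measurable_fun [set: Rn] (fun x => u x *: G x).
  apply: measurable_fun_rV => i; apply: (eq_measurable_fun (fun x => u x * G x ord0 i)).
    by move=> x _; rewrite mxE.
  apply: measurable_funM; first exact: continuous_measurable_rV.
  exact: measurableT_comp (measurable_coord i) mG.
have bnd M : 0 <= M -> (forall x, `|x - y| <= 2 * r -> `|u x| <= M) ->
    forall x, enorm (u x *: G x) <= M * (C / r) * ind (2 * r) (x - y).
  move=> M0 uM x; rewrite enormZ -mulrA; have [xr|rx] := leP `|x - y| (2 * r).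
    by apply: ler_pM => //; [exact: enorm_ge0|exact: uM].
  have := GC x; rewrite !ind0// !mulr0 => h.
  have /eqP -> : enorm (G x) == 0 by rewrite eq_le h enorm_ge0.
  by rewrite mulr0.
have iuG : lp (fun x => u x *: G x).
  have [M [_ hM]] : bounded_set (u @` [set x : Rn | `|x| <= 2 * r + `|y|]).
    apply: compact_bounded; apply: continuous_compact; last exact: compact_norm_le.
    exact: continuous_subspaceT.
  apply: (lp_bounded p2 muG (bnd (`|M| + 1) _ _)); first by rewrite addr_ge0.
  move=> x xr; apply: hM; first by rewrite (le_lt_trans (ler_norm M))// ltrDl.
  by exists x => //=; have := ler_normD (x - y) y; rewrite subrK => /le_trans; apply; rewrite lerD2r.
split => //; split => // s s0 us.
have M0 : 0 <= s * (2 * r) `^ al by rewrite mulr_ge0 ?powR_ge0.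
have h := bnd _ M0 us.
have i1 : mu.-integrable setT (EFin \o (fun x => ind (2 * r) (x - y))).
  exact: (integrable_shift (- y) (@integrable_ind R n (2 * r))).
have K0 : 0 <= s * (2 * r) `^ al * (C / r) by rewrite mulr_ge0// divr_ge0 ?(ltW C0) ?(ltW r0).
apply: (@le_trans _ _ (\int[mu]_x ((s * (2 * r) `^ al * (C / r)) `^ p * ind (2 * r) (x - y)))).
  apply: (le_Rint iuG (integrableZR _ i1)) => x.
  apply: (@le_trans _ _ ((s * (2 * r) `^ al * (C / r) * ind (2 * r) (x - y)) `^ p)).
    by rewrite ler_powRl ?(ltW p0) ?enorm_ge0.
  have [xr|rx] := leP `|x - y| (2 * r); first by rewrite ind1// !mulr1.
  by rewrite ind0// !mulr0 powR0 ?gt_eqF.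
rewrite (RintZ i1) (ball_mass y r20) -/c0.
have -> : (s * (2 * r) `^ al * (C / r)) `^ p * ((2 * r) ^+ n * c0) = (2 * C) `^ p * c0 * s `^ p.
  have Cr0 : 0 <= C / r by rewrite divr_ge0 ?(ltW C0) ?(ltW r0).
  rewrite (powRM _ M0 Cr0) (powRM _ s0 (powR_ge0 _ _)) -powRrM alp.
  have -> : (2 * r) `^ (p - n%:R) = (2 * r) `^ p / (2 * r) ^+ n.
    by rewrite powRB ?(gt_eqF r20) ?implybT// powR_mulrn// ltW.
  have -> : (2 * C) `^ p = (2 * r) `^ p * (C / r) `^ p.
    rewrite -(powRM _ (ltW r20) Cr0); congr powR.
    by field; rewrite gt_eqF.
  by field; rewrite expf_neq0// gt_eqF.
by rewrite ler_wpM2r ?powR_ge0// ler_wpM2l ?powR_ge0// lerDl.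
Qed.

(* Far from y, the values of u at x and at y + (7/8)(x - y) are compared on a ball
   that stays far from y; the errors of the successive steps form a geometric series. *)
Lemma sublinear_growth (u : Rn -> R) g y dl : W1p p u g -> u y = 0 -> 0 < dl ->
  exists2 B, 0 <= B & forall x, `|u x| <= B + dl * `|x - y| `^ al.
Proof.
move=> Wu uy dl0; have [C C0 hC] := @morrey_local R n p np p1.
have [C' C'0 hC'] := @morrey R n p np p1.
pose th := (7 / 8 : R) `^ al.
have th1 : 0 < 1 - th by rewrite subr_gt0 powR_lt1//; lra.
(* Chosen so that C e^(1/p) = dl (1 - th): one step costs exactly what is lost in replacing dl |x -
   y|^al by th dl |x - y|^al. *)
pose e := (dl * (1 - th) / C) `^ p.
have e0 : 0 < e by rewrite powR_gt0 ?divr_gt0 ?mulr_gt0.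
have [rho rho0 hrho] := energy_on_large y Wu e0.
pose B := C' * (2 * rho) `^ al * energy p g `^ p^-1.
have B0 : 0 <= B by rewrite !mulr_ge0 ?powR_ge0 ?(ltW C'0).
exists B => // x.
have small x' : `|x' - y| <= 2 * rho -> `|u x'| <= B.
  move=> x'r; have := hC' _ _ Wu x' y; rewrite uy subr0 => /le_trans; apply.
  rewrite /B ler_wpM2r ?powR_ge0// ler_wpM2l ?(ltW C'0)//.
  by rewrite ler_powRl ?(ltW al0).
have step x' : 2 * rho < `|x' - y| ->
    `|u x'| <= `|u (y + (7 / 8) *: (x' - y))| + dl * (1 - th) * `|x' - y| `^ al.
  move=> x'r; set t := `|x' - y| in x'r *; set x'' := y + _.
  have xx : x' - x'' = 8^-1 *: (x' - y).
    by apply/rowP => i; rewrite /x'' !mxE; field.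
  have nxx : `|x' - x''| = t / 8 by rewrite xx normrZ gtr0_norm ?invr_gt0// mulrC.
  (* The ball of radius 3t/8 about x' stays at distance 5t/8 from y, and rho < t/2, so its energy is
     part of the small energy outside the ball of radius rho. *)
  have : `|u x' - u x''| <= C * `|x' - x''| `^ al * e `^ p^-1.
    apply: (hC _ _ Wu _ _ _ e0); apply: le_trans (hrho rho (lexx _)).
    rewrite lerBrDr; have [_ _ ig] := Wu.
    have i1 := energy_integrable Wu x' (3 * `|x' - x''|).
    have i2 := energy_integrable Wu y rho.
    apply: le_trans (_ : \int[mu]_z (ind (3 * `|x' - x''|) (z - x') * enorm (g z) `^ p +
      ind rho (z - y) * enorm (g z) `^ p) <= _); first by rewrite (RintD i1 i2).
    apply: (le_Rint (integrableDR i1 i2) ig) => z; rewrite -mulrDl ler_piMl ?powR_ge0//.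
    have [zr|rz] := leP `|z - y| rho; last by rewrite (ind0 rz) addr0 ind_le1.
    rewrite (ind1 zr) ind0 ?add0r// nxx.
    have := ler_distD z x' y; rewrite -/t (distrC x' z); move: x'r zr rho0.
    move: (`|z - y|) (`|z - x'|) => b c; lra.
  rewrite powRK ?(gt_eqF p0) ?divr_ge0 ?mulr_ge0 ?(ltW dl0) ?(ltW th1) ?(ltW C0)//.
  rewrite nxx => h; have := ler_normD (u x' - u x'') (u x''); rewrite subrK => /le_trans; apply.
  rewrite addrC lerD2l; apply: (le_trans h).
  rewrite mulrAC [C * _]mulrC divfK ?gt_eqF// ler_wpM2l ?mulr_ge0 ?(ltW dl0) ?(ltW th1)//.
  apply: ler_powRl; [exact: ltW|by rewrite divr_ge0// normr_ge0|].
  by rewrite ler_pdivrMr// ler_peMr ?normr_ge0// ler1n.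
have key N x' : `|x' - y| * (7 / 8) ^+ N <= 2 * rho -> `|u x'| <= B + dl * `|x' - y| `^ al.
  elim: N x' => [|N IHN] x'.
    rewrite expr0 mulr1 => /small h; apply: (le_trans h).
    by rewrite lerDl mulr_ge0 ?powR_ge0 ?(ltW dl0).
  move=> x'N; have [x'r|x'r] := leP `|x' - y| (2 * rho).
    by apply: (le_trans (small _ x'r)); rewrite lerDl mulr_ge0 ?powR_ge0 ?(ltW dl0).
  apply: (le_trans (step _ x'r)).
  have nE : `|y + (7 / 8) *: (x' - y) - y| = 7 / 8 * `|x' - y|.
    by rewrite addrC addKr normrZ ger0_norm// divr_ge0.
  have := IHN (y + (7 / 8) *: (x' - y)); rewrite nE => /(_ _) h.
  have {}h : `|u (y + (7 / 8) *: (x' - y))| <= B + dl * (7 / 8 * `|x' - y|) `^ al.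
    by apply: h; rewrite mulrAC -exprS mulrC.
  rewrite powRM ?divr_ge0// -/th in h.
  apply: (le_trans (lerD h (lexx _))); rewrite -addrA lerD2l.
  by rewrite le_eqVlt; apply/orP; left; apply/eqP; ring.
have [N hN] : exists N, `|x - y| * (7 / 8) ^+ N <= 2 * rho.
  have : `|x - y| * (7 / 8) ^+ N @[N --> \oo] --> `|x - y| * 0.
    apply: cvgM; first exact: cvg_cst.
    by apply: cvg_expr; rewrite ger0_norm; lra.
  have r20 : 0 < 2 * rho by rewrite mulr_gt0.
  rewrite mulr0 => /cvgrPdist_le/(_ _ r20)[N _ /(_ _ (leqnn N))].
  rewrite sub0r normrN => h; exists N; apply: le_trans h; exact: ler_norm.
exact: key hN.
Qed.

(** v = (Q - q) u, with q equal to 1 near y and Q equal to 1 on a large ball. Four errors arise: the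
    energy of u near y and far away, and u times the gradients of q and Q. The latter two fall under
    [cutoff_energy], by the local Morrey inequality near y and by sublinear growth at infinity. *)
Lemma cutoff (u : Rn -> R) g y eps : W1p p u g -> u y = 0 -> 0 < eps ->
  exists r s v h, [/\ 0 < r /\ 0 < s, W1p p v h,
    forall x, `|x - y| <= r \/ s <= `|x - y| -> v x = 0,
    forall x, u x = 0 -> v x = 0 & energy p (fun x => g x - h x) <= eps].
Proof.
move=> Wu uy eps0; have [cu wg ig] := Wu; have mg := W1p_measurable Wu.
have [A A0 hA] := cutoff_energy; have [C C0 hC] := @morrey_local R n p np p1.
(* Four errors of size eta, combined by splitting a sum of two twice; each splitting costs a factor
   2^p. *)
pose k := 2 `^ p * (2 `^ p * 2 + 2 `^ p * 2).
have P2 : 0 < 2 `^ p :> R by exact: powR_gt0.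
have k0 : 0 < k by rewrite !mulr_gt0// addr_gt0 ?mulr_gt0.
pose eta := eps / k; have eta0 : 0 < eta by rewrite divr_gt0.
pose s0 := (eta / A) `^ p^-1; have s00 : 0 < s0 by rewrite powR_gt0// divr_gt0.
have As0 : A * s0 `^ p = eta.
  by rewrite /s0 (powRVK (divr_ge0 (ltW eta0) (ltW A0)) (lt0r_neq0 p0)) mulrC divfK// gt_eqF.
pose e1 := Num.min eta ((s0 / C) `^ p).
have e10 : 0 < e1 by rewrite lt_min eta0 powR_gt0// divr_gt0.
have [r1 r10 hr1] := energy_on_small y Wu e10.
(* The cutoff reaches distance 2r, and the local Morrey inequality asks for the energy on a ball
   three times as large. *)
pose r := r1 / 6; have r0 : 0 < r by rewrite divr_gt0.
have r6 : 3 * (2 * r) = r1 by rewrite /r; field.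
have Ce1 : e1 `^ p^-1 <= s0 / C.
  rewrite -[leRHS](powRK (divr_ge0 (ltW s00) (ltW C0)) (lt0r_neq0 p0)).
  by rewrite ler_powRl ?invr_ge0 ?(ltW p0) ?(ltW e10)// ge_min lexx orbT.
have [q [G [[cq wq] q01 q1 q0 [iuG uGs]]]] := hA u y r cu r0.
have E1 : energy p (fun x => u x *: G x) <= eta.
  rewrite -As0; apply: uGs; first exact: ltW.
  move=> x xr; have := hC _ _ Wu e1 y x e10; rewrite uy sub0r normrN => h.
  have {}h : `|u x| <= C * `|y - x| `^ al * e1 `^ p^-1.
    apply: h; apply: (energy_on_sub Wu _ hr1); rewrite subrr normr0 add0r distrC.
    by rewrite -r6 ler_wpM2l.
  apply: (le_trans h); rewrite mulrAC; apply: ler_pM; rewrite ?mulr_ge0 ?powR_ge0 ?(ltW C0)//.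
    by rewrite mulrC -ler_pdivlMr.
  by rewrite ler_powRl ?(ltW al0) ?normr_ge0// distrC.
have [B B0 hB] := sublinear_growth Wu uy (divr_gt0 s00 (ltr0n _ 2)).
have [R0 R00 hR0] := energy_on_large y Wu eta0.
(* The first summand absorbs the constant of the sublinear growth, R0 makes the tail of the energy
   small, and r ensures Q = 1 where q = 1. *)
pose S := (2 * B / s0) `^ al^-1 + R0 + r.
have S0 : 0 < S by rewrite ltr_wpDl// addr_ge0 ?powR_ge0 ?ltW.
have [Q [GQ [[cQ wQ] Q01 Q1 Q0 [iuQ uQs]]]] := hA u y S cu S0.
have BS : B <= s0 / 2 * (2 * S) `^ al.
  rewrite mulrC -ler_pdivrMr ?divr_gt0//.
  have -> : B / (s0 / 2) = (2 * B / s0) `^ al^-1 `^ al.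
    rewrite powRVK ?(gt_eqF al0) ?divr_ge0 ?mulr_ge0 ?(ltW s00)//; field; exact: lt0r_neq0.
  apply: ler_powRl; rewrite ?(ltW al0) ?powR_ge0//.
  apply: (@le_trans _ _ S); last by rewrite ler_peMl ?(ltW S0)// ler1n.
  by rewrite /S -addrA lerDl addr_ge0 ?ltW.
have E2 : energy p (fun x => u x *: GQ x) <= eta.
  rewrite -As0; apply: uQs; first exact: ltW.
  move=> x xS; apply: (le_trans (hB x)).
  have -> : s0 * (2 * S) `^ al = s0 / 2 * (2 * S) `^ al + s0 / 2 * (2 * S) `^ al by field.
  apply: lerD => //; rewrite ler_wpM2l ?divr_ge0 ?(ltW s00)//.
  by rewrite ler_powRl ?(ltW al0) ?normr_ge0.
(* The part removed: v = u - q' u, so that the gradient [d] of q' u is the error to be estimated. *)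
pose q' x := 1 + (-1 * Q x + q x); pose gq' x := -1 *: GQ x + G x.
have cQ' : continuous (fun x => -1 * Q x).
  by apply: continuousMR => //; exact: continuous_cstR.
have cq' : continuous q'.
  apply: continuousDR; first exact: continuous_cstR.
  exact: continuousDR.
have wq' : weak_gradient q' gq'.
  apply/weak_gradientP => i; move/weak_gradientP : wq => /(_ i) wqi.
  move/weak_gradientP : wQ => /(_ i) wQi.
  have := wgrad_coordD (@continuous_cstR R n 1) (continuousDR cQ' cq) (wgrad_coord_cst i 1)
    (wgrad_coordD cQ' cq (wgrad_coordZ (-1) cQ wQi) wqi).
  by apply: wgrad_coord_ext => // x; rewrite !mxE add0r.
pose d x := q' x *: g x + u x *: gq' x.
have wd : weak_gradient (fun x => q' x * u x) d by exact: weak_gradientM.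
have md := weak_gradient_measurable wd.
have dE x : d x = ((1 - Q x) *: g x - u x *: GQ x) + (q x *: g x + u x *: G x).
  by apply/rowP => i; rewrite /d /q' /gq' !mxE; ring.
pose bQ x := (enorm (g x) `^ p - ind S (x - y) * enorm (g x) `^ p) + enorm (u x *: GQ x) `^ p.
pose bq x := ind (2 * r) (x - y) * enorm (g x) `^ p + enorm (u x *: G x) `^ p.
have iS := energy_integrable Wu y S; have ir := energy_integrable Wu y (2 * r).
have ibQ : mu.-integrable setT (EFin \o bQ) by exact: integrableDR (integrableBR ig iS) iuQ.
have ibq : mu.-integrable setT (EFin \o bq) by exact: integrableDR ir iuG.
pose b x := 2 `^ p * (2 `^ p * bQ x + 2 `^ p * bq x).
have ib : mu.-integrable setT (EFin \o b).
  exact: integrableZR (integrableDR (integrableZR _ ibQ) (integrableZR _ ibq)).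
have db x : enorm (d x) `^ p <= b x.
  rewrite dE; apply: (@le_trans _ _ ((enorm ((1 - Q x) *: g x - u x *: GQ x) +
      enorm (q x *: g x + u x *: G x)) `^ p)).
    by rewrite ler_powRl ?(ltW p0) ?enorm_ge0// ler_enormD.
  apply: (le_trans (powR_scaleD2 p1 (enorm_ge0 _) (enorm_ge0 _))).
  rewrite ler_wpM2l ?(ltW P2)//; apply: lerD.
    apply: (@le_trans _ _ ((enorm ((1 - Q x) *: g x) + enorm (u x *: GQ x)) `^ p)).
      by rewrite ler_powRl ?(ltW p0) ?enorm_ge0// (le_trans (ler_enormD _ _))// enormN.
    apply: (le_trans (powR_scaleD2 p1 (enorm_ge0 _) (enorm_ge0 _))).
    rewrite ler_wpM2l ?(ltW P2)// lerD2r.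
    have [xS|Sx] := leP `|x - y| S.
      by rewrite Q1// subrr scale0r enorm0 powR0 ?(gt_eqF p0)// ind1// mul1r subrr.
    rewrite ind0// mul0r subr0 ler_powRl ?(ltW p0) ?enorm_ge0// enormZ ler_piMl ?enorm_ge0//.
    by have /andP[h1 h2] := Q01 x; rewrite ger0_norm ?subr_ge0// gerBl.
  apply: (@le_trans _ _ ((enorm (q x *: g x) + enorm (u x *: G x)) `^ p)).
    by rewrite ler_powRl ?(ltW p0) ?enorm_ge0// ler_enormD.
  apply: (le_trans (powR_scaleD2 p1 (enorm_ge0 _) (enorm_ge0 _))).
  rewrite ler_wpM2l ?(ltW P2)// lerD2r.
  have [xr|rx] := leP `|x - y| (2 * r); last first.
    by rewrite (q0 _ (ltW rx)) scale0r enorm0 (powR0 (lt0r_neq0 p0)) (mulr_ge0 (ind_ge0 _ _) (powR_ge0 _ _)).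
  rewrite ind1// mul1r ler_powRl ?(ltW p0) ?enorm_ge0// enormZ ler_piMl ?enorm_ge0//.
  by have /andP[h1 h2] := q01 x; rewrite ger0_norm.
have id : lp d.
  by apply: (integrable_le (measurable_enormp p md) _ ib) => x; rewrite ger0_norm ?powR_ge0.
have Wd : W1p p (fun x => q' x * u x) d by split => //; exact: continuousMR.
have Ed : energy p d <= eps.
  apply: (le_trans (le_Rint id ib db)).
  rewrite (RintZ (integrableDR (integrableZR _ ibQ) (integrableZR _ ibq))).
  rewrite (RintD (integrableZR _ ibQ) (integrableZR _ ibq)) (RintZ ibQ) (RintZ ibq).
  have -> : eps = 2 `^ p * (2 `^ p * (eta + eta) + 2 `^ p * (eta + eta)).
    by rewrite /eta /k; field; rewrite !gt_eqF// addr_gt0 ?mulr_gt0.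
  rewrite ler_wpM2l ?(ltW P2)//; apply: lerD; rewrite ler_wpM2l ?(ltW P2)//.
    rewrite (RintD (integrableBR ig iS) iuQ); apply: lerD; last exact: E2.
    apply: le_trans (hR0 S _); last by rewrite /S addrAC lerDr addr_ge0 ?powR_ge0 ?ltW.
    by rewrite [leLHS](RintegralB measurableT ig iS).
  apply: (@le_trans _ _ (energy_on p g y (2 * r) + energy p (fun x => u x *: G x))).
    by rewrite le_eqVlt; apply/orP; left; apply/eqP; exact (RintD ir iuG).
  apply: lerD; last exact: E1.
  apply: (@le_trans _ _ e1); last by rewrite ge_min lexx.
  apply: (energy_on_sub Wu _ hr1); rewrite subrr normr0 add0r -r6.
  by rewrite ler_peMl ?ler1n// mulr_ge0 ?(ltW r0).
have rS : r <= S by rewrite /S lerDr addr_ge0 ?powR_ge0 ?ltW.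
exists r, (2 * S), (fun x => u x - q' x * u x), (fun x => g x - d x); split.
- by split=> //; rewrite mulr_gt0.
- exact: W1pB.
- move=> x xy; rewrite /q'; case: xy => xy.
    by rewrite Q1 ?q1 ?(le_trans xy)// mulr1 addNr addr0 mul1r subrr.
  rewrite Q0 ?q0 ?mulr0 ?addr0 ?mul1r ?subrr//.
  by apply: le_trans xy; rewrite ler_wpM2l.
- by move=> x ->; rewrite mulr0 subrr.
- rewrite (_ : (fun x => _) = d)//; apply/funext => x; by rewrite subKr.
Qed.

End cutoff.

(** * Attainment of the weighted supremum *)

Section rayleigh_quotient.
Context {R : realType} {n : nat} (p : R).
Hypothesis n0 : (0 < n)%N.
Hypothesis np : n%:R < p.
Hypothesis p2 : 2 <= p.
Local Notation Rn := 'rV[R]_n.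
Local Notation mu := (@lebesgue_rV R n).
Local Notation lp g := (mu.-integrable setT (EFin \o (fun z => enorm (g z) `^ p))).
Let p1 : 1 < p. Proof. by apply: lt_le_trans p2; rewrite ltr1n. Qed.
Let p0 : 0 < p. Proof. exact: lt_trans p1. Qed.
Let al := 1 - n%:R / p.
Let al0 : 0 < al. Proof. by rewrite subr_gt0 ltr_pdivrMr// mul1r. Qed.
Let alp : al * p = p - n%:R. Proof. by rewrite mulrBl mul1r divfK// gt_eqF. Qed.

(** |g| <= n max_i |g_i|, and the p-th power of the maximum is at most the sum of the p-th
    powers. *)
Lemma Lfun_lp (g : Rn -> Rn) : (forall i : 'I_n, (fun x => g x ord0 i) \in Lfun mu p%:E) -> lp g.
Proof.
move=> gL; have mg : measurable_fun [set: Rn] g.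
  apply: measurable_fun_rV => i; have := gL i.
  by rewrite inE => /andP[/[!inE]/= mf _].
have gi i : mu.-integrable setT (EFin \o (fun x => `|g x ord0 i| `^ p)).
  exact: Lfun_integrable (ltW p1) (gL i).
have isum (r : seq 'I_n) : mu.-integrable setT (EFin \o (fun x => \sum_(i <- r) `|g x ord0 i| `^ p)).
  elim: r => [|i r IHr].
    have := integrableZR 0 (@integrable_ind R n 0); apply: eq_integrable => // x _ /=.
    by rewrite big_nil mul0r.
  have := integrableDR (gi i) IHr; apply: eq_integrable => // x _ /=.
  by rewrite big_cons.
apply: (integrable_le (measurable_enormp p mg) _ (integrableZR (n%:R `^ p) (isum (index_enum _)))) => x.
rewrite ger0_norm ?powR_ge0//.
have s0 : 0 <= \sum_i `|g x ord0 i| `^ p by apply: sumr_ge0 => i _; exact: powR_ge0.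
apply: (@le_trans _ _ ((n%:R * `|g x|) `^ p)).
  by rewrite ler_powRl ?(ltW p0) ?enorm_ge0// enorm_le_norm.
rewrite powRM// ler_wpM2l ?powR_ge0// -[leRHS](powRVK s0 (lt0r_neq0 p0)).
rewrite ler_powRl ?(ltW p0)//; apply: norm_le_coord => [|i]; first exact: powR_ge0.
rewrite -[leLHS](powRK (normr_ge0 _) (lt0r_neq0 p0)) ler_powRl ?invr_ge0 ?(ltW p0) ?powR_ge0//.
by rewrite (bigD1 i)//= lerDl sumr_ge0// => j _; exact: powR_ge0.
Qed.

Lemma D1p_W1p (u : Rn -> R) : continuous u -> D1p p u -> exists g, W1p p u g.
Proof. by move=> cu [_ [g wg gL]]; exists g; split => //; exact: Lfun_lp. Qed.

Lemma lp_Lfun (g : Rn -> Rn) i : measurable_fun [set: Rn] g -> lp g ->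
  (fun x => g x ord0 i) \in Lfun mu p%:E.
Proof.
move=> mg ig; have mgi : measurable_fun [set: Rn] (fun x => g x ord0 i).
  exact: measurableT_comp (measurable_coord i) mg.
have igi : mu.-integrable setT (EFin \o (fun x => `|g x ord0 i| `^ p)).
  apply: (integrable_le _ _ ig).
    apply: (measurableT_comp (f := fun s : R => s `^ p)); first exact: measurable_powR.
    exact: measurableT_comp.
  move=> x; rewrite ger0_norm ?powR_ge0// ler_powRl ?(ltW p0)//; exact: coord_le_enorm.
rewrite inE/=; apply/andP; split; rewrite inE//=.
rewrite /finite_norm unlock; apply: poweR_lty.
by have := integrable_lty measurableT igi.
Qed.

Lemma W1p_D1p0 (Omega : set Rn) u g : W1p p u g -> (forall x, ~ Omega x -> u x = 0) ->
  D1p0 p Omega u.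
Proof.
move=> Wu uO; have [cu wg ig] := Wu; split => //; split; first exact: L1loc_continuous.
by exists g => // i; exact: lp_Lfun (W1p_measurable Wu) ig.
Qed.

(** By uniqueness the gradient chosen in [wgrad] agrees with g almost everywhere. *)
Lemma grad_normE (u : Rn -> R) g : W1p p u g -> (grad_norm p u `^ p)%E = (energy p g)%:E.
Proof.
move=> Wu; have [cu wg ig] := Wu.
have wwg : weak_gradient u (wgrad u) by rewrite /wgrad; case: xgetP => [h _ //|/(_ g)].
have e : {ae mu, forall x, wgrad u x = g x} by exact: weak_gradient_unique cu wwg wg.
have mw := weak_gradient_measurable wwg; have mg := W1p_measurable Wu.
rewrite /grad_norm unlock -poweRrM mulVf ?gt_eqF// poweRe1; last first.
  by apply: integral_ge0 => x _; exact: poweR_ge0.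
transitivity (\int[mu]_x (enorm (g x) `^ p)%:E)%E; last first.
  by rewrite /energy /Rintegral fineK//; exact: (integrable_fin_num measurableT ig).
apply: ae_eq_integral => //.
- apply: (eq_measurable_fun (fun x => (enorm (wgrad u x) `^ p)%:E)).
    by move=> x _ /=; rewrite ger0_norm ?enorm_ge0// poweR_EFin.
  by apply/measurable_EFinP; exact: measurable_enormp.
- by apply/measurable_EFinP; exact: measurable_enormp.
- by apply: filterS e => x /= -> _; rewrite ger0_norm ?enorm_ge0// poweR_EFin.
Qed.

Variables (Omega : set Rn) (y0 : Rn).
Hypothesis oO : open Omega.
Hypothesis y0O : ~ Omega y0.

Let d := dist_compl Omega.
(* Outside Omega the distance d is 0, and the quotient is 0 by x / 0 = 0. *)
Let quo u x : R := `|u x / d x `^ al|.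

(** Where the truncation v vanishes, u equals u - v, a function of small energy that also vanishes
    at the boundary point nearest to x; Morrey's inequality between the two points bounds the
    quotient. One cutoff thus serves y and infinity together. *)
Lemma quo_small u g y eps : W1p p u g -> (forall x, ~ Omega x -> u x = 0) -> ~ Omega y ->
  0 < eps -> exists r s, [/\ 0 < r, 0 < s &
    forall x, `|x - y| <= r \/ s <= `|x - y| -> quo u x <= eps].
Proof.
move=> Wu uO yO eps0; have [C C0 hC] := @morrey R n p np p1.
have e0 : 0 < (eps / C) `^ p by rewrite powR_gt0// divr_gt0.
have [r [s [v [h [[r0 s0] Wv v0 vu Eh]]]]] := cutoff n0 np p2 Wu (uO _ yO) e0.
exists r, s; split => // x /v0 vx.
have [Ox|nOx] := pselect (Omega x); last by rewrite /quo uO// mul0r normr0 ltW.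
have [yx Oyx dyx] := dist_compl_nearest x oO y0O.
have dx0 : 0 < d x by exact: (dist_compl_gt0 oO y0O Ox).
rewrite /quo normrM normfV (gtr0_norm (powR_gt0 _ dx0)) ler_pdivrMr ?powR_gt0//.
have := hC _ _ (W1pB p1 Wu Wv) x yx; rewrite vx (uO _ Oyx) (vu _ (uO _ Oyx)) !subr0.
move=> /le_trans; apply; rewrite -/al mulrAC; apply: ler_pM; rewrite ?mulr_ge0 ?powR_ge0 ?(ltW C0)//.
  rewrite mulrC -ler_pdivlMr// -[leRHS](powRK (divr_ge0 (ltW eps0) (ltW C0)) (lt0r_neq0 p0)).
  by rewrite ler_powRl ?invr_ge0 ?(ltW p0) ?energy_ge0.
by rewrite ler_powRl ?(ltW al0)// /d -dyx norm_le_enorm.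
Qed.

(** Off Omega, where numerator and weight both vanish, continuity is the smallness just proved. *)
Lemma quo_continuous u g : W1p p u g -> (forall x, ~ Omega x -> u x = 0) -> continuous (quo u).
Proof.
move=> Wu uO x; have [cu _ _] := Wu.
have [Ox|nOx] := pselect (Omega x).
  have dx0 : 0 < d x by exact: (dist_compl_gt0 oO y0O Ox).
  have cdd := continuous_dist_compl y0O.
  have h : {for x, continuous (fun x => u x / d x `^ al)}.
    apply: (@continuousM _ _ u (fun x => (d x `^ al)^-1)); first exact: cu.
    apply: continuousV; first by rewrite gt_eqF// powR_gt0.
    apply: (@continuous_comp _ _ _ d (fun s => s `^ al)); first exact: cdd.
    apply/differentiable_continuous/derivable1_diffP.
    by case: (is_derive1_powR al dx0).
  exact: (@continuous_comp _ _ _ (fun x => u x / d x `^ al) (@Num.norm R R) x h (@norm_continuous _ _ _)).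
apply/(@cvgrPdist_le R R Rn (nbhs x) (nbhs_filter x)) => eps eps0.
have [r [s [r0 s0 hr]]] := quo_small Wu uO nOx eps0.
apply/nbhs_ballP; exists r => //= z; rewrite -ball_normE/= => xz.
have qx : quo u x = 0 by rewrite /quo uO// mul0r normr0.
have qz : quo u z <= eps by apply: hr; left; rewrite distrC ltW.
by rewrite qx sub0r normrN (ger0_norm (normr_ge0 _)).
Qed.

(** Half of the positive value at x1 is exceeded on a bounded set only, so the maximum over a
    compact ball is global. *)
Lemma quo_attained u g x1 : W1p p u g -> (forall x, ~ Omega x -> u x = 0) -> u x1 != 0 ->
  exists2 c, Omega c & 0 < quo u c /\ forall z, quo u z <= quo u c.
Proof.
move=> Wu uO ux1; have Ox1 : Omega x1 by apply: contrapT => /uO /eqP; exact/negP.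
have q1 : 0 < quo u x1.
  rewrite normr_gt0 mulf_neq0// invr_eq0 gt_eqF// powR_gt0//.
  exact: (dist_compl_gt0 oO y0O Ox1).
have [r [s [r0 s0 hs]]] := quo_small Wu uO y0O (divr_gt0 q1 (ltr0n _ 2)).
have far z : s + `|y0| < `|z| -> quo u z <= quo u x1 / 2.
  move=> zs; apply: hs; right; rewrite -(lerD2r `|y0|); apply: ltW; apply: lt_le_trans zs _.
  by have := ler_normD (z - y0) y0; rewrite subrK.
have x1s : `|x1| <= s + `|y0|.
  rewrite leNgt; apply/negP => /far; rewrite leNgt => /negP; apply.
  by rewrite ltr_pdivrMr// ltr_pMr// ltr1n.
have [|c cK cmax] := @EVT_max_rV R n (quo u) [set z : Rn | `|z| <= s + `|y0|] _ (@compact_norm_le R n _)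
  (continuous_subspaceT (quo_continuous Wu uO)).
  by exists x1.
have c1 : quo u x1 <= quo u c by apply: cmax; rewrite inE.
have qc : 0 < quo u c by exact: lt_le_trans c1.
exists c.
  apply: contrapT => Oc; move: qc; by rewrite /quo uO// mul0r normr0 ltxx.
split; first exact: qc.
move=> z; have [zs|zs] := leP `|z| (s + `|y0|); first by apply: cmax; rewrite inE.
apply: (le_trans (far _ zs)); apply: le_trans c1.
by rewrite ler_pdivrMr// ler_peMr ?(ltW q1)// ler1n.
Qed.

Lemma quo_powE u x : Omega x -> quo u x `^ p = `|u x| `^ p / d x `^ (p - n%:R).
Proof.
move=> Ox; have dx0 : 0 < d x by exact: (dist_compl_gt0 oO y0O Ox).
rewrite /quo normrM normfV (gtr0_norm (powR_gt0 _ dx0)) powRM ?invr_ge0 ?powR_ge0//.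
congr (_ * _); rewrite -[(d x `^ al)^-1]powRN -powRrM mulNr alp.
exact: powRN.
Qed.

Lemma rayleigh_attained u g x1 : W1p p u g -> (forall x, ~ Omega x -> u x = 0) -> u x1 != 0 ->
  exists c, [/\ Omega c, u c != 0,
    rayleigh p Omega u = (energy p g * (d c `^ (p - n%:R) / `|u c| `^ p))%:E &
    forall z, Omega z -> u z != 0 ->
      d c `^ (p - n%:R) / `|u c| `^ p <= d z `^ (p - n%:R) / `|u z| `^ p].
Proof.
move=> Wu uO ux1; have [c Oc [qc cmax]] := quo_attained Wu uO ux1.
have dE z : Omega z -> d z `^ (p - n%:R) / `|u z| `^ p = (quo u z `^ p)^-1.
  by move=> Oz; rewrite (quo_powE u Oz) invf_div.
have uc : u c != 0 by apply: contraTneq qc => uc; rewrite /quo uc mul0r normr0 ltxx.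
exists c; split; [exact: Oc|exact: uc| |]; last first.
  have eqle (s t : R) : s = t -> s <= t by move=> ->.
  move=> z Oz uz; apply: (le_trans (eqle _ _ (dE c Oc))).
  apply: le_trans (eqle _ _ (esym (dE z Oz))).
  have qz : 0 < quo u z.
    rewrite normr_gt0 mulf_neq0// invr_eq0 gt_eqF// powR_gt0//.
    exact: (dist_compl_gt0 oO y0O Oz).
  rewrite lef_pV2; [|by rewrite posrE powR_gt0|by rewrite posrE powR_gt0].
  by apply: ler_powRl; [exact: ltW|exact: ltW|exact: cmax].
have -> : rayleigh p Omega u = (((quo u c)%:E `^ p)^-1 * (energy p g)%:E)%E.
  rewrite /rayleigh (grad_normE Wu); congr (((_ `^ p)^-1) * _)%E.
  apply/eqP; rewrite eq_le; apply/andP; split.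
    by apply: ge_ereal_sup => _ [z Oz <-]; rewrite lee_fin; exact: cmax.
  by apply: ereal_sup_ubound; exists c.
rewrite poweR_EFin inver (gt_eqF (powR_gt0 p qc)) -EFinM (dE _ Oc).
by rewrite mulrC.
Qed.

End rayleigh_quotient.

Section real_bounds.
Context {R : realType}.

Lemma mid1_bounds (a : R) : 1 < a -> 1 < (1 + a) / 2 < a.
Proof. by move=> a1; apply/andP; split; lra. Qed.

Lemma ge_of_dist1 (b v : R) : `|1 - v| <= 1 - b -> b <= `|v|.
Proof. by have := ler_norm (1 - v); have := ler_norm v; lra. Qed.

Lemma ler_pM_of_eq (a b c d : R) : a <= b -> 0 < c -> b * c = d -> a * c <= d.
Proof. by move=> ab c0 <-; rewrite ler_pM2r. Qed.

Lemma eq_of_pM_eq (a b c d : R) : 0 < c -> b * c = d -> a * c = d -> a = b.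
Proof. by move=> c0 <- /mulIf; apply; rewrite gt_eqF. Qed.

Lemma ler_pM3 (a b c t k : R) : 0 <= a -> 0 <= b -> 0 <= c ->
  a <= t * k -> b <= t -> c <= t -> a * (b * c) <= t * (t * t) * k.
Proof.
move=> a0 b0 c0 at_ bt ct; rewrite -mulrA (mulrC (t * t)) (mulrA t).
by apply: ler_pM => //; [exact: mulr_ge0|exact: ler_pM].
Qed.

End real_bounds.

(** * Families of cones *)

Section cones.
Context {R : realType} {n : nat} (p : R).
Hypothesis n0 : (0 < n)%N.
Hypothesis np : n%:R < p.
Hypothesis p2 : 2 <= p.
Local Notation Rn := 'rV[R]_n.
Local Notation mu := (@lebesgue_rV R n).
Local Notation lp g := (mu.-integrable setT (EFin \o (fun z => enorm (g z) `^ p))).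
Let p1 : 1 < p. Proof. by apply: lt_le_trans p2; rewrite ltr1n. Qed.
Let p0 : 0 < p. Proof. exact: lt_trans p1. Qed.
Let pn0 : 0 < p - n%:R. Proof. by rewrite subr_gt0. Qed.

(** The gradient contributes t^p and the change of variables t^(-n); this is the source of the
    exponent p - n in the cone constants. *)
Lemma W1p_sim c t M (u : Rn -> R) g : 0 < t -> orthogonal M -> W1p p u g ->
  W1p p (fun x => u (sim c t M x)) (fun x => t *: (g (sim c t M x) *m M^T)) /\
  energy p (fun x => t *: (g (sim c t M x) *m M^T)) = t `^ (p - n%:R) * energy p g.
Proof.
move=> t0 oM [cu wg ig]; have oMT := orthogonal_tr oM.
have eE x : enorm (t *: (g (sim c t M x) *m M^T)) `^ p = t `^ p * enorm (g (sim c t M x)) `^ p.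
  by rewrite enormpZ gtr0_norm// enorm_orthogonal.
have i1 := integrable_sim c t0 oM ig.
split; first split.
- by move=> x; apply: (@continuous_comp _ _ _ (sim c t M) u); [exact: continuous_sim|exact: cu].
- exact: weak_gradient_sim.
- have := integrableZR (t `^ p) i1; apply: eq_integrable => // x _ /=.
  by rewrite eE.
- transitivity (\int[mu]_x (t `^ p * enorm (g (sim c t M x)) `^ p)).
    by apply: eq_Rintegral => x _; exact: eE.
  rewrite (RintZ i1) (Rintegral_sim c t0 oM ig) mulrA; congr (_ * _).
  by rewrite powRB ?(gt_eqF t0) ?implybT// powR_mulrn ?ltW.
Qed.

(** What follows are the only properties of halfspaces and punctured spaces that the comparison
    needs; [cone a] has its vertex at 0, and a is the point of normalization. *)
Variable cone : Rn -> set Rn.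
Hypothesis cone_equiv : forall a z t M, 0 < t -> orthogonal M ->
  cone (t *: (a *m M)) (t *: (z *m M)) <-> cone a z.
Hypothesis cone_refl : forall a, a != 0 -> cone a a.
Hypothesis cone_open : forall a, open (cone a).
Hypothesis cone0 : forall a, ~ cone a 0.
(** Two segments instead of one, since a single segment may pass through the puncture. *)
Hypothesis cone_chain : forall a x y, cone a x -> cone a y -> exists2 z, cone a z &
  forall t, 0 <= t <= 1 -> cone a (x + t *: (z - x)) /\ cone a (z + t *: (y - z)).

Lemma similar_exists (a b : Rn) : a != 0 -> b != 0 -> exists t M,
  [/\ 0 < t, orthogonal M, b = t *: (a *m M) & t = enorm b / enorm a].
Proof.
move=> a0 b0; have ea : 0 < enorm a by rewrite enorm_gt0.
have eb : 0 < enorm b by rewrite enorm_gt0.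
pose t := enorm b / enorm a; have t0 : 0 < t by rewrite divr_gt0.
have e : enorm (t *: a) = enorm b by rewrite enormZ gtr0_norm// divfK// gt_eqF.
have [M oM bE] := orthogonal_transitive e.
by exists t, M; split => //; rewrite scalemxAl.
Qed.

Lemma minimal_cone_pos a w g z : a != 0 -> minimal p (cone a) a w g -> (forall x, 0 <= w x) ->
  cone a z -> 0 < w z.
Proof.
move=> a0 mw w0 az; have [b ab seg] := cone_chain (cone_refl a0) az.
have wa : w a = 1 by case: mw => -[].
have wb : 0 < w b.
  have := @minimal_pos_segment _ _ _ np p2 _ _ _ _ _ a b (@cone_open a) (@cone0 a) mw w0.
  by apply; [move=> t /seg[]|rewrite wa].
have := @minimal_pos_segment _ _ _ np p2 _ _ _ _ _ b z (@cone_open a) (@cone0 a) mw w0.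
by apply => // t /seg[].
Qed.

(** The similarity taking 0 to y and a to x pulls u back to a competitor for [cone a]. In case of
    equality it is itself minimal, hence equal to w, which is positive on the cone. *)
Lemma cone_lower_bound a w g y x u h : a != 0 -> minimal p (cone a) a w g ->
  (forall z, 0 <= w z) -> W1p p u h -> (forall z, ~ cone (x - y) (z - y) -> u z = 0) ->
  u x != 0 ->
  energy p g * enorm a `^ (p - n%:R) <= energy p h * (enorm (x - y) `^ (p - n%:R) / `|u x| `^ p) /\
  (energy p g * enorm a `^ (p - n%:R) = energy p h * (enorm (x - y) `^ (p - n%:R) / `|u x| `^ p) ->
   forall z, cone (x - y) (z - y) -> u z != 0).
Proof.
move=> a0 mw w0 Wu uO ux.
have xy : x - y != 0.
  apply: contraNneq ux => xy; apply/eqP; apply: uO; rewrite xy; exact: cone0.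
have [t [M [t0 oM xyE tE]]] := similar_exists a0 xy.
have [Ws Es] := W1p_sim y t0 oM Wu.
pose u' z := (u x)^-1 * u (sim y t M z).
pose h' z := (u x)^-1 *: (t *: (h (sim y t M z) *m M^T)).
have simy z : sim y t M z - y = t *: (z *m M) by rewrite /sim addrC addKr.
have coneE z : cone (x - y) (sim y t M z - y) <-> cone a z.
  by rewrite simy xyE; exact: cone_equiv.
have sa : sim y t M a = x by rewrite /sim -xyE subrKC.
have adm : admissible p (cone a) a u' h'.
  split; first exact: W1pZ.
    move=> z az; rewrite /u' (uO (sim y t M z)) ?mulr0// => /coneE; exact: az.
  by rewrite /u' sa mulVf.
have ea : 0 < enorm a by rewrite enorm_gt0.
have ux0 : 0 < `|u x| by rewrite normr_gt0.
have Eh' : energy p h' * enorm a `^ (p - n%:R) = energy p h * (enorm (x - y) `^ (p - n%:R) / `|u x| `^ p).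
  have [_ _ iss] := Ws; rewrite (energyZ _ iss) Es normfV tE.
  rewrite (_ : `|u x|^-1 `^ p = (`|u x| `^ p)^-1); last first.
    by rewrite -(powR_inv1 (normr_ge0 _)) -powRrM mulN1r powRN.
  rewrite powRM ?invr_ge0 ?enorm_ge0//.
  rewrite (_ : (enorm a)^-1 `^ (p - n%:R) = (enorm a `^ (p - n%:R))^-1); last first.
    by rewrite -(powR_inv1 (ltW ea)) -powRrM mulN1r powRN.
  by field; rewrite !gt_eqF ?powR_gt0.
have A0 : 0 < enorm a `^ (p - n%:R) by exact: powR_gt0.
split.
  by apply: (ler_pM_of_eq _ A0 Eh'); case: mw => _ mn; exact: mn adm.
move=> /(eq_of_pM_eq A0 Eh') e z az.
have mu' : minimal p (cone a) a u' h'.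
  by split => [|v k av]; [exact: adm|rewrite -e; case: mw => _ mn; exact: mn av].
have e' := minimal_unique np p2 mw mu'.
have zE : z = sim y t M (simV y t M z) by rewrite simVK.
have : 0 < w (simV y t M z).
  by apply: (minimal_cone_pos a0 mw w0); apply/coneE; rewrite -zE.
by rewrite e' /u' -zE; apply: contraTneq => ->; rewrite mulr0 ltxx.
Qed.

(** The lower bound is applied to the minimizer w with vertex 0. The roles of a and b can be
    exchanged, so the cone constant does not depend on the point. *)
Lemma minimal_cone_constant a w g b v h : a != 0 -> b != 0 ->
  minimal p (cone a) a w g -> (forall z, 0 <= w z) ->
  minimal p (cone b) b v h -> (forall z, 0 <= v z) ->
  energy p h * enorm b `^ (p - n%:R) <= energy p g * enorm a `^ (p - n%:R).
Proof.
move=> a0 b0 mw w0 mv v0; have [[Ww wO wa] _] := mw.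
have wa0 : w a != 0 by rewrite wa oner_neq0.
have := cone_lower_bound (y := 0) (x := a) b0 mv v0 Ww.
rewrite subr0 wa normr1 powR1 divr1 => /(_ _ (oner_neq0 _))[]//.
by move=> z; rewrite subr0; exact: wO.
Qed.

(** * Domains comparable with a cone *)

Section domain.
Variables (a0 : Rn) (w0 : Rn -> R) (g0 : Rn -> Rn).
Hypothesis a00 : a0 != 0.
Hypothesis mw0 : minimal p (cone a0) a0 w0 g0.
Hypothesis w00 : forall z, 0 <= w0 z.
Let K := energy p g0 * enorm a0 `^ (p - n%:R).

(** A minimizer of zero energy would be constant, against the values 0 at the vertex and 1 at a0. *)
Lemma cone_const_gt0 : 0 < K.
Proof.
have ea : 0 < enorm a0 by rewrite enorm_gt0.
rewrite /K mulr_gt0 ?powR_gt0// lt_neqAle energy_ge0 andbT eq_sym; apply/eqP => E0.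
have [[Ww wO wa] _] := mw0; have [C C0 hC] := @morrey R n p np p1.
have := hC _ _ Ww a0 0; rewrite E0 wa (wO 0 (@cone0 a0)) powR0 ?invr_eq0 ?gt_eqF// mulr0.
by rewrite subr0 normr1 ler10.
Qed.

Variables (Omega : set Rn) (y0 : Rn).
Hypothesis oO : open Omega.
Hypothesis y0O : ~ Omega y0.
(** Gives the lower bound: functions vanishing off Omega vanish off the cone with vertex at the
    nearest point y. *)
Hypothesis supp : forall x y, Omega x -> ~ Omega y -> enorm (x - y) = dist_compl Omega x ->
  forall z, Omega z -> cone (x - y) (z - y).
(** Gives the upper bound. The inward shift del a is there because, when the boundary is curved at
    y, no dilate of an annular part of the cone, which reaches up to the boundary of the cone, need
    lie in Omega. *)
Hypothesis blow_up : exists y a, [/\ ~ Omega y, a != 0 &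
  forall r s dl : R, 0 < r -> 0 < s -> 0 < dl -> exists del t, [/\ 0 < del < dl, 0 < t &
    forall z, cone a z -> r <= enorm z <= s -> Omega (y + t *: (z + del *: a))]].

Lemma nonzero_point (u : Rn -> R) : u <> (fun=> 0) -> exists x, u x != 0.
Proof.
move=> u0; apply: contra_notP u0 => /forallNP h; apply/funext => x.
by have /negP := h x; rewrite negbK => /eqP.
Qed.

Lemma rayleigh_cone u : D1p0_nonzero p Omega u -> exists y x,
  [/\ x - y != 0, (K%:E <= rayleigh p Omega u)%E &
   rayleigh p Omega u = K%:E -> Omega = [set z | cone (x - y) (z - y)]].
Proof.
move=> [[Du cu uO] /nonzero_point[x1 ux1]].
have [g Wu] := D1p_W1p p2 cu Du.
have [c [Oc uc rE _]] := rayleigh_attained n0 np p2 oO y0O Wu uO ux1.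
have [y Oy yE] := dist_compl_nearest c oO y0O.
have sub := supp Oc Oy yE.
have uO' z : ~ cone (c - y) (z - y) -> u z = 0.
  by move=> nz; apply: uO => Oz; apply: nz; exact: sub.
have [lb eqc] := cone_lower_bound a00 mw0 w00 Wu uO' uc.
rewrite -yE in rE; exists y, c; split.
- by apply: contra_notN Oy; rewrite subr_eq0 => /eqP <-.
- by rewrite rE lee_fin.
- rewrite rE => -[e]; apply/seteqP; split=> z; first exact: sub.
  move=> cz; apply: contrapT => Oz; have := eqc (esym e) z cz.
  by rewrite uO// eqxx.
Qed.

Lemma lambda_ge : (K%:E <= lambda_p p Omega)%E.
Proof.
by apply: le_ereal_inf_tmp => _ [u Du <-]; have [y [x [_ h _]]] := rayleigh_cone Du.
Qed.

(** Evaluating the quotient at any x with u(x) <> 0, and estimating d(x) by the distance to any y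
    off Omega, bounds it from above; the optimal pair need not be known. *)
Lemma rayleigh_le u g x y : W1p p u g -> (forall z, ~ Omega z -> u z = 0) -> u x != 0 ->
  ~ Omega y -> (lambda_p p Omega <= rayleigh p Omega u)%E /\
  (rayleigh p Omega u <= (energy p g * (enorm (x - y) `^ (p - n%:R) / `|u x| `^ p))%:E)%E.
Proof.
move=> Wu uO ux Oy; have [c [Oc uc rE cmin]] := rayleigh_attained n0 np p2 oO y0O Wu uO ux.
split.
  apply: ereal_inf_lbound; exists u => //; split; first exact: W1p_D1p0 Wu uO.
  by move=> u0; move: ux; rewrite u0 eqxx.
have Ox : Omega x by apply: contrapT => /uO /eqP; exact/negP.
rewrite rE lee_fin ler_wpM2l ?energy_ge0//; apply: (le_trans (cmin x Ox ux)).
rewrite ler_wpM2r ?invr_ge0 ?powR_ge0// ler_powRl ?(ltW pn0)//.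
  exact: (dist_compl_ge0 _ y0O).
exact: dist_compl_le.
Qed.

(* The factor m = th^3 pays for the energy of the cutoff, for its value at a, and for
   the translation of the vertex. *)
Lemma lambda_le : (lambda_p p Omega <= K%:E)%E.
Proof.
have [y [a [Oy aN0 blow]]] := blow_up.
have [w [g [mw w_ge0]]] : exists w g, minimal p (cone a) a w g /\ forall z, 0 <= w z.
  apply: minimal_exists => //; first exact: cone_refl.
  by move=> cT; apply: (@cone0 a); rewrite cT.
have [[Ww wO wa] _] := mw; have [_ _ ig] := Ww; have mg := W1p_measurable Ww.
have KE := minimal_cone_constant a00 aN0 mw0 w00 mw w_ge0.
have ea : 0 < enorm a by rewrite enorm_gt0.
have K0 := cone_const_gt0.
have E0 : 0 < energy p g.
  rewrite lt_neqAle energy_ge0 andbT eq_sym; apply/eqP => e.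
  have := minimal_cone_constant aN0 a00 mw w_ge0 mw0 w00; rewrite e mul0r.
  by rewrite leNgt K0.
have [C C0 hC] := @morrey R n p np p1.
suff key m : 1 < m -> (lambda_p p Omega <= (m * K)%:E)%E.
  apply/lee_addgt0Pr => e e0; have := key (1 + e / K).
  by rewrite mulrDl mul1r divfK ?gt_eqF// -EFinD; apply; rewrite ltrDl divr_gt0.
move=> m1; have m0 : 0 < m by exact: lt_trans m1.
pose th := m `^ 3^-1; have th1 : 1 < th.
  by have := @ltr_powRl R 1 m 3^-1 _ ler01 m1; rewrite powR1; apply; rewrite invr_gt0.
have th3 : th * (th * th) = m.
  have : th ^+ 3 = m by rewrite -powR_mulrn ?powR_ge0// -powRrM mulVf ?pnatr_eq0// powRr1 ?ltW.
  by rewrite !exprS expr0 mulr1.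
have th0 : 0 < th by exact: lt_trans th1.
pose th' := (1 + th) / 2.
have /andP[th'1 th'th] := mid1_bounds th1; rewrite -/th' in th'1 th'th.
(* Solves (1 - sg)^(1-p) = th', the coefficient of energy g in [energyD_le]. *)
pose sg := 1 - th' `^ (- (p - 1)^-1).
have pp : 0 < p - 1 by rewrite subr_gt0.
have sg01 : 0 < sg < 1.
  rewrite subr_gt0 gtrBl powR_gt0 ?(lt_trans _ th'1)// andbT powRN invf_lt1 ?powR_gt0 ?(lt_trans _ th'1)//.
  by have := @ltr_powRl R 1 th' (p - 1)^-1 _ ler01 th'1; rewrite powR1; apply; rewrite invr_gt0.
have sgE : (1 - sg) `^ (1 - p) = th'.
  rewrite /sg subKr -powRrM -[1 - p]opprB mulrNN mulVf ?gt_eqF// powRr1//.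
  exact: ltW (lt_trans ltr01 th'1).
have sg0 : 0 < sg by case/andP: sg01.
have P0 : 0 < sg `^ (1 - p) by exact: powR_gt0.
(* What remains between th' and th is spent on the cutoff error, whose coefficient is sg^(1-p). *)
pose e1 := (th - th') * energy p g / sg `^ (1 - p).
have e10 : 0 < e1 by rewrite divr_gt0// mulr_gt0// subr_gt0.
have q1 : 0 < 1 - th `^ (- p^-1).
  rewrite subr_gt0 powRN invf_lt1 ?powR_gt0//.
  by have := @ltr_powRl R 1 th p^-1 _ ler01 th1; rewrite powR1; apply; rewrite invr_gt0.
pose A := C * `|a| `^ (1 - n%:R / p).
have A0 : 0 <= A by rewrite mulr_ge0 ?powR_ge0 ?ltW.
(* Morrey's inequality for w - v between a and the vertex, where both vanish, gives |1 - v(a)| <= A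
   e2^(1/p), hence |v(a)|^p >= 1/th; A + 1 avoids dividing by zero. *)
pose e2 := ((1 - th `^ (- p^-1)) / (A + 1)) `^ p.
have A1 : 0 < A + 1 by rewrite ltr_wpDl.
have e20 : 0 < e2 by rewrite powR_gt0// divr_gt0.
have eps0 : 0 < Num.min e1 e2 by rewrite lt_min e10 e20.
have [r [s [v [h [[r0 s0] Wv v0 vw Eh]]]]] := cutoff n0 np p2 Ww (wO 0 (@cone0 a)) eps0.
have [_ _ ih] := Wv; have mh := W1p_measurable Wv.
have Wd := W1pB p1 Ww Wv; have [_ _ idd] := Wd; have md := W1p_measurable Wd.
have va : th^-1 <= `|v a| `^ p.
  have h1 := hC _ _ Wd a 0.
  rewrite (wO 0 (@cone0 a)) (vw _ (wO 0 (@cone0 a))) wa !subr0 in h1.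
  have h2 : `|1 - v a| <= 1 - th `^ (- p^-1).
    apply: (le_trans h1); rewrite -/A.
    apply: (@le_trans _ _ (A * ((1 - th `^ (- p^-1)) / (A + 1)))).
      rewrite ler_wpM2l//.
      rewrite -[leRHS](@powRK _ _ p) ?gt_eqF// ?divr_ge0 ?(ltW q1) ?(ltW A1)//.
      rewrite ler_powRl ?invr_ge0 ?(ltW p0) ?energy_ge0//.
      by apply: (le_trans Eh); rewrite ge_min lexx orbT.
    by rewrite mulrC -mulrA ger_pMr// mulrC ler_pdivrMr// mul1r lerDl.
  have h3 : th `^ (- p^-1) <= `|v a| by exact: ge_of_dist1.
  have -> : th^-1 = (th `^ (- p^-1)) `^ p.
    by rewrite -powRrM mulNr mulVf ?gt_eqF// powR_inv1// ltW.
  by rewrite ler_powRl ?(ltW p0) ?powR_ge0.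
have va0 : v a != 0.
  apply: contraTneq va => ->; rewrite normr0 powR0 ?gt_eqF// -ltNge invr_gt0//.
have Ehg : energy p h <= th * energy p g.
  have hE : h = fun z => g z + -1 *: (g z - h z).
    by apply/funext => z; rewrite scaleN1r opprB addrCA subrr addr0.
  have idd' : lp (fun z => -1 *: (g z - h z)) by have [_ _] := W1pZ (-1) Wd.
  have md' : measurable_fun [set: Rn] (fun z => -1 *: (g z - h z)).
    by apply: measurable_fun_scaler.
  rewrite [X in energy p X]hE; apply: (le_trans (energyD_le p1 mg md' ig idd' sg01)).
  rewrite sgE (energyZ _ idd) normrN1 powR1 mul1r -lerBrDl -mulrBl mulrC -ler_pdivlMr//.
  by apply: (le_trans Eh); rewrite ge_min lexx.
(* (1 + dl)^(p-n) = th: the shift of the vertex may lengthen the distance of the test point by this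
   much. *)
pose dl := th `^ (p - n%:R)^-1 - 1.
have dl0 : 0 < dl.
  rewrite subr_gt0.
  by have := @ltr_powRl R 1 th (p - n%:R)^-1 _ ler01 th1; rewrite powR1; apply; rewrite invr_gt0.
have ns0 : 0 < n%:R * s :> R by rewrite mulr_gt0// ltr0n.
(* The cutoff is supported in a sup-norm ball of radius s, which lies in the Euclidean ball of
   radius n s. *)
have [del [t [/andP[del0 deldl] t0 tO]]] := blow r (n%:R * s) dl r0 ns0 dl0.
have tV0 : 0 < t^-1 by rewrite invr_gt0.
pose c := - (t^-1 *: y) - del *: a.
pose U z := v (sim c t^-1 1%:M z).
have simE z : sim c t^-1 1%:M z = t^-1 *: (z - y) - del *: a.
  by rewrite /sim /c mulmx1 addrC addrA -scalerBr.
have [WU EU] := W1p_sim c tV0 (@orthogonal1 R n) Wv.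
have UO z : ~ Omega z -> U z = 0.
  move=> Oz; apply/eqP; apply: contra_notT Oz; rewrite /U; set ze := sim _ _ _ z => vz.
  have wz : w ze != 0 by apply: contraNneq vz => wz; apply/eqP; exact: vw.
  have cz : cone a ze by apply: contrapT => /wO wz'; move: wz; rewrite wz' eqxx.
  have zr : r < `|ze|.
    by rewrite ltNge; apply/negP => h1; move: vz; rewrite v0 ?eqxx// subr0; left.
  have zs : `|ze| < s.
    by rewrite ltNge; apply/negP => h1; move: vz; rewrite v0 ?eqxx// subr0; right.
  have -> : z = y + t *: (ze + del *: a).
    by rewrite /ze simE subrK scalerA mulfV ?gt_eqF// scale1r subrKC.
  apply: tO => //; apply/andP; split; first exact: le_trans (ltW zr) (norm_le_enorm _).
  by apply: (le_trans (enorm_le_norm _)); rewrite ler_wpM2l// ltW.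
(* The point that the inverse of the dilation and shift sends to a. *)
pose x := y + t *: (a + del *: a).
have Ux : U x = v a.
  by rewrite /U simE /x addrAC subrr add0r scalerA mulVf ?gt_eqF// scale1r addrK.
have ux : U x != 0 by rewrite Ux.
have [l1 l2] := rayleigh_le WU UO ux Oy.
apply: (le_trans l1); apply: (le_trans l2); rewrite lee_fin EU -[v (sim c t^-1 1%:M x)]/(U x) Ux.
have -> : enorm (x - y) = t * ((1 + del) * enorm a).
  rewrite /x addrC addKr enormZ gtr0_norm//; congr (_ * _).
  by rewrite -[X in X + _]scale1r -scalerDl enormZ gtr0_norm// addr_gt0.
have d10 : 0 < 1 + del by rewrite addr_gt0.
rewrite powRM ?(ltW t0) ?mulr_ge0 ?(ltW d10) ?enorm_ge0// powRM ?(ltW d10) ?enorm_ge0//.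
have -> : t^-1 `^ (p - n%:R) = (t `^ (p - n%:R))^-1.
  by rewrite -(powR_inv1 (ltW t0)) -powRrM mulN1r powRN.
have T0 : 0 < t `^ (p - n%:R) by exact: powR_gt0.
have -> : (t `^ (p - n%:R))^-1 * energy p h * (t `^ (p - n%:R) *
    ((1 + del) `^ (p - n%:R) * enorm a `^ (p - n%:R)) / `|v a| `^ p) =
    (energy p h * enorm a `^ (p - n%:R)) * ((1 + del) `^ (p - n%:R) * (`|v a| `^ p)^-1).
  by field; rewrite !gt_eqF ?powR_gt0 ?normr_gt0.
have h1 : energy p h * enorm a `^ (p - n%:R) <= th * K.
  apply: (@le_trans _ _ (th * (energy p g * enorm a `^ (p - n%:R)))).
    by rewrite mulrA ler_wpM2r ?powR_ge0.
  by rewrite ler_wpM2l ?(ltW th0).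
have h2 : (1 + del) `^ (p - n%:R) <= th.
  rewrite -[leRHS](@powRVK _ _ (p - n%:R)) ?(ltW th0) ?gt_eqF//.
  by rewrite ler_powRl ?(ltW pn0) ?(ltW d10)// -lerBrDl ltW.
have h3 : (`|v a| `^ p)^-1 <= th.
  by rewrite -[leRHS]invrK lef_pV2 ?posrE ?invr_gt0 ?powR_gt0 ?normr_gt0.
have i0 : 0 <= (`|v a| `^ p)^-1 by rewrite invr_ge0 powR_ge0.
have j0 : 0 <= energy p h * enorm a `^ (p - n%:R) by rewrite mulr_ge0 ?energy_ge0 ?powR_ge0.
by have := ler_pM3 j0 (powR_ge0 _ _) i0 h1 h2 h3; rewrite th3.
Qed.

Lemma lambda_cone : lambda_p p Omega = K%:E.
Proof. by apply/eqP; rewrite eq_le lambda_le lambda_ge. Qed.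

(** Conversely, on a translated cone the translated minimizer reaches the constant: [rayleigh_le] is
    applied at the image of a, with the vertex as outside point. *)
Lemma extremal_cone : has_extremal p Omega <->
  exists y a, a != 0 /\ Omega = [set z | cone a (z - y)].
Proof.
rewrite /has_extremal lambda_cone; split=> [[u Du rE]|[y [a [aN0 OE]]]].
  have [y [x [xy _ h]]] := rayleigh_cone Du; exists y, (x - y); split => //; exact: h.
have [w [g [mw w_ge0]]] : exists w g, minimal p (cone a) a w g /\ forall z, 0 <= w z.
  apply: minimal_exists => //; first exact: cone_refl.
  by move=> cT; apply: (@cone0 a); rewrite cT.
have [[Ww wO wa] _] := mw.
have [WU EU] := W1p_sim (- y) ltr01 (@orthogonal1 R n) Ww.
rewrite powR1 mul1r in EU.
have UO z : ~ Omega z -> w (sim (- y) 1 1%:M z) = 0.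
  by rewrite OE sim_shift => nz; exact: wO.
have Oy : ~ Omega y by rewrite OE /= subrr; exact: cone0.
have ya : sim (- y) 1 1%:M (y + a) = a by rewrite sim_shift addrAC subrr add0r.
have ux : w (sim (- y) 1 1%:M (y + a)) != 0 by rewrite ya wa oner_neq0.
have [l1 l2] := rayleigh_le WU UO ux Oy.
exists (fun z => w (sim (- y) 1 1%:M z)).
  split; first exact: W1p_D1p0 WU UO.
  by move=> u0; move: ux; rewrite (congr1 (fun f => f (y + a)) u0) eqxx.
apply/eqP; rewrite eq_le; apply/andP; split; last by rewrite -lambda_cone.
apply: (le_trans l2); rewrite lee_fin ya wa normr1 powR1 divr1 EU.
rewrite (_ : y + a - y = a); last by rewrite addrC addKr.
exact: (minimal_cone_constant a00 aN0 mw0 w00 mw w_ge0).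
Qed.

End domain.
End cones.

(** * Halfspaces and punctured spaces *)

Section half_and_punctured.
Context {R : realType} {n : nat} (p : R).
Hypothesis n2 : (1 < n)%N.
Hypothesis np : n%:R < p.
Local Notation Rn := 'rV[R]_n.
Let n0 : (0 < n)%N. Proof. exact: ltn_trans n2. Qed.
Let p2 : 2 <= p. Proof. by apply: le_trans (ltW np); rewrite ler_nat. Qed.

Lemma enorm_ball (Omega : set Rn) x : open Omega -> Omega x ->
  exists2 e : R, 0 < e & forall z, enorm (z - x) < e -> Omega z.
Proof.
move=> oO Ox; have /nbhs_ballP[e /= e0 sub] : nbhs x Omega by exact: open_nbhs_nbhs.
exists e => // z ze; apply: sub; rewrite -ball_normE /ball_ /= distrC.
exact: le_lt_trans (norm_le_enorm _) ze.
Qed.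

Lemma ltr_enorm (x y : Rn) : dot x x < dot y y -> enorm x < enorm y.
Proof. by move=> xy; rewrite !enormE ltr_sqrt// (le_lt_trans (dotxx_ge0 x) xy). Qed.

Lemma ltr_enorm_shift (x y : Rn) t : t * (2 * dot x y + t * dot y y) < 0 ->
  enorm (x + t *: y) < enorm x.
Proof.
move=> h; apply: ltr_enorm; rewrite !(dotDl, dotDr, dotZl, dotZr) (dotC y x).
by move: h; lra.
Qed.

Definition half_cone (a : Rn) : set Rn := [set z | 0 < dot a z].

Lemma half_cone_equiv (a z : Rn) t M : 0 < t -> orthogonal M ->
  half_cone (t *: (a *m M)) (t *: (z *m M)) <-> half_cone a z.
Proof. by move=> t0 oM; rewrite /half_cone /= dotZl dotZr dot_orthogonal// !pmulr_rgt0. Qed.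

Lemma half_cone_refl (a : Rn) : a != 0 -> half_cone a a.
Proof. by move=> a0; rewrite /half_cone /= lt_neqAle dotxx_ge0 eq_sym dotxx_eq0 a0. Qed.

Lemma half_cone_open (a : Rn) : open (half_cone a).
Proof.
rewrite (_ : half_cone a = (fun z => dot z a) @^-1` [set s | 0 < s]).
  by apply: open_comp; [move=> x _; exact: continuous_dotr|exact: open_gt].
by apply/seteqP; split=> z; rewrite /half_cone /= dotC.
Qed.

Lemma half_cone0 (a : Rn) : ~ half_cone a 0.
Proof. by rewrite /half_cone /= dotC dot0l ltxx. Qed.

Lemma conv_gt0 (x y t : R) : 0 < x -> 0 < y -> 0 <= t <= 1 -> 0 < x + t * (y - x).
Proof. by move=> x0 y0 /andP[t0 t1]; nra. Qed.

Lemma half_cone_segment (a x y : Rn) t : half_cone a x -> half_cone a y -> 0 <= t <= 1 ->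
  half_cone a (x + t *: (y - x)).
Proof.
by move=> ax ay t01; rewrite /half_cone /= dotDr dotZr dotBr; exact: conv_gt0.
Qed.

Lemma half_cone_chain (a x y : Rn) : half_cone a x -> half_cone a y ->
  exists2 z, half_cone a z &
  forall t, 0 <= t <= 1 -> half_cone a (x + t *: (z - x)) /\ half_cone a (z + t *: (y - z)).
Proof.
move=> ax ay; exists y => // t t01; rewrite subrr scaler0 addr0; split => //.
exact: half_cone_segment.
Qed.

(** Constant in a; the parameter brings this case into the same family of cones as the
    halfspaces. *)
Definition punctured_cone (a : Rn) : set Rn := [set z | z != 0].

Lemma punctured_cone_equiv (a z : Rn) t M : 0 < t -> orthogonal M ->
  punctured_cone (t *: (a *m M)) (t *: (z *m M)) <-> punctured_cone a z.
Proof.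
move=> t0 oM; rewrite /punctured_cone /= -!enorm_gt0 enormZ enorm_orthogonal//.
by rewrite gtr0_norm// pmulr_rgt0.
Qed.

Lemma punctured_cone_open (a : Rn) : open (punctured_cone a).
Proof.
rewrite (_ : punctured_cone a = (@enorm R n) @^-1` [set s | 0 < s]).
  by apply: open_comp; [move=> x _; exact: continuous_enorm|exact: open_gt].
by apply/seteqP; split=> z; rewrite /punctured_cone /= enorm_gt0.
Qed.

Lemma punctured_cone0 (a : Rn) : ~ punctured_cone a 0.
Proof. by rewrite /punctured_cone /= eqxx. Qed.

Lemma exists_other (i : 'I_n) : exists j, j != i.
Proof.
have [i0|i0] := eqVneq (i : nat) 0%N.
  by exists (Ordinal n2); apply/eqP => /(congr1 val) /=; rewrite i0.
by exists (Ordinal n0); apply: contraNneq i0 => <-.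
Qed.

Lemma exists_nonparallel (x : Rn) : x != 0 -> exists z : Rn, forall s, z <> s *: x.
Proof.
move=> x0; have [i xi] : exists i, x ord0 i != 0.
  apply/existsP; apply: contra_neqT x0 => /existsPn h; apply/rowP => i.
  by have := h i; rewrite negbK mxE => /eqP.
have [j ji] := exists_other i; exists (delta_mx ord0 j) => s e.
have := congr1 (fun v : Rn => v ord0 i) e; rewrite !mxE eqxx eq_sym (negbTE ji) /=.
move/esym/eqP; rewrite mulf_eq0 (negbTE xi) orbF => /eqP s0.
have := congr1 (fun v : Rn => v ord0 j) e; rewrite s0 !mxE !eqxx mul0r.
by move/eqP; rewrite oner_eq0.
Qed.

Lemma segment_parallel (x y : Rn) t : x != 0 -> x + t *: (y - x) = 0 -> exists s, y = s *: x.
Proof.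
move=> x0 e; have t0 : t != 0.
  by apply: contraNneq x0 => t0; move: e; rewrite t0 scale0r addr0 => ->.
exists (1 - t^-1); have /eqP := e; rewrite addrC addr_eq0 => /eqP e'.
have -> : y = x + t^-1 *: (t *: (y - x)) by rewrite scalerA mulVf// scale1r addrC subrK.
by rewrite e' scalerN scalerBl scale1r.
Qed.

(** If y is not parallel to x, the segment from x to y misses 0. Otherwise a detour through a vector
    z off their line does, and such a z exists because n >= 2. *)
Lemma punctured_cone_chain (a x y : Rn) : punctured_cone a x -> punctured_cone a y ->
  exists2 z, punctured_cone a z &
  forall t, 0 <= t <= 1 ->
    punctured_cone a (x + t *: (z - x)) /\ punctured_cone a (z + t *: (y - z)).
Proof.
move=> x0 y0; have [par|npar] := pselect (exists s, y = s *: x).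
  have [s yE] := par; have [z zx] := exists_nonparallel x0; exists z.
    by apply/eqP => z0; apply: (zx 0); rewrite scale0r.
  move=> t _; split; apply/eqP => e.
    by have [r zr] := segment_parallel x0 e; exact: (zx r).
  have e' : y + (1 - t) *: (z - y) = 0.
    by rewrite -e; apply/rowP => i; rewrite !mxE; ring.
  by have [r zr] := segment_parallel y0 e'; apply: (zx (r * s)); rewrite zr yE scalerA.
exists y => // t _; rewrite subrr scaler0 addr0; split => //; apply/eqP => e.
by apply: npar; exact: segment_parallel e.
Qed.

Lemma exists_nonzero : exists a : Rn, a != 0.
Proof.
exists (delta_mx ord0 (Ordinal n0)); apply/eqP => /(congr1 (fun v : Rn => v ord0 (Ordinal n0))).
by rewrite !mxE !eqxx => /eqP; rewrite oner_eq0.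
Qed.

(** In this convention t is the weight of the first point, so the path starts at y and ends at x. *)
Lemma conv_rowE (t : {i01 R}) (x y : Rn) :
  @conv R (convex_lmodType Rn) t x y = y + t%:num *: (x - y) :> Rn.
Proof.
transitivity (t%:num *: x + (1 - t%:num) *: y) => //.
by apply/rowP => i; rewrite !mxE; ring.
Qed.

(** * Convex domains *)

Section convex.
Variable Omega : set Rn.
Hypothesis oO : open Omega.
Hypothesis cO : @convex_set R Rn Omega.

Lemma convex_segment x y t : Omega x -> Omega y -> 0 <= t <= 1 -> Omega (x + t *: (y - x)).
Proof.
move=> Ox Oy /andP[t0 t1].
have := cO (Itv01 t0 t1) (mem_set Oy) (mem_set Ox) => /set_mem.
by rewrite conv_rowE.
Qed.

(** If z made an obtuse angle with x - y at y, stepping from y away from z would approach x and so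
    enter Omega; y would then lie between that point and z, hence in Omega by convexity. *)
Lemma convex_support_strict x y z : Omega x -> ~ Omega y -> enorm (x - y) = dist_compl Omega x ->
  Omega z -> 0 <= dot (x - y) (z - y).
Proof.
move=> Ox Oy yE Oz; rewrite leNgt; apply/negP => ab; apply: Oy.
set a := x - y in yE ab; set b := z - y in ab.
have b0 : 0 < dot b b.
  rewrite lt_neqAle dotxx_ge0 andbT eq_sym dotxx_eq0; apply: contraTneq ab => ->.
  by rewrite dotC dot0l ltxx.
(* The minimizer of |a + k b|, positive because a.b < 0. *)
pose k := - dot a b / dot b b; have k0 : 0 < k by rewrite divr_gt0// oppr_gt0.
have Oq : Omega (y - k *: b).
  apply: (@dist_compl_ball _ _ _ x); rewrite -yE.
  have -> : x - (y - k *: b) = a + k *: b by rewrite opprB addrCA addrC.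
  apply: ltr_enorm_shift; rewrite pmulr_rlt0//.
  by rewrite {1}/k divfK ?gt_eqF// mulr_natl mulr2n addrK.
have k1 : 0 < 1 + k by rewrite addr_gt0.
have -> : y = (y - k *: b) + (k / (1 + k)) *: (z - (y - k *: b)).
  have -> : z - (y - k *: b) = (1 + k) *: b.
    by rewrite opprB addrCA scalerDl scale1r addrC.
  by rewrite scalerA divfK ?gt_eqF// subrK.
apply: convex_segment => //; rewrite divr_ge0 ?(ltW k0) ?(ltW k1)//=.
by rewrite ler_pdivrMr// mul1r lerDr.
Qed.

(** Openness makes the inequality strict: a small step from z against x - y stays in Omega. *)
Lemma convex_support x y : Omega x -> ~ Omega y -> enorm (x - y) = dist_compl Omega x ->
  forall z, Omega z -> half_cone (x - y) (z - y).
Proof.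
move=> Ox Oy yE z Oz; have a0 : 0 < enorm (x - y).
  by rewrite enorm_gt0; apply: contra_notN Oy; rewrite subr_eq0 => /eqP <-.
have [e e0 sub] := enorm_ball oO Oz.
pose k := e / (2 * enorm (x - y)); have k0 : 0 < k by rewrite divr_gt0// mulr_gt0.
have /(convex_support_strict Ox Oy yE) : Omega (z - k *: (x - y)).
  apply: sub; rewrite addrAC subrr add0r enormN enormZ gtr0_norm// /k.
  by rewrite invfM mulrA mulfVK ?gt_eqF// ltr_pdivrMr// ltr_pMr// ltr1n.
rewrite addrAC dotBr dotZr subr_ge0; apply: lt_le_trans.
by rewrite mulr_gt0// -enorm_sqr exprn_gt0.
Qed.

(** The ball about x through y lies in Omega and contains y + t z' when t |z'|^2 < 2 a.z'. The shift
    by del a forces a.z' >= del |a|^2, so one small t suits all z' of bounded norm. *)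
Lemma convex_blow_up y1 x : ~ Omega y1 -> Omega x ->
  exists y a, [/\ ~ Omega y, a != 0 &
  forall r s dl : R, 0 < r -> 0 < s -> 0 < dl -> exists del t, [/\ 0 < del < dl, 0 < t &
    forall z, half_cone a z -> r <= enorm z <= s -> Omega (y + t *: (z + del *: a))]].
Proof.
move=> Oy1 Ox; have [y Oy yE] := dist_compl_nearest x oO Oy1.
exists y, (x - y).
have a0 : x - y != 0 by apply: contra_notN Oy; rewrite subr_eq0 => /eqP <-.
split=> // r s dl r0 s0 dl0; set a := x - y in a0 yE *.
have ea : 0 < enorm a by rewrite enorm_gt0.
pose del := dl / 2; have del0 : 0 < del by rewrite divr_gt0.
have S0 : 0 < s + del * enorm a by rewrite addr_gt0// mulr_gt0.
have A0 : 0 < dot a a by exact: half_cone_refl.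
(* The denominator bounds |z + del a|^2, so t |z + del a|^2 <= del |a|^2, which is at most a.(z +
   del a). *)
pose t := del * dot a a / (s + del * enorm a) ^+ 2.
have t0 : 0 < t by rewrite divr_gt0 ?mulr_gt0 ?exprn_gt0.
exists del, t; split => //; first by rewrite del0 /del ltr_pdivrMr// ltr_pMr// ltr1n.
move=> z az /andP[_ zs]; apply: (@dist_compl_ball _ _ _ x); rewrite -yE.
set ze := z + del *: a; rewrite opprD addrA -/a.
have h1 : del * dot a a <= dot a ze by rewrite /ze dotDr dotZr lerDr ltW.
have h2 : dot ze ze <= (s + del * enorm a) ^+ 2.
  rewrite -enorm_sqr ler_sqr ?nnegrE ?enorm_ge0 ?(ltW S0)//.
  by apply: (le_trans (ler_enormD _ _)); rewrite enormZ gtr0_norm// lerD2r.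
rewrite -scaleNr; apply: ltr_enorm_shift; rewrite mulNr oppr_lt0 pmulr_rgt0// mulNr.
have h3 : t * dot ze ze <= del * dot a a.
  apply: (le_trans (ler_wpM2l (ltW t0) h2)).
  by rewrite /t divfK ?expf_neq0 ?gt_eqF.
have h4 : 0 < del * dot a a by rewrite mulr_gt0.
by move: h1 h3 h4; clear; lra.
Qed.

End convex.

Lemma half_convex (a y : Rn) : @convex_set R Rn [set z | half_cone a (z - y)].
Proof.
move=> x z t /set_mem /= ax /set_mem /= az; apply/mem_set => /=.
have t01 : 0 <= (t%:num : R) <= 1 by apply/andP; split.
rewrite conv_rowE.
rewrite (_ : _ - y = (z - y) + t%:num *: ((x - y) - (z - y))); last first.
  by apply/rowP => i; rewrite !mxE; ring.
exact: half_cone_segment.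
Qed.

Lemma half_open (a y : Rn) : open [set z | half_cone a (z - y)].
Proof.
rewrite (_ : mkset _ = (fun z : Rn => z - y) @^-1` half_cone a)//.
apply: open_comp; last exact: half_cone_open.
by move=> x _; apply: continuousB; [exact: id|exact: cst_continuous].
Qed.

Lemma is_halfspaceP (Omega : set Rn) : is_halfspace Omega <->
  exists y a, a != 0 /\ Omega = [set z | half_cone a (z - y)].
Proof.
split=> [[a [b [a0 ->]]]|[y [a [a0 ->]]]].
  have A0 := half_cone_refl a0; rewrite /half_cone /= in A0.
  exists ((b / dot a a) *: a), a; split => //; apply/seteqP; split=> z;
  by rewrite /half_cone /= dotBr dotZr divfK ?gt_eqF// subr_gt0.
exists a, (dot a y); split => //; apply/seteqP; split=> z;
by rewrite /half_cone /= dotBr subr_gt0.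
Qed.

Lemma upper_halfspaceE : exists2 a, a != 0 & upper_halfspace R n = [set z | half_cone a (z - 0)].
Proof.
have nP : (n.-1 < n)%N by rewrite ltn_predL.
pose i := Ordinal nP; exists (delta_mx ord0 i).
  apply/eqP => /(congr1 (fun v : Rn => v ord0 i)).
  by rewrite !mxE !eqxx => /eqP; rewrite oner_eq0.
have dE z : dot (delta_mx ord0 i) z = z ord0 i.
  rewrite /dot (bigD1 i)//= big1 ?addr0 ?mxE ?eqxx ?mul1r// => j ji.
  by rewrite mxE (negbTE ji) andbF mul0r.
apply/seteqP; split=> z; rewrite /half_cone /= subr0 dE.
  by apply; rewrite /= prednK.
move=> zi j jn; suff -> : j = i by [].
by apply: val_inj => /=; rewrite -[in RHS]jn.
Qed.

Lemma half_cone_minimal (a : Rn) : a != 0 -> exists w g,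
  minimal p (half_cone a) a w g /\ forall z, 0 <= w z.
Proof.
move=> a0; apply: minimal_exists => //; first exact: half_cone_open.
  exact: half_cone_refl.
by move=> cT; apply: (@half_cone0 a); rewrite cT.
Qed.

Lemma punctured_cone_minimal (a : Rn) : a != 0 -> exists w g,
  minimal p (punctured_cone a) a w g /\ forall z, 0 <= w z.
Proof.
move=> a0; apply: minimal_exists => //; first exact: punctured_cone_open.
by move=> cT; apply: (@punctured_cone0 a); rewrite cT.
Qed.

(** The upper halfspace is itself open, convex and proper, so [main] gives it the same constant. *)
Lemma convex_case (Omega : set Rn) : Omega !=set0 -> Omega <> setT -> open Omega ->
  @convex_set R Rn Omega ->
  lambda_p p Omega = lambda_p p (upper_halfspace R n) /\
  (has_extremal p Omega <-> is_halfspace Omega).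
Proof.
have [a a0 UE] := upper_halfspaceE; have [w [g [mw w_ge0]]] := half_cone_minimal a0.
have main (V : set Rn) : V !=set0 -> V <> setT -> open V -> @convex_set R Rn V ->
    lambda_p p V = (energy p g * enorm a `^ (p - n%:R))%:E /\
    (has_extremal p V <-> is_halfspace V).
  move=> [x Vx] VT oV cV.
  have [y1 Vy1] : exists y, ~ V y by apply/existsNP => h; apply: VT; apply/seteqP; split.
  have sup := convex_support oV cV; have blow := convex_blow_up oV Vy1 Vx.
  split.
    exact: (lambda_cone n0 np p2 half_cone_equiv half_cone_refl half_cone_open half_cone0
      half_cone_chain a0 mw w_ge0 oV Vy1 sup blow).
  apply: (iff_trans _ (iff_sym (is_halfspaceP V))).
  exact: (extremal_cone n0 np p2 half_cone_equiv half_cone_refl half_cone_open half_cone0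
      half_cone_chain a0 mw w_ge0 oV Vy1 sup blow).
move=> On OT oO cO; have [-> extE] := main _ On OT oO cO; split => //.
rewrite UE; have [||||->] // := main [set z | half_cone a (z - 0)].
- by exists a; rewrite /= subr0; exact: half_cone_refl.
- by move=> /seteqP[_ /(_ 0 I)] /=; rewrite subr0; exact: half_cone0.
- exact: half_open.
- exact: half_convex.
Qed.

(** * Punctured domains and complements of compact sets *)

Lemma punctured_shift (a z : Rn) (r s dl del : R) : 0 < r -> a != 0 ->
  0 < del -> del <= r / (2 * enorm a) -> r <= enorm z <= s ->
  r / 2 <= enorm (z + del *: a) <= s + r / 2.
Proof.
move=> r0 a0 del0 delr /andP[rz zs]; have ea : 0 < enorm a by rewrite enorm_gt0.
have h : enorm (del *: a) <= r / 2.
  rewrite enormZ gtr0_norm//; apply: (le_trans (ler_wpM2r (ltW ea) delr)).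
  by rewrite invfM mulrA mulfVK ?gt_eqF.
have := ler_enormD z (del *: a); have := ler_enormD (z + del *: a) (- (del *: a)).
by rewrite addrK enormN; move: h rz zs; clear; lra.
Qed.

Lemma punctured_del (a : Rn) (r dl : R) : 0 < r -> 0 < dl -> a != 0 ->
  exists2 del, 0 < del < dl & del <= r / (2 * enorm a).
Proof.
move=> r0 dl0 a0; have ea : 0 < enorm a by rewrite enorm_gt0.
exists (Num.min (dl / 2) (r / (2 * enorm a))); last by rewrite ge_min lexx orbT.
rewrite lt_min gt_min !divr_gt0 ?mulr_gt0//=.
by rewrite ltr_pdivrMr// ltr_pMr// ltr1n.
Qed.

Lemma puncture_blow_up (Omega : set Rn) x0 (a : Rn) (r s dl : R) : open Omega -> Omega x0 ->
  a != 0 -> 0 < r -> 0 < s -> 0 < dl -> exists del t, [/\ 0 < del < dl, 0 < t &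
    forall z, punctured_cone a z -> r <= enorm z <= s ->
      (Omega `\ x0) (x0 + t *: (z + del *: a))].
Proof.
move=> oO Ox0 a0 r0 s0 dl0; have [e e0 sub] := enorm_ball oO Ox0.
have [del del01 delr] := punctured_del r0 dl0 a0; have /andP[del0 _] := del01.
have S0 : 0 < s + r / 2 by rewrite addr_gt0// divr_gt0.
(* Shifted points have norm at most s + r/2, so the dilated ones stay within e/2 of x0. *)
pose t := e / (2 * (s + r / 2)); have t0 : 0 < t by rewrite divr_gt0// mulr_gt0.
exists del, t; split => // z _ rzs.
have /andP[h1 h2] := punctured_shift dl r0 a0 del0 delr rzs; split.
  apply: sub; rewrite addrC addKr enormZ gtr0_norm//.
  apply: (le_lt_trans (ler_wpM2l (ltW t0) h2)).
  by rewrite /t invfM mulrA mulfVK ?gt_eqF// ltr_pdivrMr// ltr_pMr// ltr1n.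
move=> /= /eqP; rewrite -subr_eq0 addrC addKr scaler_eq0 (gt_eqF t0) /= -enorm_eq0.
by rewrite gt_eqF// (lt_le_trans _ h1)// divr_gt0.
Qed.

Lemma compact_blow_up (K : set Rn) y (a : Rn) (r s dl : R) : compact K ->
  a != 0 -> 0 < r -> 0 < s -> 0 < dl -> exists del t, [/\ 0 < del < dl, 0 < t &
    forall z, punctured_cone a z -> r <= enorm z <= s ->
      (~` K) (y + t *: (z + del *: a))].
Proof.
move=> cK a0 r0 s0 dl0.
have [D D0 KD] : exists2 D, 0 < D & forall z, K z -> enorm (z - y) < D.
  have /pinfty_ex_gt0[M M0 KM] := compact_bounded cK.
  exists (n%:R * M + enorm y + 1).
    by rewrite ltr_wpDl// addr_ge0 ?enorm_ge0// mulr_ge0// ltW.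
  move=> z /KM zM; apply: (le_lt_trans (ler_enormD _ _)); rewrite enormN.
  apply: (@le_lt_trans _ _ (n%:R * M + enorm y)); last by rewrite ltrDl.
  by rewrite lerD2r; apply: (le_trans (enorm_le_norm _)); rewrite ler_wpM2l.
have [del del01 delr] := punctured_del r0 dl0 a0; have /andP[del0 _] := del01.
(* Shifted points have norm at least r/2; this dilation takes them to distance at least D from y,
   beyond K. *)
pose t := D / (r / 2); have t0 : 0 < t by rewrite divr_gt0// divr_gt0.
exists del, t; split => // z _ rzs.
have /andP[h1 h2] := punctured_shift dl r0 a0 del0 delr rzs.
move=> /KD; rewrite addrC addKr enormZ gtr0_norm// ltNge => /negP; apply.
by rewrite /t mulrAC ler_pdivlMr ?divr_gt0// ler_wpM2l// ltW.
Qed.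

Lemma punctured_support (Omega : set Rn) (x y : Rn) : Omega x -> ~ Omega y ->
  enorm (x - y) = dist_compl Omega x -> forall z, Omega z -> punctured_cone (x - y) (z - y).
Proof.
by move=> _ Oy _ z Oz; rewrite /punctured_cone /= subr_eq0; apply: contra_notN Oy => /eqP <-.
Qed.

(** The same constant K is quantified outside both families, so that they can be compared with each
    other and with the space punctured at 0. *)
Lemma punctured_case : exists K : R,
  (forall (Omega : set Rn) (x0 : Rn), open Omega -> Omega x0 ->
     lambda_p p (Omega `\ x0) = K%:E /\ (has_extremal p (Omega `\ x0) <-> Omega = setT)) /\
  (forall C : set Rn, compact C -> C !=set0 ->
     lambda_p p (~` C) = K%:E /\ (has_extremal p (~` C) <-> exists x, C = [set x])).
Proof.
have [a a0] := exists_nonzero; have [w [g [mw w_ge0]]] := punctured_cone_minimal a0.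
exists (energy p g * enorm a `^ (p - n%:R)).
(* Membership of a in [punctured_cone a] is a <> 0 itself, hence the identity as a proof of
   reflexivity. *)
have lam (V : set Rn) := @lambda_cone _ _ _ n0 np p2 punctured_cone punctured_cone_equiv
  (fun _ h => h) punctured_cone_open punctured_cone0 punctured_cone_chain
  a w g a0 mw w_ge0 V.
have ext (V : set Rn) := @extremal_cone _ _ _ n0 np p2 punctured_cone punctured_cone_equiv
  (fun _ h => h) punctured_cone_open punctured_cone0 punctured_cone_chain
  a w g a0 mw w_ge0 V.
split; last move=> C cC [y Cy]; first move=> Omega x0 oO Ox0.
  have oV : open (Omega `\ x0).
    by apply: openI => //; apply: closed_openC; apply: compact_closed; [exact: norm_hausdorff|exact: compact_set1].
  have Vx0 : ~ (Omega `\ x0) x0 by move=> [_]; apply.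
  have blow : exists y a, [/\ ~ (Omega `\ x0) y, a != 0 &
      forall r s dl : R, 0 < r -> 0 < s -> 0 < dl -> exists del t, [/\ 0 < del < dl, 0 < t &
      forall z, punctured_cone a z -> r <= enorm z <= s ->
        (Omega `\ x0) (y + t *: (z + del *: a))]].
    by exists x0, a; split => // r s dl; exact: puncture_blow_up.
  split; first exact: (lam _ x0 oV Vx0 (@punctured_support _) blow).
  apply: (iff_trans (ext _ x0 oV Vx0 (@punctured_support _) blow)); split=> [[y [b [b0 VE]]]|OT].
    have VP z : (Omega `\ x0) z <-> z - y != 0 by rewrite VE.
    have yx0 : x0 = y.
      by apply/eqP; rewrite -subr_eq0; apply: contra_notT Vx0 => h; apply/VP.
    apply/seteqP; split=> // z _; have [->//|zx] := eqVneq z x0.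
    by have [] : (Omega `\ x0) z by apply/VP; rewrite subr_eq0 -yx0.
  exists x0, a; split => //; rewrite OT; apply/seteqP; split=> z; rewrite /punctured_cone /= subr_eq0.
    by move=> [_ h]; apply/eqP.
  by move=> /eqP.
have oV : open (~` C) by apply: closed_openC; apply: compact_closed => //; exact: norm_hausdorff.
have Vy : ~ (~` C) y by apply.
have blow : exists y a, [/\ ~ (~` C) y, a != 0 &
    forall r s dl : R, 0 < r -> 0 < s -> 0 < dl -> exists del t, [/\ 0 < del < dl, 0 < t &
    forall z, punctured_cone a z -> r <= enorm z <= s ->
      (~` C) (y + t *: (z + del *: a))]].
  by exists y, a; split => // r s dl; exact: compact_blow_up.
split; first exact: (lam _ y oV Vy (@punctured_support _) blow).
apply: (iff_trans (ext _ y oV Vy (@punctured_support _) blow)); split=> [[x [b [b0 VE]]]|[x CE]].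
  exists x; rewrite -[C]setCK VE; apply/seteqP; split=> z; rewrite /punctured_cone /= subr_eq0.
    by move/negP; rewrite negbK => /eqP.
  by move=> ->; rewrite eqxx.
exists x, a; split => //; rewrite CE; apply/seteqP; split=> z; rewrite /punctured_cone /= subr_eq0.
  by move/eqP.
by move/eqP.
Qed.

End half_and_punctured.

Theorem theoremB (R : realType) (n : nat) (p : R)
    (hn : (2 <= n)%N) (hp : n%:R < p) :
  (forall Omega : set 'rV[R]_n,
     Omega !=set0 -> Omega <> setT -> open Omega ->
     @convex_set R 'rV[R]_n Omega ->
     lambda_p p Omega = lambda_p p (upper_halfspace R n) /\
     (has_extremal p Omega <-> is_halfspace Omega)) /\
  (forall (Omega : set 'rV[R]_n) (x0 : 'rV[R]_n),
     open Omega -> Omega x0 ->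
     lambda_p p (Omega `\ x0) = lambda_p p (~` [set (0 : 'rV[R]_n)]) /\
     (has_extremal p (Omega `\ x0) <-> Omega = setT)) /\
  (forall K : set 'rV[R]_n,
     compact K -> K !=set0 ->
     lambda_p p (~` K) = lambda_p p (~` [set (0 : 'rV[R]_n)]) /\
     (has_extremal p (~` K) <-> exists x, K = [set x])).
Proof.
split; first exact: convex_case.
have [K [punct compl]] := punctured_case hn hp.
(* The compact set {0} identifies the constant as the value for the space punctured at 0. *)
have [K0 _] := compl _ (@compact_set1 _ (0 : 'rV[R]_n)) (ex_intro _ 0 erefl).
by split=> *; rewrite K0; [exact: punct|exact: compl].
Qed.
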